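(* Let $\Gamma$ be a smoothly embedded circle in a complete Riemannian manifold $(M^n,g)$. Then the width $\mathcal{S}(\Gamma)$ satisfies $\mathcal{S}(\Gamma)>0$, and there exists a critical point $\{p,q\}\subset\Gamma$ of the distance functional $\mathcal{D}$ such that $\mathcal{D}(\{p,q\})=\mathcal{S}(\Gamma)$.
   Context: Let $d$ be the Riemannian distance of $(M^n,g)$. Non-trivial geodesics are parametrised by arc length; a geodesic is minimising if its length equals the distance $d$ between its endpoints. $\mathcal{P}$ is the set of subsets $\{p,q\}\subset\Gamma$ with at most two elements ($p=q$ allowed), and $\mathcal{D}:\mathcal{P}\to[0,\infty)$ is $\mathcal{D}(\{p,q\})=d(p,q)$. Critical points: $\{p,q\}\subset\Gamma$ is a regular point of $\mathcal{D}$ if there exists $(v_1,v_2)\in T_p\Gamma\times T_q\Gamma$ such that for every minimising geodesic $\gamma:[0,a]\to M$ with $\gamma(0)=p$, $\gamma(a)=q$ one has $\langle v_2,\gamma'(a)\rangle-\langle v_1,\gamma'(0)\rangle<0$. It is a critical point if it is not regular (all singletons $\{p\}$ are critical points). Sweepouts: a family $\{p_t,q_t\}\subset\Gamma$, $t\in[0,1]$, is a sweepout of $\Gamma$ if (i) $p_0=q_0$ and $p_1=q_1$; (ii) $t\mapsto p_t$ and $t\mapsto q_t$ are continuous maps into $\Gamma$; (iii) $p_t$ and $q_t$ bound a closed arc $C_t\subset\Gamma$ such that $t\mapsto C_t$ is continuous (the distance between arcs being the length of their symmetric difference), $C_0=\{p_0\}$ and $C_1=\Gamma$. Width: $\mathcal{S}(\Gamma)=\inf\max_{t\in[0,1]}d(p_t,q_t)$,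 the infimum being over all sweepouts $\{p_t,q_t\}$ of $\Gamma$. *)

(* Defs.v *)
From HB Require Import structures.
From mathcomp Require Import all_boot all_order all_algebra.
From mathcomp Require Import all_classical all_reals all_analysis.
Set Implicit Arguments.
Unset Strict Implicit.
Unset Printing Implicit Defensive.
Import Order.TTheory GRing.Theory Num.Theory.
Import numFieldNormedType.Exports.
Local Open Scope classical_set_scope.
Local Open Scope ring_scope.

Section Smooth.
Context {R : realType} {V W : normedModType R}.

(* [U] is meant to be open.  In finite dimension, [f] is C^(k+1) on [U] iff its
   directional derivatives exist and are C^k. *)
Fixpoint Ck (k : nat) (U : set V) (f : V -> W) : Prop :=
  (forall x, U x -> {for x, continuous f}) /\
  (if k is k'.+1 then
     forall v : V, (forall x, U x -> derivable f x v) /\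
                   Ck k' U (fun x => 'D_v f x)
   else True).

Definition smooth (U : set V) (f : V -> W) : Prop := forall k, Ck k U f.

End Smooth.

(* [chart_inv i] is only meaningful on the image of [chart_dom i].
   [chart_at p] is a preferred chart around [p]; it is used to represent vectors
   of T_pM by their coordinates in that chart. *)
Record smooth_manifold (R : realType) (n : nat) (M : topologicalType) :=
  SmoothManifold {
    chart_index : Type;
    chart_dom : chart_index -> set M;
    chart_map : chart_index -> M -> 'rV[R]_n;
    chart_inv : chart_index -> 'rV[R]_n -> M;
    chart_at : M -> chart_index;
    manifold_hausdorff : hausdorff_space M;
    manifold_second_countable : @second_countable M;
    chart_at_dom : forall p, chart_dom (chart_at p) p;
    chart_dom_open : forall i, open (chart_dom i);
    chart_img_open : forall i, open (chart_map i @` chart_dom i);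
    chart_mapK : forall i p, chart_dom i p -> chart_inv i (chart_map i p) = p;
    chart_map_continuous : forall i p,
      chart_dom i p -> {for p, continuous (chart_map i)};
    chart_inv_continuous : forall i x,
      (chart_map i @` chart_dom i) x -> {for x, continuous (chart_inv i)};
    transition_smooth : forall i j,
      smooth (chart_map i @` (chart_dom i `&` chart_dom j))
             (chart_map j \o chart_inv i) }.

Section Manifold.
Context {R : realType} {n : nat} {M : topologicalType}.
Variable A : smooth_manifold R n M.

Definition chart_img (i : chart_index A) : set 'rV[R]_n :=
  chart_map i @` chart_dom i.

Definition transition (i j : chart_index A) : 'rV[R]_n -> 'rV[R]_n :=
  chart_map j \o chart_inv i.

(* [J] is meant to be open. *)
Definition smooth_curve (J : set R) (c : R -> M) : Prop :=
  (forall t, J t -> {for t, continuous c}) /\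
  (forall i : chart_index A,
     smooth (J `&` c @^-1` chart_dom i) (chart_map i \o c)).

(* Smooth on the closed interval [a, b], i.e. up to the endpoints. *)
Definition smooth_segment (a b : R) (c : R -> M) : Prop :=
  exists2 e : R, 0 < e & smooth_curve `]a - e, b + e[ c.

Definition velocity (c : R -> M) (t : R) : 'rV[R]_n :=
  derive1 (chart_map (chart_at A (c t)) \o c) t.

(* The embedded circle is the range of a 1-periodic immersion of the line that
   is injective modulo 1; by compactness of R/Z such an injective immersion is
   an embedding. *)
Definition embedded_circle (c : R -> M) : Prop :=
  [/\ smooth_curve setT c,
      forall s t, c s = c t <-> exists k : int, s = t + k%:~R &
      forall t, velocity c t != 0].

Definition circle_tangent (c : R -> M) (p : M) : set 'rV[R]_n :=
  [set v | exists t l, c t = p /\ v = l *: velocity c t].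

End Manifold.

Definition bilin (R : realType) (n : nat) (G : 'M[R]_n) (u v : 'rV[R]_n) : R :=
  (u *m G *m v^T) 0 0.

(* [gmx i x] is the matrix of components of the metric in the chart [i]. *)
Record riemannian_metric (R : realType) (n : nat) (M : topologicalType)
    (A : smooth_manifold R n M) := RiemannianMetric {
  gmx : chart_index A -> 'rV[R]_n -> 'M[R]_n;
  gmx_smooth : forall i k l, smooth (chart_img i) (fun x => gmx i x k l);
  gmx_sym : forall i x, chart_img i x -> (gmx i x)^T = gmx i x;
  gmx_pos : forall i x (v : 'rV[R]_n),
    chart_img i x -> v != 0 -> 0 < bilin (gmx i x) v v;
  gmx_compat : forall i j p (u v : 'rV[R]_n),
    chart_dom i p -> chart_dom j p ->
    bilin (gmx i (chart_map i p)) u v =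
    bilin (gmx j (chart_map j p)) ('D_u (transition i j) (chart_map i p))
                                  ('D_v (transition i j) (chart_map i p)) }.

Section Riemannian.
Context {R : realType} {n : nat} {M : topologicalType}.
Context {A : smooth_manifold R n M}.
Variable g : riemannian_metric A.

Definition inner (p : M) (u v : 'rV[R]_n) : R :=
  bilin (gmx g (chart_at A p) (chart_map (chart_at A p) p)) u v.

Definition speed (c : R -> M) (t : R) : R :=
  Num.sqrt (inner (c t) (velocity A c t) (velocity A c t)).

Definition curve_length (a b : R) (c : R -> M) : \bar R :=
  (\int[lebesgue_measure]_(t in `[a, b]) (speed c t)%:E)%E.

(* A piecewise smooth curve from [p] to [q], as the list of its smooth pieces,
   each of them reparametrised on [0, 1]. *)
Fixpoint is_path (p : M) (s : seq (R -> M)) (q : M) : Prop :=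
  if s is c :: s' then
    [/\ smooth_segment A 0 1 c, c 0 = p & is_path (c 1) s' q]
  else p = q.

Definition path_length (s : seq (R -> M)) : \bar R :=
  (\sum_(c <- s) curve_length 0 1 c)%E.

(* The distance is +oo between distinct connected components. *)
Definition dist (p q : M) : \bar R :=
  ereal_inf [set path_length s | s in [set s | is_path p s q]].

Definition complete_riemannian : Prop :=
  forall u : nat -> M,
    (forall e : R, 0 < e -> exists N : nat, forall k l : nat,
       (N <= k)%N -> (N <= l)%N -> (dist (u k) (u l) < e%:E)%E) ->
    exists p : M, (fun k => dist (u k) p) @ \oo --> 0%E.

Definition partial (f : 'rV[R]_n -> R) (a : 'I_n) (x : 'rV[R]_n) : R :=
  'D_(delta_mx 0 a) f x.

Definition christoffel (i : chart_index A) (x : 'rV[R]_n) (k a b : 'I_n) : R :=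
  2^-1 * \sum_(l < n) invmx (gmx g i x) k l *
    (partial (fun y => gmx g i y b l) a x + partial (fun y => gmx g i y a l) b x
     - partial (fun y => gmx g i y a b) l x).

Definition geodesic_equation (c : R -> M) (t : R) : Prop :=
  forall i : chart_index A, chart_dom i (c t) ->
  let x := chart_map i \o c in
  forall k : 'I_n,
    derive1n 2 x t 0 k + \sum_(a < n) \sum_(b < n)
      christoffel i (x t) k a b * derive1 x t 0 a * derive1 x t 0 b = 0.

(* A geodesic defined on [0, a]: it extends as a geodesic to a slightly larger
   open interval (the values of [c] outside [0, a] are otherwise irrelevant),
   and it is either trivial, i.e. constant, or parametrised by arc length on a
   nondegenerate interval. *)
Definition geodesic (a : R) (c : R -> M) : Prop :=
  [/\ 0 <= a,
      exists2 e : R, 0 < e & smooth_curve A `]- e, a + e[ c /\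
        (forall t, - e < t < a + e -> geodesic_equation c t) &
      (forall t, 0 <= t <= a -> velocity A c t = 0) \/
      (0 < a /\ forall t, 0 <= t <= a -> speed c t = 1)].

Definition minimising_geodesic (a : R) (c : R -> M) : Prop :=
  geodesic a c /\ curve_length 0 a c = dist (c 0) (c a).

Section Circle.
Variable c : R -> M.

(* Reversing the geodesics and exchanging v1 and v2 shows that the notion is
   symmetric in [p] and [q], hence is a property of the set {p, q}. *)
Definition regular_pair (p q : M) : Prop :=
  exists v1 v2 : 'rV[R]_n,
    [/\ circle_tangent A c p v1, circle_tangent A c q v2 &
        forall (a : R) (gam : R -> M), minimising_geodesic a gam ->
          gam 0 = p -> gam a = q ->
          inner q v2 (velocity A gam a) - inner p v1 (velocity A gam 0) < 0].

Definition critical_pair (p q : M) : Prop := ~ regular_pair p q.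

(* [C] is a closed arc of the circle with endpoints [x] and [y]; the degenerate
   cases are a single point and the whole circle. *)
Definition bounds_arc (x y : M) (C : set M) : Prop :=
  exists s s' : R, [/\ s <= s' <= s + 1, C = c @` `[s, s'] &
    (c s = x /\ c s' = y) \/ (c s = y /\ c s' = x)].

Definition arc_dist (C D : set M) : \bar R :=
  (\int[lebesgue_measure]_(t in `[0%R, 1%R[ `&` c @^-1` (C `+` D))
     (speed c t)%:E)%E.

Definition sweepout (p q : R -> M) : Prop :=
  [/\ p 0 = q 0 /\ p 1 = q 1,
      forall t, 0 <= t <= 1 -> range c (p t) /\ range c (q t),
      {within `[0, 1], continuous p} /\ {within `[0, 1], continuous q} &
      exists C : R -> set M,
        [/\ forall t, 0 <= t <= 1 -> bounds_arc (p t) (q t) (C t),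
            forall t, 0 <= t <= 1 ->
              arc_dist (C s) (C t) @[s --> within `[0, 1] (nbhs t)] --> 0%E,
            C 0 = [set p 0] &
            C 1 = range c]].

Definition width : \bar R :=
  ereal_inf [set w | exists p q, sweepout p q /\
    w = ereal_sup [set dist (p t) (q t) | t in `[0, 1]]].

End Circle.
End Riemannian.

(* Main.v *)
(* If no pair of points of the circle at distance w = S(Gamma) > 0 were critical,
   sweepouts could be pushed below level w.

   Each pair at level w has a direction (v1, v2) as in the definition of a regular
   pair. Moving nearby pairs in that direction for a time h lowers their distance at
   a definite rate: otherwise minimizers between almost optimal pairs converge to a
   minimizing geodesic violating the strict inequality. By compactness finitely many
   such localised moves compose to a map which brings the whole sublevel {D <= w + G}
   below w - G, fixes the pairs at distance less than w/2, and thus sends sweepouts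
   to sweepouts. Applied to a sweepout that almost realises the width, it contradicts
   the definition of w. The width is positive because an arc longer than 3/4 of the
   circle and one shorter than 1/4 are a definite distance apart, so that every
   sweepout contains an arc of intermediate length, whose endpoints are far apart.

   Minimizers exist by an ultrafilter version of Hopf-Rinow. They are only Lipschitz
   for the Riemannian distance at first. In a chart the distance agrees with the norm
   of the metric at a point up to a factor 1 + O(radius), so the near equality in the
   triangle inequality makes minimizers almost affine, hence C^1 with Hoelder
   derivative. The Euler-Lagrange equation and the lemma of du Bois-Reymond make them
   C^2 solutions of the geodesic equation, hence smooth. To include the endpoints, a
   minimizer is extended by a short solution of the geodesic equation, which is
   minimizing because two-point boundary problems have unique solutions for short
   times. *)

(* No exponential map or injectivity radius occurs. Every geometric estimate compares [dist] with
   the norm of the metric frozen at one point of a chart, with constants uniform over all minimizers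
   of bounded speed; this uniformity lets difference quotients of a sequence of minimizers pass to
   the limit. Limits along a free ultrafilter exist at all parameters at once, so neither diagonal
   extraction nor equicontinuity enters. The distance has values in [\bar R], hence most bounds read
   [dist p q <= r%:E] with a real [r].

   On the circle everything is lifted to the line: a pair becomes a point of [R * R], the distance a
   function periodic in both variables, and a closed arc an interval of length at most one. The
   obstacle is that a deformation of pairs must also deform the arcs continuously, while the arc
   over a pair may start at either endpoint and may degenerate. This is why pairs at distance less
   than [w / 2] are left alone: at the others both complementary arcs have length bounded below, and
   small moves preserve the order of the lifts. *)
Require Import Defs.
From mathcomp Require Import all_boot all_order all_algebra.
From mathcomp Require Import all_classical all_reals all_analysis.
From mathcomp Require Import ring lra zify measurable_realfun.
Import Order.TTheory GRing.Theory Num.Theory.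
Import numFieldNormedType.Exports.
Local Open Scope classical_set_scope.
Local Open Scope ring_scope.
Set Implicit Arguments.
Unset Strict Implicit.
Unset Printing Implicit Defensive.

(* The cost of [lra] grows quickly with the context: [glra] uses the goal alone,
   [alra] keeps the arithmetic hypotheses only if that fails. *)
Ltac glra :=
  repeat match goal with [ H : ?T |- _ ] => match type of T with Prop => clear H end end;
  repeat match goal with [ H := _ |- _ ] => clearbody H end;
  lra.

Ltac alra := first
  [ glra
  | repeat match goal with
    | [ H : ?T |- _ ] =>
        lazymatch type of T with Prop => idtac end;
        lazymatch T with
        | is_true (_ <= _) => fail
        | is_true (_ < _) => fail
        | is_true (_ && _) => fail
        | is_true (~~ _) => fail
        | @eq (GRing.Ring.sort _) _ _ => fail
        | @eq (Real.sort _) _ _ => fail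
        | _ => clear H
        end
    end;
    repeat match goal with [ H := _ : ?T |- _ ] =>
      lazymatch type of T with Prop => fail | _ => clearbody H end end;
    lra
  | lra ].

(** * Calculus *)

Section RealCalculus.
Context {R : realType}.

Lemma continuous_epsP (T : pseudoMetricType R) (V : normedModType R) (f : T -> V) (t : T) :
  {for t, continuous f} <-> forall e : R, 0 < e -> exists2 d : R, 0 < d &
     forall s, ball t d s -> `|f s - f t| < e.
Proof.
split=> [cf e e0|H].
  have /cvgrPdist_lt /(_ e e0) := cf.
  move/nbhs_ballP => [d /= d0 Hd]; exists d => // s ts; rewrite distrC; exact: Hd.
apply/cvgrPdist_lt => e e0; have [d d0 Hd] := H e e0.
by apply/nbhs_ballP; exists d => // s /Hd; rewrite distrC.
Qed.

Lemma is_derive_eps (V : normedModType R) (f : R -> V) (t : R) (v : V) :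
  is_derive t 1 f v -> forall e : R, 0 < e -> exists2 d : R, 0 < d &
    forall s, `|s - t| < d -> `|f s - f t - (s - t) *: v| <= e * `|s - t|.
Proof.
move=> [df fv] e e0.
have /cvg_ex[/= l Hl] := df.
have El : v = l by rewrite -fv; exact/cvg_lim.
rewrite -{}El in Hl.
move/cvgrPdist_le : Hl => /(_ e e0) [d /= d0 Hd].
exists d => // s std.
have [->|st0] := eqVneq s t; first by rewrite !subrr scale0r subr0 !normr0 mulr0.
have := Hd (s - t); rewrite /ball_/= sub0r normrN subr_eq0 => /(_ std st0).
rewrite /= -[_ *: 1]/(_ * 1) mulr1 subrK => H.
have st : s - t != 0 by rewrite subr_eq0.
have -> : f s - f t - (s - t) *: v = - ((s - t) *: (v - (s - t)^-1 *: (f s - f t))).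
  by rewrite scalerBr scalerA mulfV// scale1r opprB.
by rewrite normrN normrZ mulrC ler_wpM2r.
Qed.

Lemma eps_is_derive (V : normedModType R) (f : R -> V) (t : R) (v : V) :
  (forall e : R, 0 < e -> exists2 d : R, 0 < d &
    forall s, `|s - t| < d -> `|f s - f t - (s - t) *: v| <= e * `|s - t|) ->
  is_derive t 1 f v.
Proof.
move=> H.
have Hl : (fun h => h^-1 *: ((f \o shift t) (h *: 1) - f t)) @ 0^' --> v.
  apply/cvgrPdist_le => e e0; have [d d0 Hd] := H e e0.
  exists d => //= h; rewrite /ball_/= sub0r normrN => hd h0.
  have := Hd (h + t); rewrite addrK => /(_ hd).
  rewrite -[_ *: 1]/(_ * 1) mulr1 => Hh.
  have -> : v - h^-1 *: (f (h + t) - f t) = - (h^-1 *: (f (h + t) - f t - h *: v)).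
    by rewrite (scalerBr _ _ (h *: v)) scalerA mulVf// scale1r opprB.
  by rewrite normrN normrZ normfV ler_pdivrMl ?normr_gt0// mulrC.
split; first by apply/cvg_ex; exists v.
exact/cvg_lim.
Qed.

Lemma is_derive_continuous (V : normedModType R) (f : R -> V) (t : R) (v : V) :
  is_derive t 1 f v -> {for t, continuous f}.
Proof. by move=> [df _]; exact/differentiable_continuous/derivable1_diffP. Qed.

(** The supremum [c] of the [t] with [P a t] is attained and cannot be less than [b], since the
    local hypothesis at [c] crosses it. With [P s t] a statement about the interval from [s] to [t],
    this serves both to add up infinitesimal estimates and as compactness of the interval. *)
Lemma real_induction (a b : R) (P : R -> R -> Prop) : a <= b ->
  (forall s t u, P s t -> P t u -> P s u) ->
  (forall t, a <= t <= b -> exists2 d : R, 0 < d &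
     forall s u, a <= s -> s <= t -> t <= u -> u <= b -> t - s < d -> u - t < d ->
       P s t /\ P t u) ->
  P a b.
Proof.
move=> ab Ptr Ploc.
pose S := [set t | a <= t <= b /\ P a t].
have Sa : S a.
  have [|d d0 Hd] := Ploc a; first by rewrite lexx.
  split; first by rewrite lexx.
  by have [] := Hd a a; rewrite ?lexx ?subrr.
have supS : has_sup S.
  split; first by exists a.
  by exists b => t [/andP[]].
set c := sup S.
have ac : a <= c by apply: sup_upper_bound.
have cb : c <= b by apply: ge_sup; [exists a|move=> t [/andP[]]].
have [|d d0 Hd] := Ploc c; first by rewrite ac.
have [t [/andP[at_ tb] Pat] ct] := sup_adherent d0 supS.
have tc : t <= c by apply: sup_upper_bound => //; split=> //; rewrite at_.
have tcd : c - t < d by rewrite ltrBlDr -ltrBlDl.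
have Pac : P a c.
  by apply: (Ptr _ _ _ Pat); have [] := Hd t c; rewrite ?lexx ?subrr.
have [<-//|] := eqVneq c b.
rewrite neq_lt [X in _ || X]ltNge cb orbF => ltcb.
pose u := Num.min b (c + d / 2).
have cu : c < u by rewrite lt_min ltcb ltrDl divr_gt0.
have ub : u <= b by rewrite ge_min lexx.
have Pau : P a u.
  apply: (Ptr _ _ _ Pac).
  have ucd : u - c < d.
    rewrite ltrBlDl (@le_lt_trans _ _ (c + d / 2)) ?ge_min ?lexx ?orbT//.
    by rewrite ltrD2l ltr_pdivrMr// mulr2n mulrDr mulr1 ltrDl.
  by have [] := Hd c u ac (lexx c) (ltW cu) ub _ ucd; rewrite ?subrr.
have : u <= c by apply: sup_upper_bound => //; split=> //; rewrite (le_trans ac (ltW cu)).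
by rewrite leNgt cu.
Qed.

Lemma within_continuous_of (V : normedModType R) (f : R -> V) (a b : R) :
  (forall t, a <= t <= b -> {for t, continuous f}) -> {within `[a, b], continuous f}.
Proof.
move=> cf; apply/continuous_in_subspaceT => t; rewrite inE/= in_itv/= => tab.
exact: cf.
Qed.

Lemma primitive (a b : R) (f : R -> R) : a < b ->
  (forall t, a <= t <= b -> {for t, continuous f}) ->
  exists F : R -> R, forall t, a < t < b -> is_derive t 1 F (f t).
Proof.
move=> ab cf.
have intf : (@lebesgue_measure R).-integrable `[a, b] (EFin \o f).
  apply: continuous_compact_integrable; first exact: segment_compact.
  exact: within_continuous_of.
exists (fun x => (\int[lebesgue_measure]_(t in `[a, x]) f t)%R) => t /andP[at_ tb].
have [|d1 d2] := continuous_FTC1_closed tb intf at_.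
  by apply: cf; rewrite !ltW.
apply: DeriveDef; [exact: d1|rewrite -derive1E; exact: d2].
Qed.

Lemma integral_primitive (f F : R -> R) (a b : R) : a <= b ->
  (forall t, a <= t <= b -> {for t, continuous f}) ->
  (forall t, a <= t <= b -> is_derive t 1 F (f t)) ->
  (\int[lebesgue_measure]_(x in `[a, b]) (f x)%:E = (F b - F a)%:E)%E.
Proof.
rewrite le_eqVlt => /predU1P[<- _ _|ab cf dF].
  by rewrite set_itv1 integral_set1 subrr.
rewrite (@continuous_FTC2 _ _ F)//.
- exact: within_continuous_of.
- split.
  + move=> t; rewrite in_itv/= => /andP[at_ tb].
    by have [] := dF t _; rewrite ?ltW.
  + apply: cvg_at_right_filter; apply: is_derive_continuous (dF a _).
    by rewrite lexx ltW.
  + apply: cvg_at_left_filter; apply: is_derive_continuous (dF b _).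
    by rewrite lexx ltW.
- move=> t; rewrite in_itv/= => /andP[at_ tb].
  have tI : a <= t <= b by rewrite !ltW.
  by have dt := dF t tI; rewrite derive1E derive_val.
Qed.

Lemma mvt_is_derive (f df : R -> R) (a b : R) : a <= b ->
  (forall t, a <= t <= b -> is_derive t 1 f (df t)) ->
  exists2 c, a <= c <= b & f b - f a = df c * (b - a).
Proof.
move=> ab H; have [||c cab ->] := @MVT_segment R f df a b ab.
- by move=> x; rewrite in_itv/= => /andP[ax xb]; apply: H; rewrite !ltW.
- by apply: within_continuous_of => t /H; exact: is_derive_continuous.
by exists c => //; move: cab; rewrite in_itv.
Qed.

Lemma mvt_between (f df : R -> R) (a b : R) :
  (forall t, Num.min a b <= t <= Num.max a b -> is_derive t 1 f (df t)) ->
  exists2 c, Num.min a b <= c <= Num.max a b & f b - f a = df c * (b - a).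
Proof.
case: (leP a b) => ab H; first exact: mvt_is_derive.
have [c cab E] := mvt_is_derive (ltW ab) H.
by exists c => //; rewrite -opprB E -mulrN opprB.
Qed.

Lemma is_derive_cst_le (f df : R -> R) (a b : R) : a <= b ->
  (forall t, a <= t <= b -> is_derive t 1 f (df t)) ->
  (forall t, a <= t <= b -> 0 <= df t) -> f a <= f b.
Proof.
move=> ab H H0; have [c cab E] := mvt_is_derive ab H.
by rewrite -subr_ge0 E mulr_ge0 ?H0// subr_ge0.
Qed.

Lemma is_derive_mxP m n (x : R -> 'M[R]_(m, n)) (t : R) (v : 'M[R]_(m, n)) :
  is_derive t 1 x v <-> forall i j, is_derive t 1 (fun s => x s i j) (v i j).
Proof.
split=> [[dx <-] i j|H].
  by split; [move/derivable_mxP : dx|rewrite derive_mx// mxE].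
have dx : derivable x t 1 by apply/derivable_mxP => i j; case: (H i j).
split=> //; rewrite derive_mx//; apply/matrixP => i j; rewrite mxE.
by case: (H i j).
Qed.

Lemma coord_norm_le m n (v : 'M[R]_(m, n)) i j : `|v i j| <= `|v|.
Proof.
rewrite [leRHS]/Num.norm/= mx_normrE.
exact: (@le_bigmax _ _ _ _ (fun ij : 'I_m * 'I_n => `|v ij.1 ij.2|) (i, j)).
Qed.

Lemma mx_norm_leP m n (v : 'M[R]_(m, n)) (e : R) : 0 <= e ->
  (`|v| <= e) <-> forall i j, `|v i j| <= e.
Proof.
move=> e0; split=> [ve i j|H]; first exact: le_trans (coord_norm_le _ _ _) ve.
by rewrite [leLHS]/Num.norm/= mx_normrE; apply: bigmax_le => // -[i j] _; exact: H.
Qed.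

End RealCalculus.

(** * Calculus in several variables from directional derivatives *)

Section MultivariateCalculus.
Context {R : realType}.

Lemma mx_norm_ltP m n (v : 'M[R]_(m, n)) (e : R) : 0 < e ->
  (`|v| < e) <-> forall i j, `|v i j| < e.
Proof.
move=> e0; split=> [ve i j|H]; first exact: le_lt_trans (coord_norm_le _ _ _) ve.
by rewrite [ltLHS]/Num.norm/= mx_normrE; apply: bigmax_lt => // -[i j] _; exact: H.
Qed.

Lemma is_derive_line (V W : normedModType R) (f : V -> W) (p v : V) (t : R) (l : W) :
  is_derive (p + t *: v) v f l -> is_derive t 1 (fun s : R => f (p + s *: v)) l.
Proof.
have E : (fun h : R => h^-1 *: ((f \o shift (p + t *: v)) (h *: v) - f (p + t *: v)))
    = (fun h : R => h^-1 *: (((fun s : R => f (p + s *: v)) \o shift t) (h *: 1)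
                           - f (p + t *: v))).
  apply/funext => h /=; congr (_ *: (f _ - _)).
  by rewrite -[h *: 1]/(h * 1) mulr1 scalerDl addrCA.
by case=> df <-; split; [move: df|]; rewrite /derivable /derive E.
Qed.

(** The coordinates of [x] are replaced by those of [y] one at a time, with the mean value theorem
    on each edge. The norm is the sup norm, so a ball is a box and the whole polygon stays in it. *)
Lemma telescoping_mvt n (f : 'rV[R]_n -> R) (df : 'I_n -> 'rV[R]_n -> R) x0 r :
  (forall z a, `|z - x0| < r -> is_derive z (delta_mx 0 a) f (df a z)) ->
  forall x y, `|x - x0| < r -> `|y - x0| < r ->
  exists xi : 'I_n -> 'rV[R]_n,
    (forall a, `|xi a - x0| < r /\ `|xi a - x| <= `|y - x|) /\
    f y - f x = \sum_a df a (xi a) * (y 0 a - x 0 a).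
Proof.
move=> H x y xr yr.
have r0 : 0 < r by apply: le_lt_trans xr.
pose p (j : nat) : 'rV[R]_n := \row_a (if (a < j)%N then y 0 a else x 0 a).
have pS (a : 'I_n) : p a.+1 = p a + (y 0 a - x 0 a) *: delta_mx 0 a.
  apply/rowP => b; rewrite !mxE eqxx/= ltnS leq_eqVlt.
  have [->|ba] := eqVneq b a; first by rewrite eqxx/= ltnn mulr1 addrC subrK.
  by rewrite -[_ == _ :> nat]/(b == a) (negPf ba)/= mulr0 addr0.
have xir (a : 'I_n) (c : R) : Num.min 0 (y 0 a - x 0 a) <= c <= Num.max 0 (y 0 a - x 0 a) ->
    `|p a + c *: delta_mx 0 a - x0| < r /\ `|p a + c *: delta_mx 0 a - x| <= `|y - x|.
  move=> cb.
  have xc b : `|x 0 b - x0 0 b| < r.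
    by apply: le_lt_trans xr; have := coord_norm_le (x - x0) 0 b; rewrite !mxE.
  have yc b : `|y 0 b - x0 0 b| < r.
    by apply: le_lt_trans yr; have := coord_norm_le (y - x0) 0 b; rewrite !mxE.
  have yx b : `|y 0 b - x 0 b| <= `|y - x|.
    by have := coord_norm_le (y - x) 0 b; rewrite !mxE.
  split.
    apply/mx_norm_ltP => // i b; rewrite ord1 !mxE eqxx/=.
    have [ba|ba] := eqVneq b a; last first.
      by rewrite mulr0 addr0; case: ifP.
    rewrite ba ltnn mulr1; move: cb (xc a) (yc a); rewrite !ltr_norml !minElt !maxElt.
    by case: ifP => _ /andP[? ?] /andP[? ?] /andP[? ?]; apply/andP; split; alra.
  apply/mx_norm_leP => // i b; rewrite ord1 !mxE eqxx/=.
  have [ba|ba] := eqVneq b a; last first.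
    by rewrite mulr0 addr0; case: ifP => // _; rewrite subrr normr0.
  rewrite ba ltnn mulr1; apply: le_trans (yx a).
  rewrite addrAC subrr add0r; move: cb; rewrite minElt maxElt.
  by have [h|h] := ltP 0 (y 0 a - x 0 a) => /andP[? ?];
    [rewrite !ger0_norm//; alra|rewrite !ler0_norm//; alra].
have step (a : 'I_n) : exists xi : 'rV[R]_n, (`|xi - x0| < r /\ `|xi - x| <= `|y - x|) /\
    f (p a.+1) - f (p a) = df a xi * (y 0 a - x 0 a).
  have [t tb|c cb] := @mvt_between R (fun s => f (p a + s *: delta_mx 0 a))
    (fun s => df a (p a + s *: delta_mx 0 a)) 0 (y 0 a - x 0 a).
    by apply: is_derive_line; apply: H; have [] := xir a t tb.
  rewrite scale0r addr0 -pS subr0 => E.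
  by exists (p a + c *: delta_mx 0 a); split=> //; exact: xir.
pose xi a := projT1 (cid (step a)).
exists xi; split=> [a|]; first by rewrite /xi; case: cid => /= ? [].
have Ey : p n = y by apply/rowP => a; rewrite !mxE ltn_ord.
have Ex : p 0%N = x by apply/rowP => a; rewrite !mxE.
rewrite -[in f y]Ey -[in f x]Ex -(telescope_sumr (fun j => f (p j)) (leq0n n)) big_mkord.
by apply: eq_bigr => a _; rewrite /xi; case: cid => /= ? [].
Qed.

Lemma Ck_continuous k (V W : normedModType R) (U : set V) (f : V -> W) x :
  Ck k U f -> U x -> {for x, continuous f}.
Proof. by case: k => [|k] [H _]; exact: H. Qed.

Lemma Ck_derivable k (V W : normedModType R) (U : set V) (f : V -> W) v x :
  Ck k.+1 U f -> U x -> derivable f x v.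
Proof. by move=> [_ H]; exact: (H v).1. Qed.

Lemma Ck_derive k (V W : normedModType R) (U : set V) (f : V -> W) v :
  Ck k.+1 U f -> Ck k U (fun x => 'D_v f x).
Proof. by move=> [_ H]; exact: (H v).2. Qed.

Lemma CkS k (V W : normedModType R) (U : set V) (f : V -> W) : Ck k.+1 U f -> Ck k U f.
Proof.
elim: k f => [|k IH] f [fc fd]; first by split.
by split=> // v; split; [exact: (fd v).1|apply: IH; exact: (fd v).2].
Qed.

Lemma Ck_sub k (V W : normedModType R) (U U' : set V) (f : V -> W) :
  U' `<=` U -> Ck k U f -> Ck k U' f.
Proof.
move=> UU'; elim: k f => [|k IH] f [fc fd]; split=> //; try by move=> x /UU'; exact: fc.
by move=> v; split; [move=> x /UU'; exact: (fd v).1|apply: IH; exact: (fd v).2].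
Qed.

Lemma near_open_eq (V : normedModType R) (W : Type) (U : set V) (f g : V -> W) x : open U -> U x ->
  (forall y, U y -> f y = g y) -> \near x, f x = g x.
Proof.
by move=> oU Ux fg; near=> y; apply: fg; near: y; exact: open_nbhs_nbhs.
Unshelve. all: by end_near. Qed.

Lemma Ck_ext k (V W : normedModType R) (U : set V) (f g : V -> W) : open U ->
  (forall x, U x -> f x = g x) -> Ck k U f -> Ck k U g.
Proof.
move=> oU; elim: k f g => [|k IH] f g fg [fc fd].
  split=> // x Ux; rewrite /prop_for/continuous_at -fg//.
  apply: (cvg_trans _ (fc _ Ux)); apply: near_eq_cvg.
  by apply: (near_open_eq oU Ux) => y Uy; rewrite fg.
have E x : U x -> \near x, f x = g x by move=> Ux; exact: (near_open_eq oU Ux).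
split.
  move=> x Ux; rewrite /prop_for/continuous_at -fg//.
  apply: (cvg_trans _ (fc _ Ux)); apply: near_eq_cvg.
  by apply: (near_open_eq oU Ux) => y Uy; rewrite fg.
move=> v; split.
  by move=> x Ux; apply: near_eq_derivable ((fd v).1 _ Ux); exact: E.
apply: IH (fd v).2 => x Ux; apply: near_eq_derive; exact: E.
Qed.

Lemma smooth_derive (V W : normedModType R) (U : set V) (f : V -> W) v :
  smooth U f -> smooth U (fun x => 'D_v f x).
Proof. by move=> sf k; apply: Ck_derive; exact: sf. Qed.

Lemma Ck_cst k (V W : normedModType R) (U : set V) (w : W) : Ck k U (fun _ => w).
Proof.
elim: k w => [|k IH] w; first by split=> // x _; exact: cst_continuous.
split; first by move=> x _; exact: cst_continuous.
move=> v; split; first by move=> x _; exact: derivable_cst.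
have -> : (fun x => 'D_v (fun _ : V => w) x) = (fun _ => 0) by apply/funext => x; exact: derive_cst.
exact: IH.
Qed.

Lemma Ck_add k (V W : normedModType R) (U : set V) (f g : V -> W) : open U ->
  Ck k U f -> Ck k U g -> Ck k U (fun x => f x + g x).
Proof.
move=> oU; elim: k f g => [|k IH] f g [fc fd] [gc gd].
  by split=> // x Ux; apply: continuousD; [exact: fc|exact: gc].
split=> [x Ux|v]; first by apply: continuousD; [exact: fc|exact: gc].
split=> [x Ux|].
  by apply: derivableD; [exact: (fd v).1|exact: (gd v).1].
apply: (Ck_ext oU _ (IH _ _ (fd v).2 (gd v).2)) => x Ux.
by rewrite -deriveD//; [exact: (fd v).1|exact: (gd v).1].
Qed.

Lemma Ck_mul k (V : normedModType R) (U : set V) (f g : V -> R) : open U ->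
  Ck k U f -> Ck k U g -> Ck k U (fun x => f x * g x).
Proof.
move=> oU; elim: k f g => [|k IH] f g.
  by move=> [fc fd] [gc gd]; split=> // x Ux; apply: continuousM; [exact: fc|exact: gc].
move=> Cf Cg; have := Cf; have := Cg; move=> [gc gd] [fc fd].
split=> [x Ux|v]; first by apply: continuousM; [exact: fc|exact: gc].
split=> [x Ux|].
  by apply: derivableM; [exact: (fd v).1|exact: (gd v).1].
apply: (Ck_ext oU _ (Ck_add oU (IH _ _ (CkS Cf) (gd v).2) (IH _ _ (CkS Cg) (fd v).2))) => x Ux.
by have := deriveM ((fd v).1 x Ux) ((gd v).1 x Ux) => /= ->.
Qed.

Lemma Ck_sum k (V W : normedModType R) (U : set V) (I : Type) (s : seq I) (f : I -> V -> W) : open U ->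
  (forall i, Ck k U (f i)) -> Ck k U (fun x => \sum_(i <- s) f i x).
Proof.
move=> oU Cf; elim: s => [|i s IH].
  by apply: (Ck_ext oU _ (@Ck_cst k V W U 0)) => x _; rewrite big_nil.
by apply: (Ck_ext oU _ (Ck_add oU (Cf i) IH)) => x _; rewrite big_cons.
Qed.

Lemma Ck_prod k (V : normedModType R) (U : set V) (I : Type) (s : seq I) (f : I -> V -> R) : open U ->
  (forall i, Ck k U (f i)) -> Ck k U (fun x => \prod_(i <- s) f i x).
Proof.
move=> oU Cf; elim: s => [|i s IH].
  by apply: (Ck_ext oU _ (@Ck_cst k V R U 1)) => x _; rewrite big_nil.
by apply: (Ck_ext oU _ (Ck_mul oU (Cf i) IH)) => x _; rewrite big_cons.
Qed.

Lemma Ck_inv k (V : normedModType R) (U : set V) (f : V -> R) : open U ->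
  (forall x, U x -> f x != 0) -> Ck k U f -> Ck k U (fun x => (f x)^-1).
Proof.
move=> oU f0; elim: k => [|k IH].
  by move=> [fc _]; split=> // x Ux; apply: continuousV; [exact: f0|exact: fc].
move=> Cf; have := Cf; move=> [fc fd].
split=> [x Ux|v]; first by apply: continuousV; [exact: f0|exact: fc].
split=> [x Ux|].
  by apply: derivableV; [exact: f0|exact: (fd v).1].
have CV := IH (CkS Cf).
apply: (Ck_ext oU _ (Ck_mul oU (@Ck_cst k V R U (-1)) (Ck_mul oU (Ck_mul oU CV CV) (fd v).2))) => x Ux.
have := deriveV (f0 x Ux) ((fd v).1 x Ux) => /= ->.
by rewrite mulN1r -[_ *: _]/(_ * _) -exprVn expr2 mulNr.
Qed.

Lemma Ck_mxP k (V : normedModType R) m n (U : set V) (f : V -> 'M[R]_(m, n)) : open U ->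
  Ck k U f <-> forall i j, Ck k U (fun x => f x i j).
Proof.
move=> oU; elim: k f => [|k IH] f.
  split=> [[fc _] i j|H].
    split=> // x Ux; apply: (@continuous_comp _ _ _ f (fun M : 'M[R]_(m, n) => M i j)).
      exact: fc.
    exact: coord_continuous.
  split; last exact: I.
  move=> x Ux; apply/continuous_epsP => e e0.
  have : \forall y \near x, forall ij : 'I_m * 'I_n, `|f x ij.1 ij.2 - f y ij.1 ij.2| < e.
    apply: filter_forall => -[i j]/=.
    by have [fc _] := H i j; have /cvgrPdist_lt /(_ e e0) := fc _ Ux.
  move/nbhs_ballP => [d /= d0 Hd]; exists d => // y xy.
  apply/mx_norm_ltP => // i j; rewrite !mxE distrC.
  exact: (Hd y xy (i, j)).
have fcP : (forall x, U x -> {for x, continuous f}) <->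
    (forall i j x, U x -> {for x, continuous (fun x => f x i j)}).
  split=> [fc i j x Ux|H x Ux].
    apply: (@continuous_comp _ _ _ f (fun M : 'M[R]_(m, n) => M i j)).
      exact: fc.
    exact: coord_continuous.
  apply/continuous_epsP => e e0.
  have : \forall y \near x, forall ij : 'I_m * 'I_n, `|f x ij.1 ij.2 - f y ij.1 ij.2| < e.
    apply: filter_forall => -[i j]/=.
    by have fc := H i j; have /cvgrPdist_lt /(_ e e0) := fc _ Ux.
  move/nbhs_ballP => [d /= d0 Hd]; exists d => // y xy.
  apply/mx_norm_ltP => // i j; rewrite !mxE distrC.
  exact: (Hd y xy (i, j)).
split=> [[fc fd] i j|H].
  split; first exact: fcP.1.
  move=> v; split=> [x Ux|].
    by move: i j; apply/derivable_mxP; exact: (fd v).1.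
  have /IH /(_ i j) := (fd v).2; apply: Ck_ext => // x Ux.
  by rewrite derive_mx ?mxE//; exact: (fd v).1.
have dd v x : U x -> derivable f x v.
  by move=> Ux; apply/derivable_mxP => i j; have [_ /(_ v)[/(_ x Ux)]] := H i j.
split; first by apply/fcP => i j; case: (H i j).
move=> v; split=> [x Ux|]; first exact: dd.
apply/IH => i j; have [_ /(_ v)[_]] := H i j; apply: Ck_ext => // x Ux.
by rewrite derive_mx ?mxE//; exact: dd.
Qed.

(** Cramer's rule: the entries are cofactors over the determinant, and both are polynomials in the
    entries of [A]. *)
Lemma smooth_invmx (V : normedModType R) n (U : set V) (A : V -> 'M[R]_n) : open U ->
  (forall x, U x -> A x \in unitmx) -> (forall i j, smooth U (fun x => A x i j)) ->
  forall i j, smooth U (fun x => invmx (A x) i j).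
Proof.
move=> oU Au As i j k.
have Cdet m (B : V -> 'M[R]_m) : (forall i j, Ck k U (fun x => B x i j)) ->
    Ck k U (fun x => \det (B x)).
  move=> CB; apply: Ck_sum => // s; apply: Ck_mul => //; first exact: Ck_cst.
  by apply: Ck_prod.
have CA : Ck k U (fun x => (\det (A x))^-1 * cofactor (A x) j i).
  apply: Ck_mul => //; first apply: Ck_inv => //.
  - by move=> x Ux; have := Au x Ux; rewrite unitmxE unitfE.
  - by apply: Cdet => a b; exact: As.
  apply: Ck_mul => //; first exact: Ck_cst.
  apply: Cdet => a b.
  have -> : (fun x => row' j (col' i (A x)) a b) = (fun x => A x (lift j a) (lift i b)).
    by apply/funext => x; rewrite !mxE.
  exact: As.
apply: Ck_ext CA => // x Ux.
by rewrite /invmx Au// !mxE.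
Qed.

Lemma open_ball_sub (V : normedModType R) (U : set V) x0 : open U -> U x0 ->
  exists2 r : R, 0 < r & forall x, `|x - x0| < r -> U x.
Proof.
move=> oU Ux0; have /nbhs_ballP[r /= r0 Hr] := open_nbhs_nbhs (conj oU Ux0).
by exists r => // x xr; apply: Hr; rewrite -ball_normE/= distrC.
Qed.

Lemma continuous_normP (V W : normedModType R) (f : V -> W) x :
  {for x, continuous f} <-> forall e : R, 0 < e -> exists2 d : R, 0 < d &
    forall y, `|y - x| < d -> `|f y - f x| < e.
Proof.
split=> [/continuous_epsP H e /H[d d0 Hd]|H].
  by exists d => // y yx; apply: Hd; rewrite -ball_normE/= distrC.
apply/continuous_epsP => e /H[d d0 Hd]; exists d => // y.
by rewrite -ball_normE/= distrC; exact: Hd.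
Qed.

(** Stands for a minimum of finitely many radii; starting the induction at 1 covers an empty index
    type such as ['I_0]. *)
Lemma common_radius (I : finType) (P : I -> R -> Prop) :
  (forall i d e, 0 < e -> e <= d -> P i d -> P i e) ->
  (forall i, exists2 d : R, 0 < d & P i d) -> exists2 d : R, 0 < d & forall i, P i d.
Proof.
move=> Pmono H.
suff : exists2 d : R, 0 < d & forall i, i \in enum I -> P i d.
  by move=> [d d0 Hd]; exists d => // i; apply: Hd; rewrite mem_enum.
elim: (enum I) => [|i s [d d0 Hd]]; first by exists 1.
have [d' d'0 Hd'] := H i; exists (Num.min d d'); first by rewrite lt_min d0.
move=> j; rewrite inE => /predU1P[->|/Hd].
  by apply: Pmono Hd'; rewrite ?lt_min ?d0 ?ge_min ?lexx ?orbT.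
by apply: Pmono; rewrite ?lt_min ?d0 ?ge_min ?lexx ?orbT.
Qed.

(** The differential of [f] at [z] as an explicit linear form in [v]. Linearity of ['D_v f z] in [v]
    is not part of [Ck]; it comes only with [C1_derive]. *)
Definition partials n (f : 'rV[R]_n -> R) (z v : 'rV[R]_n) : R :=
  \sum_a 'D_(delta_mx 0 a) f z * v 0 a.

Lemma C1_partials_near n (U : set 'rV[R]_n) (f : 'rV[R]_n -> R) x0 :
  open U -> U x0 -> Ck 1 U f -> forall e : R, 0 < e -> exists2 r : R, 0 < r &
    forall z, `|z - x0| < r -> U z /\
      forall a, `|'D_(delta_mx 0 a) f z - 'D_(delta_mx 0 a) f x0| < e.
Proof.
move=> oU Ux0 Cf e e0.
have [r1 r10 Hr1] := open_ball_sub oU Ux0.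
have [|a|r2 r20 Hr2] := @common_radius 'I_n (fun a r => forall z, `|z - x0| < r ->
   `|'D_(delta_mx 0 a) f z - 'D_(delta_mx 0 a) f x0| < e).
- by move=> a d d' d'0 dd' H z zd; apply: H; exact: lt_le_trans dd'.
- have fc : {for x0, continuous (fun x => 'D_(delta_mx 0 a) f x)}.
    exact: Ck_continuous (Ck_derive _ Cf) Ux0.
  by move/continuous_normP : fc => /(_ e e0)[d d0 Hd]; exists d.
exists (Num.min r1 r2); first by rewrite lt_min r10.
move=> z; rewrite lt_min => /andP[z1 z2]; split; first exact: Hr1.
by move=> a; exact: Hr2.
Qed.

Lemma C1_locally_lipschitz n (U : set 'rV[R]_n) (f : 'rV[R]_n -> R) x0 :
  open U -> U x0 -> Ck 1 U f ->
  exists r L : R, [/\ 0 < r, 0 < L & forall x y, `|x - x0| < r -> `|y - x0| < r ->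
    `|f y - f x| <= L * `|y - x|].
Proof.
move=> oU Ux0 Cf.
have [r r0 Hr] := C1_partials_near oU Ux0 Cf ltr01.
pose L := 1 + \sum_(a < n) (`|'D_(delta_mx 0 a) f x0| + 1).
exists r, L; split=> //.
  by rewrite ltr_pwDl// sumr_ge0// => a _; rewrite addr_ge0.
move=> x y xr yr.
have [|xi [Hxi ->]] := @telescoping_mvt n f (fun a z => 'D_(delta_mx 0 a) f z) x0 r _ x y xr yr.
  by move=> z a zr; apply: derivableP; apply: Ck_derivable Cf _; exact: (Hr _ zr).1.
apply: le_trans (ler_norm_sum _ _ _) _.
rewrite mulrDl mul1r mulr_suml ler_wpDl//; apply: ler_sum => a _.
rewrite normrM ler_pM//.
  rewrite -lerBlDl; apply: le_trans (lerB_dist _ _) _; apply/ltW.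
  by apply: (Hr _ _).2; exact: (Hxi a).1.
by have := coord_norm_le (y - x) 0 a; rewrite !mxE.
Qed.

(** Fréchet differentiability, which [Ck] does not contain: on a small ball the partial derivatives
    at the intermediate points of [telescoping_mvt] are close to those at [x0]. *)
Lemma C1_taylor n (U : set 'rV[R]_n) (f : 'rV[R]_n -> R) x0 :
  open U -> U x0 -> Ck 1 U f -> forall e : R, 0 < e -> exists2 d : R, 0 < d & forall y, `|y - x0| < d ->
    `|f y - f x0 - partials f x0 (y - x0)| <= e * `|y - x0|.
Proof.
move=> oU Ux0 Cf e e0; pose e' := e / (n%:R + 1).
have n1 : 0 < n%:R + 1 :> R by rewrite ltr_wpDl.
have e'0 : 0 < e' by rewrite divr_gt0.
have [r r0 Hr] := C1_partials_near oU Ux0 Cf e'0.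
exists r => // y yr.
have xr : `|x0 - x0| < r by rewrite subrr normr0.
have [|xi [Hxi ->]] := @telescoping_mvt n f (fun a z => 'D_(delta_mx 0 a) f z) x0 r _ x0 y xr yr.
  by move=> z a zr; apply: derivableP; apply: Ck_derivable Cf _; exact: (Hr _ zr).1.
rewrite /partials -sumrB.
apply: le_trans (ler_norm_sum _ _ _) _.
apply: (@le_trans _ _ (\sum_(a < n) e' * `|y - x0|)).
  apply: ler_sum => a _; rewrite !mxE -mulrBl normrM ler_pM//.
    by apply/ltW; apply: (Hr _ _).2; exact: (Hxi a).1.
  by have := coord_norm_le (y - x0) 0 a; rewrite !mxE.
rewrite sumr_const card_ord -mulrnAl ler_wpM2r// -mulr_natr /e' -mulrA ler_piMr ?ltW//.
by rewrite mulrC ltr_pdivrMr// mul1r ltrDl.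
Qed.

Lemma partials_le n (f : 'rV[R]_n -> R) z : exists2 B : R, 0 < B &
  forall v, `|partials f z v| <= B * `|v|.
Proof.
exists (1 + \sum_a `|'D_(delta_mx 0 a) f z|); first by rewrite ltr_pwDl// sumr_ge0.
move=> v; apply: le_trans (ler_norm_sum _ _ _) _.
rewrite mulrDl mul1r mulr_suml ler_wpDl//; apply: ler_sum => a _.
by rewrite normrM ler_wpM2l// coord_norm_le.
Qed.

Lemma partialsD n (f : 'rV[R]_n -> R) z u v : partials f z (u + v) = partials f z u + partials f z v.
Proof. by rewrite -big_split/=; apply: eq_bigr => a _; rewrite mxE mulrDr. Qed.

Lemma partialsZ n (f : 'rV[R]_n -> R) z k v : partials f z (k *: v) = k * partials f z v.
Proof. by rewrite mulr_sumr; apply: eq_bigr => a _; rewrite mxE mulrCA. Qed.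

Lemma partialsB n (f : 'rV[R]_n -> R) z u v : partials f z (u - v) = partials f z u - partials f z v.
Proof. by rewrite partialsD -scaleN1r partialsZ mulN1r. Qed.

Lemma is_derive_lip (V : normedModType R) (x : R -> V) (t : R) (v : V) : is_derive t 1 x v ->
  exists2 d : R, 0 < d & forall s, `|s - t| < d -> `|x s - x t| <= (`|v| + 1) * `|s - t|.
Proof.
move=> /is_derive_eps /(_ _ ltr01)[d d0 Hd]; exists d => // s /Hd.
rewrite mul1r => H.
have -> : x s - x t = (x s - x t - (s - t) *: v) + (s - t) *: v by rewrite subrK.
apply: le_trans (ler_normD _ _) _.
by rewrite normrZ mulrDl mul1r addrC lerD// mulrC.
Qed.

Lemma chain_rule n (U : set 'rV[R]_n) (f : 'rV[R]_n -> R) (x : R -> 'rV[R]_n) t v :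
  open U -> U (x t) -> Ck 1 U f -> is_derive t 1 x v ->
  is_derive t 1 (fun s => f (x s)) (partials f (x t) v).
Proof.
move=> oU Ux Cf dx; apply: eps_is_derive => e e0.
have [B B0 HB] := partials_le f (x t).
have [d1 d10 Hd1] := is_derive_lip dx.
have v1 : 0 < `|v| + 1 by rewrite ltr_wpDl.
have [d2 d20 Hd2] := C1_taylor oU Ux Cf (divr_gt0 (divr_gt0 e0 (ltr0n _ 2)) v1).
have [d3 d30 Hd3] := is_derive_eps dx (divr_gt0 (divr_gt0 e0 (ltr0n _ 2)) B0).
exists (Num.min (Num.min d1 d3) (d2 / (`|v| + 1))).
  by rewrite !lt_min d10 d30 divr_gt0.
move=> s; rewrite !lt_min => /andP[/andP[s1 s3] s2].
have Hx := Hd1 s s1.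
have xd2 : `|x s - x t| < d2.
  by apply: le_lt_trans Hx _; rewrite mulrC -ltr_pdivlMr.
have -> : f (x s) - f (x t) - (s - t) *: partials f (x t) v =
   (f (x s) - f (x t) - partials f (x t) (x s - x t)) +
   partials f (x t) (x s - x t - (s - t) *: v).
  by rewrite (partialsB f (x t) (x s - x t)) partialsZ -[_ *: _]/(_ * _); ring.
apply: le_trans (ler_normD _ _) _.
rewrite (splitr e) mulrDl lerD//.
  apply: le_trans (Hd2 _ xd2) _.
  apply: le_trans (ler_wpM2l _ Hx) _; first by rewrite !divr_ge0// ltW.
  by rewrite mulrA divfK// gt_eqF.
apply: le_trans (HB _) _.
apply: le_trans (ler_wpM2l (ltW B0) (Hd3 _ s3)) _.
by rewrite mulrA mulrC [B * _]mulrC divfK ?gt_eqF// mulrC.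
Qed.

Lemma C1_derive n (U : set 'rV[R]_n) (f : 'rV[R]_n -> R) z v :
  open U -> U z -> Ck 1 U f -> 'D_v f z = partials f z v.
Proof.
move=> oU Uz Cf.
have dx : is_derive (0 : R) 1 (fun s : R => z + s *: v) v.
  apply: eps_is_derive => e e0; exists 1 => // s _.
  by rewrite scale0r addr0 subr0 [z + _]addrC addrK subrr normr0 mulr_ge0// ltW.
have Uz' : U ((fun s : R => z + s *: v) 0) by rewrite scale0r addr0.
have := chain_rule oU Uz' Cf dx; rewrite scale0r addr0.
have := @is_derive_line _ _ f z v 0 ('D_v f z).
rewrite scale0r addr0 => /(_ (derivableP (Ck_derivable (v:=v) Cf Uz))).
by move=> [_ <-] [_ <-].
Qed.

Lemma Ck_compR k n (U : set 'rV[R]_n)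
    (f : 'rV[R]_n -> R) (x : R -> 'rV[R]_n) (P : set R) :
  open U -> open P -> (forall t, P t -> U (x t)) -> Ck k U f -> Ck k P x ->
  Ck k P (fun t => f (x t)).
Proof.
move=> oU oP PU; elim: k f => [|k IH] f Cf Cx.
  split=> // t Pt; apply: (@continuous_comp _ _ _ x f).
    exact: (Ck_continuous Cx).
  by apply: (Ck_continuous Cf); exact: PU.
have dx t : P t -> is_derive t 1 x ('D_1 x t).
  by move=> Pt; apply: derivableP; exact: Ck_derivable Cx Pt.
have Cf1 : Ck 1 U f by elim: (k) Cf => // j IHj /CkS /IHj.
have dfx t : P t -> is_derive t 1 (fun t => f (x t)) (partials f (x t) ('D_1 x t)).
  by move=> Pt; exact: chain_rule oU (PU _ Pt) Cf1 (dx t Pt).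
split=> [t Pt|v].
  by apply: is_derive_continuous (dfx t Pt).
have E t : P t -> is_derive t v (fun t => f (x t)) (v * partials f (x t) ('D_1 x t)).
  move=> /dfx[/derivable1_diffP df dE].
  split; first exact: diff_derivable.
  rewrite deriveE//; move: dE; rewrite deriveE// => <-.
  by rewrite -[v in LHS]mulr1 -[v * 1]/(v *: 1) linearZ.
split=> [t /E[]//|].
apply: (@Ck_ext _ _ _ _ (fun t => v * partials f (x t) ('D_1 x t))) => //.
  by move=> t /E[_ ->].
apply: Ck_mul => //; first exact: Ck_cst.
apply: Ck_sum => // a; apply: Ck_mul => //.
  by apply: (IH (fun z => 'D_(delta_mx 0 a) f z) _ (CkS Cx)); exact: Ck_derive.
have C1 : Ck k P (fun t => 'D_1 x t) by exact: Ck_derive.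
by have := (Ck_mxP k (fun t => 'D_1 x t) oP).1 C1 0 a.
Qed.

Lemma Ck_line k (V W : normedModType R) (U : set V) (f : V -> W) (p u : V) :
  Ck k U f -> Ck k [set t : R | U (p + t *: u)] (fun t : R => f (p + t *: u)).
Proof.
have E (h : V -> W) (v t : R) :
   (fun e : R => e^-1 *: (((fun t : R => h (p + t *: u)) \o shift t) (e *: v)
      - h (p + t *: u))) =
   (fun e : R => e^-1 *: ((h \o shift (p + t *: u)) (e *: (v *: u)) - h (p + t *: u))).
  apply/funext => e /=; congr (_ *: (h _ - _)).
  by rewrite scalerDl addrCA -[e *: v]/(e * v) scalerA.
have cl t : {for t, continuous (fun t : R => p + t *: u)}.
  move=> /=; apply: cvgD; [exact: cvg_cst|apply: cvgZr_tmp; exact: cvg_id].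
elim: k f => [|k IH] f [fc fd].
  split=> // t Ut; exact: (@continuous_comp _ _ _ (fun t : R => p + t *: u) f t (cl t) (fc _ Ut)).
split=> [t Ut|v].
  exact: (@continuous_comp _ _ _ (fun t : R => p + t *: u) f t (cl t) (fc _ Ut)).
split=> [t Ut|]; first by rewrite /derivable E; exact: (fd _).1.
have -> : (fun t : R => 'D_v (fun t : R => f (p + t *: u)) t) =
   (fun t : R => 'D_(v *: u) f (p + t *: u)) by apply/funext => t; rewrite /derive E.
exact: (IH (fun z => 'D_(v *: u) f z) (fd (v *: u)).2).
Qed.

End MultivariateCalculus.

(** * Norms of positive definite forms *)

Section BilinearForm.
Context {R : realType} {n : nat}.
Implicit Types (G : 'M[R]_n) (u v : 'rV[R]_n).

Lemma bilinE G u v : bilin G u v = \sum_k \sum_l u 0 k * G k l * v 0 l.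
Proof.
rewrite /bilin mxE exchange_big/=; apply: eq_bigr => l _.
by rewrite mxE mulr_suml; apply: eq_bigr => k _; rewrite mxE.
Qed.

Lemma bilinDl G u u' v : bilin G (u + u') v = bilin G u v + bilin G u' v.
Proof. by rewrite /bilin !mulmxDl mxE. Qed.

Lemma bilinDr G u v v' : bilin G u (v + v') = bilin G u v + bilin G u v'.
Proof. by rewrite /bilin linearD mulmxDr mxE. Qed.

Lemma bilinZl G k u v : bilin G (k *: u) v = k * bilin G u v.
Proof. by rewrite /bilin -!scalemxAl mxE. Qed.

Lemma bilinZr G k u v : bilin G u (k *: v) = k * bilin G u v.
Proof. by rewrite /bilin linearZ -scalemxAr mxE. Qed.

Lemma bilinC G u v : G^T = G -> bilin G u v = bilin G v u.
Proof.
move=> Gs; rewrite /bilin -[in RHS]Gs.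
have <- : (v *m G^T *m u^T)^T = u *m G *m v^T.
  by rewrite !trmx_mul !trmxK mulmxA.
by rewrite mxE.
Qed.

Lemma bilin0 G v : bilin G 0 v = 0.
Proof. by rewrite -(scale0r (0 : 'rV_n)) bilinZl mul0r. Qed.

Lemma bilin_le G (b : R) u v : (forall k l, `|G k l| <= b) ->
  `|bilin G u v| <= n%:R ^+ 2 * b * `|u| * `|v|.
Proof.
move=> Gb; rewrite bilinE.
apply: le_trans (ler_norm_sum _ _ _) _.
apply: (@le_trans _ _ (\sum_(k < n) \sum_(l < n) `|u| * b * `|v|)).
  apply: ler_sum => k _; apply: le_trans (ler_norm_sum _ _ _) _.
  apply: ler_sum => l _; rewrite !normrM ler_pM ?mulr_ge0// ?coord_norm_le//.
  by rewrite ler_pM// ?coord_norm_le.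
under eq_bigr do rewrite sumr_const card_ord.
rewrite sumr_const card_ord -mulrnA -[leLHS]mulr_natl natrM expr2.
by rewrite (mulrC `|u|) !mulrA.
Qed.

Lemma bilinB G G' u v : bilin G u v - bilin G' u v = bilin (G - G') u v.
Proof. by rewrite /bilin mulmxBr mulmxBl !mxE. Qed.

Definition gnorm G v : R := Num.sqrt (bilin G v v).

Definition metric_mx G := G^T = G /\ forall v, v != 0 -> 0 < bilin G v v.

Lemma metric_mx_ge0 G v : metric_mx G -> 0 <= bilin G v v.
Proof.
by move=> [_ H]; have [->|/H/ltW//] := eqVneq v 0; rewrite bilin0.
Qed.

Lemma gnorm_sqr G v : metric_mx G -> gnorm G v ^+ 2 = bilin G v v.
Proof. by move=> mG; rewrite sqr_sqrtr// metric_mx_ge0. Qed.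

Lemma gnorm_ge0 G v : 0 <= gnorm G v.
Proof. exact: sqrtr_ge0. Qed.

Lemma gnormZ G k v : gnorm G (k *: v) = `|k| * gnorm G v.
Proof. by rewrite /gnorm bilinZl bilinZr mulrA -expr2 sqrtrM ?sqr_ge0// sqrtr_sqr. Qed.

Lemma gnormN G v : gnorm G (- v) = gnorm G v.
Proof. by rewrite -scaleN1r gnormZ normrN1 mul1r. Qed.

Lemma gnorm_unit G : metric_mx G -> G \in unitmx.
Proof.
move=> [Gs Gp]; rewrite -row_free_unit -kermx_eq0; apply/eqP/row_matrixP => i.
rewrite row0; apply/eqP; apply: contraT => /Gp.
have : row i (kermx G) *m G = 0 by apply/sub_kermxP; exact: row_sub.
by rewrite /bilin => ->; rewrite mul0mx mxE ltxx.
Qed.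

Lemma cauchy_schwarz G u v : metric_mx G -> `|bilin G u v| <= gnorm G u * gnorm G v.
Proof.
move=> mG; have [->|v0] := eqVneq v 0.
  by rewrite (bilinC _ _ mG.1) bilin0 normr0 mulr_ge0 ?gnorm_ge0.
rewrite -ler_sqr ?nnegrE ?normr_ge0 ?mulr_ge0 ?gnorm_ge0//.
rewrite real_normK ?num_real// exprMn !gnorm_sqr//.
have vv := mG.2 v v0; set b := bilin G u v; set q := bilin G v v.
(* [q *: u - b *: v] is [q] times the part of [u] orthogonal to [v]; the factor [q] avoids a
   division. *)
have : 0 <= bilin G (q *: u - b *: v) (q *: u - b *: v) by exact: metric_mx_ge0.
rewrite -scaleN1r scalerA !(bilinDl, bilinDr, bilinZl, bilinZr) (bilinC v u mG.1).
rewrite -/b -/q => H.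
have : 0 <= q * (bilin G u u * q - b ^+ 2) by apply: le_trans H _; rewrite le_eqVlt; apply/orP; left; apply/eqP; ring.
by rewrite pmulr_rge0 ?subr_ge0.
Qed.

Lemma gnormD G u v : metric_mx G -> gnorm G (u + v) <= gnorm G u + gnorm G v.
Proof.
move=> mG; rewrite -ler_sqr ?nnegrE ?addr_ge0 ?gnorm_ge0//.
rewrite sqrrD !gnorm_sqr// bilinDl !bilinDr (bilinC v u mG.1).
have := ler_norm (bilin G u v); move/le_trans => /(_ _ (cauchy_schwarz u v mG)).
alra.
Qed.

Lemma gnormB_abs G u v : metric_mx G -> `|gnorm G u - gnorm G v| <= gnorm G (u - v).
Proof.
move=> mG; rewrite ler_norml; apply/andP; split.
  have := gnormD (v - u) u mG; rewrite subrK -(gnormN G (v - u)) opprB; alra.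
have := gnormD (u - v) v mG; rewrite subrK; alra.
Qed.

Lemma bilin_continuous G : continuous (fun v => bilin G v v).
Proof.
move=> v; have -> : (fun v => bilin G v v) = (fun v => \sum_k \sum_l v 0 k * G k l * v 0 l).
  by apply/funext => w; rewrite bilinE.
have : Ck 0 setT (fun v : 'rV[R]_n => \sum_k \sum_l v 0 k * G k l * v 0 l).
  have cc (k : 'I_n) : Ck 0 setT (fun v : 'rV[R]_n => v 0 k).
    by split=> // x _; exact: coord_continuous.
  apply: Ck_sum => [|k]; first exact: openT.
  apply: Ck_sum => [|l]; first exact: openT.
  by apply: Ck_mul => //; [exact: openT|apply: Ck_mul => //; [exact: openT|exact: Ck_cst]].
by move/Ck_continuous; exact.
Qed.

(** Minimum of the form on the compact unit sphere of the sup norm. The sphere is empty when [n] is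
    zero, hence the case distinction. *)
Lemma metric_mx_lower G : metric_mx G -> exists2 m : R, 0 < m &
  forall v, m * `|v| ^+ 2 <= bilin G v v.
Proof.
move=> mG; case: (pselect (exists v : 'rV[R]_n, v != 0)) => [[v1 v10]|no]; last first.
  exists 1 => // v; have -> : v = 0 by apply/eqP; apply: contraT => v0; case: no; exists v.
  by rewrite normr0 bilin0 expr0n mulr0.
pose S := [set v : 'rV[R]_n | `|v| = 1].
have S0 : S !=set0.
  by exists (`|v1|^-1 *: v1); rewrite /S/= normrZ normfV normr_id mulVf ?normr_eq0.
have cS : compact S.
  apply: bounded_closed_compact.
    by exists 1; split=> // x x1 v /= ->; exact: ltW.
  apply: (@closed_comp _ _ (fun v : 'rV[R]_n => `|v|) [set 1]).
    by move=> v _; exact: norm_continuous.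
  exact: closed_eq.
have [|v0 v0S Hv0] := EVT_min_rV S0 cS (f := fun v => bilin G v v).
  by apply: continuous_subspaceT; exact: bilin_continuous.
have v00 : v0 != 0 by rewrite -normr_eq0; move/set_mem : v0S => ->; rewrite oner_eq0.
exists (bilin G v0 v0); first exact: mG.2.
move=> v; have [->|vn0] := eqVneq v 0; first by rewrite normr0 bilin0 expr0n mulr0.
have := Hv0 (`|v|^-1 *: v); rewrite inE => /(_ _)/wrap[].
  by rewrite /S/= normrZ normfV normr_id mulVf ?normr_eq0.
rewrite bilinZl bilinZr mulrA -expr2 exprVn ler_pdivlMl ?exprn_gt0 ?normr_gt0//.
by rewrite mulrC.
Qed.

End BilinearForm.

Lemma near_eq_continuous {T U : topologicalType} (f h : T -> U) (t : T) :
  (\forall s \near t, f s = h s) -> {for t, continuous f} -> {for t, continuous h}.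
Proof.
move=> fh cf; rewrite /prop_for/continuous_at -(nbhs_singleton fh).
exact: (cvg_trans (near_eq_cvg fh) cf).
Qed.

(** * The Riemannian distance *)

Section Charts.
Context {R : realType} {n : nat} {M : topologicalType}.
Context (A : smooth_manifold R n M).
Implicit Types (i j : chart_index A) (c : R -> M).

Lemma chart_img_in i p : chart_dom i p -> chart_img i (chart_map i p).
Proof. by move=> Dp; exists p. Qed.

Lemma chart_inv_dom i x : chart_img i x -> chart_dom i (chart_inv i x).
Proof. by move=> [p Dp <-]; rewrite chart_mapK. Qed.

Lemma chart_invK i x : chart_img i x -> chart_map i (chart_inv i x) = x.
Proof. by move=> [p Dp <-]; rewrite chart_mapK. Qed.

Lemma chart_img_open' i : open (chart_img i).
Proof. exact: chart_img_open. Qed.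

Lemma transition_dom_open i j : open (chart_map i @` (chart_dom i `&` chart_dom j)).
Proof.
rewrite openE => x [p [Dip Djp] <-]; rewrite /interior.
have Ip := chart_img_in Dip.
have near1 : nbhs (chart_map i p) (chart_img i).
  by apply: open_nbhs_nbhs; split; [exact: chart_img_open'|].
have near2 : \forall y \near chart_map i p, chart_dom j (chart_inv i y).
  apply: (chart_inv_continuous Ip); rewrite chart_mapK//.
  exact: open_nbhs_nbhs (conj (chart_dom_open j) Djp).
near=> y; exists (chart_inv i y); last by rewrite chart_invK//; near: y.
split; last by near: y.
by apply: chart_inv_dom; near: y.
Unshelve. all: by end_near. Qed.

Lemma near_chart_dom i c t : {for t, continuous c} -> chart_dom i (c t) ->
  \forall s \near t, chart_dom i (c s).
Proof.
by move=> cc Dt; apply: cc; exact: open_nbhs_nbhs (conj (chart_dom_open i) Dt).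
Qed.

Lemma curve_change i j c (t : R) v : {for t, continuous c} ->
  chart_dom i (c t) -> chart_dom j (c t) -> is_derive t 1 (chart_map i \o c) v ->
  is_derive t 1 (chart_map j \o c) ('D_v (transition i j) (chart_map i (c t))).
Proof.
move=> cc Di Dj dx.
pose U := chart_map i @` (chart_dom i `&` chart_dom j).
have oU : open U by exact: transition_dom_open.
have Ux : U (chart_map i (c t)) by exists (c t).
have C1 : Ck 1 U (transition i j) by exact: transition_smooth.
have dt : is_derive t 1 (fun s => transition i j (chart_map i (c s)))
    ('D_v (transition i j) (chart_map i (c t))).
  apply/is_derive_mxP => k l; rewrite derive_mx ?mxE; last exact: Ck_derivable C1 Ux.
  have Ckl := (Ck_mxP 1 (transition i j) oU).1 C1 k l.
  rewrite (C1_derive _ oU Ux Ckl).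
  exact: (@chain_rule _ _ U (fun x => transition i j x k l) (chart_map i \o c) t v).
apply: near_eq_is_derive dt; near=> s.
rewrite /transition/= chart_mapK//; near: s; exact: near_chart_dom.
Unshelve. all: by end_near. Qed.

Lemma smooth_curve_open i (J : set R) c : open J -> smooth_curve A J c ->
  open (J `&` c @^-1` chart_dom i).
Proof.
move=> oJ [cc _]; rewrite openE => t [Jt Dt]; rewrite /interior.
apply: filterI; first exact: open_nbhs_nbhs.
by apply: near_chart_dom => //; exact: cc.
Qed.

Lemma smooth_curve_derive i (J : set R) c (t : R) : smooth_curve A J c -> J t ->
  chart_dom i (c t) -> is_derive t 1 (chart_map i \o c) ('D_1 (chart_map i \o c) t).
Proof.
move=> [_ sc] Jt Dt; apply: derivableP; apply: Ck_derivable (sc i 1%N) _.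
by split.
Qed.

Lemma velocity_derive i c (t : R) v : {for t, continuous c} ->
  chart_dom i (c t) -> is_derive t 1 (chart_map i \o c) v ->
  velocity A c t = 'D_v (transition i (chart_at A (c t))) (chart_map i (c t)).
Proof.
move=> cc Dt dx; rewrite /velocity derive1E.
by have [_ ->] := curve_change cc Dt (chart_at_dom A (c t)) dx.
Qed.

Context (g : riemannian_metric A).

Lemma gmx_metric i x : chart_img i x -> metric_mx (gmx g i x).
Proof. by move=> Ix; split; [exact: gmx_sym|move=> v; exact: gmx_pos]. Qed.

(** [velocity] uses the preferred chart at the moving point; [gmx_compat] makes the speed computable
    in any chart, so that one fixed chart serves near [t]. *)
Lemma speed_chart i c (t : R) v : {for t, continuous c} ->
  chart_dom i (c t) -> is_derive t 1 (chart_map i \o c) v ->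
  speed g c t = gnorm (gmx g i (chart_map i (c t))) v.
Proof.
move=> cc Dt dx; rewrite /speed /inner /gnorm (velocity_derive cc Dt dx).
by rewrite -gmx_compat//; exact: chart_at_dom.
Qed.

Lemma speed_ge0 c t : 0 <= speed g c t.
Proof. exact: sqrtr_ge0. Qed.

Lemma speed_continuous (J : set R) c t : open J -> smooth_curve A J c -> J t ->
  {for t, continuous (speed g c)}.
Proof.
move=> oJ sc Jt; set i := chart_at A (c t).
pose P := J `&` c @^-1` chart_dom i.
have oP : open P by exact: smooth_curve_open.
have Pt : P t by split=> //; exact: chart_at_dom.
pose x := chart_map i \o c.
have Cx k : Ck k P x by exact: sc.2.
have CG : Ck 0 P (fun s => bilin (gmx g i (x s)) ('D_1 x s) ('D_1 x s)).
  have C1x : Ck 0 P (fun s => 'D_1 x s) by exact: Ck_derive.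
  have C1 k := (Ck_mxP 0 (fun s => 'D_1 x s) oP).1 C1x 0 k.
  apply: (@Ck_ext _ _ _ _ _ (fun s => \sum_k \sum_l ('D_1 x s) 0 k * gmx g i (x s) k l * ('D_1 x s) 0 l)) => //.
    by move=> s _; rewrite bilinE.
  apply: Ck_sum => [|k]; first exact: oP.
  apply: Ck_sum => [|l]; first exact: oP.
  apply: Ck_mul; [exact: oP| |exact: C1].
  apply: Ck_mul; [exact: oP|exact: C1|].
  apply: (@Ck_compR _ _ _ (chart_img i) (fun z => gmx g i z k l)) => //.
  - exact: chart_img_open'.
  - by move=> s [_ /chart_img_in].
  - exact: gmx_smooth.
have cG := Ck_continuous CG Pt.
have cN : {for t, continuous (fun s => Num.sqrt (bilin (gmx g i (x s)) ('D_1 x s) ('D_1 x s)))}.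
  apply: (@continuous_comp _ _ _ (fun s => bilin (gmx g i (x s)) ('D_1 x s) ('D_1 x s)) Num.sqrt) => //.
  exact: sqrt_continuous.
have E s : P s -> speed g c s = Num.sqrt (bilin (gmx g i (x s)) ('D_1 x s) ('D_1 x s)).
  move=> [Js Ds]; rewrite (speed_chart _ Ds (smooth_curve_derive sc Js Ds))//.
  exact: sc.1.
apply: near_eq_continuous cN.
by apply: (near_open_eq oP Pt) => s /E ->.
Qed.

(** The primitive turns lengths of subarcs into increments of [F]; the margin [e] beyond the ends
    provides two-sided derivatives at [a] and [b]. *)
Lemma curve_length_primitive (a b e : R) c : a <= b -> 0 < e ->
  smooth_curve A `]a - e, b + e[ c ->
  exists2 F : R -> R, (forall t, a <= t <= b -> is_derive t 1 F (speed g c t)) &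
    curve_length g a b c = (F b - F a)%:E.
Proof.
move=> ab e0 sc.
have oJ : open (`]a - e, b + e[%classic : set R) by exact: itv_open.
have cs t : a - e / 2 <= t <= b + e / 2 -> {for t, continuous (speed g c)}.
  move=> /andP[ta tb]; apply: speed_continuous oJ sc _.
  by rewrite /= in_itv/=; apply/andP; split; alra.
have [|F HF] := primitive _ cs; first by alra.
have dF t : a <= t <= b -> is_derive t 1 F (speed g c t).
  by move=> /andP[ta tb]; apply: HF; apply/andP; split; alra.
exists F => //; rewrite /curve_length (integral_primitive ab _ dF)// => t /andP[ta tb].
by apply: cs; apply/andP; split; alra.
Qed.

End Charts.

(** * From infinitesimal to global estimates along a curve *)

Section Creeping.
Context {R : realType}.

(** [Q s t x] stands for a bound [x] on a subadditive quantity between [s] and [t]. If near every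
    [t] it grows at rate at most [C * F' t], up to an arbitrarily small error, these bounds add up
    to [C] times the increment of [F]. *)
Lemma creep_primitive (a b C : R) (F F' : R -> R) (Q : R -> R -> R -> Prop) :
  a <= b -> 0 <= C ->
  (forall s t u x y, Q s t x -> Q t u y -> Q s u (x + y)) ->
  (forall s t x y, Q s t x -> x <= y -> Q s t y) ->
  (forall t, a <= t <= b -> is_derive t 1 F (F' t)) ->
  (forall t, a <= t <= b -> forall e, 0 < e -> exists2 d : R, 0 < d &
    forall s, a <= s <= b -> `|s - t| < d ->
      (s <= t -> Q s t ((C * F' t + e) * (t - s))) /\
      (t <= s -> Q t s ((C * F' t + e) * (s - t)))) ->
  forall e, 0 < e -> Q a b (C * (F b - F a) + e).
Proof.
move=> ab C0 Qtri Qmono dF H e e0.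
pose e1 := e / (b - a + 1).
have ba1 : 0 < b - a + 1 by rewrite ltr_wpDl// subr_ge0.
have e10 : 0 < e1 by rewrite divr_gt0.
suff : Q a b (C * (F b - F a) + e1 * (b - a)).
  move/Qmono; apply; rewrite lerD2l /e1 mulrAC ler_pdivrMr// ler_wpM2l ?ltW//.
  by rewrite ltrDl.
apply: (@real_induction R a b (fun s t => Q s t (C * (F t - F s) + e1 * (t - s)))) => //.
  move=> s t u Qst Qtu; apply: Qmono (Qtri _ _ _ _ _ Qst Qtu) _.
  by rewrite le_eqVlt; apply/orP; left; apply/eqP; ring.
(* Half of the error [e1] is spent on the quantity itself, the other half on replacing [F' t] by a
   difference quotient of [F]; [C + 1] avoids a division by zero. *)
move=> t tab; pose e2 := e1 / (2 * (C + 1)).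
have C1 : 0 < C + 1 by rewrite ltr_wpDl.
have e20 : 0 < e2 by rewrite divr_gt0// mulr_gt0.
have e12 : 0 < e1 / 2 by rewrite divr_gt0.
have [d1 d10 Hd1] := is_derive_eps (dF t tab) e20.
have [d2 d20 Hd2] := H t tab _ e12.
have Ce2 : C * e2 <= e1 / 2.
  have E2 : e2 * (C + 1) = e1 / 2 by rewrite /e2; field; rewrite gt_eqF.
  by move: E2; alra.
exists (Num.min d1 d2); first by rewrite lt_min d10.
move=> s u as_ st tu ub; rewrite !lt_min => /andP[ts1 ts2] /andP[ut1 ut2].
have [ta tb] := andP tab.
split.
- have sab : a <= s <= b by rewrite as_ (le_trans st tb).
  have std : `|s - t| < d2 by rewrite distrC ger0_norm// subr_ge0.
  have [/(_ st) h _] := Hd2 s sab std; apply: Qmono h _.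
  have := Hd1 s; rewrite distrC ger0_norm ?subr_ge0// => /(_ ts1).
  rewrite -[_ *: _]/(_ * _) ler_norml => /andP[_ h1].
  have := ler_wpM2l C0 h1.
  have ts0 : 0 <= t - s by rewrite subr_ge0.
  have := ler_wpM2r ts0 Ce2; alra.
- have uab : a <= u <= b by rewrite ub (le_trans ta tu).
  have utd : `|u - t| < d2 by rewrite ger0_norm// subr_ge0.
  have [_ /(_ tu) h] := Hd2 u uab utd; apply: Qmono h _.
  have := Hd1 u; rewrite ger0_norm ?subr_ge0// => /(_ ut1).
  rewrite -[_ *: _]/(_ * _) ler_norml => /andP[h1 _].
  have := ler_wpM2l C0 h1.
  have tu0 : 0 <= u - t by rewrite subr_ge0.
  have := ler_wpM2r tu0 Ce2; alra.
Qed.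

Lemma is_derive_dir (V : normedModType R) (f : R -> V) (t u : R) (v : V) :
  is_derive t 1 f v -> is_derive t u f (u *: v).
Proof.
move=> [/derivable1_diffP df dE]; split; first exact: diff_derivable.
rewrite deriveE//; move: dE; rewrite deriveE// => <-.
by rewrite -[u in LHS]mulr1 -[u * 1]/(u *: 1) linearZ.
Qed.

Lemma is_derive_affine (V : normedModType R) (f : R -> V) (p t u : R) (v : V) :
  is_derive (p + t * u) 1 f v -> is_derive t 1 (fun s => f (p + s * u)) (u *: v).
Proof.
by move=> /(is_derive_dir u) H; apply: (@is_derive_line R R V f p u t).
Qed.

End Creeping.

Section Distance.
Context {R : realType} {n : nat} {M : topologicalType}.
Context {A : smooth_manifold R n M}.
Context (g : riemannian_metric A).
Implicit Types (c : R -> M) (p q : M).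
Local Notation dist := (dist g).
Local Notation is_path := (@is_path R n M A).
Implicit Types (s : seq (R -> M)).

Lemma smooth_curve_sub (J J' : set R) c : J' `<=` J -> smooth_curve A J c -> smooth_curve A J' c.
Proof.
move=> JJ [cc sc]; split=> [t /JJ/cc//|i k]; apply: Ck_sub (sc i k).
by move=> t [/JJ].
Qed.

Lemma smooth_curve_affine (J : set R) c (p u : R) : smooth_curve A J c ->
  smooth_curve A [set t | J (p + t * u)] (fun t => c (p + t * u)).
Proof.
move=> [cc sc]; split=> [t Jt|i k].
  apply: (@continuous_comp _ _ _ (fun t : R => p + t * u) c); last exact: cc.
  by apply: cvgD; [exact: cvg_cst|apply: cvgM; [exact: cvg_id|exact: cvg_cst]].
by apply: Ck_sub (Ck_line p u (sc i k)) => t [Jt Dt].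
Qed.

Lemma speed_affine (J : set R) c (p u t : R) : smooth_curve A J c -> J (p + t * u) ->
  speed g (fun t => c (p + t * u)) t = `|u| * speed g c (p + t * u).
Proof.
move=> sc Jt; set c' := fun t => _.
have cc : {for p + t * u, continuous c} by exact: sc.1.
have cc' : {for t, continuous c'} by exact: (smooth_curve_affine p u sc).1.
have D := chart_at_dom A (c' t).
have dx := smooth_curve_derive sc Jt D.
rewrite (speed_chart g cc D dx).
have dx' : is_derive t 1 (chart_map (chart_at A (c' t)) \o c')
   (u *: 'D_1 (chart_map (chart_at A (c' t)) \o c) (p + t * u)).
  exact: is_derive_affine.
by rewrite (speed_chart g cc' D dx') gnormZ.
Qed.

Lemma curve_length_ge0 (a b : R) c : (0 <= curve_length g a b c)%E.
Proof. by apply: integral_ge0 => t _; rewrite lee_fin speed_ge0. Qed.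

Lemma path_length_ge0 s : (0 <= path_length g s)%E.
Proof. by apply: sume_ge0 => c _; exact: curve_length_ge0. Qed.

Lemma dist_ge0 p q : (0 <= dist p q)%E.
Proof. by apply: le_ereal_inf_tmp => _ [s _ <-]; exact: path_length_ge0. Qed.

Lemma dist_le_path p s q : is_path p s q -> (dist p q <= path_length g s)%E.
Proof. by move=> ps; apply: ereal_inf_lbound; exists s. Qed.

Lemma dist_refl p : dist p p = 0%E.
Proof.
apply/eqP; rewrite eq_le dist_ge0 andbT.
by have := @dist_le_path p [::] p erefl; rewrite /path_length big_nil.
Qed.

Lemma dist_lt_path p q (r : \bar R) : (dist p q < r)%E ->
  exists2 s, is_path p s q & (path_length g s < r)%E.
Proof. by move=> /ereal_inf_lt[_ [s ps <-] sr]; exists s. Qed.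

Lemma is_path_cat p s q (s' : seq (R -> M)) r : is_path p s q -> is_path q s' r -> is_path p (s ++ s') r.
Proof.
elim: s p => [p ->//|c s IH p /= [sc cp ps] qr].
by split=> //; exact: IH.
Qed.

Lemma lee_addgt0 (x : \bar R) (r : R) :
  (forall e : R, 0 < e -> (x <= (r + e)%:E)%E) -> (x <= r%:E)%E.
Proof. by move=> H; apply/lee_addgt0Pr => e e0; rewrite -EFinD; exact: H. Qed.

Lemma dist_tri p q r (a b : R) : (dist p q <= a%:E)%E -> (dist q r <= b%:E)%E ->
  (dist p r <= (a + b)%:E)%E.
Proof.
move=> Ha Hb; apply: lee_addgt0 => e e0.
have e2 : 0 < e / 2 by rewrite divr_gt0.
have [|s1 ps1 l1] := @dist_lt_path p q (a + e / 2)%:E.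
  by apply: le_lt_trans Ha _; rewrite lte_fin ltrDl.
have [|s2 ps2 l2] := @dist_lt_path q r (b + e / 2)%:E.
  by apply: le_lt_trans Hb _; rewrite lte_fin ltrDl.
apply: le_trans (dist_le_path (is_path_cat ps1 ps2)) _.
rewrite /path_length big_cat/=.
have -> : a + b + e = (a + e / 2) + (b + e / 2) by alra.
by rewrite EFinD; apply: leeD; exact: ltW.
Qed.

(** The affine reparametrisation from [s] to [t] may run backwards, whence the absolute value. The
    symmetry of [dist] will rest on this. *)
Lemma dist_subcurve c (e : R) (F : R -> R) : 0 < e -> smooth_curve A `]0 - e, 1 + e[ c ->
  (forall t : R, 0 <= t <= 1 -> is_derive t 1 F (speed g c t)) ->
  forall s t : R, 0 <= s <= 1 -> 0 <= t <= 1 -> (dist (c s) (c t) <= `|F t - F s|%:E)%E.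
Proof.
move=> e0 sc dF s t /andP[s0 s1] /andP[t0 t1].
pose c' τ := c (s + τ * (t - s)).
have Jsub : `]0 - e, 1 + e[ `<=` [set τ | (`]0 - e, 1 + e[%classic : set R) (s + τ * (t - s))].
  move=> τ /=; rewrite !in_itv/= => /andP[h1 h2].
  have e1 : 0 <= e * (1 - (t - s)) by apply: mulr_ge0; [exact: ltW|alra].
  have e2 : 0 <= e * (1 + (t - s)) by apply: mulr_ge0; [exact: ltW|alra].
  have [ts|ts|<-] := ltgtP s t; last by rewrite subrr mulr0 addr0; apply/andP; split; alra.
    have h3 : 0 < (τ + e) * (t - s) by apply: mulr_gt0; alra.
    have h4 : 0 < (1 + e - τ) * (t - s) by apply: mulr_gt0; alra.
    by apply/andP; split; alra.
  have h3 : 0 < (τ + e) * (s - t) by apply: mulr_gt0; alra.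
  have h4 : 0 < (1 + e - τ) * (s - t) by apply: mulr_gt0; alra.
  by apply/andP; split; alra.
have sc' : smooth_curve A `]0 - e, 1 + e[ c'.
  exact: smooth_curve_sub Jsub (smooth_curve_affine s (t - s) sc).
have ps : is_path (c s) [:: c'] (c t).
  split; first by exists e.
    by rewrite /c' mul0r addr0.
  by rewrite /c' /= mul1r addrC subrK.
apply: le_trans (dist_le_path ps) _.
rewrite /path_length big_seq1.
have inJ τ : 0 <= τ <= 1 -> (`]0 - e, 1 + e[%classic : set R) τ.
  by move=> /andP[h1 h2]; rewrite /= in_itv/=; apply/andP; split; alra.
have affin τ : 0 <= τ <= 1 -> 0 <= s + τ * (t - s) <= 1.
  by move=> /andP[h1 h2]; apply/andP; split; nra.
have sp τ : 0 <= τ <= 1 -> speed g c' τ = `|t - s| * speed g c (s + τ * (t - s)).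
  move=> h; apply: (speed_affine sc); exact/inJ/affin.
have sgE : (Num.sg (t - s)) * (F t - F s) = `|F t - F s|.
  have [ts|ts|->] := ltgtP s t.
  - rewrite gtr0_sg ?subr_gt0// mul1r ger0_norm// subr_ge0.
    apply: (@is_derive_cst_le _ _ (speed g c)) => [|τ /andP[h1 h2]|τ _]; first exact: ltW.
      by apply: dF; rewrite (le_trans s0 h1) (le_trans h2 t1).
    exact: speed_ge0.
  - rewrite ltr0_sg ?subr_lt0// mulN1r ler0_norm// subr_le0.
    apply: (@is_derive_cst_le _ _ (speed g c)) => [|τ /andP[h1 h2]|τ _]; first exact: ltW.
      by apply: dF; rewrite (le_trans t0 h1) (le_trans h2 s1).
    exact: speed_ge0.
  - by rewrite !subrr sgr0 mul0r normr0.
(* The sign makes [H] a primitive of the speed of the reparametrised curve, which carries the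
   absolute value of [t - s] as a factor. *)
pose H τ := Num.sg (t - s) * F (s + τ * (t - s)).
have cH τ : 0 <= τ <= 1 -> {for τ, continuous (speed g c')}.
  by move=> h; apply: speed_continuous sc' (inJ _ h); exact: itv_open.
have dH (τ : R) : 0 <= τ <= 1 -> is_derive τ 1 H (speed g c' τ).
  move=> h; rewrite sp//.
  have dF' := is_derive_affine (dF _ (affin _ h)).
  have := is_deriveM (is_derive_cst (Num.sg (t - s)) τ (1 : R)) dF'.
  move/is_derive_eq; apply; rewrite scaler0 addr0 -![_ *: _]/(_ * _) mulrA.
  by rewrite -normrEsg.
rewrite /curve_length (integral_primitive ler01 cH dH) /H.
by rewrite mul1r mul0r addr0 [s + _]addrC subrK -mulrBr sgE.
Qed.

(** [σ] picks, for each arc length, some time at which that length has been covered. The speed may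
    vanish, so the time is not unique and [σ] meets the endpoints only up to distance zero. As
    neither symmetry nor separation of [dist] is available yet, both directions are recorded. *)
Lemma path_arclength p s q : is_path p s q -> exists (L : R) (σ : R -> M),
  [/\ 0 <= L, path_length g s = L%:E,
    (dist p (σ 0%R) <= 0)%E /\ (dist (σ 0%R) p <= 0)%E,
    (dist q (σ L) <= 0)%E /\ (dist (σ L) q <= 0)%E &
    forall u v, 0 <= u <= L -> 0 <= v <= L -> (dist (σ u) (σ v) <= `|u - v|%:E)%E].
Proof.
elim: s p => [p <-|c s IH p /= [[e e0 sc] cp ps]].
  exists 0, (fun=> p); rewrite /path_length big_nil dist_refl; split=> //.
have [L2 [σ2 [L20 lE2 [pσ σp] [qσ σq] σlip]]] := IH _ ps.
have [F dF lE] := curve_length_primitive g ler01 e0 sc.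
have sub := dist_subcurve e0 sc dF.
set L1 := F 1 - F 0.
have L10 : 0 <= L1.
  rewrite subr_ge0; apply: (@is_derive_cst_le _ _ (speed g c)) => // t _; exact: speed_ge0.
have chooset u : exists t, 0 <= u <= L1 -> 0 <= t <= 1 /\ F t = F 0 + u.
  have [u01|nu] := pselect (0 <= u <= L1); last by exists 0.
  have [||t t01 E] := @IVT R F 0 1 (F 0 + u) ler01.
  - by apply: within_continuous_of => t t01; exact: is_derive_continuous (dF t t01).
  - have F01 : F 0 <= F 1 by rewrite -subr_ge0.
    rewrite (min_l F01) (max_r F01); move/andP : u01 => [h1 h2].
    by rewrite lerDl h1 -lerBrDl.
  by exists t => _; split=> //; move: t01; rewrite in_itv.
pose T u := projT1 (cid (chooset u)).
have HT u : 0 <= u <= L1 -> 0 <= T u <= 1 /\ F (T u) = F 0 + u.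
  by rewrite /T; case: cid.
pose σ u := if u <= L1 then c (T u) else σ2 (u - L1).
have I0 : 0 <= (0 : R) <= 1 by rewrite lexx ler01.
have I1 : 0 <= (1 : R) <= 1 by rewrite lexx ler01.
have H0 : 0 <= (0 : R) <= L1 by rewrite lexx.
have H1 : 0 <= L1 <= L1 by rewrite lexx L10.
have d1 u : 0 <= u <= L1 -> (dist (c (T u)) (c 1%R) <= (L1 - u)%:E)%E /\
    (dist (c 1%R) (c (T u)) <= (L1 - u)%:E)%E.
  move=> hu; have [hT FT] := HT u hu.
  have E : F 1 - F (T u) = L1 - u by rewrite FT /L1; ring.
  have u0 : 0 <= L1 - u by case/andP: hu => _; rewrite subr_ge0.
  split; apply: le_trans (sub _ _ _ _) _ => //; last rewrite distrC.
    by rewrite E ger0_norm.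
  by rewrite E ger0_norm.
have d2 v : 0 <= v <= L2 -> (dist (c 1%R) (σ2 v) <= v%:E)%E /\ (dist (σ2 v) (c 1%R) <= v%:E)%E.
  move=> hv; have h0 : 0 <= (0 : R) <= L2 by rewrite lexx.
  have v0 : `|v| = v by case/andP: hv => ? _; rewrite ger0_norm.
  split.
    have := dist_tri pσ (σlip _ _ h0 hv); rewrite add0r => h; apply: le_trans h _.
    by rewrite sub0r normrN v0.
  have := dist_tri (σlip _ _ hv h0) σp; rewrite addr0 => h; apply: le_trans h _.
  by rewrite subr0 v0.
have d0 : (dist p (c (T 0%R)) <= 0)%E /\ (dist (c (T 0%R)) p <= 0)%E.
  have [hT FT] := HT 0 H0; rewrite -cp; split; apply: le_trans (sub _ _ _ _) _ => //.
    by rewrite FT addr0 subrr normr0.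
  by rewrite FT addr0 subrr normr0.
exists (L1 + L2), σ; split.
- exact: addr_ge0.
- by rewrite /path_length big_cons -/(path_length g s) lE lE2 EFinD.
- by rewrite /σ L10.
- rewrite /σ; case: ifPn => [h|h].
    have L2z : L2 = 0 by apply/eqP; rewrite eq_le L20 andbT; rewrite gerDl in h.
    move: qσ σq; rewrite L2z addr0 => qσ σq.
    have hz : 0 <= (0 : R) <= L2 by rewrite L2z lexx.
    have [a1 a2] := d1 _ H1; have [b1 b2] := d2 _ hz; move: a1 a2; rewrite subrr => a1 a2.
    split.
      by have := dist_tri qσ (dist_tri b2 a2); rewrite !addr0.
    by have := dist_tri a1 (dist_tri b1 σq); rewrite !addr0.
  by rewrite addrC addKr.
- have half u v : u <= L1 -> L1 < v -> 0 <= u -> v <= L1 + L2 ->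
     (dist (c (T u)) (σ2 (v - L1)%R) <= `|u - v|%:E)%E /\
     (dist (σ2 (v - L1)%R) (c (T u)) <= `|u - v|%:E)%E.
    move=> hu hv u0 vL.
    have [] := d1 u _; first by rewrite u0.
    move=> a1 a2; have [] := d2 (v - L1) _; first by apply/andP; split; alra.
    move=> b1 b2.
    have -> : `|u - v| = (L1 - u) + (v - L1).
      rewrite ler0_norm ?subr_le0; last by rewrite (le_trans hu)// ltW.
      by ring.
    by split; [exact: dist_tri a1 b1|rewrite (addrC (L1 - u)); exact: dist_tri b2 a2].
  move=> u v /andP[u0 uL] /andP[v0 vL]; rewrite /σ.
  have [hu|hu] := leP u L1; have [hv|hv] := leP v L1.
  + have [] := HT u _; rewrite ?u0// => a1 a2.
    have [] := HT v _; rewrite ?v0// => b1 b2.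
    apply: le_trans (sub _ _ a1 b1) _.
    by rewrite a2 b2 opprD addrACA subrr add0r distrC.
  + by have [] := half u v hu hv u0 vL.
  + by rewrite distrC; have [] := half v u hv hu v0 uL.
  + apply: le_trans (σlip _ _ _ _) _; try by apply/andP; split; alra.
    by have -> : u - L1 - (v - L1) = u - v by ring.
Qed.

(** The list of pieces is not reversed: the bound on [σ] is symmetric in its two arguments, so the
    path can be read backwards. *)
Lemma dist_sym_le p q (r : R) : (dist p q <= r%:E)%E -> (dist q p <= r%:E)%E.
Proof.
move=> H; apply: lee_addgt0 => e e0.
have [|s ps l] := @dist_lt_path p q (r + e)%:E.
  by apply: le_lt_trans H _; rewrite lte_fin ltrDl.
have [L [σ [L0 lE [a1 a2] [b1 b2] lip]]] := path_arclength ps.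
have I0 : 0 <= (0 : R) <= L by rewrite lexx.
have I1 : 0 <= L <= L by rewrite lexx L0.
have := dist_tri b1 (dist_tri (lip _ _ I1 I0) a2).
rewrite add0r addr0 subr0 ger0_norm// => h; apply: le_trans h _.
by move: l; rewrite lE lte_fin lee_fin => /ltW.
Qed.

Lemma dist_sym p q : dist p q = dist q p.
Proof.
apply/eqP; rewrite eq_le; apply/andP; split.
  case E : (dist q p) => [r||]; rewrite ?leey//; last by have := dist_ge0 q p; rewrite E.
  by apply: dist_sym_le; rewrite E.
case E : (dist p q) => [r||]; rewrite ?leey//; last by have := dist_ge0 p q; rewrite E.
by apply: dist_sym_le; rewrite E.
Qed.

(** The source of lower bounds on [dist]: a test function that grows along every smooth curve at
    rate at most [C] times the speed is [C]-Lipschitz. *)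
Lemma lip_test (Φ : M -> R) (C : R) : 0 <= C ->
  (forall (J : set R) c t, open J -> smooth_curve A J c -> J t -> forall e, 0 < e ->
     exists2 d : R, 0 < d & forall s : R, `|s - t| < d ->
       `|Φ (c s) - Φ (c t)| <= (C * speed g c t + e) * `|s - t|) ->
  forall p q (d : R), (dist p q <= d%:E)%E -> Φ q - Φ p <= C * d.
Proof.
move=> C0 H.
have piece c : smooth_segment A 0 1 c -> exists2 L : R, curve_length g 0 1 c = L%:E &
    Φ (c 1) - Φ (c 0) <= C * L.
  move=> [e e0 sc]; have [F dF lE] := curve_length_primitive g ler01 e0 sc.
  exists (F 1 - F 0) => //; apply/ler_addgt0Pr => e1 e10.
  refine (@creep_primitive R 0 1 C F (speed g c) (fun s t r : R => Φ (c t) - Φ (c s) <= r)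
    ler01 C0 _ _ dF _ e1 e10).
  - by move=> s t u x y h1 h2; have := lerD h1 h2; alra.
  - by move=> s t x y; exact: le_trans.
  move=> t /andP[t0 t1] e2 e20.
  have [||d d0 Hd] := H _ c t _ sc _ e2 e20; first exact: itv_open.
    by rewrite /= in_itv/=; apply/andP; split; alra.
  exists d => // s _ /Hd h; split=> st.
    by apply: le_trans (ler_norm _) _; move: h; rewrite distrC (distrC s) (ger0_norm (_ : 0 <= t - s)) ?subr_ge0.
  by apply: le_trans (ler_norm _) _; move: h; rewrite (ger0_norm (_ : 0 <= s - t)) ?subr_ge0.
have path s : forall p q, is_path p s q -> exists2 L : R, path_length g s = L%:E & Φ q - Φ p <= C * L.
  elim: s => [p q ->|c s IH p q /= [sc cp ps]].
    by exists 0; rewrite ?subrr ?mulr0// /path_length big_nil.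
  have [L1 l1 h1] := piece c sc; have [L2 l2 h2] := IH _ _ ps.
  exists (L1 + L2); first by rewrite /path_length big_cons -/(path_length g s) l1 l2 EFinD.
  by rewrite -cp; have := lerD h1 h2; alra.
move=> p q d Hd; apply/ler_addgt0Pr => e e0.
have C1 : 0 < C + 1 by rewrite ltr_wpDl.
have [|s ps l] := @dist_lt_path p q (d + e / (C + 1))%:E.
  by apply: le_lt_trans Hd _; rewrite lte_fin ltrDl divr_gt0.
have [L lE] := path s p q ps; move/le_trans; apply.
move: l; rewrite lE lte_fin => /ltW /(ler_wpM2l C0)/le_trans; apply.
rewrite mulrDr lerD2l mulrCA ler_piMr ?ltW//.
by rewrite ltr_pdivrMr// mul1r ltrDl.
Qed.

End Distance.

(** * Comparison of the distance with the metric in a chart *)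

Section LocalMetric.
Context {R : realType} {n : nat} {M : topologicalType}.
Context {A : smooth_manifold R n M}.
Context (g : riemannian_metric A).
Local Notation dist := (dist g).
Local Notation Nrm i x := (gnorm (gmx g i x)).

(** [l] and [L] compare the metric with the sup norm; the last clause, multiplicative in the base
    point, is what yields factors [1 + O(radius)]. *)
Definition good_radius (i : chart_index A) (x0 : 'rV[R]_n) (r l L K : R) : Prop :=
  [/\ [/\ 0 < r, 0 < l, 0 < L & 0 < K],
      forall x, `|x - x0| < r -> chart_img i x,
      forall x v, `|x - x0| < r -> l * `|v| <= Nrm i x v /\ Nrm i x v <= L * `|v| &
      forall x y v, `|x - x0| < r -> `|y - x0| < r ->
        Nrm i y v <= (1 + K * `|y - x|) * Nrm i x v].

Lemma good_radius_exists i x0 : chart_img i x0 ->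
  exists r l L K, good_radius i x0 r l L K.
Proof.
move=> Ix0.
have oI := @chart_img_open' _ _ _ A i.
have [r1 r10 Hr1] := open_ball_sub oI Ix0.
have Hlip (kl : 'I_n * 'I_n) : exists2 rL : R * R, 0 < rL.1 /\ 0 < rL.2 &
    forall x y, `|x - x0| < rL.1 -> `|y - x0| < rL.1 ->
    `|gmx g i y kl.1 kl.2 - gmx g i x kl.1 kl.2| <= rL.2 * `|y - x|.
  have [r [L [r0 L0 H]]] := C1_locally_lipschitz oI Ix0 (gmx_smooth g i kl.1 kl.2 1).
  by exists (r, L).
pose rL kl := projT1 (cid2 (Hlip kl)).
have HrL kl : [/\ 0 < (rL kl).1, 0 < (rL kl).2 & forall x y, `|x - x0| < (rL kl).1 -> `|y - x0| < (rL kl).1 ->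
    `|gmx g i y kl.1 kl.2 - gmx g i x kl.1 kl.2| <= (rL kl).2 * `|y - x|].
  by rewrite /rL; case: cid2 => /= ? [].
pose L1 := \sum_kl (rL kl).2.
have [r2 r20 Hr2] : exists2 r2 : R, 0 < r2 & forall kl, r2 <= (rL kl).1.
  apply: (@common_radius R _ (fun kl r => r <= (rL kl).1)).
    by move=> kl d e _ ed; exact: le_trans.
  by move=> kl; exists (rL kl).1 => //; case: (HrL kl).
have L10 : 0 <= L1 by apply: sumr_ge0 => kl _; case: (HrL kl) => _ /ltW.
have lipG x y k l : `|x - x0| < r2 -> `|y - x0| < r2 ->
    `|gmx g i y k l - gmx g i x k l| <= L1 * `|y - x|.
  move=> xr yr; have [_ _ H] := HrL (k, l).
  have := H x y (lt_le_trans xr (Hr2 _)) (lt_le_trans yr (Hr2 _)) => /= /le_trans; apply.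
  rewrite ler_wpM2r// /L1 (bigD1 (k, l))//= lerDl.
  by apply: sumr_ge0 => kl _; case: (HrL kl) => _ /ltW.
have [m m0 Hm] := metric_mx_lower (gmx_metric g Ix0).
pose B := n%:R ^+ 2 * L1.
have B0 : 0 <= B by rewrite mulr_ge0// exprn_ge0.
have dG x y v : `|x - x0| < r2 -> `|y - x0| < r2 ->
    `|bilin (gmx g i y) v v - bilin (gmx g i x) v v| <= B * `|y - x| * `|v| ^+ 2.
  move=> xr yr; rewrite bilinB.
  apply: le_trans (@bilin_le _ _ _ (L1 * `|y - x|) v v _) _.
    by move=> k l; rewrite !mxE; exact: lipG.
  by rewrite expr2 /B le_eqVlt; apply/orP; left; apply/eqP; ring.
pose r3 := m / (2 * (B + 1)).
have B1 : 0 < B + 1 by rewrite ltr_wpDl.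
have r30 : 0 < r3 by rewrite divr_gt0// mulr_gt0.
pose b0 := \sum_(k < n) \sum_(l < n) `|gmx g i x0 k l|.
have b00 : 0 <= b0 by apply: sumr_ge0 => k _; apply: sumr_ge0.
have Hb0 v : bilin (gmx g i x0) v v <= n%:R ^+ 2 * b0 * `|v| ^+ 2.
  apply: le_trans (ler_norm _) _.
  apply: le_trans (@bilin_le _ _ _ b0 v v _) _.
    move=> k l; rewrite /b0 (bigD1 k)//= (bigD1 l)//= -addrA lerDl.
    apply: addr_ge0; first by apply: sumr_ge0.
    by apply: sumr_ge0 => k' _; apply: sumr_ge0.
  by rewrite expr2 mulrA.
pose r := Num.min r1 (Num.min r2 r3).
have rE x : `|x - x0| < r -> [/\ `|x - x0| < r1, `|x - x0| < r2 & `|x - x0| < r3].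
  by rewrite !lt_min => /andP[? /andP[? ?]].
have x0r : `|x0 - x0| < r2 by rewrite subrr normr0.
have r3B : B * r3 <= m / 2.
  have E : r3 * (B + 1) = m / 2 by rewrite /r3; field; rewrite gt_eqF.
  by move: E r30; alra.
have low x v : `|x - x0| < r -> m / 2 * `|v| ^+ 2 <= bilin (gmx g i x) v v.
  move=> /rE[_ xr2 xr3]; have := dG x0 x v x0r xr2; rewrite ler_norml => /andP[h _].
  have v20 : 0 <= `|v| ^+ 2 by rewrite exprn_ge0.
  have h1 := Hm v.
  have h2 : B * `|x - x0| * `|v| ^+ 2 <= m / 2 * `|v| ^+ 2.
    by rewrite ler_wpM2r//; apply: le_trans r3B; rewrite ler_wpM2l// ltW.
  by move: h h1 h2; alra.
pose c2 := n%:R ^+ 2 * b0 + m.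
have c20 : 0 < c2 by rewrite ltr_wpDl// mulr_ge0// exprn_ge0.
have up x v : `|x - x0| < r -> bilin (gmx g i x) v v <= c2 * `|v| ^+ 2.
  move=> /rE[_ xr2 xr3]; have := dG x0 x v x0r xr2; rewrite ler_norml => /andP[_ h].
  have v20 : 0 <= `|v| ^+ 2 by rewrite exprn_ge0.
  have h1 := Hb0 v.
  have h2 : B * `|x - x0| * `|v| ^+ 2 <= m / 2 * `|v| ^+ 2.
    by rewrite ler_wpM2r//; apply: le_trans r3B; rewrite ler_wpM2l// ltW.
  have h3 : m / 2 * `|v| ^+ 2 <= m * `|v| ^+ 2 by rewrite ler_wpM2r//; move: m0; alra.
  by rewrite /c2; move: h h1 h2 h3; alra.
have m20 : 0 < m / 2 by rewrite divr_gt0.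
(* The Lipschitz constant [B] of the form relative to its lower bound [m / 2]; then
   [1 + x <= (1 + x) ^+ 2] carries the estimate over to square roots. *)
pose K := 1 + B / (m / 2).
have K0 : 0 < K by rewrite ltr_pwDl// divr_ge0// ltW.
exists r, (Num.sqrt (m / 2)), (Num.sqrt c2), K; split.
- by rewrite !lt_min r10 r20 r30 !sqrtr_gt0.
- by move=> x /rE[/Hr1].
- move=> x v xr; split.
    rewrite /gnorm -[`|v|]ger0_norm// -sqrtr_sqr -sqrtrM ?ler_wsqrtr//; last exact: ltW.
    exact: low.
  rewrite /gnorm -[`|v|]ger0_norm// -sqrtr_sqr -sqrtrM ?ler_wsqrtr//; last exact: ltW.
  exact: up.
- move=> x y v xr yr.
  have [_ xr2 _] := rE _ xr; have [_ yr2 _] := rE _ yr.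
  have k0 : 0 <= K * `|y - x| by rewrite mulr_ge0// ltW.
  rewrite -[1 + _]ger0_norm ?addr_ge0// -sqrtr_sqr -sqrtrM ?sqr_ge0//.
  apply: ler_wsqrtr.
  have := dG x y v xr2 yr2; rewrite ler_norml => /andP[_ h].
  have h1 : B * `|y - x| * `|v| ^+ 2 <= K * `|y - x| * bilin (gmx g i x) v v.
    have h2 := low x v xr.
    have h3 : B / (m / 2) * (m / 2 * `|v| ^+ 2) <= B / (m / 2) * bilin (gmx g i x) v v.
      by rewrite ler_wpM2l// divr_ge0// ltW.
    have E : B / (m / 2) * (m / 2 * `|v| ^+ 2) = B * `|v| ^+ 2 by field; rewrite gt_eqF.
    rewrite E in h3.
    have h4 : 0 <= bilin (gmx g i x) v v.
      by apply: le_trans h2; rewrite mulr_ge0 ?(ltW m20)// exprn_ge0.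
    have h5 : B * `|v| ^+ 2 <= K * bilin (gmx g i x) v v by rewrite /K; move: h3 h4; alra.
    have := ler_wpM2r (normr_ge0 (y - x)) h5; alra.
  have h4 : 0 <= bilin (gmx g i x) v v.
    by apply: le_trans (low x v xr); rewrite mulr_ge0 ?(ltW m20)// exprn_ge0.
  have h6 : 0 <= (K * `|y - x|) * bilin (gmx g i x) v v by rewrite mulr_ge0.
  have h7 : 0 <= (K * `|y - x|) ^+ 2 * bilin (gmx g i x) v v by rewrite mulr_ge0// sqr_ge0.
  by move: h h1 h6 h7; alra.
Qed.

Section Good.
Context (i : chart_index A) (x0 : 'rV[R]_n) (r l L K : R).
Context (good : good_radius i x0 r l L K).
Let r0 : 0 < r. Proof. by case: good => [[]]. Qed.
Let l0 : 0 < l. Proof. by case: good => [[]]. Qed.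
Let L0 : 0 < L. Proof. by case: good => [[]]. Qed.
Let K0 : 0 < K. Proof. by case: good => [[]]. Qed.
Let img x : `|x - x0| < r -> chart_img i x. Proof. by case: good => _ H _ _; exact: H. Qed.
Let met x : `|x - x0| < r -> metric_mx (gmx g i x).
Proof. by move=> /img/(gmx_metric g). Qed.
Let low x v : `|x - x0| < r -> l * `|v| <= Nrm i x v.
Proof. by move=> xr; case: good => _ _ H _; case: (H x v xr). Qed.
Let upp x v : `|x - x0| < r -> Nrm i x v <= L * `|v|.
Proof. by move=> xr; case: good => _ _ H _; case: (H x v xr). Qed.
Let lip x y v : `|x - x0| < r -> `|y - x0| < r -> Nrm i y v <= (1 + K * `|y - x|) * Nrm i x v.
Proof. by move=> xr yr; case: good => _ _ _ H; exact: H. Qed.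

(** The straight segment is a competitor. The radius [r / 6] leaves room to prolong it to parameters
    between -1 and 2, because a smooth piece must be smooth on a neighbourhood of its closed
    interval. *)
Lemma segment_upper a b : `|a - x0| < r / 6 -> `|b - x0| < r / 6 ->
  (dist (chart_inv i a) (chart_inv i b) <= ((1 + K * `|b - a|) * Nrm i a (b - a))%:E)%E.
Proof.
move=> ar br.
have bar : `|b - a| < r / 3.
  have -> : b - a = (b - x0) - (a - x0) by rewrite opprB addrA subrK.
  by apply: le_lt_trans (ler_normB _ _) _; move: ar br; lra.
pose y (t : R) := a + t *: (b - a).
have yr t : -1 < t < 2 -> `|y t - x0| < r.
  move=> /andP[t1 t2]; rewrite /y addrAC; apply: le_lt_trans (ler_normD _ _) _.
  rewrite normrZ.
  have : `|t| * `|b - a| <= 2 * `|b - a| by rewrite ler_wpM2r// ler_norml; apply/andP; split; lra.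
  by move: r0 ar bar; lra.
pose c (t : R) := chart_inv i (y t).
have dy (t : R) : is_derive t 1 y (b - a).
  apply: eps_is_derive => e e0; exists 1 => // s _.
  rewrite /y opprD addrACA subrr add0r -scalerBl subrr normr0.
  by rewrite mulr_ge0// ltW.
have cy t : {for t, continuous y} by exact: is_derive_continuous (dy t).
have e1 : (0 : R) < 1 by [].
have J t : (`]0 - 1, 1 + 1[%classic : set R) t -> -1 < t < 2.
  by rewrite /= in_itv/= => /andP[? ?]; apply/andP; split; lra.
have sc : smooth_curve A `]0 - 1, 1 + 1[ c.
  split=> [t /J/yr/img It|j k].
    apply: (@continuous_comp _ _ _ y (chart_inv i)); first exact: cy.
    exact: chart_inv_continuous.
  apply: Ck_sub (Ck_line a (b - a) (@transition_smooth _ _ _ A i j k)) => t [/J/yr/img It Dj] /=.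
  exists (chart_inv i (y t)); last by rewrite chart_invK.
  by split=> //; exact: chart_inv_dom.
have [F dF lE] := curve_length_primitive g ler01 e1 sc.
have J01 (t : R) : 0 <= t <= 1 -> -1 < t < 2 by move=> /andP[? ?]; apply/andP; split; lra.
have sp t : 0 <= t <= 1 -> speed g c t = Nrm i (y t) (b - a).
  move=> /J01 t01; have It := img (yr _ t01).
  have Dt : chart_dom i (c t) by exact: chart_inv_dom.
  have cc : {for t, continuous c}.
    by apply: sc.1; rewrite /= in_itv/=; case/andP: t01 => ? ?; apply/andP; split; lra.
  have dx : is_derive t 1 (chart_map i \o c) (b - a).
    have yI : \forall s \near t, chart_img i (y s).
      apply: (cy t); apply: open_nbhs_nbhs; split=> //; exact: chart_img_open'.
    by apply: near_eq_is_derive (dy t); apply: filterS yI => s Is; rewrite /c/= chart_invK.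
  by rewrite (speed_chart g cc Dt dx) /c/= chart_invK.
have ps : @is_path R n M A (chart_inv i a) [:: c] (chart_inv i b).
  split; first by exists 1.
    by rewrite /c /y scale0r addr0.
  by rewrite /c /y /= scale1r addrC subrK.
apply: le_trans (dist_le_path g ps) _.
rewrite /path_length big_seq1 lE lee_fin.
have [t t01 ->] := mvt_is_derive ler01 dF.
rewrite subr0 mulr1 sp//.
have ar' : `|a - x0| < r by apply: lt_trans ar _; move: r0; lra.
apply: le_trans (lip _ ar' (yr _ (J01 _ t01))) _.
rewrite ler_wpM2r ?gnorm_ge0// lerD2l ler_wpM2l ?(ltW K0)//.
rewrite /y addrC addKr normrZ ler_piMl// ger0_norm; by case/andP: t01.
Qed.

(* Truncation at [h] makes the chart distance to [x] a function on all of [M],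
   to which [lip_test] applies. *)
Let trunc (z x : 'rV[R]_n) (h : R) (m : M) : R :=
  if `[< chart_dom i m /\ Nrm i z (chart_map i m - x) < h >]
  then Nrm i z (chart_map i m - x) else h.

(** The third hypothesis puts the region where the truncation is active inside the ball of radius
    [rho] about [z]; there the metric differs from the one frozen at [z] by a factor of at most
    [1 + K * rho]. *)
Lemma trunc_lip z x (rho h : R) : 0 < rho -> `|z - x0| + rho < r -> `|x - z| + h / l < rho -> 0 < h ->
  forall p q (d : R), (dist p q <= d%:E)%E ->
    trunc z x h q - trunc z x h p <= (1 + K * rho) * d.
Proof.
move=> rho0 zr xh h0.
have z_r : `|z - x0| < r by move: zr rho0; lra.
have hB u : Nrm i z (u - x) <= h -> `|u - z| < rho.
  move=> hu; have := low (u - x) z_r => /le_trans /(_ hu) lu.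
  have -> : u - z = (u - x) + (x - z) by rewrite addrA subrK.
  apply: le_lt_trans (ler_normD _ _) _.
  have : `|u - x| <= h / l by rewrite ler_pdivlMr// mulrC.
  by move: xh; lra.
have inr u : `|u - z| < rho -> `|u - x0| < r.
  move=> uz; have -> : u - x0 = (u - z) + (z - x0) by rewrite addrA subrK.
  by apply: le_lt_trans (ler_normD _ _) _; move: zr uz; lra.
have C0 : 0 <= 1 + K * rho by rewrite addr_ge0// mulr_ge0// ltW.
pose T u := Num.min (Nrm i z (u - x)) h.
have TE m : chart_dom i m -> trunc z x h m = T (chart_map i m).
  move=> Dm; rewrite /trunc /T; case: ifPn => [/asboolP[_ lth]|/asboolPn nh].
    by rewrite min_l// ltW.
  rewrite min_r// leNgt; apply/negP => lth; exact: nh.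
have Tlip u v : `|T u - T v| <= Nrm i z (u - v).
  have h1 := gnormB_abs (u - x) (v - x) (met z_r).
  have E : (u - x) - (v - x) = u - v by rewrite opprB addrA subrK.
  rewrite E in h1; apply: le_trans h1; rewrite /T.
  have [a|a] := leP (Nrm i z (u - x)) h; have [b|b] := leP (Nrm i z (v - x)) h => //.
  - by move: a b; rewrite !ler_norml => a b; rewrite !ler0_norm; lra.
  - by rewrite !ger0_norm; lra.
  - by rewrite subrr normr0.
apply: lip_test C0 _ => J c t oJ sc Jt e e0.
have cc := sc.1 t Jt.
pose U := [set m | chart_dom i m /\ `|chart_map i m - z| < rho].
case: (pselect (U (c t))) => [[Dt zt]|nU].
  have dx := smooth_curve_derive sc Jt Dt.
  set v := 'D_1 _ t in dx; set xx := chart_map i \o c in dx.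
  have Ixx : `|xx t - x0| < r by exact: inr.
  have e' : 0 < e / L by rewrite divr_gt0.
  have [d1 d10 Hd1] := is_derive_eps dx e'.
  have : \forall s \near t, chart_dom i (c s) by exact: near_chart_dom.
  move=> /nbhs_ballP[d2 /= d20 Hd2].
  exists (Num.min d1 d2); first by rewrite lt_min d10.
  move=> s; rewrite lt_min => /andP[s1 s2].
  have Ds : chart_dom i (c s) by apply: Hd2; rewrite -ball_normE/= distrC.
  rewrite !TE//; apply: le_trans (Tlip _ _) _.
  have -> : chart_map i (c s) - chart_map i (c t) =
     (s - t) *: v + (xx s - xx t - (s - t) *: v) by rewrite [RHS]addrC subrK.
  apply: le_trans (gnormD _ _ (met z_r)) _.
  rewrite mulrDl lerD//.
    rewrite gnormZ mulrC ler_wpM2r// (speed_chart g cc Dt dx).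
    apply: le_trans (lip v Ixx z_r) _.
    rewrite ler_wpM2r ?gnorm_ge0// lerD2l ler_wpM2l ?(ltW K0)// distrC; exact: ltW.
  apply: le_trans (upp _ z_r) _.
  apply: le_trans (ler_wpM2l (ltW L0) (Hd1 s s1)) _.
  by rewrite mulrA mulrCA divff ?gt_eqF// mulr1.
(* Outside [U] the truncation is locally constant: the closed ball is compact,
   hence closed in the Hausdorff space [M]. *)
pose B := [set u : 'rV[R]_n | Nrm i z (u - x) <= h].
have cB : compact B.
  apply: bounded_closed_compact.
    exists (`|z| + rho); split=> [|s hs u /hB uz]; first exact: num_real.
    rewrite -(subrK z u); apply: le_trans (ler_normD _ _) _.
    by move: uz hs; lra.
  have cN : continuous (fun u : 'rV[R]_n => Nrm i z (u - x)).
    move=> u; apply: (@continuous_comp _ _ _ (fun u : 'rV[R]_n => bilin (gmx g i z) (u - x) (u - x)) Num.sqrt); last exact: sqrt_continuous.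
    apply: (@continuous_comp _ _ _ (fun u : 'rV[R]_n => u - x) (fun v => bilin (gmx g i z) v v)).
      apply/continuous_normP => e1 e10; exists e1 => // w.
      by rewrite opprB addrA subrK.
    exact: bilin_continuous.
  apply: (@closed_comp _ _ (fun u : 'rV[R]_n => Nrm i z (u - x)) [set a | a <= h]).
    by move=> u _; exact: cN.
  exact: closed_le.
have cIB : closed (chart_inv i @` B).
  apply: compact_closed; first exact: (manifold_hausdorff A).
  apply: continuous_compact => //; apply/continuous_in_subspaceT => u /set_mem Bu.
  by apply: chart_inv_continuous; apply: img; apply: inr; exact: hB.
have nB : ~ (chart_inv i @` B) (c t).
  move=> [u Bu E]; apply: nU; have uI := img (inr _ (hB _ Bu)).
  by rewrite -E; split; [exact: chart_inv_dom|rewrite chart_invK//; exact: hB].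
have : \forall s \near t, (~` (chart_inv i @` B)) (c s).
  by apply: cc; apply: open_nbhs_nbhs; split=> //; exact: closed_openC.
move=> /nbhs_ballP[d d0 Hd]; exists d => // s st.
have Th m : (~` (chart_inv i @` B)) m -> trunc z x h m = h.
  move=> nm; rewrite /trunc; case: ifPn => // /asboolP[Dm lth]; case: nm.
  by exists (chart_map i m); [exact: ltW|rewrite chart_mapK].
rewrite !Th//; last by apply: Hd; rewrite -ball_normE/= distrC.
rewrite subrr normr0 mulr_ge0//; apply: addr_ge0; last exact: ltW.
apply: mulr_ge0; last exact: speed_ge0.
by rewrite addr_ge0// mulr_ge0// ltW.
Qed.

(** The truncation vanishes at [x]; a value below [h] at [m] can only come from its first branch,
    which forces [m] into the chart, near [z]. *)
Lemma chart_lower z x (rho h : R) : 0 < rho -> `|z - x0| + rho < r -> `|x - z| + h / l < rho -> 0 < h ->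
  forall m (d : R), (dist (chart_inv i x) m <= d%:E)%E -> (1 + K * rho) * d < h ->
  [/\ chart_dom i m, Nrm i z (chart_map i m - x) <= (1 + K * rho) * d & `|chart_map i m - z| < rho].
Proof.
move=> rho0 zr xh h0 m d Hd dh.
have := trunc_lip rho0 zr xh h0 Hd.
have xr : `|x - x0| < r.
  have -> : x - x0 = (x - z) + (z - x0) by rewrite addrA subrK.
  apply: le_lt_trans (ler_normD _ _) _.
  have : 0 < h / l by rewrite divr_gt0.
  by move: zr xh; lra.
have -> : trunc z x h (chart_inv i x) = 0.
  have D := chart_inv_dom (img xr).
  have E : Nrm i z (chart_map i (chart_inv i x) - x) = 0.
    by rewrite chart_invK ?subrr; [rewrite /gnorm bilin0 sqrtr0|exact: img].
  by rewrite /trunc; case: ifPn => // /asboolPn []; rewrite E.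
rewrite subr0 /trunc; case: ifPn => [/asboolP[Dm lth] H|_ H]; last by move: (le_lt_trans H dh); rewrite ltxx.
split=> //.
have z_r : `|z - x0| < r by move: zr rho0; lra.
have := low (chart_map i m - x) z_r => /le_trans /(_ (ltW lth)) lu.
have -> : chart_map i m - z = (chart_map i m - x) + (x - z) by rewrite addrA subrK.
apply: le_lt_trans (ler_normD _ _) _.
have : `|chart_map i m - x| <= h / l by rewrite ler_pdivlMr// mulrC.
by move: xh; lra.
Qed.

End Good.

(** The same constants serve for every centre [z] and every scale [rho] below [r], with a relative
    error linear in [rho]. The regularity of minimizers depends on this linear rate. *)
Lemma local_metric (i : chart_index A) (x0 : 'rV[R]_n) : chart_img i x0 ->
  exists r l L K k : R, [/\ [/\ 0 < r, 0 < l, 0 < L, 0 < K & 0 < k],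
    forall x, `|x - x0| < r -> chart_img i x /\
      forall v, l * `|v| <= Nrm i x v /\ Nrm i x v <= L * `|v|,
    forall z x y rho, `|z - x0| < r -> 0 < rho -> rho < r ->
      `|x - z| < rho -> `|y - z| < rho ->
      (dist (chart_inv i x) (chart_inv i y) <= ((1 + K * rho) * Nrm i z (y - x))%:E)%E,
    forall z x y rho d, `|z - x0| < r -> 0 < rho -> rho < r ->
      `|x - z| < rho -> `|y - z| < rho ->
      (dist (chart_inv i x) (chart_inv i y) <= d%:E)%E -> Nrm i z (y - x) <= (1 + K * rho) * d &
    forall x m rho d, `|x - x0| < r -> 0 < rho -> rho < r ->
      (dist (chart_inv i x) m <= d%:E)%E -> d < k * rho ->
      chart_dom i m /\ `|chart_map i m - x| < rho].
Proof.
move=> Ix0; have [r [l [L [K good]]]] := good_radius_exists Ix0.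
have [[r0 l0 L0 K0] img bnd lip] := good.
(* Two points within [rho] of [z] have frozen distance at most [2 * L * rho], the truncation height
   used below. Its region needs the radius [C * rho], and the choice of [r'] keeps this below
   [r / 12]. *)
pose C := 2 + 2 * (L / l).
have Ll : 0 < L / l by rewrite divr_gt0.
have C2 : 2 < C by rewrite /C ltrDl mulr_gt0.
pose r' := r / (12 * C).
have r'E : r' * (12 * C) = r by rewrite /r' divfK// gt_eqF// mulr_gt0//; move: C2; alra.
have r'0 : 0 < r' by rewrite divr_gt0// mulr_gt0//; move: C2; alra.
have r'C : r' * C = r / 12 by move: r'E; alra.
have r'r : r' < r / 24 by have := mulr_gt0 r'0 (_ : 0 < C - 2); rewrite subr_gt0 => /(_ C2); move: r'C; alra.
pose K' := K * (C + 3 + 2 * K * r).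
have Kr : 0 < K * r by rewrite mulr_gt0.
have K'0 : 0 < K' by rewrite mulr_gt0//; move: C2 Kr; alra.
pose k := l / (2 * (1 + K * r)).
have k0 : 0 < k by rewrite divr_gt0// mulr_gt0//; move: Kr; alra.
exists r', l, L, K', k; split=> //.
- move=> x xr; have xr' : `|x - x0| < r by move: xr r'r r0; alra.
  by split=> [|v]; [exact: img|exact: bnd].
- move=> z x y rho zr rho0 rhor xz yz.
  have xx0 : `|x - x0| < r / 6.
    have -> : x - x0 = (x - z) + (z - x0) by rewrite addrA subrK.
    by apply: le_lt_trans (ler_normD _ _) _; move: xz zr r'r r0; alra.
  have yx0 : `|y - x0| < r / 6.
    have -> : y - x0 = (y - z) + (z - x0) by rewrite addrA subrK.
    by apply: le_lt_trans (ler_normD _ _) _; move: yz zr r'r r0; alra.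
  have zx0 : `|z - x0| < r by move: zr r'r r0; alra.
  apply: le_trans (segment_upper good xx0 yx0) _; rewrite lee_fin.
  have xx0' : `|x - x0| < r by move: xx0 r0; alra.
  have yxd : `|y - x| <= 2 * rho.
    have -> : y - x = (y - z) - (x - z) by rewrite opprB addrA subrK.
    by apply: le_trans (ler_normB _ _) _; move: xz yz; alra.
  have h1 : 1 + K * `|y - x| <= 1 + K * (2 * rho) by rewrite lerD2l ler_wpM2l// ltW.
  have h2 : 0 <= 1 + K * `|y - x| by rewrite addr_ge0// mulr_ge0// ltW.
  have h3 := lip z x (y - x) zx0 xx0'.
  have h4 : (1 + K * `|x - z|) * Nrm i z (y - x) <= (1 + K * rho) * Nrm i z (y - x).
    by rewrite ler_wpM2r ?gnorm_ge0// lerD2l ler_wpM2l ?(ltW K0)// ltW.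
  have h5 := le_trans h3 h4.
  apply: le_trans (ler_pM h2 (gnorm_ge0 _ _) h1 h5) _.
  rewrite mulrA ler_wpM2r ?gnorm_ge0// /K'.
  have h6 : 0 <= K * K * rho * (r - rho) by rewrite !mulr_ge0 ?(ltW K0) ?(ltW rho0)//; move: rhor r'r r0; alra.
  have h7 : 0 <= K * rho * C by rewrite !mulr_ge0 ?(ltW K0) ?(ltW rho0)//; move: C2; alra.
  by move: h6 h7; alra.
- move=> z x y rho d zr rho0 rhor xz yz Hd.
  have zx0 : `|z - x0| < r by move: zr r'r r0; alra.
  have Crho0 : 0 < C * rho by rewrite mulr_gt0//; move: C2; alra.
  have Crho : C * rho < r / 12 by rewrite -r'C mulrC ltr_pM2r//; move: C2; alra.
  have yI : chart_img i y.
    apply: img; have -> : y - x0 = (y - z) + (z - x0) by rewrite addrA subrK.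
    by apply: le_lt_trans (ler_normD _ _) _; move: yz zr rhor r'r r0; alra.
  have KK : 1 + K * (C * rho) <= 1 + K' * rho.
    rewrite lerD2l mulrA ler_wpM2r ?(ltW rho0)// /K' ler_wpM2l ?(ltW K0)//.
    by move: Kr; alra.
  have d0 : 0 <= d by rewrite -lee_fin; exact: le_trans (dist_ge0 _ _ _) Hd.
  apply: le_trans (ler_wpM2r d0 KK).
  pose h := 2 * L * rho.
  have h0 : 0 < h by rewrite !mulr_gt0.
  have [dh|hd] := ltP ((1 + K * (C * rho)) * d) h.
    have := chart_lower good Crho0 _ _ h0 Hd dh.
    move=> /(_ z)[||_]; last by rewrite chart_invK.
      by move: zr Crho r'r r0; alra.
    have -> : h / l = 2 * (L / l) * rho by rewrite /h; ring.
    by rewrite /C; move: xz rho0; alra.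
  apply: le_trans hd; apply: le_trans (bnd z (y - x) zx0).2 _.
  have -> : h = L * (2 * rho) by rewrite /h; ring.
  rewrite ler_wpM2l ?(ltW L0)//.
  have -> : y - x = (y - z) - (x - z) by rewrite opprB addrA subrK.
  by apply: le_trans (ler_normB _ _) _; move: xz yz; alra.
- move=> x m rho d xr rho0 rhor Hd dk.
  pose h := l * rho / 2.
  have h0 : 0 < h by rewrite divr_gt0// mulr_gt0.
  have hl : h / l = rho / 2 by rewrite /h; field; rewrite gt_eqF.
  have a1 : `|x - x0| + rho < r by move: xr rhor r'r r0; alra.
  have a2 : `|x - x| + h / l < rho by rewrite subrr normr0 hl; move: rho0; alra.
  have a3 : (1 + K * rho) * d < h.
    have d0 : 0 <= d by rewrite -lee_fin; exact: le_trans (dist_ge0 _ _ _) Hd.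
    have Kr1 : 0 < 1 + K * r by move: Kr; alra.
    have krE : k * rho * (1 + K * r) = h by rewrite /k /h; field; rewrite gt_eqF.
    rewrite -krE; apply: (@le_lt_trans _ _ ((1 + K * r) * d)).
      rewrite ler_wpM2r// lerD2l ler_wpM2l ?(ltW K0)//; move: rhor r'r r0; alra.
    by rewrite mulrC ltr_pM2r.
  by have [] := chart_lower good rho0 a1 a2 h0 Hd a3.
Qed.

(** Together with [dist_near], this says that [dist] induces the topology of [M]. *)
Lemma chart_near (i : chart_index A) p (e : R) : chart_dom i p -> 0 < e -> exists2 d : R, 0 < d &
  forall m, (dist p m <= d%:E)%E -> chart_dom i m /\ `|chart_map i m - chart_map i p| < e.
Proof.
move=> Dp e0.
have [r [l [L [K [k [[r0 l0 L0 K0 k0] _ _ _ H]]]]]] := local_metric (chart_img_in Dp).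
pose rho := Num.min e (r / 2).
have rho0 : 0 < rho by rewrite lt_min e0 divr_gt0.
have rhor : rho < r by rewrite gt_min; apply/orP; right; move: r0; alra.
exists (k * rho / 2); first by rewrite divr_gt0// mulr_gt0.
move=> m Hm.
have pp : `|chart_map i p - chart_map i p| < r by rewrite subrr normr0.
have kk : k * rho / 2 < k * rho by have : 0 < k * rho := mulr_gt0 k0 rho0; alra.
have [|Dm mp] := H (chart_map i p) m rho (k * rho / 2) pp rho0 rhor _ kk.
  by rewrite chart_mapK.
by split=> //; apply: lt_le_trans mp _; rewrite ge_min lexx.
Qed.

Lemma dist_near (i : chart_index A) p (e : R) : chart_dom i p -> 0 < e -> exists2 d : R, 0 < d &
  forall y, `|y - chart_map i p| < d -> chart_img i y /\ (dist p (chart_inv i y) <= e%:E)%E.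
Proof.
move=> Dp e0.
have [r [l [L [K [k [[r0 l0 L0 K0 k0] H1 H2 _ _]]]]]] := local_metric (chart_img_in Dp).
have KL : 0 < (1 + K * (r / 2)) * L.
  by rewrite mulr_gt0// ltr_wpDr// mulr_ge0// ltW// divr_gt0.
exists (Num.min (r / 2) (e / ((1 + K * (r / 2)) * L))).
  by rewrite lt_min !divr_gt0.
move=> y; rewrite lt_min => /andP[y1 y2].
have yr : `|y - chart_map i p| < r by move: y1 r0; alra.
split; first by have [] := H1 y yr.
have pp : `|chart_map i p - chart_map i p| < r by rewrite subrr normr0.
have := H2 (chart_map i p) (chart_map i p) y (r / 2) pp.
rewrite subrr normr0 chart_mapK// divr_gt0// => /(_ isT) /(_ _ isT y1)H.
apply: le_trans (H _) _; first by move: r0; alra.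
rewrite lee_fin.
have K1 : 0 <= 1 + K * (r / 2) by rewrite addr_ge0// mulr_ge0 ?(ltW K0)// divr_ge0// ltW.
have [_ Hu] := (H1 _ pp).2 (y - chart_map i p).
apply: le_trans (ler_wpM2l K1 Hu) _.
by have := ltW y2; rewrite ler_pdivlMr//; alra.
Qed.

Lemma dist_eq0 p q : (dist p q <= 0)%E -> p = q.
Proof.
move=> H; set i := chart_at A p; have Dp := chart_at_dom A p.
have near e : 0 < e -> chart_dom i q /\ `|chart_map i q - chart_map i p| < e.
  move=> e0; have [d d0 Hd] := chart_near Dp e0; apply: Hd.
  by apply: le_trans H _; rewrite lee_fin ltW.
have [Dq _] := near 1 ltr01.
rewrite -(chart_mapK Dp) -(chart_mapK Dq); congr (chart_inv i _).
apply/eqP; rewrite eq_sym -subr_eq0 -normr_eq0 eq_le normr_ge0 andbT.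
by apply/ler_addgt0Pl => e /near[_ /ltW]; rewrite addr0.
Qed.

Lemma continuous_dist (T : pseudoMetricType R) (c : T -> M) t : {for t, continuous c} ->
  forall e : R, 0 < e -> exists2 d : R, 0 < d & forall s, ball t d s -> (dist (c t) (c s) <= e%:E)%E.
Proof.
move=> cc e e0; set i := chart_at A (c t); have Dt := chart_at_dom A (c t).
have [d d0 Hd] := dist_near Dt e0.
have : \forall s \near t, chart_dom i (c s).
  by apply: cc; exact: open_nbhs_nbhs (conj (chart_dom_open i) Dt).
have /continuous_epsP cx : {for t, continuous (chart_map i \o c)}.
  apply: (@continuous_comp _ _ _ c (chart_map i)) => //.
  exact: chart_map_continuous.
have [d1 d10 Hd1] := cx d d0.
move=> /nbhs_ballP[d2 /= d20 Hd2].
exists (Num.min d1 d2); first by rewrite lt_min d10.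
move=> s ts; have s1 : ball t d1 s by apply: le_ball ts; rewrite ge_min lexx.
have s2 : ball t d2 s by apply: le_ball ts; rewrite ge_min lexx orbT.
have [_] := Hd _ (Hd1 s s1); rewrite /= chart_mapK//.
exact: Hd2.
Qed.

Lemma dist_continuous (T : pseudoMetricType R) (c : T -> M) t :
  (forall e : R, 0 < e -> exists2 d : R, 0 < d & forall s, ball t d s -> (dist (c t) (c s) <= e%:E)%E) ->
  {for t, continuous c}.
Proof.
move=> H; set i := chart_at A (c t); have Dt := chart_at_dom A (c t).
have cx : (chart_map i \o c) x @[x --> t] --> chart_map i (c t).
  apply/cvgrPdist_lt => e e0; have [d d0 Hd] := chart_near Dt e0.
  have [d' d'0 Hd'] := H d d0; apply/nbhs_ballP; exists d' => // s /Hd' /Hd[_].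
  by rewrite distrC.
have [d d0 Hd] := chart_near Dt ltr01.
have [d' d'0 Hd'] := H d d0.
have E : \forall s \near t, chart_inv i (chart_map i (c s)) = c s.
  apply/nbhs_ballP; exists d' => // s /Hd' /Hd[Ds _]; exact: chart_mapK.
apply: near_eq_continuous E _.
apply: (@continuous_comp _ _ _ (chart_map i \o c) (chart_inv i)) => //.
exact: chart_inv_continuous (chart_img_in Dt).
Qed.

(** A curve that is merely differentiable need not be an admissible path. It is replaced by chart
    segments between nearby points, whose lengths add up by [creep_primitive]; so variations of a
    minimizer can be measured before it is known to be smooth. *)
Lemma speed_bound (i : chart_index A) (a b : R) (y y' : R -> 'rV[R]_n) (G G' : R -> R) : a <= b ->
  (forall t, a <= t <= b -> chart_img i (y t)) ->
  (forall t : R, a <= t <= b -> is_derive t 1 y (y' t)) ->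
  (forall t : R, a <= t <= b -> is_derive t 1 G (G' t)) ->
  (forall t, a <= t <= b -> Nrm i (y t) (y' t) <= G' t) ->
  (dist (chart_inv i (y a)) (chart_inv i (y b)) <= (G b - G a)%:E)%E.
Proof.
move=> ab yI dy dG NG; apply: lee_addgt0 => e e0.
have := @creep_primitive R a b 1 G G'
  (fun s t r : R => (dist (chart_inv i (y s)) (chart_inv i (y t)) <= r%:E)%E) ab ler01.
rewrite mul1r; apply => //.
- by move=> s t u p q; exact: dist_tri.
- by move=> s t p q H pq; apply: le_trans H _; rewrite lee_fin.
move=> t tab e1 e10.
have [r [l [L [K good]]]] := good_radius_exists (yI t tab).
have [[r0 l0 L0 K0] _ bnd _] := good.
have tr : `|y t - y t| < r by rewrite subrr normr0.
set N := Nrm i (y t) (y' t).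
have N0 : 0 <= N by exact: gnorm_ge0.
have e2 : 0 < e1 / (4 * L) by rewrite divr_gt0// mulr_gt0.
have [d1 d10 Hd1] := is_derive_eps (dy t tab) e2.
(* The three bounds serve [segment_upper], the estimate of [K] times the increment by 1, and that of
   its product with [N + 1] by [e1 / 4]. *)
pose eta := Num.min (r / 6) (Num.min (1 / K) (e1 / (4 * K * (N + 1)))).
have N1 : 0 < N + 1 by rewrite ltr_wpDl.
have eta0 : 0 < eta by rewrite !lt_min !divr_gt0// ?mulr_gt0.
have /continuous_normP /(_ eta eta0)[d2 d20 Hd2] := is_derive_continuous (dy t tab).
exists (Num.min d1 d2); first by rewrite lt_min d10.
move=> s _; rewrite lt_min => /andP[s1 s2].
have := Hd2 s s2; rewrite !lt_min => /and3P[h1 h2 h3].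
have tr6 : `|y t - y t| < r / 6 by rewrite subrr normr0 divr_gt0.
have D : (dist (chart_inv i (y t)) (chart_inv i (y s)) <= ((1 * G' t + e1) * `|s - t|)%:E)%E.
  apply: le_trans (segment_upper good tr6 h1) _; rewrite lee_fin.
  have -> : y s - y t = (s - t) *: y' t + (y s - y t - (s - t) *: y' t) by rewrite [RHS]addrC subrK.
  have K1 : 0 <= 1 + K * `|(s - t) *: y' t + (y s - y t - (s - t) *: y' t)|.
    by rewrite addr_ge0// mulr_ge0// ltW.
  apply: le_trans (ler_wpM2l K1 (gnormD _ _ (gmx_metric g (yI t tab)))) _.
  rewrite gnormZ -/N.
  have h4 := le_trans (bnd (y t) _ tr).2 (ler_wpM2l (ltW L0) (Hd1 s s1)).
  have E4 : L * (e1 / (4 * L) * `|s - t|) = e1 / 4 * `|s - t| by field; rewrite gt_eqF.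
  rewrite E4 in h4.
  have {}K1 : 0 <= 1 + K * `|y s - y t| by rewrite addr_ge0// mulr_ge0// ltW.
  rewrite [X in K * `|X|]addrC subrK.
  have h5 : `|s - t| * N + Nrm i (y t) (y s - y t - (s - t) *: y' t) <= `|s - t| * (N + e1 / 4).
    by move: h4; alra.
  apply: le_trans (ler_wpM2l K1 h5) _.
  rewrite mulrCA mulrC ler_wpM2r// mul1r.
  have h6 : K * `|y s - y t| <= 1.
    by have := ltW h2; rewrite ler_pdivlMr// mulrC.
  have h7 : K * `|y s - y t| * (N + 1) <= e1 / 4.
    have := ltW h3; rewrite ler_pdivlMr ?mulr_gt0//; alra.
  have h8 : 0 <= K * `|y s - y t| by rewrite mulr_ge0// ltW.
  have h9 : K * `|y s - y t| * (e1 / 4) <= 1 * (e1 / 4) by rewrite ler_wpM2r// divr_ge0// ltW.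
  have := NG t tab; rewrite -/N; move: h7 h8 h9 e10; alra.
split=> st.
  by move: D; rewrite distrC ger0_norm ?subr_ge0//; exact: dist_sym_le.
by move: D; rewrite ger0_norm ?subr_ge0.
Qed.

End LocalMetric.

(** * Limits along ultrafilters *)

Lemma ultra_fmap (T T' : Type) (f : T -> T') (F : set_system T) :
  UltraFilter F -> UltraFilter (fmap f F).
Proof.
move=> FU; split; first exact: fmap_proper_filter.
move=> G GF FG; rewrite predeqE => B; split; last exact: FG.
move=> GB; have [//|FnB] := in_ultra_setVsetC (f @^-1` B) FU.
have GnB : G (~` B) by apply: FG.
by have /filter_ex [? []] : G (B `&` ~` B) by exact: filterI.
Qed.

Lemma ultra_ex2 (T : Type) (F : set_system T) (P Q : set T) : UltraFilter F -> F P -> F Q ->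
  exists x, P x /\ Q x.
Proof.
move=> FU FP FQ; have /filter_ex [x [Px Qx]] : F (P `&` Q) by exact: filterI.
by exists x.
Qed.

Lemma ultra_ex3 (T : Type) (F : set_system T) (P Q S : set T) : UltraFilter F ->
  F P -> F Q -> F S -> exists x, P x /\ Q x /\ S x.
Proof.
move=> FU FP FQ FS.
have FQS : F (Q `&` S) by exact: filterI.
by have [x [Px [Qx Sx]]] := ultra_ex2 FU FP FQS; exists x.
Qed.

(** Any ultrafilter refining [\oo], hence a free one; limits of sequences in compact sets exist
    along it without choosing subsequences. *)
Lemma ultra_nat : exists2 V : set_system nat, UltraFilter V & forall N, V [set k | (N <= k)%N].
Proof.
have [V [VU HV]] := @ultraFilterLemma nat (nbhs \oo) _.
by exists V => // N; apply: HV; exact: nbhs_infty_ge.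
Qed.

Lemma ultra_bounded {R : realType} n (V : set_system nat) (q : nat -> 'rV[R]_n) (B : R) : UltraFilter V ->
  V [set k | `|q k| <= B] -> exists D : 'rV[R]_n, forall e : R, 0 < e -> V [set k | `|q k - D| < e].
Proof.
move=> VU HB; pose S := [set x : 'rV[R]_n | `|x| <= B].
have cS : compact S.
  apply: bounded_closed_compact.
    exists B; split=> [|s hs u Bu]; first exact: num_real.
    exact: le_trans Bu (ltW hs).
  apply: (@closed_comp _ _ (fun u : 'rV[R]_n => `|u|) [set a | a <= B]).
    by move=> u _; exact: norm_continuous.
  exact: closed_le.
move: cS; rewrite compact_ultra => /(_ _ (ultra_fmap q VU) HB)[D [_ DV]].
exists D => e e0.
have : fmap q V [set z | `|z - D| < e].
  by apply: DV; apply/nbhs_ballP; exists e => // z; rewrite -ball_normE/= distrC.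
exact.
Qed.

(** * Existence of minimizers *)

Section HopfRinow.
Context {R : realType} {n : nat} {M : topologicalType}.
Context {A : smooth_manifold R n M}.
Context (g : riemannian_metric A).
Local Notation dist := (dist g).

Definition dcvg (U : set_system M) (m : M) : Prop :=
  forall e : R, 0 < e -> U [set x | (dist m x <= e%:E)%E].

(* Compactness of the closed ball of radius [r] around [p], for convergence with
   respect to the Riemannian distance. *)
Definition proper_ball (p : M) (r : R) : Prop :=
  forall U : set_system M, UltraFilter U -> U [set x | (dist p x <= r%:E)%E] ->
    exists m, dcvg U m.

Lemma proper_ball_le p r r' : r' <= r -> proper_ball p r -> proper_ball p r'.
Proof.
move=> rr H U UU Ur'; apply: H => //; apply: filterS Ur' => x /= /le_trans; apply.
by rewrite lee_fin.
Qed.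

(** Cut an almost shortest path at arc length [s]. The path is taken of length less than
    [s + 2 * e], as the distance may equal [s + e]. *)
Lemma intermediate_point p q (s e : R) : 0 <= s -> 0 < e -> (dist p q <= (s + e)%:E)%E ->
  exists m, (dist p m <= s%:E)%E /\ (dist m q <= (2 * e)%:E)%E.
Proof.
move=> s0 e0 H.
have [|sq ps l] := @dist_lt_path _ _ _ _ g p q (s + 2 * e)%:E.
  by apply: le_lt_trans H _; rewrite lte_fin; alra.
have [L [σ [L0 lE [a1 a2] [b1 b2] lip]]] := path_arclength g ps.
move: l; rewrite lE lte_fin => Ll.
have I0 : 0 <= (0 : R) <= L by rewrite lexx.
have I1 : 0 <= L <= L by rewrite lexx L0.
have [Ls|sL] := leP L s.
  exists q; rewrite dist_refl lee_fin mulr_ge0 ?(ltW e0)//; split=> //.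
  have := dist_tri a1 (dist_tri (lip _ _ I0 I1) b2); move/le_trans; apply.
  by rewrite lee_fin sub0r normrN ger0_norm//; alra.
have Is : 0 <= s <= L by rewrite s0 ltW.
exists (σ s); split.
  have := dist_tri a1 (lip _ _ I0 Is); move/le_trans; apply.
  by rewrite lee_fin sub0r normrN ger0_norm//; alra.
have := dist_tri (lip _ _ Is I1) b2; move/le_trans; apply.
by rewrite lee_fin ler0_norm; alra.
Qed.

Lemma proper_ball_small p : exists2 d : R, 0 < d & proper_ball p d.
Proof.
set i := chart_at A p; have Dp : chart_dom i p by exact: chart_at_dom.
have [r r0 Hr] := open_ball_sub (@chart_img_open' _ _ _ A i) (chart_img_in Dp).
have r20 : 0 < r / 2 by rewrite divr_gt0.
have [d d0 Hd] := chart_near g Dp r20.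
exists d => // U UU Ud.
pose B := [set x : 'rV[R]_n | `|x - chart_map i p| <= r / 2].
have cB : compact B.
  apply: bounded_closed_compact.
    exists (`|chart_map i p| + r / 2); split=> [|s hs u Bu]; first exact: num_real.
    rewrite -(subrK (chart_map i p) u); apply: le_trans (ler_normD _ _) _.
    by move: hs Bu; rewrite /B/=; alra.
  apply: (@closed_comp _ _ (fun u : 'rV[R]_n => `|u - chart_map i p|) [set a | a <= r / 2]).
    move=> u _; apply/continuous_normP => e e0; exists e => // w uw.
    by apply: le_lt_trans (ler_dist_dist _ _) _; rewrite opprB addrA subrK.
  exact: closed_le.
have UD : U [set x | chart_dom i x /\ `|chart_map i x - chart_map i p| < r / 2].
  by apply: filterS Ud => x; exact: Hd.
have VU := ultra_fmap (chart_map i) UU.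
move: cB; rewrite compact_ultra => /(_ _ VU)[].
  change (U [set x | `|chart_map i x - chart_map i p| <= r / 2]).
  by apply: filterS UD => x [_ /ltW].
move=> y [By yV].
have Iy : chart_img i y.
  by apply: Hr; apply: le_lt_trans By _; rewrite ltr_pdivrMr//; alra.
exists (chart_inv i y) => e e0.
have [d' d'0 Hd'] := dist_near g (chart_inv_dom Iy) e0.
rewrite chart_invK// in Hd'.
have Vy : fmap (chart_map i) U [set z | `|z - y| < d'].
  apply: yV; apply/nbhs_ballP; exists d' => // z.
  by rewrite -ball_normE/= distrC.
have : U ([set x | chart_dom i x /\ `|chart_map i x - chart_map i p| < r / 2] `&`
  (chart_map i) @^-1` [set z | `|z - y| < d']) by exact: filterI.
apply: filterS => x [[Dx _] /= /Hd'[_]].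
by rewrite chart_mapK.
Qed.

Lemma dcvg_ball U p m r : UltraFilter U -> U [set x | (dist p x <= r%:E)%E] -> dcvg U m ->
  (dist p m <= r%:E)%E.
Proof.
move=> UU Ur Um; apply: lee_addgt0 => e e0.
have /filter_ex [x [/= px mx]] : U ([set x | (dist p x <= r%:E)%E] `&` [set x | (dist m x <= e%:E)%E]).
  by apply: filterI => //; exact: Um.
exact: dist_tri px (dist_sym_le mx).
Qed.

Lemma inv_nat_small (e : R) : 0 < e -> exists N : nat, forall k, (N <= k)%N -> k.+1%:R^-1 <= e.
Proof.
move=> e0; have [N _ HN] := @near_infty_natSinv_lt R (PosNum e0).
exists N => k kN; apply: ltW; exact: HN.
Qed.

(** Compactness yields one radius [d0] at which every ball centred in the ball of radius [r] is
    compact. Points at distance up to [r + d0 / 3] are pulled back into that ball over at most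
    [2 * (d0 / 3)]; if [m] is the limit of the pulled-back points, most of the original ones lie
    within [d0] of [m]. *)
Lemma proper_ball_grow p r : 0 <= r -> proper_ball p r -> exists2 d : R, 0 < d & proper_ball p (r + d).
Proof.
move=> r0 Hr.
have [d0 d00 Hd0] : exists2 d0 : R, 0 < d0 & forall m, (dist p m <= r%:E)%E -> proper_ball m d0.
  apply: contrapT => H.
  have Hk (k : nat) : exists m, (dist p m <= r%:E)%E /\ ~ proper_ball m (k.+1%:R^-1).
    apply: contrapT => Hk; apply: H; exists (k.+1%:R^-1); first by rewrite invr_gt0.
    by move=> m pm; apply: contrapT => nm; apply: Hk; exists m.
  pose mk k := projT1 (cid (Hk k)).
  have Hmk k : (dist p (mk k) <= r%:E)%E /\ ~ proper_ball (mk k) (k.+1%:R^-1).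
    by rewrite /mk; case: cid.
  have [V VU VN] := ultra_nat.
  have [|m Hm] := Hr (fmap mk V) (ultra_fmap mk VU).
    change (V [set k | (dist p (mk k) <= r%:E)%E]).
    by apply: filterS (VN 0%N) => k _; exact: (Hmk k).1.
  have [d d_0 Hd] := proper_ball_small m.
  have d20 : 0 < d / 2 by rewrite divr_gt0.
  have [N HN] := inv_nat_small d20.
  have /filter_ex [k [/= mmk Nk]] : V ((mk @^-1` [set x | (dist m x <= (d / 2)%:E)%E]) `&` [set k | (N <= k)%N]).
    by apply: filterI => //; exact: Hm.
  apply: (Hmk k).2 => U UU Uk; apply: Hd => //; apply: filterS Uk => x /= mx.
  have := dist_tri mmk mx; move/le_trans; apply; rewrite lee_fin.
  by move: (HN k Nk); move: (k.+1%:R^-1) => z; alra.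
exists (d0 / 3); first by rewrite divr_gt0.
move=> U UU Ur.
have Hpi x : exists y, (dist p x <= (r + d0 / 3)%:E)%E -> (dist p y <= r%:E)%E /\ (dist y x <= (2 * (d0 / 3))%:E)%E.
  have [px|npx] := pselect (dist p x <= (r + d0 / 3)%:E)%E; last by exists p.
  have d3 : 0 < d0 / 3 by rewrite divr_gt0.
  have [y Hy] := intermediate_point r0 d3 px.
  by exists y.
pose pi x := projT1 (cid (Hpi x)).
have piP x : (dist p x <= (r + d0 / 3)%:E)%E -> (dist p (pi x) <= r%:E)%E /\ (dist (pi x) x <= (2 * (d0 / 3))%:E)%E.
  by rewrite /pi; case: cid.
have Upi : fmap pi U [set x | (dist p x <= r%:E)%E].
  change (U [set x | (dist p (pi x) <= r%:E)%E]).
  by apply: filterS Ur => x /= /piP[].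
have [m Hm] := Hr _ (ultra_fmap pi UU) Upi.
have pm := dcvg_ball (ultra_fmap pi UU) Upi Hm.
apply: (Hd0 m pm) => //.
have d30 : 0 < d0 / 3 by rewrite divr_gt0.
have : U ((pi @^-1` [set x | (dist m x <= (d0 / 3)%:E)%E]) `&` [set x | (dist p x <= (r + d0 / 3)%:E)%E]).
  by apply: filterI => //; exact: Hm.
apply: filterS => x [/= h1 /piP[_ h2]].
have := dist_tri h1 h2; move/le_trans; apply; rewrite lee_fin; alra.
Qed.

Context (complete : complete_riemannian g).

(** Completeness enters here. Pulling the points back by [e] into a smaller, compact ball yields a
    centre [y] with most points within [3 * e]; for [e] tending to zero these centres form a Cauchy
    sequence. *)
Lemma proper_ball_closed p r : 0 <= r -> (forall r', 0 <= r' -> r' < r -> proper_ball p r') -> proper_ball p r.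
Proof.
move=> r0 Hr U UU Ur.
have step (e : R) : 0 < e -> exists y, U [set x | (dist y x <= (3 * e)%:E)%E].
  move=> e0; have [re|er] := leP r e.
    by exists p; apply: filterS Ur => x /= /le_trans; apply; rewrite lee_fin; alra.
  have re0 : 0 <= r - e by alra.
  have ree : r - e < r by alra.
  have Hpi x : exists y, (dist p x <= r%:E)%E -> (dist p y <= (r - e)%:E)%E /\ (dist y x <= (2 * e)%:E)%E.
    have [px|npx] := pselect (dist p x <= r%:E)%E; last by exists p.
    have px' : (dist p x <= (r - e + e)%:E)%E by rewrite subrK.
    by have [y Hy] := intermediate_point re0 e0 px'; exists y.
  pose pi x := projT1 (cid (Hpi x)).
  have piP x : (dist p x <= r%:E)%E -> (dist p (pi x) <= (r - e)%:E)%E /\ (dist (pi x) x <= (2 * e)%:E)%E.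
    by rewrite /pi; case: cid.
  have Upi : fmap pi U [set x | (dist p x <= (r - e)%:E)%E].
    change (U [set x | (dist p (pi x) <= (r - e)%:E)%E]).
    by apply: filterS Ur => x /= /piP[].
  have [m Hm] := Hr _ re0 ree _ (ultra_fmap pi UU) Upi.
  exists m; have : U ((pi @^-1` [set x | (dist m x <= e%:E)%E]) `&` [set x | (dist p x <= r%:E)%E]).
    by apply: filterI => //; exact: Hm.
  apply: filterS => x [/= h1 /piP[_ h2]].
  have := dist_tri h1 h2; move/le_trans; apply; rewrite lee_fin; alra.
have inv0 (k : nat) : 0 < (k.+1%:R^-1 : R) by rewrite invr_gt0.
pose y k := projT1 (cid (step _ (inv0 k))).
have Hy k : U [set x | (dist (y k) x <= (3 * k.+1%:R^-1)%:E)%E] by rewrite /y; case: cid.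
have yy k l : (dist (y k) (y l) <= (3 * k.+1%:R^-1 + 3 * l.+1%:R^-1)%:E)%E.
  have [x [/= h1 h2]] := ultra_ex2 UU (Hy k) (Hy l).
  exact: dist_tri h1 (dist_sym_le h2).
have [m Hm] : exists m, (fun k => dist (y k) m) @ \oo --> 0%E.
  apply: complete => e e0.
  have e12 : 0 < e / 12 by rewrite divr_gt0.
  have [N HN] := inv_nat_small e12.
  exists N => k l Nk Nl; apply: le_lt_trans (yy k l) _; rewrite lte_fin.
  by move: (HN k Nk) (HN l Nl); move: (k.+1%:R^-1) (l.+1%:R^-1) => z z'; alra.
exists m => e e0.
have e20 : 0 < e / 2 by rewrite divr_gt0.
have e60 : 0 < e / 6 by rewrite divr_gt0.
have [N HN] := inv_nat_small e60.
have : \forall k \near \oo, (dist (y k) m < (e / 2)%:E)%E.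
  have : nbhs 0%E [set x : \bar R | (x < (e / 2)%:E)%E].
    by apply: open_nbhs_nbhs; split; [exact: open_ereal_lt_ereal|rewrite /= lte_fin].
  by move=> /Hm.
move=> [N2 _ HN2].
have := Hy (maxn N N2); apply: filterS => x /= h1.
have h2 := ltW (HN2 (maxn N N2) (leq_maxr _ _)).
have := dist_tri (dist_sym_le h2) h1; move/le_trans; apply; rewrite lee_fin.
by move: (HN (maxn N N2) (leq_maxl _ _)); move: ((maxn N N2).+1%:R^-1) => z; alra.
Qed.

Theorem hopf_rinow p r : proper_ball p r.
Proof.
have [r0|r0] := ltP r 0.
  have [d d0 Hd] := proper_ball_small p.
  by apply: proper_ball_le Hd; alra.
apply: contrapT => nr.
pose S := [set s : R | 0 <= s /\ proper_ball p s].
have S0 : S 0.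
  split=> //; have [d d0 Hd] := proper_ball_small p.
  by apply: proper_ball_le Hd; exact: ltW.
have Sub : ubound S r.
  move=> s [s0 Hs]; rewrite leNgt; apply/negP => rs; apply: nr.
  exact: proper_ball_le (ltW rs) Hs.
have supS : has_sup S by split; [exists 0|exists r].
have s0 : 0 <= sup S by apply: sup_upper_bound.
have Hs : proper_ball p (sup S).
  apply: proper_ball_closed => // r' r'0 r's.
  have e0 : 0 < sup S - r' by rewrite subr_gt0.
  have [s [s_0 Hs] rs] := sup_adherent e0 supS.
  apply: proper_ball_le Hs; apply: ltW; move: rs.
  by rewrite opprB addrC subrK.
have [d d0 Hd] := proper_ball_grow s0 Hs.
have : sup S + d <= sup S by apply: sup_upper_bound => //; split=> //; rewrite addr_ge0// ltW.
by rewrite gerDl leNgt d0.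
Qed.

(** Purely metric, with constant speed [κ], possibly zero. The notion passes to pointwise limits,
    and smoothness is deduced from it. *)
Definition minimizer (κ a b : R) (γ : R -> M) : Prop :=
  forall s t, a <= s <= b -> a <= t <= b -> dist (γ s) (γ t) = (κ * `|s - t|)%:E.

(** The limit is taken at every [t] separately; all it takes is one ball, compact by [hopf_rinow],
    that contains most of the points. *)
Lemma ultralimit (V : set_system nat) (a b r : R) (p : M) (σ : nat -> R -> M) : UltraFilter V ->
  (forall t, a <= t <= b -> V [set k | (dist p (σ k t) <= r%:E)%E]) ->
  exists γ : R -> M, forall t, a <= t <= b -> forall e : R, 0 < e ->
    V [set k | (dist (γ t) (σ k t) <= e%:E)%E].
Proof.
move=> VU H.
have Ht t : exists m, a <= t <= b -> dcvg (fmap (fun k => σ k t) V) m.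
  have [tab|] := pselect (a <= t <= b); last by exists p.
  have [|m Hm] := @hopf_rinow p r _ (ultra_fmap (fun k => σ k t) VU); first exact: H.
  by exists m.
exists (fun t => projT1 (cid (Ht t))) => t tab e e0.
by case: cid => /= m /(_ tab) /(_ e e0).
Qed.

Lemma ultralimit_dist (V : set_system nat) x y (σ τ : nat -> M) d : UltraFilter V ->
  (forall e : R, 0 < e -> V [set k | (dist x (σ k) <= e%:E)%E]) ->
  (forall e : R, 0 < e -> V [set k | (dist y (τ k) <= e%:E)%E]) ->
  (forall e : R, 0 < e -> V [set k | (dist (σ k) (τ k) <= (d + e)%:E)%E]) ->
  (dist x y <= d%:E)%E.
Proof.
move=> VU Hx Hy Hd; apply: lee_addgt0 => e e0.
have e3 : 0 < e / 3 by rewrite divr_gt0.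
have [k [/= h1 [h2 h3]]] := ultra_ex3 VU (Hx _ e3) (Hy _ e3) (Hd _ e3).
have := dist_tri h1 (dist_tri h3 (dist_sym_le h2)); move/le_trans; apply.
by rewrite lee_fin; alra.
Qed.

(** By the triangle inequality, any gain between [s] and [t] would shorten the whole curve below the
    distance of its ends. *)
Lemma lip_minimizer (κ a b : R) γ : 0 <= κ -> a <= b ->
  (forall s t, a <= s <= b -> a <= t <= b -> (dist (γ s) (γ t) <= (κ * `|s - t|)%:E)%E) ->
  ((κ * (b - a))%:E <= dist (γ a) (γ b))%E -> minimizer κ a b γ.
Proof.
move=> κ0 ab lip H.
have Ia : a <= a <= b by rewrite lexx.
have Ib : a <= b <= b by rewrite lexx ab.
have main s t : a <= s -> s <= t -> t <= b -> dist (γ s) (γ t) = (κ * (t - s))%:E.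
  move=> as_ st tb.
  have Is : a <= s <= b by rewrite as_ (le_trans st).
  have It : a <= t <= b by rewrite tb (le_trans as_).
  have := lip s t Is It; rewrite distrC ger0_norm ?subr_ge0// => h.
  apply/eqP; rewrite eq_le h/=; move: h.
  case E : (dist (γ s) (γ t)) => [d||]; rewrite ?leey// => h.
    have h1 := lip a s Ia Is; rewrite distrC ger0_norm ?subr_ge0// in h1.
    have h2 := lip t b It Ib; rewrite distrC ger0_norm ?subr_ge0// in h2.
    have Ed : (dist (γ s) (γ t) <= d%:E)%E by rewrite E.
    have := dist_tri (dist_tri h1 Ed) h2; move/(le_trans H).
    by rewrite !lee_fin; alra.
  by have := dist_ge0 g (γ s) (γ t); rewrite E.
move=> s t /andP[as_ sb] /andP[at_ tb].
have [st|/ltW ts] := leP s t.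
  by rewrite main// distrC ger0_norm// subr_ge0.
by rewrite dist_sym main// ger0_norm// subr_ge0.
Qed.

(** Almost shortest paths, by arc length, live on intervals from 0 to [Lk k], where [Lk k] tends to
    [d] from above. Their ultralimit is 1-Lipschitz, hence minimizing by [lip_minimizer]. *)
Lemma minimizer_exists p q (d : R) : dist p q = d%:E ->
  exists γ, [/\ minimizer 1 0 d γ, γ 0 = p & γ d = q].
Proof.
move=> E.
have d0 : 0 <= d by rewrite -lee_fin -E dist_ge0.
have Hk (k : nat) : exists Lσ : R * (R -> M), [/\ d <= Lσ.1, Lσ.1 <= d + k.+1%:R^-1,
    (dist p (Lσ.2 0%R) <= 0)%E, (dist q (Lσ.2 Lσ.1) <= 0)%E &
    forall u v, 0 <= u <= Lσ.1 -> 0 <= v <= Lσ.1 -> (dist (Lσ.2 u) (Lσ.2 v) <= `|u - v|%:E)%E].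
  have [|s ps l] := @dist_lt_path _ _ _ _ g p q (d + k.+1%:R^-1)%:E.
    by rewrite E lte_fin ltrDl invr_gt0.
  have [L [σ [L0 lE [a1 a2] [b1 b2] lip]]] := path_arclength g ps.
  exists (L, σ); split=> //=.
    by have := dist_le_path g ps; rewrite E lE lee_fin.
  by move: l; rewrite lE lte_fin => /ltW.
pose Lk k := (projT1 (cid (Hk k))).1; pose σ k := (projT1 (cid (Hk k))).2.
have HP k : [/\ d <= Lk k, Lk k <= d + k.+1%:R^-1,
    (dist p (σ k 0%R) <= 0)%E, (dist q (σ k (Lk k)) <= 0)%E &
    forall u v, 0 <= u <= Lk k -> 0 <= v <= Lk k -> (dist (σ k u) (σ k v) <= `|u - v|%:E)%E].
  by rewrite /Lk /σ; case: cid.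
have [V VU VN] := ultra_nat.
have V1 (P : set nat) : (forall k, P k) -> V P by move=> HPk; apply: filterS (VN 0%N) => k _.
have inI k u : 0 <= u <= d -> 0 <= u <= Lk k.
  by move=> /andP[-> ud]; have [h _ _ _ _] := HP k; rewrite (le_trans ud h).
have I0 : 0 <= (0 : R) <= d by rewrite lexx.
have Id : 0 <= d <= d by rewrite lexx d0.
have [|γ Hγ] := @ultralimit V 0 d d p σ VU.
  move=> t td; apply: V1 => k; have [h1 h2 h3 h4 h5] := HP k.
  have := dist_tri h3 (h5 0 t (inI k _ I0) (inI k _ td)); move/le_trans; apply.
  by rewrite lee_fin sub0r normrN ger0_norm; case/andP: td => *; alra.
have lip s t : 0 <= s <= d -> 0 <= t <= d -> (dist (γ s) (γ t) <= (1 * `|s - t|)%:E)%E.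
  move=> hs ht; apply: (ultralimit_dist VU (Hγ s hs) (Hγ t ht)) => e e0.
  apply: V1 => k; have [_ _ _ _ h5] := HP k.
  by apply: le_trans (h5 s t (inI k _ hs) (inI k _ ht)) _; rewrite lee_fin mul1r lerDl ltW.
have γ0 : γ 0 = p.
  apply: (dist_eq0 (g := g)).
  apply: (@ultralimit_dist V (γ 0) p (fun k => σ k 0) (fun k => σ k 0) 0 VU (Hγ 0 I0)).
    move=> e e0; apply: V1 => k; have [_ _ h3 _ _] := HP k.
    by apply: le_trans h3 _; rewrite lee_fin ltW.
  by move=> e e0; apply: V1 => k /=; rewrite dist_refl lee_fin add0r ltW.
have γd : γ d = q.
  apply: (dist_eq0 (g := g)).
  apply: (@ultralimit_dist V (γ d) q (fun k => σ k d) (fun k => σ k (Lk k)) 0 VU (Hγ d Id)).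
    move=> e e0; apply: V1 => k; have [_ _ _ h3 _] := HP k.
    by apply: le_trans h3 _; rewrite lee_fin ltW.
  move=> e e0; have [N HN] := inv_nat_small e0; apply: filterS (VN N) => k /= /HN hk.
  have [h1 h2 _ _ h5] := HP k.
  have Ik : 0 <= Lk k <= Lk k by rewrite lexx (le_trans d0 h1).
  apply: le_trans (h5 _ _ (inI k _ Id) Ik) _.
  move: h2 hk; move: (k.+1%:R^-1) => z h2 hk.
  by rewrite lee_fin add0r ler0_norm; alra.
exists γ; split=> //; apply: lip_minimizer => //.
by rewrite γ0 γd E mul1r subr0.
Qed.

End HopfRinow.

(** * Regularity of minimizers *)

Section HolderDerivative.
Context {R : realType} {n : nat}.

Definition quot (x : R -> 'rV[R]_n) (s t : R) : 'rV[R]_n := (t - s)^-1 *: (x t - x s).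

(* With [u] the midpoint of [s] and [t], the difference quotients on its two
   sides differ by at most [2 * Num.sqrt (C * (t - s))]. *)
Definition almost_affine (C a b : R) (x : R -> 'rV[R]_n) : Prop :=
  forall s u t, a <= s -> s < u -> u < t -> t <= b ->
    `|(t - u) *: (x u - x s) - (u - s) *: (x t - x u)| ^+ 2
      <= C * ((u - s) * (t - u) * (t - s) ^+ 3).

Lemma sqr_le_sqrt (N c t : R) : 0 <= N -> N ^+ 2 <= c ^+ 2 * t -> 0 <= c -> 0 <= t -> N <= c * Num.sqrt t.
Proof.
move=> N0 H c0 t0; rewrite -ler_sqr ?nnegrE ?mulr_ge0 ?sqrtr_ge0//.
by rewrite exprMn sqr_sqrtr.
Qed.

Section Fixed.
Context (C a b : R) (x : R -> 'rV[R]_n).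
Context (C0 : 0 <= C).
Context (aff : almost_affine C a b x).
Let c := Num.sqrt (4 * C).
Let c0 : 0 <= c. Proof. exact: sqrtr_ge0. Qed.
Let cE : c ^+ 2 = 4 * C. Proof. by rewrite sqr_sqrtr// mulr_ge0. Qed.

Lemma quot_quarter s u t : a <= s -> s < u -> u <= t -> t <= b -> t - s <= 4 * (u - s) ->
  `|quot x s u - quot x s t| <= c * Num.sqrt (t - s).
Proof.
move=> as_ su; rewrite le_eqVlt => /predU1P[->|ut] tb H.
  by rewrite subrr normr0 mulr_ge0 ?sqrtr_ge0.
have us0 : 0 < u - s by lra.
have ts0 : 0 < t - s by lra.
apply: sqr_le_sqrt => //; last exact: ltW.
have E : quot x s u - quot x s t =
    ((u - s) * (t - s))^-1 *: ((t - u) *: (x u - x s) - (u - s) *: (x t - x u)).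
  apply/rowP => j; rewrite !mxE; field; rewrite !gt_eqF//.
rewrite E normrZ exprMn normfV ger0_norm ?mulr_ge0 ?(ltW us0) ?(ltW ts0)//.
rewrite exprVn ler_pdivrMl ?exprn_gt0 ?mulr_gt0//.
apply: le_trans (aff as_ su ut tb) _; rewrite cE.
have h1 : 0 <= (u - s) * (t - s) ^+ 3 * C by rewrite !mulr_ge0 ?exprn_ge0 ?(ltW us0) ?(ltW ts0).
have h2 : 0 <= 4 * (u - s) - (t - u) by lra.
by have := mulr_ge0 h1 h2; lra.
Qed.

(** The length of the interval is reduced by factors of 4. Each step costs [c] times the square root
    of the length, which halves from one scale to the next, and the geometric series gives the
    factor 2. *)
Lemma quot_le s u t : a <= s -> s < u -> u <= t -> t <= b ->
  `|quot x s u - quot x s t| <= 2 * c * Num.sqrt (t - s).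
Proof.
move=> as_ su; have [k Hk] : exists k : nat, t - s <= 4 ^+ k * (u - s).
  have us0 : 0 < u - s by lra.
  have [k Hk] : exists k : nat, (t - s) / (u - s) <= k%:R.
    exists (Num.truncn `|(t - s) / (u - s)|).+1; apply: le_trans (ler_norm _) _.
    by apply: ltW; exact: truncnS_gt.
  exists k; rewrite -ler_pdivrMr//; apply: le_trans Hk _.
  by rewrite -natrX ler_nat ltnW// ltn_expl.
elim: k t Hk => [|k IH] t Hk ut tb.
  have -> : t = u by move: Hk; rewrite expr0 mul1r; lra.
  by rewrite subrr normr0 !mulr_ge0 ?sqrtr_ge0.
pose t' := s + (t - s) / 4.
have [ut'|t'u] := leP u t'; last first.
  have H : t - s <= 4 * (u - s) by move: t'u; rewrite /t'; lra.
  apply: le_trans (quot_quarter as_ su ut tb H) _.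
  by rewrite ler_wpM2r ?sqrtr_ge0//; move: c0; lra.
have t'b : t' <= b by rewrite /t'; move: su ut tb; lra.
have H1 : t' - s <= 4 ^+ k * (u - s) by move: Hk; rewrite /t' exprS; lra.
have h1 := IH t' H1 ut' t'b.
have st' : s < t' by rewrite /t'; lra.
have t't : t' <= t by rewrite /t'; lra.
have H2 : t - s <= 4 * (t' - s) by rewrite /t'; lra.
have h2 := quot_quarter as_ st' t't tb H2.
have E : Num.sqrt (t' - s) = Num.sqrt (t - s) / 2.
  have -> : t' - s = (t - s) * (2^-1) ^+ 2 by rewrite /t'; field.
  by rewrite sqrtrM ?sqrtr_sqr ?ger0_norm//; lra.
rewrite E in h1.
rewrite -(subrK (quot x s t') (quot x s u)) -addrA.
by apply: le_trans (ler_normD _ _) _; move: h1 h2; lra.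
Qed.

Lemma quot_mid s u t : a <= s -> s < u -> u < t -> t <= b -> u - s = t - u ->
  `|quot x s u - quot x u t| <= c * Num.sqrt (t - s).
Proof.
move=> as_ su ut tb H.
have us0 : 0 < u - s by lra.
have tu0 : 0 < t - u by lra.
have ts0 : 0 < t - s by lra.
apply: sqr_le_sqrt => //; last exact: ltW.
have E : quot x s u - quot x u t =
    ((u - s) * (t - u))^-1 *: ((t - u) *: (x u - x s) - (u - s) *: (x t - x u)).
  apply/rowP => j; rewrite !mxE; field; rewrite !gt_eqF//.
rewrite E normrZ exprMn normfV ger0_norm ?mulr_ge0 ?(ltW us0) ?(ltW tu0)//.
rewrite exprVn ler_pdivrMl ?exprn_gt0 ?mulr_gt0//.
apply: le_trans (aff as_ su ut tb) _; rewrite cE.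
have -> : t - s = 2 * (t - u) by lra.
rewrite H le_eqVlt; apply/orP; left; apply/eqP; ring.
Qed.

(** The quotients over the intervals from [s] to [uk k] are bounded by [quot_le], so they have an
    ultralimit; the same lemma then extends the estimate to every [u]. *)
Lemma right_derivative s : a <= s -> s < b -> exists D, forall u, s < u -> u <= b ->
  `|quot x s u - D| <= 2 * c * Num.sqrt (u - s).
Proof.
move=> as_ sb; have [V VU VN] := ultra_nat.
have bs0 : 0 < b - s by lra.
pose uk (k : nat) := s + (b - s) / k.+1%:R.
have uk1 k : s < uk k by rewrite /uk ltrDl divr_gt0.
have uk2 k : uk k <= b.
  rewrite /uk -lerBrDl ler_pdivrMr// ler_peMr ?(ltW bs0)//.
  by rewrite ler1n.
pose B := 2 * c * Num.sqrt (b - s) + `|quot x s b|.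
have [|D HD] := @ultra_bounded R n V (fun k => quot x s (uk k)) B VU.
  apply: filterS (VN 0%N) => k _ /=.
  rewrite -(subrK (quot x s b) (quot x s (uk k))).
  by apply: le_trans (ler_normD _ _) _; rewrite lerD2r quot_le.
exists D => u su ub; apply/ler_addgt0Pr => e e0.
have ue : 0 < (u - s) / (b - s) by rewrite divr_gt0//; lra.
have [N HN] := inv_nat_small ue.
have [k [/= h1 h2]] := ultra_ex2 VU (HD e e0) (VN N).
have uku : uk k <= u.
  have := HN k h2; rewrite ler_pdivlMr// => h3.
  by rewrite /uk -lerBrDl mulrC.
have h4 := quot_le as_ (uk1 k) uku ub.
rewrite -(subrK (quot x s (uk k)) (quot x s u)) -addrA.
apply: le_trans (ler_normD _ _) _; rewrite distrC.
by move: h1 h4; lra.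
Qed.

End Fixed.

Lemma almost_affine_rev C a b x : almost_affine C a b x ->
  almost_affine C (- b) (- a) (fun t => x (- t)).
Proof.
move=> H s u t bs su ut ta.
have := H (- t) (- u) (- s); rewrite lerNr => /(_ ta).
rewrite !ltrN2 lerNl => /(_ ut su bs).
have -> : - s - - u = u - s by ring.
have -> : - u - - t = t - u by ring.
have -> : - s - - t = t - s by ring.
have -> : (u - s) *: (x (- u) - x (- t)) - (t - u) *: (x (- s) - x (- u)) =
   (t - u) *: (x (- u) - x (- s)) - (u - s) *: (x (- t) - x (- u)).
  by apply/rowP => j; rewrite !mxE; ring.
by rewrite [(t - u) * (u - s)]mulrC.
Qed.

Lemma left_derivative C a b x s : 0 <= C -> almost_affine C a b x -> a < s -> s <= b ->
  exists D, forall u, a <= u -> u < s ->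
  `|quot x u s - D| <= 2 * Num.sqrt (4 * C) * Num.sqrt (s - u).
Proof.
move=> C0 /almost_affine_rev aff as_ sb.
have [||D HD] := right_derivative C0 aff (s := - s); rewrite ?lerN2 ?ltrN2//.
exists (- D) => u au us.
have := HD (- u); rewrite ltrN2 lerN2 => /(_ us au).
rewrite /quot !opprK (addrC (- u)).
have E : x u - x s = - (x s - x u) by rewrite opprB.
by rewrite E scalerN -opprD normrN.
Qed.

(** The two one-sided derivatives agree because quotients over adjacent intervals of equal length
    are close, by [quot_mid]. The derivative is continuous because the quotient over the interval
    between [u] and [s] approximates it at both ends. *)
Lemma almost_affine_derive C a b x : 0 <= C -> almost_affine C a b x -> a < b ->
  exists D : R -> 'rV[R]_n, forall s, a < s < b ->
    is_derive s 1 x (D s) /\ {for s, continuous D}.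
Proof.
move=> C0 aff ab; pose c := Num.sqrt (4 * C).
have c0 : 0 <= c by exact: sqrtr_ge0.
have HD s : exists D, a < s < b -> (forall u, s < u -> u <= b ->
   `|quot x s u - D| <= 2 * c * Num.sqrt (u - s)) /\
   (forall u, a <= u -> u < s -> `|quot x u s - D| <= 2 * c * Num.sqrt (s - u)).
  have [/andP[as_ sb]|ns] := pselect (a < s < b); last by exists 0.
  have [D1 H1] := right_derivative C0 aff (ltW as_) sb.
  have [D2 H2] := left_derivative C0 aff as_ (ltW sb).
  suff E : D1 = D2 by exists D1 => _; split=> //; rewrite E.
  apply/eqP; rewrite -subr_eq0 -normr_eq0 eq_le normr_ge0 andbT.
  apply/ler_addgt0Pr => e e0; rewrite add0r.
  (* Both one-sided quotients and their comparison contribute [2 * c * q] each; the comparison is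
     over an interval of length [2 * h], and [Num.sqrt (2 * h) <= 2 * q]. *)
  pose q := e / (6 * (c + 1)).
  have c1 : 0 < c + 1 by alra.
  have q0 : 0 < q by rewrite divr_gt0// mulr_gt0.
  pose h := Num.min (q ^+ 2) (Num.min (s - a) (b - s)).
  have h0 : 0 < h by rewrite !lt_min exprn_gt0// !subr_gt0 as_ sb.
  have hq : h <= q ^+ 2 by rewrite ge_min lexx.
  have hsa : h <= s - a by rewrite !ge_min lexx/= orbT.
  have hbs : h <= b - s by rewrite !ge_min lexx/= !orbT.
  have shs : s < s + h by rewrite ltrDl.
  have shb : s + h <= b by alra.
  have ash : a <= s - h by alra.
  have ssh : s - h < s by alra.
  have h1 := H1 (s + h) shs shb; have h2 := H2 (s - h) ash ssh.
  have mid : s - (s - h) = s + h - s by ring.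
  have h3 := quot_mid C0 aff ash ssh shs shb mid.
  have sq1 : Num.sqrt h <= q.
    by rewrite -[q]ger0_norm ?(ltW q0)// -sqrtr_sqr ler_wsqrtr.
  have sq2 : Num.sqrt (2 * h) <= 2 * q.
    have q2 : 0 <= 2 * q by rewrite mulr_ge0// ltW.
    rewrite -(ger0_norm q2) -sqrtr_sqr ler_wsqrtr// exprMn.
    have qq : 0 <= q ^+ 2 by rewrite exprn_ge0// ltW.
    by move: hq qq; alra.
  have e1 : s + h - s = h by ring.
  have e2 : s - (s - h) = h by ring.
  have e3 : s + h - (s - h) = 2 * h by ring.
  rewrite e1 in h1; rewrite e2 in h2; rewrite e3 -/c in h3.
  have cq : 6 * c * q <= e.
    have E : q * (6 * (c + 1)) = e by rewrite /q divfK// gt_eqF// mulr_gt0.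
    by move: E q0; alra.
  have k1 := ler_wpM2l c0 sq1; have k2 := ler_wpM2l c0 sq2.
  have -> : D1 - D2 = - (quot x s (s + h) - D1) + (quot x (s - h) s - D2)
       - (quot x (s - h) s - quot x s (s + h)).
    by apply/rowP => j; rewrite !mxE; ring.
  apply: le_trans (ler_normB _ _) _; apply: le_trans (lerD (ler_normD _ _) (lexx _)) _.
  rewrite normrN; move: h1 h2 h3 k1 k2 cq; rewrite -/c; alra.
pose D s := projT1 (cid (HD s)).
have HD' s : a < s < b -> (forall u, s < u -> u <= b ->
   `|quot x s u - D s| <= 2 * c * Num.sqrt (u - s)) /\
   (forall u, a <= u -> u < s -> `|quot x u s - D s| <= 2 * c * Num.sqrt (s - u)).
  by rewrite /D; case: cid.
have small (e K : R) : 0 < e -> 0 <= K -> exists2 d : R, 0 < d & forall h, 0 <= h -> h < d -> K * Num.sqrt h <= e.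
  move=> e0 K0; have K1 : 0 < K + 1 by alra.
  exists ((e / (K + 1)) ^+ 2); first by rewrite exprn_gt0// divr_gt0.
  move=> h h0 hd.
  have : Num.sqrt h <= e / (K + 1).
    have eK : 0 <= e / (K + 1) by rewrite divr_ge0// ltW.
    by rewrite -(ger0_norm eK) -sqrtr_sqr ler_wsqrtr// ltW.
  by rewrite ler_pdivlMr//; have := sqrtr_ge0 h; alra.
exists D => s sab; have [as_ sb] := andP sab.
have [Hr Hl] := HD' s sab.
split.
  apply: eps_is_derive => e e0.
  have [|d d0 Hd] := small e (2 * c) e0; first by rewrite mulr_ge0.
  exists (Num.min d (Num.min (s - a) (b - s))); first by rewrite !lt_min d0 !subr_gt0 as_ sb.
  move=> u; rewrite !lt_min => /and3P[ud usa ubs].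
  have [us|su|->] := ltgtP u s.
  - have E : x u - x s - (u - s) *: D s = (u - s) *: (quot x u s - D s).
      rewrite /quot scalerBr scalerA; have -> : (u - s) * (s - u)^-1 = -1.
        by rewrite -opprB mulNr divff// subr_eq0 gt_eqF.
      by rewrite scaleN1r opprB.
    rewrite E normrZ mulrC ler_wpM2r//.
    have au : a <= u by move: usa; rewrite ltr0_norm ?subr_lt0//; alra.
    apply: le_trans (Hl u au us) _; apply: Hd; first by alra.
    by move: ud; rewrite ltr0_norm ?subr_lt0//; alra.
  - have E : x u - x s - (u - s) *: D s = (u - s) *: (quot x s u - D s).
      rewrite /quot scalerBr scalerA divff ?scale1r// subr_eq0 gt_eqF//.
    rewrite E normrZ mulrC ler_wpM2r//.
    have ub : u <= b by move: ubs; rewrite gtr0_norm ?subr_gt0//; alra.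
    apply: le_trans (Hr u su ub) _; apply: Hd; first by alra.
    by move: ud; rewrite gtr0_norm ?subr_gt0//; alra.
  - by rewrite !subrr scale0r subr0 normr0 mulr_ge0// ltW.
apply/continuous_normP => e e0.
have e20 : 0 < e / 2 by rewrite divr_gt0.
have [|d d0 Hd] := small (e / 2) (4 * c) e20; first by rewrite mulr_ge0.
exists (Num.min d (Num.min (s - a) (b - s))); first by rewrite !lt_min d0 !subr_gt0 as_ sb.
move=> u; rewrite !lt_min => /and3P[ud usa ubs].
apply: (@le_lt_trans _ _ (e / 2)); last by alra.
have uab : a < u < b.
  move: usa ubs; rewrite !ltr_norml => /andP[? ?] /andP[? ?]; apply/andP; split; alra.
have [Hru Hlu] := HD' u uab.
have [us|su|->] := ltgtP u s; last by rewrite subrr normr0 ltW.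
- have au : a <= u by case/andP: uab => /ltW.
  have h1 := Hru s us (ltW sb); have h2 := Hl u au us.
  have h3 : 4 * c * Num.sqrt (s - u) <= e / 2.
    by apply: Hd; [alra|move: ud; rewrite ltr0_norm ?subr_lt0//; alra].
  have -> : D u - D s = - (quot x u s - D u) + (quot x u s - D s).
    by apply/rowP => j; rewrite !mxE; ring.
  apply: le_trans (ler_normD _ _) _; rewrite normrN; move: h1 h2 h3; alra.
- have ub : u <= b by case/andP: uab => _ /ltW.
  have h1 := Hr u su ub; have h2 := Hlu s (ltW as_) su.
  have h3 : 4 * c * Num.sqrt (u - s) <= e / 2.
    by apply: Hd; [alra|move: ud; rewrite gtr0_norm ?subr_gt0//; alra].
  have -> : D u - D s = - (quot x s u - D u) + (quot x s u - D s).
    by apply/rowP => j; rewrite !mxE; ring.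
  apply: le_trans (ler_normD _ _) _; rewrite normrN; move: h1 h2 h3; alra.
Qed.

End HolderDerivative.

Lemma small2 {R : realType} (a b : R) : 0 < a -> 0 < b -> exists q, [/\ 0 < q, q <= a & q <= b].
Proof.
by move=> a0 b0; exists (Num.min a b); rewrite lt_min a0 b0 !ge_min !lexx/= orbT.
Qed.

Lemma small4 {R : realType} (a b c d : R) : 0 < a -> 0 < b -> 0 < c -> 0 < d ->
  exists q, [/\ 0 < q, q <= a, q <= b, q <= c & q <= d].
Proof.
move=> a0 b0 c0 d0; have [p [p0 pa pb]] := small2 a0 b0; have [q [q0 qc qd]] := small2 c0 d0.
have [r [r0 rp rq]] := small2 p0 q0; exists r.
by split=> //; [exact: le_trans pa|exact: le_trans pb|exact: le_trans qc|exact: le_trans qd].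
Qed.

Lemma itv_of_dist {R : realType} (a b t0 h t : R) : h <= (t0 - a) / 2 -> h <= (b - t0) / 2 -> 0 < h ->
  `|t - t0| <= h -> a < t < b.
Proof. by move=> ha hb h0; rewrite ler_norml => /andP[? ?]; apply/andP; split; alra. Qed.

(** * Minimizers are C^1 in charts *)

Section MinimizerRegularity.
Context {R : realType} {n : nat} {M : topologicalType}.
Context {A : smooth_manifold R n M}.
Context (g : riemannian_metric A).
Local Notation dist := (dist g).
Local Notation Nrm i x := (gnorm (gmx g i x)).
Implicit Types (i : chart_index A) (γ : R -> M).

(** Stewart's identity in vector form. If the norms of [X1], [X2] and [X1 + X2] were exactly
    proportional to [α], [β] and [α + β], the right side would vanish; near equality in the triangle
    inequality therefore bounds the left side. *)
Lemma gnorm_combination (G : 'M[R]_n) (X1 X2 : 'rV[R]_n) (α β : R) : metric_mx G ->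
  gnorm G (β *: X1 - α *: X2) ^+ 2 =
    β * (α + β) * gnorm G X1 ^+ 2 + α * (α + β) * gnorm G X2 ^+ 2 - α * β * gnorm G (X1 + X2) ^+ 2.
Proof.
move=> mG; rewrite !gnorm_sqr// -scaleN1r scalerA !(bilinDl, bilinDr, bilinZl, bilinZr) (bilinC X2 X1 mG.1).
by ring.
Qed.

Lemma sq_bounds (e m N : R) : 0 <= e -> e <= 1 -> 0 <= m -> 0 <= N ->
  m <= (1 + e) * N -> N <= (1 + e) * m -> `|N ^+ 2 - m ^+ 2| <= 3 * e * m ^+ 2.
Proof.
move=> e0 e1 m0 N0 mN Nm.
have mm : 0 <= m ^+ 2 by rewrite exprn_ge0.
have em : 0 <= e * m ^+ 2 by rewrite mulr_ge0.
have eem : 0 <= e * m ^+ 2 * (1 - e) by rewrite mulr_ge0//; alra.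
have h1 : N ^+ 2 <= ((1 + e) * m) ^+ 2 by rewrite lerXn2r ?nnegrE ?mulr_ge0//; alra.
have eN : (1 - e) * m <= N.
  have : (1 - e) * m <= (1 - e) * ((1 + e) * N) by rewrite ler_wpM2l//; alra.
  move/le_trans; apply; have eeN : 0 <= e ^+ 2 * N by rewrite mulr_ge0// exprn_ge0.
  by alra.
have h2 : ((1 - e) * m) ^+ 2 <= N ^+ 2 by rewrite lerXn2r ?nnegrE ?mulr_ge0//; alra.
have eem2 : 0 <= e ^+ 2 * m ^+ 2 by rewrite mulr_ge0// exprn_ge0.
rewrite ler_norml; apply/andP; split; [move: h2|move: h1]; rewrite exprMn; alra.
Qed.

Lemma minimizer_chart i x0 (κ0 : R) : chart_img i x0 -> 0 <= κ0 -> exists r C d : R,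
  [/\ 0 < r, 0 <= C, 0 < d & forall γ a b κ, a <= b -> b - a < d -> 0 <= κ -> κ <= κ0 ->
    minimizer g κ a b γ -> chart_dom i (γ a) -> `|chart_map i (γ a) - x0| < r ->
    (forall t, a <= t <= b -> chart_dom i (γ t) /\ `|chart_map i (γ t) - x0| < 2 * r) /\
    almost_affine C a b (chart_map i \o γ)].
Proof.
move=> Ix0 κ00; have [r1 [l [L [K [k [[r10 l0 L0 K0 k0] bnd up low near]]]]]] := local_metric g Ix0.
(* A stretch of duration [τ] at speed at most [κ0] then stays within chart distance [c1 * τ]; the
   added 1 makes the inequality strict, as the last clause of [local_metric] demands. *)
have [c1 c10 kc] : exists2 c1 : R, 0 < c1 & k * c1 = κ0 + 1.
  by exists ((κ0 + 1) / k); [rewrite divr_gt0//; alra|field; rewrite gt_eqF].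
pose d := Num.min (r1 / (2 * c1)) (1 / (K * c1)).
have d0 : 0 < d by rewrite lt_min !divr_gt0// mulr_gt0.
have dr : c1 * d <= r1 / 2.
  have : d <= r1 / (2 * c1) by rewrite ge_min lexx.
  by rewrite ler_pdivlMr ?mulr_gt0//; alra.
have dK : K * c1 * d <= 1.
  have : d <= 1 / (K * c1) by rewrite ge_min lexx orbT.
  by rewrite ler_pdivlMr ?mulr_gt0//; alra.
pose C := 6 * K * c1 * κ0 ^+ 2 / l ^+ 2.
have C0 : 0 <= C by rewrite divr_ge0 ?exprn_ge0 ?(ltW l0)// !mulr_ge0 ?exprn_ge0// ltW.
exists (r1 / 2), C, d; split=> //; first by rewrite divr_gt0.
move=> γ a b κ ab bad κ_0 κκ0 mγ Da xa.
have c1d : 0 < c1 * d by rewrite mulr_gt0.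
have inball t : a <= t <= b -> chart_dom i (γ t) /\ `|chart_map i (γ t) - x0| < r1.
  move=> /andP[at_ tb].
  have xa1 : `|chart_map i (γ a) - x0| < r1 by move: xa r10; glra.
  have [|||Dt xt] := near (chart_map i (γ a)) (γ t) (c1 * d) (κ * (t - a)) xa1 c1d.
  - by move: dr r10; glra.
  - rewrite chart_mapK// mγ; [|by rewrite lexx|by rewrite at_].
    by rewrite distrC ger0_norm// subr_ge0.
  - have h1 : κ * (t - a) <= κ0 * (t - a) by rewrite ler_wpM2r// subr_ge0.
    have h2 : κ0 * (t - a) <= κ0 * d by rewrite ler_wpM2l//; alra.
    by rewrite mulrA kc; move: d0 h1 h2; glra.
  split=> //; have -> : chart_map i (γ t) - x0 = (chart_map i (γ t) - chart_map i (γ a)) + (chart_map i (γ a) - x0).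
    by rewrite addrA subrK.
  by apply: le_lt_trans (ler_normD _ _) _; move: xt xa dr; glra.
split.
  by move=> t /inball[Dt xt]; split=> //; move: xt; glra.
move=> s u t as_ su ut tb.
have Is : a <= s <= b by apply/andP; split; move: as_ su ut tb; glra.
have Iu : a <= u <= b by apply/andP; split; move: as_ su ut tb; glra.
have It : a <= t <= b by apply/andP; split; move: as_ su ut tb; glra.
have [Ds xs] := inball s Is; have [Du xu] := inball u Iu; have [Dt xt] := inball t It.
pose τ := t - s; have τ0 : 0 < τ by rewrite /τ; move: su ut; glra.
pose ρ := c1 * τ; have ρ0 : 0 < ρ by rewrite mulr_gt0.
have ρd : ρ < c1 * d by rewrite ltr_pM2l// /τ; move: as_ tb bad; glra.
have ρr : ρ < r1 by move: ρd dr r10; glra.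
have close v : s <= v -> v <= t -> a <= v <= b -> `|chart_map i (γ v) - chart_map i (γ s)| < ρ.
  move=> sv vt Iv.
  have dsv : (dist (chart_inv i (chart_map i (γ s))) (γ v) <= (κ * (v - s))%:E)%E.
    by rewrite chart_mapK// mγ// distrC ger0_norm// subr_ge0.
  have lt1 : κ * (v - s) < k * ρ.
    have h1 : κ * (v - s) <= κ0 * (v - s) by rewrite ler_wpM2r// subr_ge0.
    have h2 : κ0 * (v - s) <= κ0 * τ by rewrite ler_wpM2l// /τ; move: vt; glra.
    by rewrite /ρ mulrA kc; move: τ0 h1 h2; glra.
  by have [] := near _ _ _ _ xs ρ0 ρr dsv lt1.
have cs : `|chart_map i (γ s) - chart_map i (γ s)| < ρ by rewrite subrr normr0.
have cu := close u (ltW su) (ltW ut) Iu.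
have ct := close t (ltW (lt_trans su ut)) (lexx t) It.
set z := chart_map i (γ s) in xs cs cu ct *.
pose e := K * ρ.
have e0 : 0 <= e by rewrite mulr_ge0// ltW.
have e1 : e <= 1.
  have : e <= K * (c1 * d) by rewrite ler_wpM2l ?(ltW K0)// ltW.
  by move: dK; glra.
have est p q x y : a <= p <= b -> a <= q <= b -> p <= q -> x = chart_map i (γ p) -> y = chart_map i (γ q) ->
    chart_dom i (γ p) -> chart_dom i (γ q) -> `|x - z| < ρ -> `|y - z| < ρ ->
    `|Nrm i z (y - x) ^+ 2 - (κ * (q - p)) ^+ 2| <= 3 * e * (κ * (q - p)) ^+ 2.
  move=> Ip Iq pq xE yE Dp Dq xz yz.
  have dE : dist (chart_inv i x) (chart_inv i y) = (κ * (q - p))%:E.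
    by rewrite xE yE !chart_mapK// mγ// distrC ger0_norm// subr_ge0.
  apply: sq_bounds => //.
  - by rewrite mulr_ge0// subr_ge0.
  - exact: gnorm_ge0.
  - by have := up z x y ρ xs ρ0 ρr xz yz; rewrite dE lee_fin.
  - by apply: (low z x y ρ _ xs ρ0 ρr xz yz); rewrite dE.
pose X1 := chart_map i (γ u) - z; pose X2 := chart_map i (γ t) - chart_map i (γ u).
have E1 := est s u z (chart_map i (γ u)) Is Iu (ltW su) erefl erefl Ds Du cs cu.
have E2 := est u t (chart_map i (γ u)) (chart_map i (γ t)) Iu It (ltW ut) erefl erefl Du Dt cu ct.
have E3 := est s t z (chart_map i (γ t)) Is It (ltW (lt_trans su ut)) erefl erefl Ds Dt cs ct.
have X3 : chart_map i (γ t) - z = X1 + X2 by rewrite /X1 /X2 [RHS]addrC addrA subrK.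
rewrite X3 in E3; rewrite -/X1 in E1; rewrite -/X2 in E2.
have zI : metric_mx (gmx g i z) by apply: gmx_metric; exact: (bnd z xs).1.
set Y := (t - u) *: _ - _.
have -> : Y = (t - u) *: X1 - (u - s) *: X2 by [].
have [α αE] : exists α, α = u - s by exists (u - s).
have [β βE] : exists β, β = t - u by exists (t - u).
rewrite -αE -βE.
have α0 : 0 < α by rewrite αE; move: su; glra.
have β0 : 0 < β by rewrite βE; move: ut; glra.
have τE : t - s = α + β by rewrite αE βE; ring.
have id4 := gnorm_combination X1 X2 α β zI.
have lowN := (bnd z xs).2 (β *: X1 - α *: X2).
have lN : l ^+ 2 * `|β *: X1 - α *: X2| ^+ 2 <= Nrm i z (β *: X1 - α *: X2) ^+ 2.
  by rewrite -exprMn lerXn2r ?nnegrE ?mulr_ge0 ?gnorm_ge0 ?(ltW l0)//; exact: lowN.1.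
have main : Nrm i z (β *: X1 - α *: X2) ^+ 2 <= 6 * e * κ ^+ 2 * (α * β * (α + β) ^+ 2).
  rewrite id4; rewrite -αE in E1; rewrite -βE in E2; rewrite τE in E3.
  move: E1 E2 E3; rewrite !ler_norml => /andP[_ E1] /andP[_ E2] /andP[E3 _].
  have αβ : 0 <= α * β by rewrite mulr_ge0 ?ltW.
  have c1' : 0 <= β * (α + β) by rewrite !(mulr_ge0, addr_ge0)// ltW.
  have c2' : 0 <= α * (α + β) by rewrite !(mulr_ge0, addr_ge0)// ltW.
  have F1 := ler_wpM2l c1' E1; have F2 := ler_wpM2l c2' E2; have F3 := ler_wpM2l αβ E3.
  by move: F1 F2 F3; glra.
have l20 : 0 < l ^+ 2 by rewrite exprn_gt0.
rewrite -(ler_pM2l l20).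
apply: le_trans lN _; apply: le_trans main _.
rewrite τE /C.
have -> : l ^+ 2 * (6 * K * c1 * κ0 ^+ 2 / l ^+ 2 * (α * β * (α + β) ^+ 3)) =
   6 * (K * c1 * (α + β)) * κ0 ^+ 2 * (α * β * (α + β) ^+ 2).
  by field; rewrite gt_eqF.
have -> : e = K * c1 * (α + β) by rewrite /e /ρ /τ τE mulrA.
apply: ler_wpM2r; first by rewrite !mulr_ge0 ?exprn_ge0 ?addr_ge0 ?ltW.
apply: ler_wpM2l; first by rewrite !mulr_ge0 ?addr_ge0 ?ltW.
by rewrite lerXn2r.
Qed.

Lemma minimizer_C1 (κ a b : R) γ i t0 : 0 <= κ -> minimizer g κ a b γ -> a < t0 < b -> chart_dom i (γ t0) ->
  exists2 h : R, 0 < h & forall t : R, `|t - t0| < h ->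
    [/\ a < t < b, chart_dom i (γ t),
        is_derive t 1 (chart_map i \o γ) ('D_1 (chart_map i \o γ) t),
        {for t, continuous (fun s => 'D_1 (chart_map i \o γ) s)} &
        Nrm i (chart_map i (γ t)) ('D_1 (chart_map i \o γ) t) = κ].
Proof.
move=> κ0 mγ /andP[at0 t0b] Dt0.
set x := chart_map i \o γ; pose x0 := x t0.
have Ix0 : chart_img i x0 by exact: chart_img_in.
have [r [C [d [r0 C0 d0 H]]]] := minimizer_chart Ix0 κ0.
have [r1 [l [L [K [k [[r10 l0 L0 K0 k0] bnd up low near]]]]]] := local_metric g Ix0.
pose r2 := Num.min r (r1 / 2).
have r20 : 0 < r2 by rewrite lt_min r0 divr_gt0.
have [d1 d10 Hd1] := chart_near g Dt0 r20.
have κ1 : 0 < κ + 1 by alra.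
have [d30 d10' ta0 bt0] : [/\ 0 < d / 3, 0 < d1 / (κ + 1), 0 < (t0 - a) / 2 & 0 < (b - t0) / 2].
  by rewrite !divr_gt0// subr_gt0.
have [h [h0 hd hd1 ha hb]] := small4 d30 d10' ta0 bt0.
have htab t : `|t - t0| <= h -> a < t < b by exact: itv_of_dist.
have htab' t : `|t - t0| <= h -> a <= t <= b by move=> /htab/andP[/ltW-> /ltW->].
have t0h : `|t0 - t0| <= h by rewrite subrr normr0 ltW.
have inr t : `|t - t0| <= h -> chart_dom i (γ t) /\ `|x t - x0| < r2.
  move=> th; apply: Hd1; rewrite mγ.
  - rewrite lee_fin distrC.
    have : κ * `|t - t0| <= κ * h by rewrite ler_wpM2l.
    by move: hd1; rewrite ler_pdivlMr// => e1 e2; move: h0 e1 e2; glra.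
  - exact: htab'.
  - exact: htab'.
have msub : minimizer g κ (t0 - h) (t0 + h) γ.
  move=> s t hs ht; apply: mγ; apply: htab'; rewrite ler_distl; first exact: hs.
  exact: ht.
have [|Da xa] := inr (t0 - h); first by rewrite addrAC subrr add0r normrN ger0_norm// ltW.
have xar : `|chart_map i (γ (t0 - h)) - x0| < r by apply: lt_le_trans xa _; rewrite ge_min lexx.
have hh3 : t0 - h < t0 + h by move: h0; glra.
have hh1 := ltW hh3.
have hh2 : t0 + h - (t0 - h) < d by move: h0 hd d0; glra.
have [_ aff] := H γ (t0 - h) (t0 + h) κ hh1 hh2 κ0 (lexx κ) msub Da xar.
have [D HD] := almost_affine_derive C0 aff hh3.
have DE t : `|t - t0| < h -> is_derive t 1 x (D t) /\ {for t, continuous D}.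
  by rewrite ltr_norml => /andP[h1 h2]; apply: HD; apply/andP; split; [move: h1|move: h2]; glra.
have DE' t : `|t - t0| < h -> 'D_1 x t = D t by move=> /DE[[_ ->]].
exists h; first exact: h0.
move=> t th; have [dx cD] := DE t th.
have [Dt xt] := inr t (ltW th).
split.
- exact/htab/ltW.
- exact: Dt.
- by rewrite DE'.
- apply: near_eq_continuous cD.
  apply/nbhs_ballP; exists (h - `|t - t0|); first by rewrite /= subr_gt0.
  move=> s; rewrite -ball_normE/= => ts; rewrite DE'//.
  have -> : s - t0 = - (t - s) + (t - t0) by ring.
  by apply: le_lt_trans (ler_normD _ _) _; rewrite normrN -ltrBrDr.
rewrite DE'//; set z := chart_map i (γ t).
have zr : `|z - x0| < r1.
  by apply: lt_le_trans xt _; rewrite ge_min; apply/orP; right; move: r10; glra.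
have mz : metric_mx (gmx g i z) by apply: gmx_metric; exact: (bnd z zr).1.
have [c1 c10 kc] : exists2 c1 : R, 0 < c1 & k * c1 = κ + 1.
  by exists ((κ + 1) / k); [rewrite divr_gt0|field; rewrite gt_eqF].
apply/eqP; rewrite -subr_eq0 -normr_eq0 eq_le normr_ge0 andbT.
apply/ler_addgt0Pr => e e0; rewrite add0r.
have e2 : 0 < e / (2 * L) by rewrite divr_gt0// mulr_gt0.
have [d2 d20 Hd2] := is_derive_eps dx e2.
have Kc : 0 < K * c1 by rewrite mulr_gt0.
have [a1 a2 a3 a4] : [/\ 0 < d2 / 2, 0 < (h - `|t - t0|) / 2, 0 < r1 / (2 * c1) & 0 < 1 / (K * c1)].
  by rewrite !divr_gt0// ?subr_gt0// mulr_gt0.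
have a5 : 0 < e / (4 * K * c1 * (κ + 1)) by rewrite divr_gt0// !mulr_gt0.
have [q' [q'0 q1' q2' q3' q4']] := small4 a1 a2 a3 a4.
have [q [q0 qq' q5]] := small2 q'0 a5.
have q1 := le_trans qq' q1'; have q2 := le_trans qq' q2'.
have q3 : q * (2 * c1) <= r1 by rewrite -ler_pdivlMr ?mulr_gt0//; exact: le_trans qq' q3'.
have q4 : q * (K * c1) <= 1 by rewrite -ler_pdivlMr//; exact: le_trans qq' q4'.
rewrite ler_pdivlMr ?mulr_gt0// in q5.
clear q' q'0 q1' q2' q3' q4' qq' a1 a2 a3 a4 a5.
pose u := t + q.
have ut : u - t = q by rewrite /u; ring.
have uh : `|u - t0| <= h.
  have -> : u - t0 = (t - t0) + q by rewrite /u; ring.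
  by apply: le_trans (ler_normD _ _) _; rewrite (gtr0_norm q0); move: q2 q0 th; glra.
have [Du xu] := inr u uh.
pose ρ := c1 * q; have ρ0 : 0 < ρ by rewrite mulr_gt0.
have ρr : ρ < r1 by rewrite /ρ; move: q3 r10; glra.
have tab : a <= t <= b by exact/htab'/ltW.
have uab : a <= u <= b by exact: htab'.
have dE : dist (chart_inv i z) (γ u) = (κ * q)%:E.
  by rewrite /z chart_mapK// mγ// distrC ut gtr0_norm.
have uz : `|chart_map i (γ u) - z| < ρ.
  have dle : (dist (chart_inv i z) (γ u) <= (κ * q)%:E)%E by rewrite dE.
  have lt1 : κ * q < k * ρ by rewrite /ρ mulrA kc; move: q0; glra.
  by have [] := near _ _ _ _ zr ρ0 ρr dle lt1.
have zz : `|z - z| < ρ by rewrite subrr normr0.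
have dE' : dist (chart_inv i z) (chart_inv i (chart_map i (γ u))) = (κ * q)%:E by rewrite chart_mapK.
have B1 := up z z (chart_map i (γ u)) ρ zr ρ0 ρr zz uz.
rewrite dE' lee_fin in B1.
have B2 := low z z (chart_map i (γ u)) ρ (κ * q) zr ρ0 ρr zz uz.
rewrite dE' in B2; have {}B2 := B2 (lexx _).
set N := Nrm i z (chart_map i (γ u) - z) in B1 B2.
have N0 : 0 <= N by exact: gnorm_ge0.
have := Hd2 u; rewrite ut gtr0_norm// => /(_ _)/wrap[]; first by move: q1 q0; glra.
move=> B3.
have B4 := (bnd z zr).2 (x u - x t - q *: D t).
have B5 := gnormB_abs (chart_map i (γ u) - z) (q *: D t) mz.
rewrite gnormZ (gtr0_norm q0) -/N in B5.
have B6 : `|N - q * Nrm i z (D t)| <= e / 2 * q.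
  apply: le_trans B5 _; apply: le_trans B4.2 _.
  apply: le_trans (ler_wpM2l (ltW L0) B3) _.
  by rewrite le_eqVlt; apply/orP; left; apply/eqP; field; rewrite gt_eqF.
have Kρ : K * ρ <= 1 by rewrite /ρ; move: q4; glra.
have Kρ0 : 0 <= K * ρ by rewrite mulr_ge0 ?ltW.
have B7 : 2 * (K * ρ) * κ <= e / 2.
  have : 0 <= q * (4 * K * c1) by rewrite !mulr_ge0 ?ltW.
  by rewrite /ρ; move: q5; glra.
have κq : 0 <= κ * q by rewrite mulr_ge0// ltW.
have B8 : `|N - κ * q| <= e / 2 * q.
  have B7q := ler_wpM2r (ltW q0) B7.
  have f1 : K * ρ * N <= K * ρ * ((1 + K * ρ) * (κ * q)) by rewrite ler_wpM2l.
  have f2 : K * ρ * (K * ρ * (κ * q)) <= K * ρ * (1 * (κ * q)).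
    by rewrite ler_wpM2l// ler_wpM2r.
  have f3 : 0 <= K * ρ * (κ * q) by rewrite mulr_ge0.
  by rewrite ler_norml; apply/andP; split; move: B1 B2 f1 f2 f3 B7q; glra.
rewrite -(ler_pM2l q0).
have -> : q * `|Nrm i z (D t) - κ| = `|- (N - q * Nrm i z (D t)) + (N - κ * q)|.
  rewrite -[in LHS](gtr0_norm q0) -normrM; congr `|_|; ring.
apply: le_trans (ler_normD _ _) _; rewrite normrN; move: B6 B8; glra.
Qed.

End MinimizerRegularity.

Section DeriveForms.
Context {R : realType}.
Implicit Types (f h : R -> R) (t : R).

Lemma is_derive_add f h t a b : is_derive t 1 f a -> is_derive t 1 h b ->
  is_derive t 1 (fun s => f s + h s) (a + b).
Proof. by move=> df dh; exact: is_deriveD. Qed.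

Lemma is_derive_sub f h t a b : is_derive t 1 f a -> is_derive t 1 h b ->
  is_derive t 1 (fun s => f s - h s) (a - b).
Proof. by move=> df dh; exact: is_deriveB. Qed.

Lemma is_derive_mul f h t a b : is_derive t 1 f a -> is_derive t 1 h b ->
  is_derive t 1 (fun s => f s * h s) (f t * b + h t * a).
Proof. by move=> df dh; exact: is_deriveM. Qed.

Lemma is_derive_scale (k : R) f t a : is_derive t 1 f a -> is_derive t 1 (fun s => k * f s) (k * a).
Proof. by move=> df; exact: is_deriveZ. Qed.

Lemma is_derive_summ (I : Type) (r : seq I) (f : I -> R -> R) t (a : I -> R) :
  (forall i, is_derive t 1 (f i) (a i)) -> is_derive t 1 (fun s => \sum_(i <- r) f i s) (\sum_(i <- r) a i).
Proof.
move=> H; elim: r => [|i r IH].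
  have -> : (fun s => \sum_(i <- [::]) f i s) = (fun _ => 0) by apply/funext => s; rewrite big_nil.
  by rewrite big_nil; exact: is_derive_cst.
have -> : (fun s => \sum_(j <- i :: r) f j s) = (fun s => f i s + \sum_(j <- r) f j s).
  by apply/funext => s; rewrite big_cons.
by rewrite big_cons; exact: is_derive_add.
Qed.

Lemma is_derive_unique (V : normedModType R) (f : R -> V) t (a b : V) :
  is_derive t 1 f a -> is_derive t 1 f b -> a = b.
Proof. by move=> [_ <-] [_ <-]. Qed.

Lemma cont_bounded (f : R -> R) (a b : R) : a <= b ->
  (forall t, a <= t <= b -> {for t, continuous f}) ->
  exists2 B : R, 0 < B & forall t, a <= t <= b -> `|f t| <= B.
Proof.
move=> ab cf.
have [|c _ Hc] := @EVT_max R (fun t => `|f t|) a b ab.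
  apply: within_continuous_of => t /cf ct.
  by apply: (@continuous_comp _ _ _ f (fun x : R => `|x|)) => //; exact: norm_continuous.
exists (`|f c| + 1); first by rewrite ltr_wpDl.
by move=> t tab; have := Hc t; rewrite in_itv/= => /(_ tab) ?; alra.
Qed.

End DeriveForms.

Section MetricTaylor.
Context {R : realType} {n : nat} {M : topologicalType}.
Context {A : smooth_manifold R n M}.
Context (g : riemannian_metric A).
Local Notation dist := (dist g).
Local Notation Nrm i x := (gnorm (gmx g i x)).
Implicit Types (i : chart_index A) (γ : R -> M).

Definition dgmx i (k : 'I_n) (x : 'rV[R]_n) : 'M[R]_n :=
  \matrix_(p, q) partial (fun y => gmx g i y p q) k x.

Lemma ball_segment (V : normedModType R) (x0 x v : V) (r c τ : R) : Num.min 0 τ <= c <= Num.max 0 τ ->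
  `|x - x0| < r -> `|x + τ *: v - x0| < r -> `|x + c *: v - x0| < r.
Proof.
move=> cb xr yr; have [τ0|τ0] := eqVneq τ 0.
  have -> : c = 0 by move: cb; rewrite τ0 minxx maxxx => /andP[? ?]; apply/eqP; rewrite eq_le; apply/andP.
  by rewrite scale0r addr0.
pose θ := c / τ.
have θ01 : 0 <= θ <= 1.
  rewrite /θ; move: cb; rewrite minElt maxElt; case: (ltgtP 0 τ) τ0 => // τ0 _ /andP[h1 h2].
    by rewrite divr_ge0 ?(ltW τ0)//= ler_pdivrMr// mul1r.
  by rewrite -mulrNN -invrN divr_ge0 ?oppr_ge0 ?(ltW τ0)//= ler_pdivrMr ?oppr_gt0// mul1r lerN2.
have -> : x + c *: v - x0 = (1 - θ) *: (x - x0) + θ *: (x + τ *: v - x0).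
  have e (s : R) : x + s *: v - x0 = (x - x0) + s *: v by rewrite addrAC.
  by rewrite !e [θ *: (_ + _)]scalerDr addrA -scalerDl subrK scale1r scalerA /θ divfK.
have [h1 h2] := andP θ01.
have [->|θ1] := eqVneq θ 1; first by rewrite subrr scale0r add0r scale1r.
have h3 : 0 < 1 - θ by rewrite subr_gt0 lt_neqAle θ1.
apply: le_lt_trans (ler_normD _ _) _.
rewrite (_ : `|θ *: _| = θ * `|x + τ *: v - x0|); last by rewrite normrZ ger0_norm.
rewrite (_ : `|(1 - θ) *: _| = (1 - θ) * `|x - x0|); last by rewrite normrZ gtr0_norm.
have : (1 - θ) * `|x - x0| < (1 - θ) * r by rewrite ltr_pM2l.
have : θ * `|x + τ *: v - x0| <= θ * r by rewrite ler_wpM2l// ltW.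
alra.
Qed.

Lemma norm_delta_le (k : 'I_n) : `|delta_mx 0 k : 'rV[R]_n| <= 1.
Proof.
by apply/mx_norm_leP => // p q; rewrite !mxE; case: (_ && _); rewrite ?normr1 ?normr0.
Qed.

Lemma metric_taylor i x0 : chart_img i x0 -> exists r C : R, [/\ 0 < r, 0 < C,
  forall x, `|x - x0| < r -> chart_img i x /\ (forall p q, `|gmx g i x p q| <= C) &
  forall x τ k, `|x - x0| < r -> `|x + τ *: delta_mx 0 k - x0| < r ->
    (forall p q, `|gmx g i (x + τ *: delta_mx 0 k) p q - gmx g i x p q| <= C * `|τ|) /\
    (forall p q, `|gmx g i (x + τ *: delta_mx 0 k) p q - gmx g i x p q - τ * dgmx i k x p q| <= C * τ ^+ 2)].
Proof.
move=> Ix0; have oI := @chart_img_open' _ _ _ A i.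
have [r1 r10 Hr1] := open_ball_sub oI Ix0.
(* The inverse of the radius [d] doubles as the constant, so that shrinking [d] weakens all clauses
   and [common_radius] handles all entries together. *)
pose P (kpq : 'I_n * ('I_n * 'I_n)) (d : R) := let k := kpq.1 in let p := kpq.2.1 in let q := kpq.2.2 in
  forall x, `|x - x0| < d -> `|gmx g i x p q| <= d^-1 /\
   forall τ, `|x + τ *: delta_mx 0 k - x0| < d ->
   `|gmx g i (x + τ *: delta_mx 0 k) p q - gmx g i x p q| <= d^-1 * `|τ| /\
   `|gmx g i (x + τ *: delta_mx 0 k) p q - gmx g i x p q - τ * dgmx i k x p q| <= d^-1 * τ ^+ 2.
have [|kpq|d d0 Hd] := @common_radius R _ P.
- move=> [k [p q]] d e e0 ed; rewrite /P/= => H x xe.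
  have de : d^-1 <= e^-1 by rewrite lef_pV2 ?posrE//; exact: lt_le_trans ed.
  have [h1 h2] := H x (lt_le_trans xe ed).
  split; first exact: le_trans de.
  move=> τ xt; have [h3 h4] := h2 τ (lt_le_trans xt ed).
  split; first by apply: le_trans h3 _; rewrite ler_wpM2r.
  by apply: le_trans h4 _; rewrite ler_wpM2r// sqr_ge0.
- case: kpq => k [p q]; rewrite /P/=.
  have sf := gmx_smooth g i p q; set f := (fun x => gmx g i x p q) in sf.
  have [r2 [L2 [r20 L20 H2]]] := C1_locally_lipschitz oI Ix0 (sf 1%N).
  have [r3 [L3 [r30 L30 H3]]] := C1_locally_lipschitz oI Ix0 (smooth_derive (delta_mx 0 k) sf 1%N).
  pose B := L2 + L3 + (`|f x0| + L2 * r2) + r1^-1 + r2^-1 + r3^-1.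
  have f0 := normr_ge0 (f x0).
  have Lr : 0 < L2 * r2 by rewrite mulr_gt0.
  have [i1 i2 i3] : [/\ 0 < r1^-1, 0 < r2^-1 & 0 < r3^-1] by rewrite !invr_gt0.
  have B0 : 0 < B by rewrite /B; move: L20 L30 f0 Lr i1 i2 i3; glra.
  have Br1 : B^-1 <= r1 by rewrite -[leRHS]invrK lef_pV2 ?posrE// /B; move: L20 L30 f0 Lr i1 i2 i3; glra.
  have Br2 : B^-1 <= r2 by rewrite -[leRHS]invrK lef_pV2 ?posrE// /B; move: L20 L30 f0 Lr i1 i2 i3; glra.
  have Br3 : B^-1 <= r3 by rewrite -[leRHS]invrK lef_pV2 ?posrE// /B; move: L20 L30 f0 Lr i1 i2 i3; glra.
  exists (B^-1); first by rewrite invr_gt0.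
  rewrite invrK => x xB.
  have x1 := lt_le_trans xB Br1; have x2 := lt_le_trans xB Br2; have x3 := lt_le_trans xB Br3.
  have x02 : `|x0 - x0| < r2 by rewrite subrr normr0.
  have e1 (τ : R) : `|x + τ *: delta_mx 0 k - x| <= `|τ|.
    rewrite addrAC subrr add0r normrZ ler_piMr//.
    exact: norm_delta_le.
  split.
    have := H2 x0 x x02 x2; rewrite -/(f x) => h.
    have h' : L2 * `|x - x0| <= L2 * r2 by rewrite ler_wpM2l ?ltW.
    rewrite -/(f x) -(subrK (f x0) (f x)); apply: le_trans (ler_normD _ _) _.
    by move: h h' L20 L30 f0 Lr i1 i2 i3; rewrite /B; glra.
  move=> τ yB.
  have y1 := lt_le_trans yB Br1; have y2 := lt_le_trans yB Br2; have y3 := lt_le_trans yB Br3.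
  split.
    apply: le_trans (H2 _ _ x2 y2) _.
    apply: le_trans (ler_wpM2l (ltW L20) (e1 τ)) _.
    by rewrite ler_wpM2r// /B; move: L20 L30 f0 Lr i1 i2 i3; glra.
  have [|c cb E] := @mvt_between R (fun s => f (x + s *: delta_mx 0 k))
    (fun s => 'D_(delta_mx 0 k) f (x + s *: delta_mx 0 k)) 0 τ.
    move=> t tb; apply: is_derive_line; apply: derivableP; apply: Ck_derivable (sf 1%N) _.
    by apply: Hr1; apply: ball_segment tb x1 y1.
  move: E; rewrite scale0r addr0 subr0 -!/(f _) => ->.
  rewrite !mxE /partial -/f [_ * τ]mulrC -mulrBr normrM expr2 mulrA [B * τ]mulrC -mulrA.
  have cτ : `|c| <= `|τ|.
    move: cb; rewrite minElt maxElt; case: ifP => h /andP[h1 h2].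
      by rewrite !ger0_norm; move: h h1 h2; glra.
    by rewrite !ler0_norm; move: h1 h2; glra.
  have h := H3 _ _ x3 (ball_segment cb x3 y3).
  apply: (@le_trans _ _ (`|τ| * (L3 * `|τ|))).
    rewrite ler_wpM2l//; apply: le_trans h _; rewrite ler_wpM2l ?(ltW L30)//.
    exact: le_trans (e1 c) cτ.
  have ττ : `|τ| * `|τ| = τ * τ by rewrite -normrM ger0_norm// -expr2 sqr_ge0.
  have : 0 <= τ * τ by rewrite -expr2 sqr_ge0.
  have : 0 <= (B - L3) * (τ * τ) by rewrite mulr_ge0// -?expr2 ?sqr_ge0// /B; move: L20 L30 f0 Lr i1 i2 i3; glra.
  have -> : `|τ| * (L3 * `|τ|) = L3 * (τ * τ) by rewrite -ττ mulrCA.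
  have -> : τ * (B * τ) = B * (τ * τ) by rewrite mulrCA.
  glra.
exists (Num.min d r1), (d^-1); split.
- by rewrite lt_min d0.
- by rewrite invr_gt0.
- move=> x; rewrite lt_min => /andP[xd xr]; split; first exact: Hr1.
  move=> p q; have [k|] := pickP 'I_n; last by move/(_ p).
  by have [] := Hd (k, (p, q)) x xd.
- move=> x τ k; rewrite !lt_min => /andP[xd xr] /andP[yd yr]; split=> p q.
    by have [_ /(_ τ yd)[]] := Hd (k, (p, q)) x xd.
  by have [_ /(_ τ yd)[]] := Hd (k, (p, q)) x xd.
Qed.

Lemma bilin_Ck k (V : normedModType R) (J : set V) (G : V -> 'M[R]_n) (u v : V -> 'rV[R]_n) : open J ->
  (forall p q, Ck k J (fun t => G t p q)) -> Ck k J u -> Ck k J v ->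
  Ck k J (fun t => bilin (G t) (u t) (v t)).
Proof.
move=> oJ cG /(Ck_mxP _ _ oJ) cu /(Ck_mxP _ _ oJ) cv.
apply: (Ck_ext (f := fun t => \sum_p \sum_q u t 0 p * G t p q * v t 0 q)) => // [t _|].
  by rewrite bilinE.
by do 2!(apply: Ck_sum => // ?); apply: Ck_mul => //; exact: Ck_mul.
Qed.

End MetricTaylor.

(** * The lemma of du Bois-Reymond and the Euler-Lagrange equation *)

Section DuBoisReymond.
Context {R : realType}.

(** [K] is nondecreasing and yet not larger at [b] than at [a], so it is constant. This stands for
    the vanishing of the integral of a square. *)
Lemma sq_derivative_eq0 (K k : R -> R) (a b : R) : K b <= K a ->
  (forall t, a <= t <= b -> is_derive t 1 K (k t ^+ 2)) -> forall t, a < t < b -> k t = 0.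
Proof.
move=> Kab dK t /andP[a_t tb].
have mono s u : a <= s -> s <= u -> u <= b -> K s <= K u.
  move=> h1 h2 h3; apply: (is_derive_cst_le (df := fun t => k t ^+ 2)) => // w /andP[w1 w2].
    by apply: dK; rewrite (le_trans h1 w1) (le_trans w2 h3).
  exact: sqr_ge0.
have cK s : a <= s -> s <= b -> K s = K t.
  move=> h1 h2; have := mono _ _ (lexx a) h1 h2; have := mono _ _ h1 h2 (lexx b).
  have := mono _ _ (lexx a) (ltW a_t) (ltW tb); have := mono _ _ (ltW a_t) (ltW tb) (lexx b); alra.
have h1 : is_derive t 1 K (k t ^+ 2) by apply: dK; rewrite !ltW.
have h2 : is_derive t 1 K 0.
  apply: eps_is_derive => e e0; have [d [d0 d1 d2]] := @small2 R (t - a) (b - t) ltac:(alra) ltac:(alra).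
  exists d => // s; rewrite ltr_distl => /andP[s1 s2].
  rewrite cK; [|move: s1 d1; alra|move: s2 d2; alra].
  by rewrite subrr scaler0 subr0 normr0 mulr_ge0// ltW.
by apply/eqP; rewrite -sqrf_eq0; apply/eqP; exact: is_derive_unique h1 h2.
Qed.

(** With [Z] a primitive of [W], integration by parts turns the integrand into [(P - Z) * ψ']. The
    test function with [ψ' = P - Z - m], where the mean [m] makes it vanish at both ends, produces a
    square; so [P = Z + m]. Integrals appear as increments of the primitive [Q], and a one-sided
    inequality is enough. *)
Lemma du_bois_reymond (P W : R -> R) (t0 h : R) : 0 < h ->
  (forall t, `|t - t0| < h -> {for t, continuous P} /\ {for t, continuous W}) ->
  (forall α β (ψ ψ' Q : R -> R), t0 - h < α -> α <= β -> β < t0 + h ->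
     (forall t, α <= t <= β -> [/\ is_derive t 1 ψ (ψ' t), {for t, continuous ψ'} &
       is_derive t 1 Q (P t * ψ' t + W t * ψ t)]) -> ψ α = 0 -> ψ β = 0 -> Q β <= Q α) ->
  is_derive t0 1 P (W t0).
Proof.
move=> h0 cPW var.
have prim (f : R -> R) (h1 h2 : R) : h1 < h2 -> 0 < h1 ->
    (forall t, `|t - t0| < h2 -> {for t, continuous f}) ->
    exists F : R -> R, forall t, `|t - t0| < h1 -> is_derive t 1 F (f t).
  move=> h12 h10 cf.
  have [||F HF] := @primitive R (t0 - h1) (t0 + h1) f; first by alra.
    move=> t /andP[t1 t2]; apply: cf; apply: (@le_lt_trans _ _ h1) => //.
    by rewrite ler_norml; alra.
  by exists F => t; rewrite ltr_distl => ?; apply: HF.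
(* Every primitive is obtained on a slightly smaller interval, hence the radii [h / 2], [h / 3],
   [h / 4] and [h / 5]. *)
have [|||Z HZ] := prim W (h / 2) h; [alra|alra|by move=> t /cPW[]|].
have cPZ t : `|t - t0| < h / 2 -> {for t, continuous (fun s => P s - Z s)}.
  move=> ht; apply: continuousB; first by have [] := cPW t; [apply: lt_trans ht _; alra|].
  exact: is_derive_continuous (HZ t ht).
have [||N HN] := prim _ (h / 3) (h / 2) _ _ cPZ; [alra|alra|].
pose α := t0 - h / 5; pose β := t0 + h / 5; pose m := (N β - N α) / (β - α).
have ab : β - α != 0 by rewrite /α/β; apply/eqP; alra.
have cH t : `|t - t0| < h / 3 -> {for t, continuous (fun s => P s - Z s - m)}.
  move=> ht; apply: continuousB; first by apply: cPZ; apply: lt_trans ht _; alra.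
  exact: cst_continuous.
have [|||K HK] := prim (fun s => (P s - Z s - m) ^+ 2) (h / 4) (h / 3); [alra|alra| |].
  move=> t ht; have c := cH t ht.
  have -> : (fun s => (P s - Z s - m) ^+ 2) = (fun s => (P s - Z s - m) * (P s - Z s - m)).
    by apply/funext => s; rewrite expr2.
  exact: continuousM.
pose ψ s := N s - N α - m * (s - α).
have dψ t : `|t - t0| < h / 3 -> is_derive t 1 ψ (P t - Z t - m).
  move=> ht; have dN := HN t ht.
  have -> : P t - Z t - m = (P t - Z t) - 0 - m * (1 - 0) by rewrite !subr0 mulr1.
  exact: is_derive_sub.
have inab t : α <= t <= β -> `|t - t0| <= h / 5.
  by rewrite /α/β => ?; rewrite ler_norml; alra.
have ψβ : ψ β = 0 by rewrite /ψ /m divfK ?subrr.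
have ψα : ψ α = 0 by rewrite /ψ !subrr mulr0 subr0.
have KK : K β <= K α.
  have -> : K β = K β + m * ψ β + Z β * ψ β by rewrite ψβ !mulr0 !addr0.
  have -> : K α = K α + m * ψ α + Z α * ψ α by rewrite ψα !mulr0 !addr0.
  apply: (var α β ψ (fun t => P t - Z t - m) (fun t => K t + m * ψ t + Z t * ψ t)) => //;
    [by rewrite /α; alra|by rewrite /α/β; alra|by rewrite /β; alra|].
  move=> t /inab ht.
  have [h2 h3 h4] : [/\ `|t - t0| < h / 2, `|t - t0| < h / 3 & `|t - t0| < h / 4].
    by split; apply: le_lt_trans ht _; alra.
  split; [exact: dψ|exact: cH|].
  have -> : P t * (P t - Z t - m) + W t * ψ t =
    (P t - Z t - m) ^+ 2 + m * (P t - Z t - m) + (Z t * (P t - Z t - m) + ψ t * W t) by ring.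
  apply: is_derive_add; last by apply: is_derive_mul; [exact: HZ|exact: dψ].
  by apply: is_derive_add; [exact: HK|apply: is_derive_scale; exact: dψ].
have H0 t : `|t - t0| < h / 5 -> P t = Z t + m.
  rewrite ltr_distl => ht; have : P t - Z t - m = 0; last alra.
  apply: (sq_derivative_eq0 (k := fun t => P t - Z t - m) KK) => [s /inab hs|//].
  by apply: HK; apply: le_lt_trans hs _; alra.
have dZ : is_derive t0 1 Z (W t0) by apply: HZ; rewrite subrr normr0; alra.
have -> : W t0 = W t0 + 0 by rewrite addr0.
have dZm : is_derive t0 1 (fun t => Z t + m) (W t0 + 0) by exact: is_deriveD.
apply: eps_is_derive => e e0; have [d d0 Hd] := is_derive_eps dZm e0.
have [q [q0 q1 q2]] := @small2 R d (h / 5) d0 ltac:(alra).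
exists q => // s sq; rewrite !H0 ?subrr ?normr0; [|alra|exact: lt_le_trans q2].
by apply: Hd; exact: lt_le_trans q1.
Qed.

End DuBoisReymond.

Section EulerLagrange.
Context {R : realType} {n : nat} {M : topologicalType}.
Context {A : smooth_manifold R n M}.
Context (g : riemannian_metric A).
Local Notation dist := (dist g).
Local Notation Nrm i x := (gnorm (gmx g i x)).
Implicit Types (i : chart_index A) (γ : R -> M).

Lemma bilin_scale (G : 'M[R]_n) (τ : R) u v : bilin (τ *: G) u v = τ * bilin G u v.
Proof. by rewrite /bilin -scalemxAr -scalemxAl mxE. Qed.

(** The base point moves by [τ] and the vector by [σ] in direction [k]. The first-order terms are
    kept exactly; what remains is quadratic in the two, uniformly for [u] bounded by [B]. *)
Lemma variation_pointwise (Gx Gy dG : 'M[R]_n) (u : 'rV[R]_n) (k : 'I_n) (τ σ C B : R) :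
  Gy^T = Gy -> 0 <= C -> `|u| <= B ->
  (forall p q, `|Gy p q| <= C) -> (forall p q, `|Gy p q - Gx p q| <= C * `|τ|) ->
  (forall p q, `|Gy p q - Gx p q - τ * dG p q| <= C * τ ^+ 2) ->
  bilin Gy (u + σ *: delta_mx 0 k) (u + σ *: delta_mx 0 k) <=
    bilin Gx u u + τ * bilin dG u u + 2 * σ * bilin Gx u (delta_mx 0 k)
    + n%:R ^+ 2 * C * (τ ^+ 2 * B ^+ 2 + 2 * `|σ| * `|τ| * B + σ ^+ 2).
Proof.
move=> Gs C0 uB hG hD hT; set e := delta_mx 0 k.
have e1 : `|e| <= 1 by exact: norm_delta_le.
have n0 : 0 <= n%:R ^+ 2 * C by rewrite mulr_ge0// sqr_ge0.
have u0 := normr_ge0 u; have e0 := normr_ge0 e; have B0 := le_trans u0 uB.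
have h1 : bilin (Gy - Gx - τ *: dG) u u <= n%:R ^+ 2 * C * (τ ^+ 2 * B ^+ 2).
  apply: le_trans (ler_norm _) _; apply: le_trans (bilin_le (b := C * τ ^+ 2) _ _ _) _.
    by move=> p q; rewrite !mxE.
  have -> : n%:R ^+ 2 * (C * τ ^+ 2) * `|u| * `|u| = n%:R ^+ 2 * C * (τ ^+ 2 * (`|u| * `|u|)) by ring.
  by rewrite ler_wpM2l// ler_wpM2l ?sqr_ge0// [B ^+ 2]expr2 ler_pM.
have h2 : `|bilin (Gy - Gx) u e| <= n%:R ^+ 2 * C * (`|τ| * B).
  apply: le_trans (bilin_le (b := C * `|τ|) _ _ _) _.
    by move=> p q; rewrite !mxE.
  have -> : n%:R ^+ 2 * (C * `|τ|) * `|u| * `|e| = n%:R ^+ 2 * C * (`|τ| * (`|u| * `|e|)) by ring.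
  by rewrite ler_wpM2l// ler_wpM2l// -[leRHS]mulr1 ler_pM.
have h3 : bilin Gy e e <= n%:R ^+ 2 * C.
  apply: le_trans (ler_norm _) _; apply: le_trans (bilin_le (b := C) _ _ hG) _.
  by rewrite -mulrA ler_piMr// mulr_ile1.
have E : bilin Gy (u + σ *: e) (u + σ *: e) = bilin Gy u u + 2 * σ * bilin Gy u e + σ ^+ 2 * bilin Gy e e.
  by rewrite bilinDl !bilinDr !bilinZl !bilinZr (bilinC e u Gs) expr2; ring.
have E2 : bilin Gy u u = bilin Gx u u + τ * bilin dG u u + bilin (Gy - Gx - τ *: dG) u u.
  by rewrite -!bilinB bilin_scale; ring.
have E3 : bilin Gy u e = bilin Gx u e + bilin (Gy - Gx) u e by rewrite -bilinB; ring.
have h4 : σ * bilin (Gy - Gx) u e <= `|σ| * (n%:R ^+ 2 * C * (`|τ| * B)).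
  by apply: le_trans (ler_norm _) _; rewrite normrM ler_wpM2l.
have h5 : σ ^+ 2 * bilin Gy e e <= σ ^+ 2 * (n%:R ^+ 2 * C) by rewrite ler_wpM2l// sqr_ge0.
rewrite E E2 E3.
have -> : n%:R ^+ 2 * C * (τ ^+ 2 * B ^+ 2 + 2 * `|σ| * `|τ| * B + σ ^+ 2) =
  n%:R ^+ 2 * C * (τ ^+ 2 * B ^+ 2) + 2 * (`|σ| * (n%:R ^+ 2 * C * (`|τ| * B))) + σ ^+ 2 * (n%:R ^+ 2 * C).
  by ring.
move: h1 h4 h5; generalize (bilin (Gy - Gx) u e) => z; clear.
have -> : 2 * σ * (bilin Gx u e + z) = 2 * σ * bilin Gx u e + 2 * (σ * z) by ring.
alra.
Qed.

(** The coordinate [k] is varied by [ε * ψ]. Dividing [2 * κ * N <= κ ^+ 2 + N ^+ 2] by [2 * κ]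
    bounds the length of the varied curve by its energy, which is smooth in [ε]; this is where
    [0 < κ] enters. *)
Lemma euler_lagrange (κ a b : R) γ i t0 k : 0 < κ -> minimizer g κ a b γ -> a < t0 < b -> chart_dom i (γ t0) ->
  let x := chart_map i \o γ in let x' := fun t => 'D_1 x t in
  is_derive t0 1 (fun t => 2 * bilin (gmx g i (x t)) (x' t) (delta_mx 0 k))
    (bilin (dgmx g i k (x t0)) (x' t0) (x' t0)).
Proof.
move=> κ0 mγ t0b it0 x x'.
have [h1 h10 H1] := minimizer_C1 (ltW κ0) mγ t0b it0.
have xI : chart_img i (x t0) by exact: chart_img_in.
have [r [C [r0 C0 Hx HT]]] := metric_taylor g xI.
have ht0 : `|t0 - t0| < h1 by rewrite subrr normr0.
have [_ _ dx0 _ _] := H1 _ ht0.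
have [h2 h20 H2] := (continuous_normP _ _).1 (is_derive_continuous dx0) (r / 2) ltac:(alra).
have [h [h0 hh1 hh2]] := small2 h10 h20.
pose J := [set t : R | `|t - t0| < h1].
have oJ : open J.
  have -> : J = ball t0 h1 by apply/seteqP; split => t; rewrite /J/ball/= distrC.
  exact: ball_open.
have cx : Ck 0 J x.
  by split; [move=> t Jt; have [_ _ d _ _] := H1 t Jt; exact: is_derive_continuous d|exact: I].
have cx' : Ck 0 J x' by split; [move=> t Jt; have [_ _ _ d _] := H1 t Jt; exact: d|exact: I].
have Jx t : J t -> chart_img i (x t) by move=> /H1[_ it _ _ _]; exact: chart_img_in.
have oI := @chart_img_open' _ _ _ A i.
have cP : Ck 0 J (fun t => 2 * bilin (gmx g i (x t)) (x' t) (delta_mx 0 k)).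
  apply: Ck_mul => //; first exact: Ck_cst.
  apply: bilin_Ck; [exact: oJ| |assumption|exact: Ck_cst].
  by move=> p q; apply: (Ck_compR oI oJ Jx (gmx_smooth g i p q 0%N) cx).
have cW : Ck 0 J (fun t => bilin (dgmx g i k (x t)) (x' t) (x' t)).
  apply: bilin_Ck => // p q.
  have -> : (fun t => dgmx g i k (x t) p q) = (fun t => 'D_(delta_mx 0 k) (fun y => gmx g i y p q) (x t)).
    by apply/funext => t; rewrite mxE.
  by apply: (Ck_compR oI oJ Jx (smooth_derive _ (gmx_smooth g i p q) 0%N) cx).
apply: (@du_bois_reymond _ _ (fun t => bilin (dgmx g i k (x t)) (x' t) (x' t)) _ h) => //.
  move=> t th; have Jt : J t by exact: lt_le_trans hh1.
  by split; [exact: (cP.1 t Jt)|exact: (cW.1 t Jt)].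
move=> α β ψ ψ' Q αh αβ βh dψ ψα ψβ.
have Jab t : α <= t <= β -> `|t - t0| < h by move=> ?; rewrite ltr_norml; move: αh βh; alra.
have [Bψ Bψ0 HBψ] : exists2 B : R, 0 < B & forall t, α <= t <= β -> `|ψ t| <= B.
  by apply: cont_bounded => // t /dψ[d _ _]; exact: is_derive_continuous d.
have [Bd Bd0 HBd] : exists2 B : R, 0 < B & forall t, α <= t <= β -> `|ψ' t| <= B.
  by apply: cont_bounded => // t /dψ[].
have [Bu Bu0 HBu] : exists2 B : R, 0 < B & forall t, α <= t <= β -> `|x' t| <= B.
  have [|t tab|B B0 HB] := @cont_bounded R (fun t => `|x' t|) α β => //.
    apply: (@continuous_comp _ _ _ x' (fun z : 'rV[R]_n => `|z|)); last exact: norm_continuous.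
    by apply: (cx'.1 t); exact: lt_le_trans (Jab t tab) hh1.
  by exists B => // t /HB; rewrite normr_id.
set e := (delta_mx 0 k : 'rV[R]_n).
pose D := n%:R ^+ 2 * C * (Bψ ^+ 2 * Bu ^+ 2 + 2 * Bd * Bψ * Bu + Bd ^+ 2).
have D0 : 0 <= D.
  have n0 : 0 <= n%:R ^+ 2 * C by rewrite mulr_ge0 ?(ltW C0)// sqr_ge0.
  by rewrite /D mulr_ge0// !addr_ge0// ?mulr_ge0 ?sqr_ge0// ?(ltW Bd0)// ?(ltW Bψ0)// ?(ltW Bu0).
(* The varied curve has the same ends, so its length is at least [κ * (β - α)]; the comparison
   leaves an inequality of second order in [ε], valid for both signs. *)
have key ε : `|ε| * Bψ < r / 2 -> 0 <= ε * (Q β - Q α) + D * ε ^+ 2 * (β - α).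
  move=> εs.
  pose y t := x t + (ε * ψ t) *: e.
  pose y' t := x' t + (ε * ψ' t) *: e.
  have yr t : α <= t <= β -> `|x t - x t0| < r /\ `|y t - x t0| < r.
    move=> tab; have xt : `|x t - x t0| < r / 2.
      by apply: H2; exact: lt_le_trans (Jab t tab) hh2.
    split; first by move: xt r0; glra.
    rewrite /y addrAC; apply: le_lt_trans (ler_normD _ _) _; rewrite normrZ normrM.
    have : `|ε| * `|ψ t| * `|e| <= `|ε| * Bψ.
      by rewrite -[leRHS]mulr1 ler_pM ?norm_delta_le// ?mulr_ge0// ler_wpM2l ?HBψ.
    by move: xt εs; glra.
  pose G t := κ * t + (2 * κ)^-1 * (ε * Q t + D * ε ^+ 2 * t).
  have := @speed_bound _ _ _ _ g i α β y y' G (fun t => κ * 1 + (2 * κ)^-1 *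
    (ε * (2 * bilin (gmx g i (x t)) (x' t) e * ψ' t + bilin (dgmx g i k (x t)) (x' t) (x' t) * ψ t) + D * ε ^+ 2 * 1)) αβ.
  have -> : chart_inv i (y α) = γ α.
    rewrite /y ψα mulr0 scale0r addr0 /x/= chart_mapK//.
    by have [] := H1 α (lt_le_trans (Jab α _) hh1); rewrite ?lexx ?αβ.
  have -> : chart_inv i (y β) = γ β.
    rewrite /y ψβ mulr0 scale0r addr0 /x/= chart_mapK//.
    by have [] := H1 β (lt_le_trans (Jab β _) hh1); rewrite ?lexx ?αβ.
  have inab t : α <= t <= β -> a <= t <= b.
    by move=> /Jab th; have [/andP[? ?]] := H1 t (lt_le_trans th hh1); rewrite !ltW.
  rewrite mγ ?inab ?lexx ?αβ// lee_fin => H; rewrite ler0_norm ?subr_le0// opprB in H.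
  have {}H : κ * (β - α) <= G β - G α.
    apply: H.
    - by move=> t /yr[_ /Hx[]].
    - move=> t tab; have [_ _ dx _ _] := H1 t (lt_le_trans (Jab t tab) hh1).
      have [dψt _ _] := dψ t tab.
      rewrite /y /y'; apply: is_deriveD.
      apply/is_derive_mxP => p q; rewrite mxE.
      have -> : (fun s => ((ε * ψ s) *: e) p q) = (fun s => e p q * ε * ψ s).
        by apply/funext => s; rewrite !mxE mulrC mulrA.
      have -> : ε * ψ' t * e p q = e p q * ε * ψ' t by rewrite mulrC mulrA.
      exact: is_derive_scale.
    - by move=> t tab; have [_ _ dQ] := dψ t tab; rewrite /G; do !(apply: is_derive_add || apply: is_derive_scale) => //; exact: is_derive_id.
    - move=> t tab; have [xr ytr] := yr t tab.
      have [_ it _ _ Nt] := H1 t (lt_le_trans (Jab t tab) hh1).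
      have [T1 T2] := HT _ _ _ xr ytr.
      have [yI yC] := Hx _ ytr.
      have mt := gmx_metric g yI.
      have := @variation_pointwise (gmx g i (x t)) (gmx g i (y t)) (dgmx g i k (x t)) (x' t) k (ε * ψ t) (ε * ψ' t) C Bu
        mt.1 (ltW C0) (HBu t tab) yC T1 T2.
      rewrite -/e -/(y' t) -(gnorm_sqr _ mt) -gnorm_sqr; last by apply: gmx_metric; have [] := Hx _ xr.
      rewrite Nt; have N0 := gnorm_ge0 (gmx g i (y t)) (y' t).
      set N := Nrm i (y t) (y' t) in N0 *.
      set b1 := bilin _ (x' t) e; set b2 := bilin _ (x' t) (x' t) => V.
      have V2 : n%:R ^+ 2 * C * ((ε * ψ t) ^+ 2 * Bu ^+ 2 + 2 * `|ε * ψ' t| * `|ε * ψ t| * Bu + (ε * ψ' t) ^+ 2)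
          <= D * ε ^+ 2.
        have -> : D * ε ^+ 2 = n%:R ^+ 2 * C * (ε ^+ 2 * (Bψ ^+ 2 * Bu ^+ 2 + 2 * Bd * Bψ * Bu + Bd ^+ 2)).
          by rewrite /D -[LHS]mulrA; congr (_ * _); exact: mulrC.
        rewrite ler_wpM2l//; first by rewrite mulr_ge0 ?(ltW C0)// sqr_ge0.
        have -> : (ε * ψ t) ^+ 2 * Bu ^+ 2 + 2 * `|ε * ψ' t| * `|ε * ψ t| * Bu + (ε * ψ' t) ^+ 2 =
          ε ^+ 2 * (`|ψ t| ^+ 2 * Bu ^+ 2 + 2 * `|ψ' t| * `|ψ t| * Bu + `|ψ' t| ^+ 2).
          rewrite !real_normK ?num_real// !normrM -[ε ^+ 2 in RHS]real_normK ?num_real//.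
          by rewrite !exprMn -(real_normK (num_real ε)); ring.
        have p1 := HBψ t tab; have p2 := HBd t tab; have q1 := normr_ge0 (ψ t); have q2 := normr_ge0 (ψ' t).
        rewrite ler_wpM2l ?sqr_ge0//.
        apply: lerD; last by rewrite ler_sqr ?nnegrE// ltW.
        apply: lerD; first by rewrite ler_wpM2r ?sqr_ge0// ler_sqr ?nnegrE// ltW.
        by rewrite ler_wpM2r ?(ltW Bu0)// -!mulrA ler_wpM2l// ler_pM.
      have amgm : 2 * κ * N <= κ ^+ 2 + N ^+ 2.
        by have := sqr_ge0 (κ - N); rewrite sqrrB; move: (κ ^+ 2) (N ^+ 2) => ? ?; rewrite -mulrA mulr2n mulrDl mul1r; alra.
      have i0 : 0 < (2 * κ)^-1 by rewrite invr_gt0 mulr_gt0.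
      have -> : N = (2 * κ)^-1 * (2 * κ * N) by rewrite mulKf// mulf_neq0// gt_eqF.
      have -> : κ * 1 = (2 * κ)^-1 * (2 * κ * κ) by rewrite mulKf ?mulr1// mulf_neq0// gt_eqF.
      rewrite -mulrDr ler_wpM2l ?(ltW i0)//; apply: le_trans amgm _.
      move: V V2; set X := n%:R ^+ 2 * C * _; move: X => X V V2.
      have -> : 2 * κ * κ = κ ^+ 2 + κ ^+ 2 by rewrite expr2; ring.
      have -> : ε * (2 * b1 * ψ' t + b2 * ψ t) = ε * ψ t * b2 + 2 * (ε * ψ' t) * b1 by ring.
      by move: V V2; glra.
  have {}H : 0 <= (2 * κ)^-1 * (ε * (Q β - Q α) + D * ε ^+ 2 * (β - α)).
    have -> : (2 * κ)^-1 * (ε * (Q β - Q α) + D * ε ^+ 2 * (β - α)) = G β - G α - κ * (β - α) by rewrite /G; ring.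
    by rewrite subr_ge0.
  by move: H; rewrite pmulr_rge0// invr_gt0 mulr_gt0.
(* For a small negative [ε] the linear term outweighs the quadratic one. *)
rewrite leNgt; apply/negP => QQ.
have ba : 0 <= β - α by rewrite subr_ge0.
pose q := Q β - Q α; have q0 : 0 < q by rewrite subr_gt0.
have DD : 0 < D * (β - α) + 1 by rewrite ltr_wpDl// mulr_ge0.
have [ε [ε0 ε1 ε2]] := @small2 R (r / 2 / 2 / Bψ) (q / 2 / (D * (β - α) + 1)) ltac:(by rewrite !divr_gt0) ltac:(by rewrite !divr_gt0).
have e4 : ε * Bψ < r / 2 by move: ε1 r0; rewrite ler_pdivlMr//; glra.
have := key (- ε); rewrite normrN gtr0_norm// sqrrN -/q => /(_ e4).
have e3 : ε * (D * (β - α) + 1) <= q / 2 by rewrite -ler_pdivlMr.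
have : ε * (ε * (D * (β - α) + 1)) <= ε * (q / 2) by rewrite ler_wpM2l ?(ltW ε0).
have -> : - ε * q + D * ε ^+ 2 * (β - α) = - (ε * q) + ε * (ε * (D * (β - α) + 1)) - ε * ε by rewrite expr2; ring.
have : 0 < ε * q by rewrite mulr_gt0.
have : 0 < ε * ε by rewrite mulr_gt0.
by glra.
Qed.

End EulerLagrange.

(** * From momenta to the geodesic equation *)

Section GeodesicEquation.
Context {R : realType} {n : nat} {M : topologicalType}.
Context {A : smooth_manifold R n M}.
Context (g : riemannian_metric A).
Local Notation dist := (dist g).
Local Notation Nrm i x := (gnorm (gmx g i x)).
Implicit Types (i : chart_index A) (γ : R -> M).

(** Right-hand side of the geodesic equation solved for the second derivative. *)
Definition acceleration i (x v : 'rV[R]_n) : 'rV[R]_n :=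
  \row_k - \sum_(a < n) \sum_(b < n) christoffel g i x k a b * v 0 a * v 0 b.

(** The part of the derivative of the momentum [g(x', e_l)] along a curve that comes from the moving
    base point. *)
Definition inertia i (x v : 'rV[R]_n) (l : 'I_n) : R :=
  \sum_a \sum_b partial (fun y => gmx g i y b l) a x * v 0 a * v 0 b.

Lemma invmx_symm (G : 'M[R]_n) : G^T = G -> (invmx G)^T = invmx G.
Proof. by move=> h; rewrite trmx_inv h. Qed.

(** Raising the index in the Euler-Lagrange equation gives the Christoffel symbols: two of their
    three terms agree after summation against the symmetric [v 0 a * v 0 b]. *)
Lemma accelerationE i x v k : chart_img i x ->
  acceleration i x v 0 k =
    \sum_l (2^-1 * bilin (dgmx g i l x) v v - inertia i x v l) * invmx (gmx g i x) l k.
Proof.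
move=> xI; rewrite mxE.
have S := invmx_symm (gmx_sym g xI).
rewrite (eq_bigr (fun a => \sum_b \sum_l 2^-1 * (invmx (gmx g i x) l k *
    (partial (fun y => gmx g i y b l) a x + partial (fun y => gmx g i y a l) b x
     - partial (fun y => gmx g i y a b) l x) * v 0 a * v 0 b))); last first.
  move=> a _; apply: eq_bigr => b _; rewrite /christoffel mulr_sumr !mulr_suml.
  by apply: eq_bigr => l _; rewrite -{1}S mxE !mulrA.
rewrite (eq_bigr _ (fun a _ => exchange_big _ _ _ _ _ _)) exchange_big/= -sumrN.
apply: eq_bigr => l _.
rewrite bilinE /inertia.
have E : \sum_a \sum_b partial (fun y => gmx g i y b l) a x * v 0 a * v 0 b =
   2^-1 * (\sum_a \sum_b partial (fun y => gmx g i y b l) a x * v 0 a * v 0 b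
     + \sum_a \sum_b partial (fun y => gmx g i y a l) b x * v 0 a * v 0 b).
  rewrite [X in _ = _ * (_ + X)]exchange_big/=.
  rewrite [X in _ = _ * (_ + X)](eq_bigr (fun a => \sum_b partial (fun y => gmx g i y b l) a x * v 0 a * v 0 b)).
    by alra.
  by move=> a _; apply: eq_bigr => b _; rewrite mulrAC.
rewrite {}E -mulrBr -mulrA [_ * invmx _ _ _]mulrC.
rewrite -big_split/= -sumrB/= !mulr_sumr -sumrN; apply: eq_bigr => a _.
rewrite -big_split/= -sumrB/= !mulr_sumr -sumrN; apply: eq_bigr => b _.
by rewrite !mxE; ring.
Qed.

(** The differentiability of [x'] is a conclusion: [x'] is the momentum, whose derivative is given,
    times the inverse metric, which is smooth. Differentiating the momentum in a second way, as [x']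
    times the metric, identifies the derivative [u]. *)
Lemma momentum_geodesic i (x x' : R -> 'rV[R]_n) (t0 h : R) : 0 < h ->
  (forall t, `|t - t0| < h -> chart_img i (x t)) ->
  is_derive t0 1 x (x' t0) ->
  (forall k, is_derive t0 1 (fun t => 2 * bilin (gmx g i (x t)) (x' t) (delta_mx 0 k))
    (bilin (dgmx g i k (x t0)) (x' t0) (x' t0))) ->
  is_derive t0 1 x' (acceleration i (x t0) (x' t0)).
Proof.
move=> h0 xI dx dP.
have t00 : `|t0 - t0| < h by rewrite subrr normr0.
have xI0 := xI _ t00; have oI := @chart_img_open' _ _ _ A i.
have U t : chart_img i t -> gmx g i t \in unitmx by move=> /(gmx_metric g)/gnorm_unit.
pose p t l := bilin (gmx g i (x t)) (x' t) (delta_mx 0 l).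
have pE t : x' t *m gmx g i (x t) = \row_l p t l.
  apply/rowP => l; rewrite [RHS]mxE /p /bilin [RHS]mxE (bigD1 l)//= big1 ?addr0.
    by rewrite !mxE !eqxx mulr1.
  by move=> q ql; rewrite !mxE (negPf ql) andbF mulr0.
have dp l : is_derive t0 1 (fun t => p t l) (2^-1 * bilin (dgmx g i l (x t0)) (x' t0) (x' t0)).
  have -> : (fun t => p t l) = (fun t => 2^-1 * (2 * p t l)) by apply/funext => t; rewrite mulKf.
  exact: is_derive_scale.
have dG (a l : 'I_n) : is_derive t0 1 (fun t => gmx g i (x t) a l) (partials (fun y => gmx g i y a l) (x t0) (x' t0)).
  exact: (chain_rule oI xI0 (gmx_smooth g i a l 1%N) dx).
have dI (a l : 'I_n) : is_derive t0 1 (fun t => invmx (gmx g i (x t)) a l)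
    (partials (fun y => invmx (gmx g i y) a l) (x t0) (x' t0)).
  apply: (chain_rule oI xI0 _ dx).
  exact: (smooth_invmx oI U (fun p q => gmx_smooth g i p q) a l 1%N).
have x'E t : `|t - t0| < h -> x' t = \row_k \sum_l p t l * invmx (gmx g i (x t)) l k.
  move=> th; rewrite -[LHS](mulmxK (U _ (xI t th))) pE.
  by apply/rowP => k; rewrite !mxE; apply: eq_bigr => l _; rewrite mxE.
pose u := \row_k \sum_l (p t0 l * partials (fun y => invmx (gmx g i y) l k) (x t0) (x' t0)
    + invmx (gmx g i (x t0)) l k * (2^-1 * bilin (dgmx g i l (x t0)) (x' t0) (x' t0))).
have du : is_derive t0 1 x' u.
  have d : is_derive t0 1 (fun t => \row_k \sum_l p t l * invmx (gmx g i (x t)) l k) u.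
    apply/is_derive_mxP => q k; rewrite mxE.
    have -> : (fun t => (\row_k \sum_l p t l * invmx (gmx g i (x t)) l k) q k) =
      (fun t => \sum_l p t l * invmx (gmx g i (x t)) l k) by apply/funext => t; rewrite mxE.
    by apply: is_derive_summ => l; apply: is_derive_mul.
  apply: eps_is_derive => e e0; have [d' d0 Hd] := is_derive_eps d e0.
  have [w [w0 w1 w2]] := small2 d0 h0.
  exists w => // s sw; rewrite !x'E//; first by apply: Hd; exact: lt_le_trans w1.
  exact: lt_le_trans w2.
suff -> : acceleration i (x t0) (x' t0) = u by [].
have E : u *m gmx g i (x t0) = \row_l (2^-1 * bilin (dgmx g i l (x t0)) (x' t0) (x' t0) - inertia i (x t0) (x' t0) l).
  apply/rowP => l; rewrite [RHS]mxE.
  have d2 : is_derive t0 1 (fun t => p t l) (\sum_a (x' t0 0 a * partials (fun y => gmx g i y a l) (x t0) (x' t0)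
      + gmx g i (x t0) a l * u 0 a)).
    have -> : (fun t => p t l) = (fun t => \sum_a x' t 0 a * gmx g i (x t) a l).
      by apply/funext => t; have /rowP/(_ l) := pE t; rewrite !mxE => <-.
    apply: is_derive_summ => a; apply: is_derive_mul => //.
    by move/is_derive_mxP : du; apply.
  rewrite (is_derive_unique (dp l) d2) big_split/= mxE.
  rewrite (_ : \sum_a x' t0 0 a * _ = inertia i (x t0) (x' t0) l).
    by rewrite addrC addrK; apply: eq_bigr => a _; rewrite mulrC.
  rewrite /inertia exchange_big/=; apply: eq_bigr => a _.
  rewrite /partials mulr_sumr; apply: eq_bigr => b _.
  by rewrite /partial mulrC.
apply/rowP => k; rewrite accelerationE// -[u in RHS](mulmxK (U _ xI0)) E mxE.
by apply: eq_bigr => l _; rewrite mxE.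
Qed.

Lemma minimizer0 (a b : R) γ s t : minimizer g 0 a b γ -> a <= s <= b -> a <= t <= b -> γ s = γ t.
Proof. by move=> m sa ta; apply: (@dist_eq0 _ _ _ _ g); rewrite m// mul0r. Qed.

Lemma acceleration0 i x : acceleration i x 0 = 0.
Proof.
apply/rowP => k; rewrite [LHS]mxE [RHS]mxE big1; first by rewrite oppr0.
by move=> a _; rewrite big1// => b _; rewrite mxE mulr0 mul0r.
Qed.

(** At speed zero the Euler-Lagrange argument, which divides by [κ], does not apply; there the curve
    is constant. *)
Lemma minimizer_geodesic (κ a b : R) γ i t0 : 0 <= κ -> minimizer g κ a b γ -> a < t0 < b -> chart_dom i (γ t0) ->
  is_derive t0 1 (fun s => 'D_1 (chart_map i \o γ) s)
    (acceleration i (chart_map i (γ t0)) ('D_1 (chart_map i \o γ) t0)).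
Proof.
move=> κ0 m t0b it0; have [h h0 H] := minimizer_C1 κ0 m t0b it0.
have t00 : `|t0 - t0| < h by rewrite subrr normr0.
move: κ0 m; rewrite le_eqVlt => /predU1P[<-|κ0] m; last first.
  apply: (@momentum_geodesic i (chart_map i \o γ) (fun s => 'D_1 (chart_map i \o γ) s) t0 h h0).
  - by move=> t /H[_ it _ _ _]; exact: chart_img_in.
  - by have [] := H _ t00.
  - by move=> k; exact: euler_lagrange m t0b it0.
have D0 t : `|t - t0| < h -> 'D_1 (chart_map i \o γ) t = 0.
  move=> th; have [/andP[t1 t2] _ d _ _] := H t th.
  apply: (is_derive_unique d); apply: eps_is_derive => e e0.
  have [w [w0 w1 w2]] := @small2 R (t - a) (b - t) ltac:(by rewrite subr_gt0) ltac:(by rewrite subr_gt0).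
  exists w => // s; rewrite ltr_distl => /andP[s1 s2] /=.
  rewrite (@minimizer0 a b γ s t)//; last by rewrite !ltW.
    by rewrite subrr scaler0 subr0 normr0 mulr_ge0// ltW.
  by move: s1 s2 w1 w2; glra.
rewrite D0// acceleration0; apply: eps_is_derive => e e0; exists h => // s sh.
by rewrite !D0// scaler0 !subr0 normr0 mulr_ge0// ltW.
Qed.

End GeodesicEquation.

Lemma normD5 {R : realType} {V : normedModType R} (a b c d e : V) :
  `|a - b + c + d + e| <= `|a| + `|b| + `|c| + `|d| + `|e|.
Proof.
by do 3!(apply: le_trans (ler_normD _ _) (lerD _ (lexx _))); rewrite -[`|b|]normrN ler_normD.
Qed.

(** * Ordinary differential equations *)

Section Ode.
Context {R : realType} {m : nat}.
Context (F : 'rV[R]_m -> 'rV[R]_m) (z0 : 'rV[R]_m) (B L ρ δ : R).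
Context (B0 : 0 < B) (L0 : 0 < L) (δ0 : 0 < δ) (Bδ : B * δ <= ρ).
Context (F_le : forall z, `|z - z0| <= ρ -> `|F z| <= B).
Context (F_lip : forall z w, `|z - z0| <= ρ -> `|w - z0| <= ρ -> `|F z - F w| <= L * `|z - w|).

Definition euler (N : nat) (j : nat) : 'rV[R]_m := iter j (fun z => z + N.+1%:R^-1 *: F z) z0.

Lemma euler_ball N j : j%:R / N.+1%:R <= δ -> `|euler N j - z0| <= B * (j%:R / N.+1%:R).
Proof.
have N0 : (0 : R) < N.+1%:R^-1 by rewrite invr_gt0 ltr0Sn.
elim: j => [|j IH] hj; first by rewrite /euler/= subrr normr0 mul0r mulr0.
have hj' : j%:R / N.+1%:R <= δ by apply: le_trans hj; rewrite ler_pM2r// ler_nat.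
have h1 := IH hj'.
have h2 : `|euler N j - z0| <= ρ by apply: le_trans h1 (le_trans _ Bδ); rewrite ler_wpM2l ?(ltW B0).
rewrite /euler iterS -/(euler N j) addrAC; apply: le_trans (ler_normD _ _) _.
rewrite normrZ gtr0_norm// -[j.+1%:R]natr1 mulrDl mul1r mulrDr; apply: lerD => //.
by rewrite mulrC ler_wpM2r ?(ltW N0)// F_le.
Qed.

Lemma euler_in N j : j%:R / N.+1%:R <= δ -> `|euler N j - z0| <= ρ.
Proof.
move=> hj; apply: le_trans (euler_ball hj) (le_trans _ Bδ); by rewrite ler_wpM2l ?(ltW B0).
Qed.

Lemma euler_lip N j k : (j + k)%:R / N.+1%:R <= δ -> `|euler N (j + k) - euler N j| <= B * (k%:R / N.+1%:R).
Proof.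
have N0 : (0 : R) < N.+1%:R^-1 by rewrite invr_gt0 ltr0Sn.
elim: k => [|k IH] hk; first by rewrite addn0 subrr normr0 mul0r mulr0.
have hk' : (j + k)%:R / N.+1%:R <= δ by apply: le_trans hk; rewrite ler_pM2r// ler_nat addnS.
rewrite addnS /euler iterS -/(euler N (j + k)) -/(euler N j) addrAC; apply: le_trans (ler_normD _ _) _.
rewrite normrZ gtr0_norm// -[k.+1%:R]natr1 mulrDl mul1r mulrDr; apply: lerD; first exact: IH.
by rewrite mulrC ler_wpM2r ?(ltW N0)// F_le// euler_in.
Qed.

(** Along the polygon [F] differs from its value at step [j] by at most [L * B] times the elapsed
    time, and summation gives the square. The bound is uniform in the step size, so it survives the
    limit. *)
Lemma euler_taylor N j k : (j + k)%:R / N.+1%:R <= δ ->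
  `|euler N (j + k) - euler N j - (k%:R / N.+1%:R) *: F (euler N j)| <= L * B * (k%:R / N.+1%:R) ^+ 2.
Proof.
have N0 : (0 : R) < N.+1%:R^-1 by rewrite invr_gt0 ltr0Sn.
elim: k => [|k IH] hk; first by rewrite addn0 mul0r scale0r !subrr normr0 expr0n mulr0.
have hk' : (j + k)%:R / N.+1%:R <= δ by apply: le_trans hk; rewrite ler_pM2r// ler_nat addnS.
have hj' : j%:R / N.+1%:R <= δ by apply: le_trans hk'; rewrite ler_pM2r// ler_nat leq_addr.
rewrite addnS {1}/euler iterS -/(euler N (j + k)).
have -> : euler N (j + k) + N.+1%:R^-1 *: F (euler N (j + k)) - euler N j - (k.+1%:R / N.+1%:R) *: F (euler N j)
  = (euler N (j + k) - euler N j - (k%:R / N.+1%:R) *: F (euler N j)) + N.+1%:R^-1 *: (F (euler N (j + k)) - F (euler N j)).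
  apply/rowP => q; rewrite !mxE -natr1; ring.
apply: le_trans (ler_normD _ _) _; rewrite normrZ gtr0_norm//.
have h1 := IH hk'.
have h2 := F_lip (euler_in hk') (euler_in hj').
have h3 := le_trans h2 (ler_wpM2l (ltW L0) (euler_lip hk')).
have h4 := ler_wpM2l (ltW N0) h3.
apply: le_trans (lerD h1 h4) _.
rewrite -[k.+1%:R]natr1; move: (ler0n R k) N0; move: (k%:R : R) (N.+1%:R^-1 : R) => K e K0 e0.
have : 0 <= L * B * (K * e * e) by rewrite !mulr_ge0 ?(ltW L0) ?(ltW B0) ?(ltW e0).
have : 0 <= L * B * (e * e) by rewrite !mulr_ge0 ?(ltW L0) ?(ltW B0) ?(ltW e0).
rewrite !expr2; set X := L * B; move=> hx hy.
have -> : e * (L * (B * (K * e))) = X * (K * e * e) by rewrite /X; ring.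
have -> : X * ((K + 1) * e * ((K + 1) * e)) = X * (K * e * (K * e)) + 2 * (X * (K * e * e)) + X * (e * e) by ring.
by move: hx hy; glra.
Qed.

Lemma truncn_approx (t N : R) : 0 <= t -> 0 < N -> (Num.truncn (t * N))%:R / N <= t /\ t - N^-1 <= (Num.truncn (t * N))%:R / N.
Proof.
move=> t0 N0; have tN : 0 <= t * N by rewrite mulr_ge0// ltW.
have /andP[h1 h2] := truncn_itv tN.
split; first by rewrite ler_pdivrMr.
rewrite ler_pdivlMr// mulrBl mulVf ?gt_eqF//.
by move: h2; rewrite -natr1 => ?; lra.
Qed.

(** The Euler polygons converge pointwise along the ultrafilter. The Taylor estimate passes to the
    limit and already contains the differential equation, so uniform convergence is not at issue. *)
Lemma ode_taylor : exists z : R -> 'rV[R]_m, [/\ z 0 = z0,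
  forall t, 0 <= t <= δ -> `|z t - z0| <= ρ &
  forall s t, 0 <= s -> s <= t -> t <= δ -> `|z t - z s - (t - s) *: F (z s)| <= L * B * (t - s) ^+ 2].
Proof.
have [V UV HV] := ultra_nat.
pose y N (t : R) := euler N (Num.truncn (t * N.+1%:R)).
have tr t N : 0 <= t <= δ -> (Num.truncn (t * N.+1%:R))%:R / N.+1%:R <= δ.
  by move=> /andP[t0 tδ]; have [h _] := truncn_approx t0 (ltr0Sn R N); exact: le_trans tδ.
have yin N t : 0 <= t <= δ -> `|y N t - z0| <= ρ by move=> tb; apply: euler_in; exact: tr.
have lim t : exists D : 'rV[R]_m, 0 <= t <= δ -> forall e : R, 0 < e -> V [set N | `|y N t - D| < e].
  have [tb|tb] := boolP (0 <= t <= δ); last by exists 0.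
  have [|D HD] := @ultra_bounded R m V (fun N => y N t) (ρ + `|z0|) UV; last by exists D.
  apply: filterS (HV 0%N) => N _ /=.
  by rewrite -(subrK z0 (y N t)); apply: le_trans (ler_normD _ _) _; rewrite lerD2r yin.
have [z Hz] := choice lim.
have zin t : 0 <= t <= δ -> `|z t - z0| <= ρ.
  move=> tb; rewrite leNgt; apply/negP => h.
  have e0 : 0 < `|z t - z0| - ρ by rewrite subr_gt0.
  have [N [/= h1 h2]] := ultra_ex2 UV (Hz t tb _ e0) (HV 0%N).
  have : `|z t - z0| <= `|y N t - z t| + `|y N t - z0|.
    by rewrite -[`|y N t - z t|]normrN opprB -{1}(subrKA (y N t)) ler_normD.
  by have := yin N t tb; lra.
exists z; split => //.
- have b0 : 0 <= (0 : R) <= δ by rewrite lexx ltW.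
  apply/eqP; rewrite -subr_eq0 -normr_eq0 eq_le normr_ge0 andbT leNgt; apply/negP => h.
  have [N [/= h1 _]] := ultra_ex2 UV (Hz 0 b0 _ h) (HV 0%N).
  by move: h1; rewrite /y mul0r truncn0 /euler/= distrC ltxx.
- move=> s t s0 st tδ.
  have sb : 0 <= s <= δ by rewrite s0 (le_trans st).
  have tb : 0 <= t <= δ by rewrite tδ (le_trans s0).
  have Fs := F_le (zin s sb).
  apply/ler_addgt0Pr => e e0.
  pose K := 2 + (t - s) * L + 2 * B + L * B * (2 * (t - s) + 1) * 1.
  have ts0 : 0 <= t - s by rewrite subr_ge0.
  have K0 : 0 < K.
    have : 0 <= L * B * (2 * (t - s) + 1) by rewrite !mulr_ge0 ?(ltW L0) ?(ltW B0)// addr_ge0// mulr_ge0.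
    have : 0 <= (t - s) * L by rewrite mulr_ge0// ltW.
    by rewrite /K; move: B0; glra.
  have [η [η0 η1 η2]] := @small2 R (e / K) 1 ltac:(by rewrite divr_gt0) ltac:(lra).
  have [N0 HN0] := inv_nat_small η0.
  have [N [/= h1 [h2 h3]]] := ultra_ex3 UV (Hz t tb η η0) (Hz s sb η η0) (HV N0).
  have {h3} hN := HN0 N h3.
  have [a1 a2] := truncn_approx s0 (ltr0Sn R N).
  have [b1 b2] := truncn_approx (le_trans s0 st) (ltr0Sn R N).
  have jk : (Num.truncn (s * N.+1%:R) <= Num.truncn (t * N.+1%:R))%N.
    by apply: le_truncn; rewrite ler_wpM2r.
  pose k := (Num.truncn (t * N.+1%:R) - Num.truncn (s * N.+1%:R))%N.
  have Ek : (Num.truncn (s * N.+1%:R) + k = Num.truncn (t * N.+1%:R))%N by rewrite subnKC.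
  have := @euler_taylor N (Num.truncn (s * N.+1%:R)) k; rewrite Ek => /(_ (tr t N tb)).
  rewrite -/(y N t) -/(y N s).
  have Ek' : (k%:R / N.+1%:R : R) = (Num.truncn (t * N.+1%:R))%:R / N.+1%:R - (Num.truncn (s * N.+1%:R))%:R / N.+1%:R.
    by rewrite natrB// mulrBl.
  rewrite Ek'; move: a1 a2 b1 b2; set p := _ / _; set q := (Num.truncn (t * _))%:R / _ => a1 a2 b1 b2 T.
  have L1 := F_lip (yin N s sb) (zin s sb).
  have -> : z t - z s - (t - s) *: F (z s) = (y N t - y N s - (q - p) *: F (y N s))
     - (y N t - z t) + (y N s - z s) + ((q - p) - (t - s)) *: F (y N s) + (t - s) *: (F (y N s) - F (z s)).
    by apply/rowP => w; rewrite !mxE; ring.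
  have Fy := F_le (yin N s sb).
  have qp0 : 0 <= q - p by rewrite /q /p -Ek' divr_ge0.
  clear Ek'; clearbody p q.
  have qp : `|(q - p) - (t - s)| <= η.
    by rewrite ler_norml; move: a1 a2 b1 b2 hN; move: (N.+1%:R^-1 : R) => ν; glra.
  have n1 : `|(q - p - (t - s)) *: F (y N s)| <= η * B by rewrite normrZ ler_pM.
  have n2 : `|(t - s) *: (F (y N s) - F (z s))| <= (t - s) * (L * η).
    rewrite normrZ ger0_norm// ler_wpM2l//; apply: le_trans L1 _.
    by rewrite ler_wpM2l ?(ltW L0)// ltW.
  have n3 : L * B * (q - p) ^+ 2 <= L * B * (t - s) ^+ 2 + L * B * (2 * (t - s) + 1) * η.
    rewrite -(mulrA (L * B) (2 * _ + 1)) -mulrDr ler_wpM2l//; first by rewrite mulr_ge0 ?(ltW L0) ?(ltW B0).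
    move: qp; rewrite ler_norml => /andP[_ qp].
    have : (q - p) ^+ 2 <= (t - s + η) ^+ 2 by rewrite ler_sqr ?nnegrE; move: qp qp0 ts0 η0; glra.
    have : η * η <= η * 1 by rewrite ler_wpM2l// ltW.
    have -> : (t - s + η) ^+ 2 = (t - s) ^+ 2 + 2 * (t - s) * η + η * η by ring.
    by rewrite mulrDl; glra.
  apply: le_trans (normD5 _ _ _ _ _) _.
  have Kη : η * K <= e by rewrite -ler_pdivlMr.
  have : η * K = η + η + (t - s) * (L * η) + η * B + η * B + L * B * (2 * (t - s) + 1) * η by rewrite /K; ring.
  have : 0 < η * B by rewrite mulr_gt0.
  move: n1 n2 n3 T h1 h2 Kη. 
  set x1 := `|_|; set x2 := `|_|; set x3 := `|_|; set x4 := `|_|; set x5 := `|_|; glra.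
Qed.

Lemma ode_exists : exists z : R -> 'rV[R]_m, [/\ z 0 = z0,
  forall t, 0 <= t <= δ -> `|z t - z0| <= ρ &
  forall t : R, 0 <= t < δ -> is_derive t 1 z (F (z t))].
Proof.
have [z [zz zin T]] := ode_taylor.
(* The affine continuation to negative times provides a two-sided derivative at 0. *)
pose w t := if t < 0 then z0 + t *: F z0 else z t.
have wE t : 0 <= t -> w t = z t by move=> t0; rewrite /w ltNge t0.
exists w; split; first by rewrite wE.
  by move=> t tb; rewrite wE; [exact: zin|case/andP: tb].
have C0 : 0 < L * B by rewrite mulr_gt0.
have zl s t : 0 <= s -> s <= t -> t <= δ -> `|z t - z s| <= (B + L * B * (t - s)) * (t - s).
  move=> s0 st tδ; have ts0 : 0 <= t - s by rewrite subr_ge0.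
  rewrite -(subrK ((t - s) *: F (z s)) (z t - z s)); apply: le_trans (ler_normD _ _) _.
  rewrite mulrDl addrC -mulrA -expr2; apply: lerD; last exact: T.
  by rewrite normrZ ger0_norm// mulrC ler_wpM2r// F_le// zin// s0 (le_trans st).
move=> t /andP[t0 tδ]; rewrite wE//.
apply: eps_is_derive => e e0.
pose K := L * B + L * (B + L * B).
have K0 : 0 < K by rewrite addr_gt0// mulr_gt0// addr_gt0.
have [h [h0 h1 h2 h3]] := @small4 R (if t == 0 then 1 else t) (δ - t) (e / K) 1
  ltac:(by case: eqP => // /eqP; rewrite lt_def t0 andbT) ltac:(by rewrite subr_gt0) ltac:(by rewrite divr_gt0) ltac:(lra).
move=> h4; exists h => // s sh.
have Ke x : 0 <= x -> x < h -> K * (x * x) <= e * x.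
  move=> x0 xh; rewrite mulrA ler_wpM2r// mulrC -ler_pdivlMr//; apply: le_trans h3; exact: ltW.
have [ts|st] := leP t s.
  have ts0 : 0 <= s - t by rewrite subr_ge0.
  rewrite (ger0_norm ts0) in sh *; rewrite !wE//; last exact: le_trans ts.
  apply: le_trans (T t s t0 ts _) _; first by move: sh h2; lra.
  apply: le_trans (Ke _ ts0 sh); rewrite expr2 ler_wpM2r ?mulr_ge0//.
  by rewrite /K lerDl mulr_ge0 ?(ltW L0)// addr_ge0 ?(ltW B0)// ltW.
move: h1; case: eqP => [tz|/eqP tnz] h1.
  have -> : w s = z0 + s *: F z0 by rewrite /w -tz st.
  by rewrite tz wE// zz subr0 [z0 + _]addrC addrK subrr normr0 mulr_ge0// ltW.
have st0 : 0 <= t - s by rewrite subr_ge0 ltW.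
rewrite distrC (ger0_norm st0) in sh *.
have s0 : 0 <= s by move: sh h1; lra.
have sδ : s <= δ by move: st tδ; lra.
rewrite !wE//.
have -> : z s - z t - (s - t) *: F (z t) = - (z t - z s - (t - s) *: F (z s)) + (t - s) *: (F (z t) - F (z s)).
  by apply/rowP => q; rewrite !mxE; ring.
apply: le_trans (ler_normD _ _) _; rewrite normrN normrZ (ger0_norm st0).
have n1 := T s t s0 (ltW st) (ltW tδ).
have n2 : (t - s) * `|F (z t) - F (z s)| <= (t - s) * (L * ((B + L * B) * (t - s))).
  rewrite ler_wpM2l//; apply: le_trans (F_lip _ _) _.
  - by apply: zin; rewrite t0 ltW.
  - by apply: zin; rewrite s0.
  - rewrite ler_wpM2l ?(ltW L0)//; apply: le_trans (zl _ _ s0 (ltW st) (ltW tδ)) _.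
    rewrite ler_wpM2r// lerD2l ler_piMr ?(ltW C0)//; apply: le_trans h4; exact: ltW.
have := Ke _ st0 sh.
have -> : K * ((t - s) * (t - s)) = L * B * (t - s) ^+ 2 + (t - s) * (L * ((B + L * B) * (t - s))).
  by rewrite /K expr2; ring.
by move: n1 n2; glra.
Qed.

End Ode.

(** * Uniqueness for short times *)

Section ShortTimeUniqueness.
Context {R : realType} {n : nat}.

Lemma contraction_eq0 (T : Type) (I : set T) (S : T -> R) (m0 : R) : 
  (forall t, I t -> 0 <= S t) -> (forall t, I t -> S t <= m0) ->
  (forall m, 0 <= m -> (forall t, I t -> S t <= m) -> forall t, I t -> S t <= m / 2) ->
  forall t, I t -> S t = 0.
Proof.
move=> S0 Sm H t It.
have hs : has_sup (S @` I).
  by split; [exists (S t), t|exists m0 => _ [s Is <-]; exact: Sm].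
have le s : I s -> S s <= sup (S @` I) by move=> Is; apply: (ub_le_sup hs.2); exists s.
have s0 := le_trans (S0 t It) (le t It).
have h : sup (S @` I) <= sup (S @` I) / 2.
  by apply: ge_sup; [exact: hs.1|move=> _ [s Is <-]; exact: H].
apply/eqP; rewrite eq_le S0// andbT; apply: le_trans (le t It) _; alra.
Qed.

(** The last two hypotheses bound a difference by the length of the interval times a bound on its
    derivative; for initial data they come from the mean value theorem, for boundary data from
    Rolle. With the constants [4^-1], each of the two norms is at most a quarter of any bound on
    their sum, so the sum is halved, hence zero. *)
Lemma second_order_unique (F : 'rV[R]_n -> 'rV[R]_n -> 'rV[R]_n) (P : 'rV[R]_n -> 'rV[R]_n -> Prop)
    (x x' y y' : R -> 'rV[R]_n) (t1 t2 K B : R) :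
  0 <= K -> t2 - t1 <= 4^-1 -> K * (t2 - t1) <= 4^-1 ->
  (forall a v b w, P a v -> P b w -> `|F a v - F b w| <= K * (`|a - b| + `|v - w|)) ->
  (forall t, t1 < t < t2 -> [/\ P (x t) (x' t), P (y t) (y' t), `|x t - y t| <= B & `|x' t - y' t| <= B]) ->
  (forall m k, 0 <= m -> (forall t, t1 < t < t2 -> `|x' t 0 k - y' t 0 k| <= m) ->
     forall t, t1 < t < t2 -> `|x t 0 k - y t 0 k| <= m * (t2 - t1)) ->
  (forall m k, 0 <= m -> (forall t, t1 < t < t2 -> `|F (x t) (x' t) 0 k - F (y t) (y' t) 0 k| <= m) ->
     forall t, t1 < t < t2 -> `|x' t 0 k - y' t 0 k| <= m * (t2 - t1)) ->
  forall t, t1 < t < t2 -> x t = y t /\ x' t = y' t.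
Proof.
move=> K0 t14 Kt Flip D h1 h2 t tI.
have S0 : `|x t - y t| + `|x' t - y' t| = 0.
  apply: (@contraction_eq0 _ [set t | t1 < t < t2] (fun t => `|x t - y t| + `|x' t - y' t|) (B + B)) => //.
    by move=> s /D[_ _ ? ?]; exact: lerD.
  move=> m m0 H s sI /=.
  have d0 : 0 <= t2 - t1 by move: sI; alra.
  have a1 k w : t1 < w < t2 -> `|x' w 0 k - y' w 0 k| <= m / 4.
    move=> wI; apply: le_trans (h2 (K * m) k _ _ w wI) _; first by rewrite mulr_ge0.
      move=> v vI; have [p1 p2 _ _] := D v vI.
      have := coord_norm_le (F (x v) (x' v) - F (y v) (y' v)) 0 k; rewrite !mxE => h.
      apply: le_trans h (le_trans (Flip _ _ _ _ p1 p2) _); rewrite ler_wpM2l//; exact: H.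
    by rewrite mulrAC mulrC ler_wpM2l.
  have a2 k w : t1 < w < t2 -> `|x w 0 k - y w 0 k| <= m / 4.
    move=> wI; apply: le_trans (h1 m k m0 _ w wI) _; last by rewrite ler_wpM2l.
    by move=> v vI; apply: le_trans (a1 k v vI) _; alra.
  have m4 : 0 <= m / 4 by rewrite divr_ge0.
  have -> : m / 2 = m / 4 + m / 4 by alra.
  by apply: lerD; apply/mx_norm_leP => // p q; rewrite !mxE (ord1 p); [exact: a2|exact: a1].
move/eqP: S0; rewrite paddr_eq0// !normr_eq0 !subr_eq0 => /andP[/eqP -> /eqP ->].
by [].
Qed.

Lemma ivp_unique (F : 'rV[R]_n -> 'rV[R]_n -> 'rV[R]_n) (P : 'rV[R]_n -> 'rV[R]_n -> Prop)
    (x x' y y' : R -> 'rV[R]_n) (t1 t2 K B : R) :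
  0 <= K -> t2 - t1 <= 4^-1 -> K * (t2 - t1) <= 4^-1 ->
  (forall a v b w, P a v -> P b w -> `|F a v - F b w| <= K * (`|a - b| + `|v - w|)) ->
  (forall t, t1 < t < t2 -> [/\ P (x t) (x' t), P (y t) (y' t), `|x t - y t| <= B & `|x' t - y' t| <= B]) ->
  (forall t : R, t1 <= t < t2 -> is_derive t 1 x (x' t) /\ is_derive t 1 x' (F (x t) (x' t))) ->
  (forall t : R, t1 <= t < t2 -> is_derive t 1 y (y' t) /\ is_derive t 1 y' (F (y t) (y' t))) ->
  x t1 = y t1 -> x' t1 = y' t1 ->
  forall t, t1 < t < t2 -> x t = y t /\ x' t = y' t.
Proof.
move=> K0 t14 Kt Flip D dx dy e1 e2.
have mv (f f' : R -> R) m : 0 <= m -> f t1 = 0 -> (forall t, t1 <= t < t2 -> is_derive t 1 f (f' t)) ->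
    f' t1 = 0 \/ True -> (forall t, t1 < t < t2 -> `|f' t| <= m) -> `|f' t1| <= m ->
    forall t, t1 < t < t2 -> `|f t| <= m * (t2 - t1).
  move=> m0 f0 df _ fm fm1 t /andP[h1 h2].
  have [|s sb E] := @mvt_is_derive R f f' t1 t (ltW h1).
    by move=> s /andP[s1 s2]; apply: df; rewrite s1 (le_lt_trans s2).
  have -> : f t = f' s * (t - t1) by rewrite -E f0 subr0.
  have tt1 : 0 <= t - t1 by rewrite subr_ge0 ltW.
  rewrite normrM (ger0_norm tt1); apply: ler_pM => //; last by move: h2; alra.
  case/andP: sb => s1 s2; move: s1; rewrite le_eqVlt => /predU1P[<-//|s1].
  by apply: fm; rewrite s1 (le_lt_trans s2).
have dxk (u : R -> 'rV[R]_n) (t : R) v k : is_derive t 1 u v -> is_derive t 1 (fun s => u s 0 k) (v 0 k).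
  by move/is_derive_mxP; apply.
apply: (@second_order_unique F P x x' y y' t1 t2 K B) => //.
- move=> m k m0 fm; apply: (mv (fun t => x t 0 k - y t 0 k) (fun t => x' t 0 k - y' t 0 k)) => //.
  + by rewrite e1 subrr.
  + by move=> t tb; apply: is_derive_sub; apply: dxk; [exact: (dx t tb).1|exact: (dy t tb).1].
  + by right.
  + by rewrite e2 subrr normr0.
- move=> m k m0 fm; apply: (mv (fun t => x' t 0 k - y' t 0 k) (fun t => F (x t) (x' t) 0 k - F (y t) (y' t) 0 k)) => //.
  + by rewrite e2 subrr.
  + by move=> t tb; apply: is_derive_sub; apply: dxk; [exact: (dx t tb).2|exact: (dy t tb).2].
  + by right.
  + by rewrite e1 e2 subrr normr0.
Qed.

(** Each coordinate of [x - y] vanishes at both ends, so its derivative has a zero in between. That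
    zero depends on the coordinate, which is why [second_order_unique] works coordinatewise.
    Derivatives are required in the open interval only, since a minimizer is not yet known to be
    differentiable at its ends. *)
Lemma bvp_unique (F : 'rV[R]_n -> 'rV[R]_n -> 'rV[R]_n) (P : 'rV[R]_n -> 'rV[R]_n -> Prop)
    (x x' y y' : R -> 'rV[R]_n) (t1 t2 K B : R) :
  0 <= K -> t2 - t1 <= 4^-1 -> K * (t2 - t1) <= 4^-1 ->
  (forall a v b w, P a v -> P b w -> `|F a v - F b w| <= K * (`|a - b| + `|v - w|)) ->
  (forall t, t1 < t < t2 -> [/\ P (x t) (x' t), P (y t) (y' t), `|x t - y t| <= B & `|x' t - y' t| <= B]) ->
  (forall t : R, t1 < t < t2 -> is_derive t 1 x (x' t) /\ is_derive t 1 x' (F (x t) (x' t))) ->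
  (forall t : R, t1 < t < t2 -> is_derive t 1 y (y' t) /\ is_derive t 1 y' (F (y t) (y' t))) ->
  {within `[t1, t2], continuous x} -> {within `[t1, t2], continuous y} ->
  x t1 = y t1 -> x t2 = y t2 ->
  forall t, t1 < t < t2 -> x t = y t /\ x' t = y' t.
Proof.
move=> K0 t14 Kt Flip D dx dy cx cy e1 e2.
have dxk (u : R -> 'rV[R]_n) (t : R) v k : is_derive t 1 u v -> is_derive t 1 (fun s => u s 0 k) (v 0 k).
  by move/is_derive_mxP; apply.
have ck (u : R -> 'rV[R]_n) a b k : {within `[a, b], continuous u} -> {within `[a, b], continuous (fun s => u s 0 k)}.
  move=> cu s; apply: (@continuous_comp _ _ _ (u : subspace `[a, b] -> _) (fun z : 'rV[R]_n => z 0 k)).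
    exact: cu.
  exact: coord_continuous.
apply: (@second_order_unique F P x x' y y' t1 t2 K B) => //.
- move=> m k m0 fm t /andP[h1 h2].
  have [||s /andP[]] := @MVT R (fun t => x t 0 k - y t 0 k) (fun t => x' t 0 k - y' t 0 k) t1 t h1.
  + move=> s; rewrite in_itv/= => /andP[s1 s2].
    have sI : t1 < s < t2 by rewrite s1 (lt_trans s2).
    by apply: is_derive_sub; apply: dxk; [exact: (dx s sI).1|exact: (dy s sI).1].
  + apply: (@continuous_subspaceW _ _ _ `[t1, t2]).
      by move=> s /=; rewrite !in_itv/= => /andP[-> /le_trans ->//]; exact: ltW.
    by move=> s; apply: continuousB; apply: ck.
  rewrite !bnd_simp => s1 s2; rewrite e1 subrr subr0 => ->.
  have tt1 : 0 <= t - t1 by rewrite subr_ge0 ltW.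
  rewrite normrM (ger0_norm tt1); apply: ler_pM => //; last by move: h2; alra.
  by apply: fm; rewrite s1 (lt_trans s2).
- move=> m k m0 fm t /andP[h1 h2].
  have t12 := lt_trans h1 h2.
  have dφ s : t1 < s < t2 -> is_derive s 1 (fun t => x t 0 k - y t 0 k) (x' s 0 k - y' s 0 k).
    by move=> sI; apply: is_derive_sub; apply: dxk; [exact: (dx s sI).1|exact: (dy s sI).1].
  have [|||s] := @Rolle R (fun t => x t 0 k - y t 0 k) t1 t2 t12.
  + by move=> s; rewrite in_itv/= => sI; have [] := dφ s sI.
  + by move=> s; apply: continuousB; apply: ck.
  + by rewrite e1 e2 !subrr.
  rewrite in_itv/= => sI d0.
  have E0 := is_derive_unique (dφ s sI) d0.
  have [|w wb E] := @mvt_between R (fun t => x' t 0 k - y' t 0 k) (fun t => F (x t) (x' t) 0 k - F (y t) (y' t) 0 k) s t.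
    move=> w wb; have wI : t1 < w < t2.
      by move: wb sI h1 h2; rewrite minElt maxElt; case: ifP => _; alra.
    by apply: is_derive_sub; apply: dxk; [exact: (dx w wI).2|exact: (dy w wI).2].
  have wI : t1 < w < t2.
    by move: wb sI h1 h2; rewrite minElt maxElt; case: ifP => _; alra.
  move: E; rewrite E0 subr0 => ->; rewrite normrM; apply: ler_pM => //; first exact: fm.
  by rewrite ler_norml; move: sI h1 h2; alra.
Qed.

End ShortTimeUniqueness.

Section AccelerationBounds.
Context {R : realType} {n : nat} {M : topologicalType}.
Context {A : smooth_manifold R n M}.
Context (g : riemannian_metric A).
Implicit Types (i : chart_index A).

Lemma christoffel_smooth i k a b : smooth (chart_img i) (fun x => christoffel g i x k a b).
Proof.
move=> d; have oI := @chart_img_open' _ _ _ A i.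
have cp p q l : Ck d (chart_img i) (fun x => partial (fun y => gmx g i y p q) l x).
  exact: smooth_derive (gmx_smooth g i p q) d.
rewrite /christoffel; apply: Ck_mul => //; first exact: Ck_cst.
apply: Ck_sum => // l; apply: Ck_mul => //.
  apply: smooth_invmx => // [x xI|p q]; last exact: gmx_smooth.
  by apply: gnorm_unit; exact: gmx_metric.
apply: (Ck_ext (f := fun x => partial (fun y => gmx g i y b l) a x + partial (fun y => gmx g i y a l) b x
   + (-1) * partial (fun y => gmx g i y a b) l x)) => // [x _|]; first by rewrite mulN1r.
apply: Ck_add => //; first exact: Ck_add.
by apply: Ck_mul => //; exact: Ck_cst.
Qed.

Definition christoffel_mx i k x : 'M[R]_n := \matrix_(a, b) christoffel g i x k a b.

Lemma acceleration_bilin i x v k : acceleration g i x v 0 k = - bilin (christoffel_mx i k x) v v.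
Proof.
rewrite mxE bilinE; congr (- _); apply: eq_bigr => a _; apply: eq_bigr => b _.
by rewrite [christoffel_mx _ _ _ _ _]mxE [v 0 a * _]mulrC.
Qed.

Lemma bilin_diff (G H : 'M[R]_n) v w : - bilin G v v - - bilin H w w =
  - (bilin (G - H) v v + bilin H (v - w) v + bilin H w (v - w)).
Proof.
rewrite -bilinB; have e : v = (v - w) + w by rewrite subrK.
have -> : bilin H (v - w) v = bilin H v v - bilin H w v.
  by rewrite {3}e [bilin H (v - w + w) v]bilinDl addrK.
have -> : bilin H w (v - w) = bilin H w v - bilin H w w.
  by rewrite {2}e [bilin H w (v - w + w)]bilinDr addrK.
alra.
Qed.

Lemma acceleration_lip i x0 (V : R) : chart_img i x0 -> 0 < V -> exists r K : R, [/\ 0 < r, 0 < K,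
  forall x, `|x - x0| < r -> chart_img i x,
  forall x v, `|x - x0| < r -> `|v| <= V -> `|acceleration g i x v| <= K &
  forall x y v w, `|x - x0| < r -> `|y - x0| < r -> `|v| <= V -> `|w| <= V ->
    `|acceleration g i x v - acceleration g i y w| <= K * (`|x - y| + `|v - w|)].
Proof.
move=> Ix0 V0; have oI := @chart_img_open' _ _ _ A i.
have [r1 r10 Hr1] := open_ball_sub oI Ix0.
pose P (kab : 'I_n * ('I_n * 'I_n)) (d : R) :=
  forall x y, `|x - x0| < d -> `|y - x0| < d ->
   `|christoffel g i x kab.1 kab.2.1 kab.2.2| <= d^-1 /\
   `|christoffel g i x kab.1 kab.2.1 kab.2.2 - christoffel g i y kab.1 kab.2.1 kab.2.2| <= d^-1 * `|x - y|.
have [||d d0 Hd] := @common_radius R _ P.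
- move=> [k [a b]] d e e0 ed; rewrite /P/= => H x y xe ye.
  have de : d^-1 <= e^-1 by rewrite lef_pV2 ?posrE//; exact: lt_le_trans ed.
  have [h1 h2] := H x y (lt_le_trans xe ed) (lt_le_trans ye ed).
  split; first exact: le_trans de.
  by apply: le_trans h2 _; rewrite ler_wpM2r.
- move=> [k [a b]]; rewrite /P/=; set f := fun x => christoffel g i x k a b.
  have [r2 [L2 [r20 L20 H2]]] := C1_locally_lipschitz oI Ix0 (@christoffel_smooth i k a b 1%N).
  have f0 := normr_ge0 (f x0).
  have Lr : 0 < L2 * r2 by rewrite mulr_gt0.
  have i2 : 0 < r2^-1 by rewrite invr_gt0.
  pose B := L2 + `|f x0| + L2 * r2 + r2^-1.
  have B0 : 0 < B by rewrite /B; move: L20 f0 Lr i2; glra.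
  have Br2 : B^-1 <= r2 by rewrite -[leRHS]invrK lef_pV2 ?posrE// /B; move: L20 f0 Lr i2; glra.
  have x02 : `|x0 - x0| < r2 by rewrite subrr normr0.
  exists B^-1; first by rewrite invr_gt0.
  rewrite invrK => x y xB yB; have x2 := lt_le_trans xB Br2; have y2 := lt_le_trans yB Br2.
  split.
    have h := H2 x0 x x02 x2.
    have h' : L2 * `|x - x0| <= L2 * r2 by rewrite ler_wpM2l ?ltW.
    rewrite -/(f x) -(subrK (f x0) (f x)); apply: le_trans (ler_normD _ _) _.
    by move: h h' L20 i2; rewrite -/(f x) -/(f x0) /B; glra.
  apply: le_trans (H2 _ _ y2 x2) _; rewrite ler_wpM2r// /B; move: f0 Lr i2; glra.
have [r [r0 rd rr1]] := small2 d0 r10.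
pose K := n%:R ^+ 2 * d^-1 * (V * V) + 2 * (n%:R ^+ 2 * d^-1 * V) + 1.
have nd : 0 <= n%:R ^+ 2 * d^-1 by rewrite mulr_ge0 ?sqr_ge0// invr_ge0 ltW.
have nd1 : 0 <= n%:R ^+ 2 * d^-1 * (V * V) by rewrite mulr_ge0// mulr_ge0// ltW.
have nd2 : 0 <= n%:R ^+ 2 * d^-1 * V by rewrite mulr_ge0// ltW.
have K0 : 0 < K by rewrite /K; move: nd1 nd2; glra.
have cm x k : `|x - x0| < r -> forall p q, `|christoffel_mx i k x p q| <= d^-1.
  by move=> xr p q; rewrite mxE; have [] := Hd (k, (p, q)) x x (lt_le_trans xr rd) (lt_le_trans xr rd).
exists r, K; split => //.
- by move=> x xr; apply: Hr1; exact: lt_le_trans rr1.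
- move=> x v xr vV; apply/mx_norm_leP => [|p k]; first exact: ltW.
  rewrite (ord1 p) acceleration_bilin normrN; apply: le_trans (bilin_le v v (cm x k xr)) _.
  have : n%:R ^+ 2 * d^-1 * (`|v| * `|v|) <= n%:R ^+ 2 * d^-1 * (V * V) by rewrite ler_wpM2l// ler_pM.
  by rewrite mulrA /K; move: nd2; glra.
- move=> x y v w xr yr vV wV; apply/mx_norm_leP => [|p k].
    by apply: mulr_ge0; [exact: ltW|exact: addr_ge0].
  have -> : (acceleration g i x v - acceleration g i y w) p k = acceleration g i x v 0 k - acceleration g i y w 0 k.
    by rewrite (ord1 p) mxE [(- acceleration g i y w) 0 k]mxE.
  rewrite !acceleration_bilin.
  rewrite bilin_diff normrN; apply: le_trans (ler_normD _ _) _.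
  have s1 : `|bilin (christoffel_mx i k x - christoffel_mx i k y) v v| <= n%:R ^+ 2 * d^-1 * (V * V) * `|x - y|.
    apply: le_trans (bilin_le (b := d^-1 * `|x - y|) v v _) _.
      move=> a b; rewrite !mxE.
      by have [] := Hd (k, (a, b)) x y (lt_le_trans xr rd) (lt_le_trans yr rd).
    have -> : n%:R ^+ 2 * (d^-1 * `|x - y|) * `|v| * `|v| = n%:R ^+ 2 * d^-1 * `|x - y| * (`|v| * `|v|) by ring.
    by rewrite [leRHS]mulrAC; apply: ler_wpM2l; [exact: mulr_ge0|exact: ler_pM].
  have s2 : `|bilin (christoffel_mx i k y) (v - w) v| <= n%:R ^+ 2 * d^-1 * V * `|v - w|.
    apply: le_trans (bilin_le _ _ (cm y k yr)) _.
    by rewrite [leRHS]mulrAC ler_wpM2l// mulr_ge0.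
  have s3 : `|bilin (christoffel_mx i k y) w (v - w)| <= n%:R ^+ 2 * d^-1 * V * `|v - w|.
    by apply: le_trans (bilin_le _ _ (cm y k yr)) _; rewrite ler_wpM2r// ler_wpM2l.
  have s4 := ler_normD (bilin (christoffel_mx i k x - christoffel_mx i k y) v v) (bilin (christoffel_mx i k y) (v - w) v).
  have -> : K * (`|x - y| + `|v - w|) = n%:R ^+ 2 * d^-1 * (V * V) * `|x - y| + 2 * (n%:R ^+ 2 * d^-1 * V * `|v - w|)
     + (n%:R ^+ 2 * d^-1 * (V * V) * `|v - w| + 2 * (n%:R ^+ 2 * d^-1 * V * `|x - y|) + `|x - y| + `|v - w|).
    by rewrite /K; ring.
  have p1 : 0 <= n%:R ^+ 2 * d^-1 * (V * V) * `|v - w| by rewrite mulr_ge0.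
  have p2 : 0 <= n%:R ^+ 2 * d^-1 * V * `|x - y| by rewrite mulr_ge0.
  have p3 := normr_ge0 (x - y); have p4 := normr_ge0 (v - w).
  by move: s1 s2 s3 s4 p1 p2 p3 p4; glra.
Qed.

End AccelerationBounds.

Lemma lip_within {R : realType} {V : normedModType R} (f : R -> V) (a b C : R) : 0 <= C ->
  (forall s t, a <= s <= b -> a <= t <= b -> `|f s - f t| <= C * `|s - t|) -> {within `[a, b], continuous f}.
Proof.
move=> C0 H; apply/subspace_continuousP => t /=; rewrite in_itv/= => tab.
apply/cvgrPdist_lt => e e0; rewrite near_withinE.
exists (e / (C + 1)) => /=; first by rewrite divr_gt0// ltr_wpDl.
move=> s /= st; rewrite in_itv/= => sab; apply: le_lt_trans (H t s tab sab) _.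
apply: (@le_lt_trans _ _ ((C + 1) * `|t - s|)); first by rewrite ler_wpM2r// lerDl.
by rewrite mulrC -ltr_pdivlMr// ltr_wpDl.
Qed.

(** * Geodesics extend minimizers *)

Section GeodesicExtension.
Context {R : realType} {n : nat} {M : topologicalType}.
Context {A : smooth_manifold R n M}.
Context (g : riemannian_metric A) (hg : complete_riemannian g).
Local Notation dist := (dist g).
Local Notation Nrm i x := (gnorm (gmx g i x)).
Implicit Types (i : chart_index A) (γ : R -> M).

Lemma dist_fin p q (d : R) : (dist p q <= d%:E)%E -> exists D : R, [/\ dist p q = D%:E, 0 <= D & D <= d].
Proof.
have := dist_ge0 g p q; case: (dist p q) => [D| |] //=; rewrite !lee_fin => D0 Dd.
by exists D.
Qed.

Lemma minimizer_sub (κ a b a' b' : R) γ : minimizer g κ a b γ -> a <= a' -> b' <= b -> minimizer g κ a' b' γ.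
Proof.
by move=> m aa bb s t /andP[s1 s2] /andP[t1 t2]; apply: m; apply/andP; split;
  [exact: le_trans s1|exact: le_trans bb|exact: le_trans t1|exact: le_trans bb].
Qed.

Lemma minimizer_eq (κ a b : R) γ γ' : (forall t, a <= t <= b -> γ t = γ' t) ->
  minimizer g κ a b γ -> minimizer g κ a b γ'.
Proof. by move=> e m s t sa ta; rewrite -!e// m. Qed.

Lemma minimizer_rev (κ a b : R) γ : minimizer g κ a b γ -> minimizer g κ (- b) (- a) (fun t => γ (- t)).
Proof.
move=> m s t /andP[s1 s2] /andP[t1 t2]; rewrite m.
- by rewrite opprK addrC distrC.
- by rewrite lerNr s2 lerNl s1.
- by rewrite lerNr t2 lerNl t1.
Qed.

Lemma minimizer_affine (κ a b d p : R) γ : 0 <= κ -> a < b -> minimizer g 1 0 d γ -> κ * (b - a) = d ->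
  minimizer g κ a b (fun t => γ (κ * (t - a))).
Proof.
move=> κ0 ab m E s t /andP[s1 s2] /andP[t1 t2].
rewrite m; first by rewrite mul1r -mulrBr opprB addrA subrK normrM ger0_norm.
- by rewrite mulr_ge0 ?subr_ge0//= -E ler_wpM2l// lerB.
- by rewrite mulr_ge0 ?subr_ge0//= -E ler_wpM2l// lerB.
Qed.

Lemma mvt_lip (x x' : R -> 'rV[R]_n) (t0 h V : R) :
  (forall t : R, `|t - t0| < h -> is_derive t 1 x (x' t) /\ `|x' t| <= V) -> 0 <= V ->
  forall s t, `|s - t0| < h -> `|t - t0| < h -> `|x t - x s| <= V * `|t - s|.
Proof.
move=> H V0 s t sh th; apply/mx_norm_leP => [|p k]; first exact: mulr_ge0.
rewrite (ord1 p) !mxE.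
have [|c cb ->] := @mvt_between R (fun t => x t 0 k) (fun t => x' t 0 k) s t.
  move=> w wb; have [|/is_derive_mxP d _] := H w; last exact: d.
  by move: wb sh th; rewrite !ltr_distl minElt maxElt; case: ifP => _; alra.
rewrite normrM ler_wpM2r//; apply: le_trans (coord_norm_le _ _ _) _.
have [|//] := H c.
by move: cb sh th; rewrite !ltr_distl minElt maxElt; case: ifP => _; alra.
Qed.

(** A minimizer joining the ends of a short piece of the solution exists by [minimizer_exists]. It
    solves the same equation in the same chart with the same boundary values, so [bvp_unique]
    identifies the two curves. *)
Lemma ode_locally_minimizing i (x x' : R -> 'rV[R]_n) (t0 h0 : R) : 0 < h0 ->
  (forall t : R, `|t - t0| < h0 -> [/\ chart_img i (x t), is_derive t 1 x (x' t) &
     is_derive t 1 x' (acceleration g i (x t) (x' t))]) ->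
  exists h κ, [/\ 0 < h, h < h0, 0 <= κ & minimizer g κ (t0 - h) (t0 + h) (fun t => chart_inv i (x t))].
Proof.
move=> h00 H.
have t00 : `|t0 - t0| < h0 by rewrite subrr normr0.
have [xI0 dx0 dx'0] := H _ t00.
have [r [l [L [K [k [[r0 l0 L0 K0 k0] N1 D2 D3 D4]]]]]] := local_metric g xI0.
have [h1 h10 Hh1] := (continuous_normP _ _).1 (is_derive_continuous dx'0) 1 ltr01.
pose V1 := `|x' t0| + 1.
have V10 : 0 < V1 by rewrite /V1 ltr_wpDl.
have HV1 t : `|t - t0| < h1 -> `|x' t| <= V1.
  move=> /Hh1 th; rewrite -(subrK (x' t0) (x' t)); apply: le_trans (ler_normD _ _) _.
  by rewrite /V1 addrC lerD2l ltW.
(* A bound on the speed of the minimizer that is known before [h] is chosen: its endpoints have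
   coordinates at most [V1 * (2 * h)] apart, and [local_metric] bounds their distance. *)
pose κ0 := (1 + K * (r / 2)) * (L * V1).
have κ00 : 0 < κ0 by rewrite mulr_gt0 ?mulr_gt0// addr_gt0// mulr_gt0// divr_gt0.
pose V := V1 + κ0 / l.
have κl : 0 < κ0 / l by rewrite divr_gt0.
have V0 : 0 < V by rewrite addr_gt0.
have [r3 [K3 [r30 K30 HI HB HL]]] := acceleration_lip g xI0 V0.
have [ρ [ρ0 ρ1 ρ2]] := @small2 R (r / 4) (r3 / 4) ltac:(by rewrite divr_gt0) ltac:(by rewrite divr_gt0).
have [h2 [h20 h2a h2b h2c h2d]] := @small4 R (h0 / 2) (h1 / 2) (8^-1) (8^-1 / K3) ltac:(by rewrite divr_gt0) ltac:(by rewrite divr_gt0) ltac:(by rewrite invr_gt0) ltac:(by rewrite divr_gt0).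
have [h [hp ha hb hc]] := @small4 R h2 (k * ρ / 4 / κ0) (ρ / 2 / V1) 1 h20 ltac:(by rewrite !divr_gt0// mulr_gt0) ltac:(by rewrite !divr_gt0) ltr01 => _.
have hκ0 : κ0 * (2 * h) < k * ρ.
  have : h * κ0 <= k * ρ / 4 by rewrite -ler_pdivlMr.
  have : 0 < k * ρ by rewrite mulr_gt0.
  have -> : κ0 * (2 * h) = 2 * (h * κ0) by ring.
  by glra.
have hV1 : V1 * h <= ρ / 2 by rewrite mulrC -ler_pdivlMr.
have hin t : t0 - h <= t <= t0 + h -> [/\ `|t - t0| < h0, `|t - t0| < h1 & `|t - t0| <= h].
  move=> tb; have th : `|t - t0| <= h by rewrite ler_distl.
  by split => //; apply: le_lt_trans th _; move: ha h2a h2b hp; glra.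
have xlip s t : t0 - h <= s <= t0 + h -> t0 - h <= t <= t0 + h -> `|x t - x s| <= V1 * `|t - s|.
  have [h' [h'0 h'1 h'2]] := small2 h00 h10.
  move=> sb tb; apply: (@mvt_lip x x' t0 (2 * h) V1 _ (ltW V10)).
  - move=> w wh; split.
      by have [] := H w; first by move: wh ha h2a h00 hp; glra.
    by apply: HV1; move: wh ha h2b h10 hp; glra.
  - by have [_ _ sh] := hin s sb; move: sh hp; glra.
  - by have [_ _ th] := hin t tb; move: th hp; glra.
have xρ t : t0 - h <= t <= t0 + h -> `|x t - x t0| <= ρ / 2.
  move=> tb; have t0b : t0 - h <= t0 <= t0 + h by move: hp; glra.
  apply: le_trans (xlip t0 t t0b tb) (le_trans _ hV1); rewrite ler_wpM2l ?(ltW V10)//.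
  by have [] := hin t tb.
have ab : t0 - h <= t0 - h <= t0 + h by move: hp; glra.
have bb : t0 - h <= t0 + h <= t0 + h by move: hp; glra.
have bma : t0 + h - (t0 - h) = 2 * h by glra.
have xr t : t0 - h <= t <= t0 + h -> `|x t - x t0| < r / 2.
  by move=> /xρ xt; move: xt ρ0 ρ1 r0; glra.
set α := t0 - h in hin xlip xρ ab bb bma xr *.
set β := t0 + h in hin xlip xρ ab bb bma xr *.
have αβ : α < β by move: bma hp; glra.
have xx0 : `|x t0 - x t0| < r by rewrite subrr normr0.
have r2 : r / 2 < r by move: r0; glra.
have r20 : 0 < r / 2 by rewrite divr_gt0.
have [D [ED D0 DL]] : exists D : R, [/\ dist (chart_inv i (x α)) (chart_inv i (x β)) = D%:E, 0 <= D & D <= κ0 * (2 * h)].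
  apply: dist_fin; apply: le_trans (D2 (x t0) (x α) (x β) (r / 2) xx0 r20 r2 (xr α ab) (xr β bb)) _.
  rewrite lee_fin /κ0 -[leRHS]mulrA ler_wpM2l; [by []|by move: r20 K0 => /mulr_gt0 /[apply]; rewrite mulrC; glra|].
  have [_ /(_ (x β - x α))[_ h5]] := N1 _ xx0.
  apply: le_trans h5 _; rewrite -mulrA ler_wpM2l ?(ltW L0)//.
  by have := xlip α β ab bb; rewrite bma [`|2 * h|]gtr0_norm// mulr_gt0.
pose κ := D / (2 * h).
have h20' : 0 < 2 * h by rewrite mulr_gt0.
have κp : 0 <= κ by rewrite divr_ge0// ltW.
have κκ0 : κ <= κ0 by rewrite ler_pdivrMr.
have Eκ : κ * (β - α) = D by rewrite bma divfK// gt_eqF.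
have [σ [mσ σ0 σD]] := minimizer_exists hg ED.
pose γ t := σ (κ * (t - α)).
have mγ : minimizer g κ α β γ by exact: minimizer_affine αβ mσ Eκ.
have γα : γ α = chart_inv i (x α) by rewrite /γ subrr mulr0.
have γβ : γ β = chart_inv i (x β) by rewrite /γ Eκ.
have xI t : α <= t <= β -> chart_img i (x t) by move=> /hin[th _ _]; have [] := H t th.
have cγ t : α <= t <= β -> chart_dom i (γ t) /\ `|chart_map i (γ t) - x α| < ρ.
  move=> tb; apply: (D4 (x α) (γ t) ρ (κ0 * (2 * h))) => //.
  - by apply: lt_trans r2; exact: xr.
  - by move: ρ1 ρ0 r0; glra.
  - rewrite -γα mγ// lee_fin; apply: ler_pM => //.
    by case/andP: tb => t1 t2; rewrite distrC ger0_norm ?subr_ge0// -bma lerB.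
pose y := chart_map i \o γ.
have yr t : α <= t <= β -> `|y t - x t0| < 2 * ρ.
  move=> tb; have [_ h5] := cγ t tb; have := xρ α ab; move=> h6.
  rewrite -(subrKA (x α) (y t)); apply: le_lt_trans (ler_normD _ _) _.
  by move: h5 h6 ρ0; rewrite /y /=; glra.
have ylip s t : α <= s <= β -> α <= t <= β -> `|y s - y t| <= ((1 + K * (r / 2)) * κ) / l * `|s - t|.
  move=> sb tb.
  have [ds _] := cγ s sb; have [dt _] := cγ t tb.
  have := D3 (x t0) (y t) (y s) (r / 2) (κ * `|s - t|) xx0 r20 r2.
  rewrite /y /= !chart_mapK// mγ// lee_fin [`|t - s|]distrC => H5.
  have {}H5 : Nrm i (x t0) (y s - y t) <= (1 + K * (r / 2)) * (κ * `|s - t|).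
    apply: H5 => //.
      by apply: lt_le_trans (yr t tb) _; move: ρ1 r0; glra.
    by apply: lt_le_trans (yr s sb) _; move: ρ1 r0; glra.
  have [_ /(_ (y s - y t))[h5 _]] := N1 _ xx0.
  rewrite mulrAC ler_pdivlMr// mulrC; apply: le_trans h5 _.
  by apply: le_trans H5 _; rewrite mulrA.
have yC t : α < t < β -> [/\ is_derive t 1 y ('D_1 y t),
    is_derive t 1 (fun s => 'D_1 y s) (acceleration g i (y t) ('D_1 y t)) & `|'D_1 y t| <= V].
  move=> tI; have tb : α <= t <= β by case/andP: tI => *; rewrite !ltW.
  have [dt _] := cγ t tb.
  have [w w0 Hw] := minimizer_C1 κp mγ tI dt.
  have [|_ _ d _ Nt] := Hw t; first by rewrite subrr normr0.
  split; [exact: d|exact: (minimizer_geodesic κp mγ tI dt)|].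
  have yt : `|y t - x t0| < r by apply: lt_le_trans (yr t tb) _; move: ρ1 r0; glra.
  have [_ /(_ ('D_1 y t))[h5 _]] := N1 _ yt.
  rewrite Nt in h5.
  have : `|'D_1 y t| <= κ0 / l by rewrite ler_pdivlMr// mulrC; exact: le_trans κκ0.
  by rewrite /V; move: V10; glra.
have r3' : 2 * ρ <= r3 by move: ρ2 r30; glra.
pose P (a v : 'rV[R]_n) := `|a - x t0| < r3 /\ `|v| <= V.
have E t : α < t < β -> x t = y t /\ x' t = 'D_1 y t.
  apply: (@bvp_unique _ _ (acceleration g i) P x x' y (fun s => 'D_1 y s) α β K3 (r3 + r3 + V + V) (ltW K30)).
  - by rewrite bma; move: ha h2c hp; glra.
  - have : h * K3 <= 8^-1 by rewrite -ler_pdivlMr//; exact: le_trans h2d.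
    by rewrite bma mulrCA [K3 * h]mulrC; glra.
  - by move=> a v b w [a1 v1] [b1 w1]; exact: HL.
  - move=> s sI; have sb : α <= s <= β by case/andP: sI => *; rewrite !ltW.
    have [d1 d2 v2] := yC s sI.
    have [_ sh1 _] := hin s sb.
    have v1 : `|x' s| <= V by apply: le_trans (HV1 s sh1) _; rewrite /V lerDl ltW.
    have xs : `|x s - x t0| < r3 by move: (xρ s sb) r3' ρ0; glra.
    have ys : `|y s - x t0| < r3 by exact: lt_le_trans (yr s sb) r3'.
    split => //.
      rewrite -(subrKA (x t0)); apply: le_trans (ler_normD _ _) _; rewrite [`|x t0 - _|]distrC.
      by move: xs ys V0; glra.
    by apply: le_trans (ler_normB _ _) _; move: v1 v2 r30; glra.
  - by move=> s /andP[s1 s2]; have [|sh _ _] := hin s; [rewrite !ltW|have [] := H s sh].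
  - by move=> s sI; have [] := yC s sI.
  - by apply: (lip_within (ltW V10)) => s w sb wb; exact: xlip.
  - by apply: (lip_within _ ylip); rewrite divr_ge0 ?(ltW l0)// mulr_ge0// addr_ge0// mulr_ge0 ?(ltW K0)// ltW.
  - by rewrite /y /= γα chart_invK//; exact: xI.
  - by rewrite /y /= γβ chart_invK//; exact: xI.
exists h, κ; split => //; first by move: ha h2a hp h00; glra.
apply: minimizer_eq mγ => t; rewrite -/α -/β => tb.
case/andP: (tb) => t1 t2.
move: t1; rewrite le_eqVlt => /predU1P[<-//|t1].
move: t2; rewrite le_eqVlt => /predU1P[->//|t2].
have [|-> _] := E t; first by rewrite t1.
by rewrite /y /= chart_mapK//; have [] := cγ t tb.
Qed.

End GeodesicExtension.

(** * Prolongation of minimizers beyond their ends *)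

Section GeodesicExistence.
Context {R : realType} {n : nat} {M : topologicalType}.
Context {A : smooth_manifold R n M}.
Context (g : riemannian_metric A) (hg : complete_riemannian g).
Local Notation dist := (dist g).
Local Notation Nrm i x := (gnorm (gmx g i x)).
Implicit Types (i : chart_index A) (γ : R -> M).

(** Every [t] is interior to a minimizer, so interior regularity holds on all of [J], also where a
    minimizer is joined to its prolongation. The speed [κ] may a priori depend on [t]. *)
Definition locally_minimizing (J : set R) γ :=
  forall t, J t -> exists h κ, [/\ 0 < h, 0 <= κ & minimizer g κ (t - h) (t + h) γ].

Definition phase (z : 'rV[R]_(n + n)) i : 'rV[R]_(n + n) :=
  row_mx (rsubmx z) (acceleration g i (lsubmx z) (rsubmx z)).

Lemma norm_lsubmx (z : 'rV[R]_(n + n)) : `|lsubmx z| <= `|z|.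
Proof. by apply/mx_norm_leP => // p k; rewrite mxE; exact: coord_norm_le. Qed.

Lemma norm_rsubmx (z : 'rV[R]_(n + n)) : `|rsubmx z| <= `|z|.
Proof. by apply/mx_norm_leP => // p k; rewrite mxE; exact: coord_norm_le. Qed.

Lemma norm_row_mx (u v : 'rV[R]_n) : `|row_mx u v| <= `|u| + `|v|.
Proof.
apply/mx_norm_leP => [|p k]; first exact: addr_ge0.
rewrite (ord1 p); case: (split_ordP k) => q ->; rewrite ?row_mxEl ?row_mxEr.
  by apply: le_trans (coord_norm_le _ _ _) _; rewrite lerDl.
by apply: le_trans (coord_norm_le _ _ _) _; rewrite lerDr.
Qed.

Lemma is_derive_lsubmx (z : R -> 'rV[R]_(n + n)) (t : R) v : is_derive t 1 z v ->
  is_derive t 1 (fun s => lsubmx (z s)) (lsubmx v).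
Proof.
move/is_derive_mxP => d; apply/is_derive_mxP => p k; rewrite mxE.
by have -> : (fun s => lsubmx (z s) p k) = (fun s => z s p (lshift n k)) by apply/funext => s; rewrite mxE.
Qed.

Lemma is_derive_rsubmx (z : R -> 'rV[R]_(n + n)) (t : R) v : is_derive t 1 z v ->
  is_derive t 1 (fun s => rsubmx (z s)) (rsubmx v).
Proof.
move/is_derive_mxP => d; apply/is_derive_mxP => p k; rewrite mxE.
by have -> : (fun s => rsubmx (z s) p k) = (fun s => z s p (rshift n k)) by apply/funext => s; rewrite mxE.
Qed.

Lemma is_derive_shift (V : normedModType R) (f : R -> V) (p t : R) (v : V) :
  is_derive (t - p) 1 f v -> is_derive t 1 (fun s => f (s - p)) v.
Proof.
move=> d; have := @is_derive_affine R V f (- p) t 1 v.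
rewrite mulr1 addrC scale1r => /(_ d).
by have -> : (fun s => f (- p + s * 1)) = (fun s => f (s - p)) by apply/funext => s; rewrite mulr1 addrC.
Qed.

Lemma second_order_ode i (x0 v0 : 'rV[R]_n) (r V ρ K δ : R) : 0 < δ -> 0 < V -> 0 < K -> (V + K) * δ <= ρ ->
  (forall x v, `|x - x0| <= ρ -> `|v - v0| <= ρ -> `|v| <= V /\ `|acceleration g i x v| <= K) ->
  (forall x y v w, `|x - x0| <= ρ -> `|y - x0| <= ρ -> `|v - v0| <= ρ -> `|w - v0| <= ρ ->
    `|acceleration g i x v - acceleration g i y w| <= K * (`|x - y| + `|v - w|)) ->
  exists X X' : R -> 'rV[R]_n, [/\ X 0 = x0, X' 0 = v0,
   forall t, 0 <= t <= δ -> `|X t - x0| <= ρ /\ `|X' t - v0| <= ρ &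
   forall t : R, 0 <= t < δ -> is_derive t 1 X (X' t) /\ is_derive t 1 X' (acceleration g i (X t) (X' t))].
Proof.
move=> δ0 V0 K0 hδ HB HL.
have sub z : `|z - row_mx x0 v0| <= ρ -> `|lsubmx z - x0| <= ρ /\ `|rsubmx z - v0| <= ρ.
  move=> h; split.
    have -> : lsubmx z - x0 = lsubmx (z - row_mx x0 v0) by rewrite linearB/= row_mxKl.
    exact: le_trans (norm_lsubmx _) h.
  have -> : rsubmx z - v0 = rsubmx (z - row_mx x0 v0) by rewrite linearB/= row_mxKr.
  exact: le_trans (norm_rsubmx _) h.
have [||z zh|z w zh wh|z [z0 zb dz]] := @ode_exists R (n + n) (fun z => phase z i) (row_mx x0 v0) (V + K) (1 + K * 2) ρ δ _ _ δ0 hδ.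
- exact: addr_gt0.
- by rewrite addr_gt0// mulr_gt0.
- have [h1 h2] := sub z zh; have [h3 h4] := HB _ _ h1 h2.
  by apply: le_trans (norm_row_mx _ _) _; exact: lerD.
- have [h1 h2] := sub z zh; have [h3 h4] := sub w wh.
  have -> : phase z i - phase w i = row_mx (rsubmx z - rsubmx w)
     (acceleration g i (lsubmx z) (rsubmx z) - acceleration g i (lsubmx w) (rsubmx w)).
    by rewrite /phase opp_row_mx add_row_mx.
  apply: le_trans (norm_row_mx _ _) _; rewrite mulrDl mul1r.
  have n1 : `|rsubmx z - rsubmx w| <= `|z - w| by rewrite -linearB; exact: norm_rsubmx.
  have n2 : `|lsubmx z - lsubmx w| <= `|z - w| by rewrite -linearB; exact: norm_lsubmx.
  apply: lerD => //; apply: le_trans (HL _ _ _ _ h1 h3 h2 h4) _.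
  by rewrite -mulrA ler_wpM2l ?(ltW K0)// mulr2n mulrDl mul1r; exact: lerD.
exists (fun t => lsubmx (z t)), (fun t => rsubmx (z t)); split.
- by rewrite z0 row_mxKl.
- by rewrite z0 row_mxKr.
- by move=> t /zb/sub.
- move=> t tb; have d := dz t tb; split.
    by have := is_derive_lsubmx d; rewrite row_mxKl.
  by have := is_derive_rsubmx d; rewrite row_mxKr.
Qed.

(** At [b] no velocity is known yet. The equation is therefore solved from [t1 = b - δ / 2], with
    the position and velocity of the minimizer there, for a time [δ]. Before [b] the solution
    coincides with the minimizer by [ivp_unique]; then it runs past [b]. *)
Lemma extend_right (κ a b : R) γ : 0 <= κ -> a < b -> minimizer g κ a b γ ->
  exists (e : R) γ', [/\ 0 < e, forall t, a <= t <= b -> γ' t = γ t & locally_minimizing `]a, b + e[ γ'].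
Proof.
move=> κ0 ab m.
pose i := chart_at A (γ b); have ib : chart_dom i (γ b) by exact: chart_at_dom.
pose x0 := chart_map i (γ b); have xI0 : chart_img i x0 by exact: chart_img_in.
have [r [l [L [K [k [[r0 l0 L0 _ k0] N1 _ _ D4]]]]]] := local_metric g xI0.
pose V := κ / l + 1.
have κl : 0 <= κ / l by rewrite divr_ge0// ltW.
have V0 : 0 < V by rewrite ltr_wpDl.
have [r3 [K3 [r30 K30 HI HB HL]]] := acceleration_lip g xI0 V0.
have [ρ [ρ0 ρ1 ρ2 ρ3 _]] := @small4 R (r / 2) (r3 / 2) 1 1 ltac:(by rewrite divr_gt0) ltac:(by rewrite divr_gt0) ltr01 ltr01.
have VK : 0 < V + K3 by rewrite addr_gt0.
have [w [w0 w1 w2 w3 w4]] := @small4 R (ρ / (V + K3) ) (b - a) (4^-1) (4^-1 / K3)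
  ltac:(by rewrite divr_gt0) ltac:(by rewrite subr_gt0) ltac:(by rewrite invr_gt0) ltac:(by rewrite divr_gt0// invr_gt0).
have kk : 0 < k * ρ / 2 / (κ + 1) by rewrite !divr_gt0// ?mulr_gt0// ltr_wpDl.
have [δ [δ0 δw δ2]] := small2 w0 kk.
have ρδ : (V + K3) * δ <= ρ by rewrite mulrC -ler_pdivlMr//; exact: le_trans w1.
pose t1 := b - δ / 2.
have bt1 : b - t1 = δ / 2 by rewrite /t1 opprB addrCA subrr addr0.
have at1 : a < t1 by rewrite /t1; move: δ0 δw w2; glra.
have t1b : t1 < b by rewrite /t1; move: δ0; glra.
have κδ : κ * δ < k * ρ.
  have k1 : 0 < κ + 1 by rewrite ltr_wpDl.
  have : δ * (κ + 1) <= k * ρ / 2 by rewrite -ler_pdivlMr.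
  have : 0 < k * ρ by rewrite mulr_gt0.
  by rewrite mulrDr mulr1 mulrC; move: δ0; glra.
have bab : a <= b <= b by rewrite lexx ltW.
have near t : t1 <= t <= b -> chart_dom i (γ t) /\ `|chart_map i (γ t) - x0| < ρ.
  move=> /andP[h1 h2].
  apply: (D4 x0 (γ t) ρ (κ * δ)) => //; first by rewrite subrr normr0.
    by move: ρ1 r0 ρ0; glra.
  rewrite /x0 chart_mapK// m//; last by rewrite h2 (le_trans (ltW at1)).
  rewrite lee_fin ler_wpM2l// ger0_norm ?subr_ge0//.
  by move: h1; rewrite /t1; move: δ0; glra.
pose x := chart_map i \o γ.
have xC t : t1 <= t < b -> [/\ is_derive t 1 x ('D_1 x t),
    is_derive t 1 (fun s => 'D_1 x s) (acceleration g i (x t) ('D_1 x t)) & `|'D_1 x t| <= κ / l].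
  move=> /andP[h1 h2].
  have [dt xt] : chart_dom i (γ t) /\ `|chart_map i (γ t) - x0| < ρ by apply: near; rewrite h1 ltW.
  have tI : a < t < b by rewrite h2 (lt_le_trans at1).
  have [h h0 H] := minimizer_C1 κ0 m tI dt.
  have [|_ _ d _ Nt] := H t; first by rewrite subrr normr0.
  split; [exact: d|exact: (minimizer_geodesic κ0 m tI dt)|].
  have [|_ /(_ ('D_1 x t))[h5 _]] := N1 (x t).
    by apply: lt_le_trans xt _; move: ρ1 r0; glra.
  by rewrite ler_pdivlMr// mulrC -[κ in leRHS]Nt.
have t1b' : t1 <= t1 < b by rewrite lexx.
have [_ _ v1] := xC t1 t1b'.
have [_ xt1] := near t1 (introT andP (conj (lexx t1) (ltW t1b))).
have x3 y : `|y - x t1| <= ρ -> `|y - x0| < r3.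
  move=> h; rewrite -(subrKA (x t1) y); apply: le_lt_trans (ler_normD _ _) _.
  by move: h xt1 ρ2 r30; rewrite /x /=; glra.
have vV v : `|v - 'D_1 x t1| <= ρ -> `|v| <= V.
  move=> h; rewrite -(subrK ('D_1 x t1) v); apply: le_trans (ler_normD _ _) _.
  by rewrite /V; move: h ρ3 v1; glra.
have [||X [X' [X0 X'0 Xb dX]]] := @second_order_ode i (x t1) ('D_1 x t1) r V ρ K3 δ δ0 V0 K30 ρδ.
- by move=> y v /x3 yr /vV vv; split => //; exact: HB.
- by move=> y z v w' /x3 yr /x3 zr /vV vv /vV wv; exact: HL.
pose Y t := X (t - t1); pose Y' t := X' (t - t1).
have dY t : t1 <= t < t1 + δ -> is_derive t 1 Y (Y' t) /\ is_derive t 1 Y' (acceleration g i (Y t) (Y' t)).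
  move=> tb; have [|d1 d2] := dX (t - t1); first by move: tb; glra.
  by split; apply: is_derive_shift.
have YC t : t1 <= t < t1 + δ -> `|Y t - x0| < r3 /\ `|Y' t| <= V.
  move=> tb; have [|h1 h2] := Xb (t - t1); first by move: tb; glra.
  by split; [exact: x3|exact: vV].
have bδ : b < t1 + δ by rewrite /t1; move: δ0; glra.
pose P (a v : 'rV[R]_n) := `|a - x0| < r3 /\ `|v| <= V.
have E t : t1 < t < b -> x t = Y t.
  move=> tI; apply: (proj1 (@ivp_unique _ _ (acceleration g i) P x (fun s => 'D_1 x s) Y Y' t1 b K3 (r3 + r3 + V + V) (ltW K30) _ _ _ _ _ _ _ _ t tI)).
  - by rewrite bt1; move: w3 δw δ0; glra.
  - have : δ * K3 <= 4^-1 by rewrite -ler_pdivlMr//; exact: le_trans w4.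
    have : 0 < δ * K3 by rewrite mulr_gt0.
    by rewrite bt1 mulrCA mulrA; glra.
  - by move=> c v d' w' [a1 v2] [b1 w5]; exact: HL.
  - move=> s /andP[s1 s2]; have sb : t1 <= s < b by rewrite s2 ltW.
    have [_ _ v2] := xC s sb.
    have v3 : `|'D_1 x s| <= V by apply: le_trans v2 _; rewrite /V lerDl.
    have [_ xs] : chart_dom i (γ s) /\ `|chart_map i (γ s) - x0| < ρ by apply: near; rewrite !ltW.
    have xs' : `|x s - x0| < r3 by apply: lt_le_trans xs _; move: ρ2 r30; glra.
    have [|ys v4] := YC s; first by rewrite (ltW s1) (lt_trans s2).
    split => //.
      rewrite -(subrKA x0); apply: le_trans (ler_normD _ _) _; rewrite [`|x0 - _|]distrC.
      by move: xs' ys V0; glra.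
    by apply: le_trans (ler_normB _ _) _; move: v3 v4 r30; glra.
  - by move=> s /xC[].
  - by move=> s /andP[s1 s2]; apply: dY; rewrite s1 (lt_trans s2).
  - by rewrite /Y subrr X0.
  - by rewrite /Y' subrr X'0.
(* Uniqueness was obtained before [b] only; the value at [b] follows from the continuity of both
   curves. *)
have Eb : Y b = x0.
  apply/eqP; rewrite -subr_eq0 -normr_eq0 eq_le normr_ge0 andbT leNgt; apply/negP => h.
  have [|dYb _] := dY b; first by rewrite bδ ltW.
  have h2 : 0 < `|Y b - x0| / 2 by rewrite divr_gt0.
  have [d1 d10 H1] := (continuous_normP _ _).1 (is_derive_continuous dYb) _ h2.
  have [d2 d20 H2] := chart_near g ib h2.
  have [q [q0 q1 q2 q3 _]] := @small4 R (d1 / 2) (d2 / (κ + 1)) (δ / 4) 1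
    ltac:(by rewrite divr_gt0) ltac:(by rewrite divr_gt0// ltr_wpDl) ltac:(by rewrite divr_gt0) ltr01.
  have tb : t1 < b - q < b by rewrite /t1; move: q0 q3 δ0; glra.
  have := H1 (b - q); rewrite addrAC subrr add0r normrN gtr0_norm// => /(_ _)/wrap[|h3].
    by move: q1 d10; glra.
  have := H2 (γ (b - q)); rewrite m//; last by move: tb at1; glra.
  rewrite lee_fin opprB addrCA subrr addr0 gtr0_norm// => /(_ _)/wrap[|[_ h4]].
    have : q * (κ + 1) <= d2 by rewrite -ler_pdivlMr// ltr_wpDl.
    by rewrite mulrDr mulr1 mulrC; move: q0; glra.
  move: h4; rewrite -/x0 -[chart_map _ _]/(x (b - q)) E// => h4.
  have : `|Y b - x0| <= `|Y (b - q) - Y b| + `|Y (b - q) - x0|.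
    by rewrite -[`|Y (b - q) - Y b|]normrN opprB -{1}(subrKA (Y (b - q)) (Y b)) ler_normD.
  by move: h3 h4; glra.
exists (δ / 2), (fun t => if t <= b then γ t else chart_inv i (Y t)); split.
- by rewrite divr_gt0.
- by move=> t /andP[_ ->].
have bδ' : b + δ / 2 = t1 + δ by rewrite /t1; alra.
move=> t /=; rewrite in_itv/= bδ' => /andP[h1 h2].
have [tb|bt] := ltP t b.
  have [h [h0 ha hb]] := @small2 R (t - a) (b - t) ltac:(by rewrite subr_gt0) ltac:(by rewrite subr_gt0).
  exists h, κ; split => //; apply: (@minimizer_eq _ _ _ _ _ _ _ _ γ).
    by move=> s /andP[_ s2]; rewrite (_ : s <= b)//; move: s2 hb; glra.
  by apply: minimizer_sub m _ _; move: ha hb; glra.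
have t1t : t1 < t by exact: lt_le_trans bt.
have [h [h0 ha hb]] := @small2 R (t - t1) (t1 + δ - t) ltac:(by rewrite subr_gt0) ltac:(by rewrite subr_gt0).
have [s sh|h' [κ' [h'0 h'h κ'0 m']]] := @ode_locally_minimizing _ _ _ _ g hg i Y Y' t h h0.
  have sb : t1 <= s < t1 + δ by move: sh; rewrite ltr_distl; move: ha hb; glra.
  have [d1 d2] := dY s sb; split => //.
  by apply: HI; have [] := YC s sb.
exists h', κ'; split => //; apply: minimizer_eq m' => s /andP[s1 s2].
case: ifP => // sb.
have : t1 < s by move: s1 h'h ha; glra.
move: sb; rewrite le_eqVlt => /predU1P[->|sb] t1s.
  by rewrite Eb /x0 chart_mapK.
rewrite -E ?t1s//= /x/= chart_mapK//.
by have [] : chart_dom i (γ s) /\ `|chart_map i (γ s) - x0| < ρ by apply: near; rewrite !ltW.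
Qed.

(** The left prolongation is the right prolongation of the reversed minimizer. Both agree with the
    minimizer between [a] and [b], so they can be glued at the midpoint. *)
Lemma extend_both (κ a b : R) γ : 0 <= κ -> a < b -> minimizer g κ a b γ ->
  exists (e : R) γ', [/\ 0 < e, forall t, a <= t <= b -> γ' t = γ t & locally_minimizing `]a - e, b + e[ γ'].
Proof.
move=> κ0 ab m.
have [e1 [γ1 [e10 E1 L1]]] := extend_right κ0 ab m.
have ba : - b < - a by rewrite ltrN2.
have [e2 [γ2 [e20 E2 L2]]] := extend_right κ0 ba (minimizer_rev m).
have [e [e0 h1 h2]] := small2 e10 e20.
pose c := (a + b) / 2; have [ac cb] : a < c /\ c < b by rewrite /c; split; alra.
pose γ' t := if t <= c then γ2 (- t) else γ1 t.
have G1 t : a <= t -> γ' t = γ1 t.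
  move=> at_; rewrite /γ'; case: ifP => // tc.
  rewrite E2 ?opprK ?E1 ?at_ ?(le_trans tc (ltW cb))//.
  by rewrite !lerN2 at_ (le_trans tc (ltW cb)).
have G2 t : t <= b -> γ' t = γ2 (- t).
  move=> tb; rewrite /γ'; case: ifP => // /negbT; rewrite -ltNge => ct.
  have at_ : a <= t by apply: le_trans (ltW ct); exact: ltW.
  by rewrite E1 ?at_// E2 ?opprK// !lerN2 tb at_.
exists e, γ'; split => //.
  by move=> t /andP[h3 h4]; rewrite G1// E1// h3.
move=> t /=; rewrite in_itv/= => /andP[h3 h4].
have [at_|ta] := ltP a t.
  have [|h [κ' [h0 κ'0 m']]] := L1 t; first by rewrite /= in_itv/= at_ (lt_le_trans h4)// lerD2l.
  have [q [q0 q1 q2]] := @small2 R h (t - a) h0 ltac:(by rewrite subr_gt0).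
  exists q, κ'; split => //; apply: (@minimizer_eq _ _ _ _ _ _ _ _ γ1).
    by move=> s /andP[s1 _]; rewrite G1//; move: s1 q2; glra.
  by apply: minimizer_sub m' _ _; move: q1; glra.
have [|h [κ' [h0 κ'0 m']]] := L2 (- t).
  by rewrite /= in_itv/= ltrN2 (le_lt_trans ta ab)/= ltrNl opprD opprK; move: h3 h2; glra.
have tb : t < b by exact: le_lt_trans ab.
have [q [q0 q1 q2]] := @small2 R h (b - t) h0 ltac:(by rewrite subr_gt0).
exists q, κ'; split => //; apply: (@minimizer_eq _ _ _ _ _ _ _ _ (fun t => γ2 (- t))).
  by move=> s /andP[_ s2]; rewrite G2//; move: s2 q2; glra.
have := minimizer_rev m'; rewrite !opprD !opprK addrC.
by move=> m2; apply: minimizer_sub m2 _ _; move: q1; glra.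
Qed.

End GeodesicExistence.

(** * Smoothness of minimizers *)

Section MinimizerSmooth.
Context {R : realType} {n : nat} {M : topologicalType}.
Context {A : smooth_manifold R n M}.
Context (g : riemannian_metric A) (hg : complete_riemannian g).
Local Notation dist := (dist g).
Local Notation Nrm i x := (gnorm (gmx g i x)).
Implicit Types (i : chart_index A) (γ : R -> M).

Lemma minimizer_continuous (κ a b : R) γ t : 0 <= κ -> minimizer g κ a b γ -> a < t < b -> {for t, continuous γ}.
Proof.
move=> κ0 m /andP[h1 h2]; apply: (@dist_continuous _ _ _ _ g) => e e0.
have k1 : 0 < κ + 1 by rewrite ltr_wpDl.
have [q [q0 q1 q2 q3 _]] := @small4 R (t - a) (b - t) (e / (κ + 1)) 1 ltac:(by rewrite subr_gt0) ltac:(by rewrite subr_gt0) ltac:(by rewrite divr_gt0) ltr01.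
exists q => // s; rewrite /ball/= => st.
have sb : a <= s <= b by move: st; rewrite ltr_distl; move: q1 q2; glra.
rewrite m ?sb ?(ltW h1) ?(ltW h2)// lee_fin.
have : q * (κ + 1) <= e by rewrite -ler_pdivlMr.
have : `|t - s| * (κ + 1) <= q * (κ + 1) by rewrite ler_wpM2r ?(ltW k1)// ltW.
by rewrite mulrDr mulr1 mulrC; have := normr_ge0 (t - s); glra.
Qed.

Lemma locally_minimizing_C2 (J : set R) γ i t : locally_minimizing g J γ -> J t -> chart_dom i (γ t) ->
  [/\ {for t, continuous γ}, is_derive t 1 (chart_map i \o γ) ('D_1 (chart_map i \o γ) t) &
   is_derive t 1 (fun s => 'D_1 (chart_map i \o γ) s)
     (acceleration g i (chart_map i (γ t)) ('D_1 (chart_map i \o γ) t))].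
Proof.
move=> L Jt it; have [h [κ [h0 κ0 m]]] := L t Jt.
have tI : t - h < t < t + h by move: h0; glra.
split; [exact: minimizer_continuous m tI| |exact: minimizer_geodesic m tI it].
by have [w w0 H] := minimizer_C1 κ0 m tI it; have [|] := H t; first by rewrite subrr normr0.
Qed.

(** Bootstrap: if [x] and [x'] are C^k, so is the acceleration along the curve, hence [x'] is
    C^(k+1). *)
Lemma ode_smooth i (U : set R) (x x' : R -> 'rV[R]_n) : open U ->
  (forall t : R, U t -> [/\ chart_img i (x t), is_derive t 1 x (x' t) &
    is_derive t 1 x' (acceleration g i (x t) (x' t))]) -> forall k, Ck k U x /\ Ck k U x'.
Proof.
move=> oU H; have oI := @chart_img_open' _ _ _ A i.
have xI t : U t -> chart_img i (x t) by case/H.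
have step k (y y' : R -> 'rV[R]_n) : (forall t : R, U t -> is_derive t 1 y (y' t)) -> Ck k U y' -> Ck k.+1 U y.
  move=> dy cy'; split; first by move=> t Ut; exact: is_derive_continuous (dy t Ut).
  move=> v; split; first by move=> t Ut; have [] := is_derive_dir v (dy t Ut).
  apply: (Ck_ext (f := fun t => v *: y' t)) => // [t Ut|].
    by have [_ ->] := is_derive_dir v (dy t Ut).
  apply/(Ck_mxP _ _ oU) => p q.
  have -> : (fun t => (v *: y' t) p q) = (fun t => v * y' t p q) by apply/funext => t; rewrite mxE.
  apply: Ck_mul => //; first exact: Ck_cst.
  exact: ((Ck_mxP _ _ oU).1 cy' p q).
elim=> [|k [IH IH']].
  by split; (split; last by []); move=> t Ut; have [_ d d'] := H t Ut;
    [exact: is_derive_continuous d|exact: is_derive_continuous d'].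
have cx : Ck k.+1 U x by apply: step IH' => t /H[].
split; first exact: cx.
apply: (step k _ (fun t => acceleration g i (x t) (x' t))) => [t /H[_ _ d]|]; first exact: d.
apply/(Ck_mxP _ _ oU) => p q; rewrite (ord1 p).
have -> : (fun t => acceleration g i (x t) (x' t) 0 q) =
   (fun t => (-1) * bilin (christoffel_mx g i q (x t)) (x' t) (x' t)).
  by apply/funext => t; rewrite acceleration_bilin mulN1r.
apply: Ck_mul => //; first exact: Ck_cst.
apply: bilin_Ck => // a b.
have -> : (fun t => christoffel_mx g i q (x t) a b) = (fun t => christoffel g i (x t) q a b).
  by apply/funext => t; rewrite mxE.
exact: (Ck_compR oI oU xI (@christoffel_smooth _ _ _ _ g i q a b k) IH).
Qed.

Lemma locally_minimizing_smooth (J : set R) γ : open J -> locally_minimizing g J γ -> smooth_curve A J γ.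
Proof.
move=> oJ L.
have cγ t : J t -> {for t, continuous γ}.
  by move=> Jt; have [] := locally_minimizing_C2 L Jt (chart_at_dom A (γ t)).
split => // i k.
have oU : open (J `&` γ @^-1` chart_dom i).
  rewrite openE => t [Jt it]; apply: filterI; first exact: open_nbhs_nbhs.
  by apply: cγ => //; apply: open_nbhs_nbhs; split => //; exact: chart_dom_open.
have [] // := @ode_smooth i (J `&` γ @^-1` chart_dom i) (chart_map i \o γ) (fun s => 'D_1 (chart_map i \o γ) s) oU _ k.
move=> t [Jt it]; have [_ d d'] := locally_minimizing_C2 L Jt it.
by split => //; exact: chart_img_in.
Qed.

Lemma locally_minimizing_geodesic (J : set R) γ t : locally_minimizing g J γ -> J t -> geodesic_equation g γ t.
Proof.
move=> L Jt i it x k.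
have [_ d d'] := locally_minimizing_C2 L Jt it.
have E1 : derive1 x = (fun s => 'D_1 x s) by apply/funext => s; rewrite derive1E.
have -> : derive1n 2 x t = acceleration g i (x t) ('D_1 x t).
  by rewrite /= E1 derive1E; have [_ ->] := d'.
by rewrite mxE E1 addNr.
Qed.

Lemma minimising_geodesic_exists (a : R) γ : 0 < a -> minimizer g 1 0 a γ ->
  exists gam, minimising_geodesic g a gam /\ forall t, 0 <= t <= a -> gam t = γ t.
Proof.
move=> a0 m; have [e [γ' [e0 E L]]] := extend_both hg ler01 a0 m.
have oJ : open [set` `]0 - e, a + e[] by exact: interval_open.
have S := locally_minimizing_smooth oJ L.
have m' : minimizer g 1 0 a γ' by apply: minimizer_eq m => t tb; rewrite E.
have sp_in t : 0 < t < a -> speed g γ' t = 1.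
  move=> tI; have it := chart_at_dom A (γ' t).
  have [w w0 H] := minimizer_C1 ler01 m' tI it.
  have [|_ _ d _ Nt] := H t; first by rewrite subrr normr0.
  by rewrite (speed_chart g _ it d) ?Nt//; exact: minimizer_continuous m' tI.
have J0 t : 0 <= t <= a -> [set` `]0 - e, a + e[] t.
  by move=> tb; rewrite /= in_itv/=; move: tb e0; glra.
(* At the two ends, unit speed follows from the continuity of the speed of the prolonged curve. *)
have sp t : 0 <= t <= a -> speed g γ' t = 1.
  move=> tb; have c := @speed_continuous _ _ _ _ g _ _ _ oJ S (J0 t tb).
  apply/eqP; rewrite -subr_eq0 -normr_eq0 eq_le normr_ge0 andbT leNgt; apply/negP => h.
  have [d d0 H] := (continuous_normP _ _).1 c _ h.
  have [s [s1 s2]] : exists s, 0 < s < a /\ `|s - t| < d.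
    have [q [q0 q1 q2]] := @small2 R (d / 2) (a / 4) ltac:(by rewrite divr_gt0) ltac:(by rewrite divr_gt0).
    have [ta|ta] := leP t (a / 2).
      exists (t + q); split; first by move: tb q0 q2 ta; glra.
      by rewrite addrAC subrr add0r gtr0_norm//; move: q1 d0; glra.
    exists (t - q); split; first by move: tb q0 q2 ta; glra.
    by rewrite addrAC subrr add0r normrN gtr0_norm//; move: q1 d0; glra.
  by have := H s s2; rewrite sp_in// distrC ltxx.
exists γ'; split; last exact: E.
have S' : smooth_curve A `]- e, a + e[ γ' by rewrite -[- e]add0r.
split.
  split; first exact: ltW.
    exists e => //; split => // t tI; apply: locally_minimizing_geodesic L _.
    by rewrite /= in_itv/= sub0r.
  by right; split.
have -> : curve_length g 0 a γ' = (\int[lebesgue_measure]_(t in `[0%R, a]) (1%R)%:E)%E.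
  by apply: eq_integral => t; rewrite inE/= in_itv/= => /sp ->.
rewrite m' ?lexx ?(ltW a0)// sub0r normrN mul1r gtr0_norm//.
by rewrite integral_cst//= lebesgue_measure_itv/= lte_fin a0 mul1e oppr0 adde0.
Qed.

End MinimizerSmooth.

(** * First variation of the distance *)

Section FirstVariation.
Context {R : realType} {n : nat} {M : topologicalType}.
Context {A : smooth_manifold R n M}.
Context (g : riemannian_metric A) (hg : complete_riemannian g).
Local Notation dist := (dist g).
Local Notation Nrm i x := (gnorm (gmx g i x)).
Implicit Types (i : chart_index A) (γ : R -> M).

(** Strict differentiability: both [s] and [t] may vary, as they do when the base points move along
    a sequence. *)
Lemma C1_uniform (x x' : R -> 'rV[R]_n) (t0 h e : R) : 0 < h -> 0 < e ->
  (forall t : R, `|t - t0| < h -> is_derive t 1 x (x' t)) -> {for t0, continuous x'} ->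
  exists2 η : R, 0 < η & forall s t, `|s - t0| < η -> `|t - t0| < η ->
    `|x t - x s - (t - s) *: x' t0| <= e * `|t - s|.
Proof.
move=> h0 e0 dx cx.
have [d d0 Hd] := (continuous_normP _ _).1 cx e e0.
have [η [η0 η1 η2]] := small2 h0 d0.
exists η => // s t sη tη.
have := @mvt_lip R n (fun t => x t - t *: x' t0) (fun t => x' t - x' t0) t0 η e _ (ltW e0) s t sη tη.
have -> : x t - t *: x' t0 - (x s - s *: x' t0) = x t - x s - (t - s) *: x' t0.
  by apply/rowP => k; rewrite !mxE; ring.
apply=> w wη; split; last by apply/ltW/Hd; exact: lt_le_trans η2.
apply: is_deriveB; first by apply: dx; exact: lt_le_trans η1.
apply/is_derive_mxP => p q.
have -> : (fun s => (s *: x' t0) p q) = (fun s => x' t0 p q * s) by apply/funext => z; rewrite mxE mulrC.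
have := @is_derive_scale R (x' t0 p q) id w 1 (is_derive_id w 1).
by rewrite mulr1.
Qed.

(** Expand the squared norm [N ^+ 2] and use [2 * r * N <= N ^+ 2 + r ^+ 2]. Moving the end by
    [h *: v] gains [h * bilin G u v]; the quadratic term carries the factor [h / r], which is small
    when [r] is a large multiple of [h]. *)
Lemma gnorm_linear_bound (G : 'M[R]_n) (Δ v u : 'rV[R]_n) (h r κ e L : R) : metric_mx G ->
  0 < h -> 0 < r -> 0 <= κ -> κ <= 1 -> 0 <= e -> 0 <= L ->
  (forall a, gnorm G a <= L * `|a|) ->
  gnorm G Δ <= (1 + κ) * r -> `|Δ - r *: u| <= e * r ->
  gnorm G (Δ - h *: v) <=
    r + 3 / 2 * κ * r - h * bilin G u v + h * (L * e * gnorm G v) + h * (h / r * gnorm G v ^+ 2 / 2).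
Proof.
move=> mG h0 r0 κ0 κ1 e0 L0 HL HΔ Hu.
have N0 := gnorm_ge0 G (Δ - h *: v).
have Nv0 : 0 <= gnorm G v := gnorm_ge0 G v.
have E : gnorm G (Δ - h *: v) ^+ 2 = gnorm G Δ ^+ 2 - 2 * h * bilin G Δ v + h ^+ 2 * gnorm G v ^+ 2.
  rewrite !gnorm_sqr// -scaleN1r scalerA bilinDl !bilinDr !bilinZl !bilinZr (bilinC v Δ mG.1); ring.
have ND : gnorm G Δ ^+ 2 <= r ^+ 2 + 3 * κ * r ^+ 2.
  have : gnorm G Δ ^+ 2 <= ((1 + κ) * r) ^+ 2.
    by rewrite ler_sqr ?nnegrE ?gnorm_ge0// mulr_ge0 ?addr_ge0 ?(ltW r0).
  move/le_trans; apply; rewrite exprMn.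
  have -> : r ^+ 2 + 3 * κ * r ^+ 2 = (1 + 3 * κ) * r ^+ 2 by ring.
  rewrite ler_wpM2r ?sqr_ge0//.
  have : κ * κ <= κ * 1 by rewrite ler_wpM2l.
  have -> : (1 + κ) ^+ 2 = 1 + 2 * κ + κ * κ by ring.
  by glra.
have BB : bilin G Δ v = r * bilin G u v + bilin G (Δ - r *: u) v.
  by rewrite -bilinZl -bilinDl addrC subrK.
have B2 : `|bilin G (Δ - r *: u) v| <= L * (e * r) * gnorm G v.
  apply: le_trans (cauchy_schwarz _ _ mG) _; rewrite ler_wpM2r//.
  by apply: le_trans (HL _) _; rewrite ler_wpM2l.
have r20 : 0 < 2 * r by rewrite mulr_gt0.
rewrite -(ler_pM2l r20).
have amgm : 2 * r * gnorm G (Δ - h *: v) <= gnorm G (Δ - h *: v) ^+ 2 + r ^+ 2.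
  have := sqr_ge0 (gnorm G (Δ - h *: v) - r).
  have -> : (gnorm G (Δ - h *: v) - r) ^+ 2 = gnorm G (Δ - h *: v) ^+ 2 + r ^+ 2 - 2 * r * gnorm G (Δ - h *: v) by ring.
  by glra.
apply: le_trans amgm _; rewrite E BB.
have B3 : - bilin G (Δ - r *: u) v <= L * (e * r) * gnorm G v by apply: le_trans B2; rewrite -normrN ler_norm.
have B4 : 2 * h * (- bilin G (Δ - r *: u) v) <= 2 * h * (L * (e * r) * gnorm G v).
  by rewrite ler_wpM2l// mulr_ge0// ltW.
have -> : 2 * r * (r + 3 / 2 * κ * r - h * bilin G u v + h * (L * e * gnorm G v) + h * (h / r * gnorm G v ^+ 2 / 2)) =
  r ^+ 2 + r ^+ 2 + 3 * κ * r ^+ 2 - 2 * h * (r * bilin G u v) + 2 * h * (L * (e * r) * gnorm G v) + h ^+ 2 * gnorm G v ^+ 2.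
  by field; rewrite gt_eqF.
have -> : 2 * h * (r * bilin G u v + bilin G (Δ - r *: u) v) = 2 * h * (r * bilin G u v) - 2 * h * (- bilin G (Δ - r *: u) v) by ring.
by move: ND B4; glra.
Qed.

(** The constant [C] of [almost_affine] is common to all the curves, so for most [k] their
    difference quotients stay close to [u] at all scales below a single [r0]: convergence of the
    curves entails convergence of their initial directions. *)
Lemma quot_limit (V : set_system nat) (y : nat -> R -> 'rV[R]_n) (z : R -> 'rV[R]_n) (u : 'rV[R]_n) (C b e : R) :
  UltraFilter V -> 0 <= C -> 0 < b -> 0 < e ->
  V [set k | almost_affine C 0 b (y k)] ->
  (forall r : R, 0 <= r <= b -> forall e, 0 < e -> V [set k | `|y k r - z r| < e]) ->
  is_derive (0 : R) 1 z u ->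
  exists2 r0 : R, 0 < r0 & V [set k | forall r, 0 < r -> r <= r0 -> `|y k r - y k 0 - r *: u| <= e * r].
Proof.
move=> UV C0 b0 e0 aff lim dz.
pose D := 2 * Num.sqrt (4 * C) + 1.
have D0 : 0 < D by rewrite /D ltr_wpDl// mulr_ge0// sqrtr_ge0.
have e30 : 0 < e / 3 by rewrite divr_gt0.
have [d d0 Hd] := is_derive_eps dz e30.
have q0 : 0 < (e / 3 / D) ^+ 2 by rewrite exprn_gt0// !divr_gt0.
have [r' [r'0 r'1 r'2 r'3 _]] := @small4 R b (d / 2) ((e / 3 / D) ^+ 2) 1 b0 ltac:(by rewrite divr_gt0) q0 ltr01.
have sq : 2 * Num.sqrt (4 * C) * Num.sqrt r' <= e / 3.
  have : Num.sqrt r' <= e / 3 / D.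
    have p0 : 0 <= e / 3 / D by apply/ltW/divr_gt0.
    by rewrite -[leRHS](ger0_norm p0) -sqrtr_sqr ler_wsqrtr.
  rewrite ler_pdivlMr// /D mulrDr mulr1 mulrC; have := sqrtr_ge0 r'; glra.
exists r' => //.
have e6 : 0 < r' * (e / 3) / 2 by rewrite divr_gt0// mulr_gt0.
have b1 : 0 <= r' <= b by rewrite ltW.
have b2 : 0 <= (0 : R) <= b by rewrite lexx ltW.
apply: filterS (filterI (filterI (lim r' b1 _ e6) (lim 0 b2 _ e6)) aff) => k [[/= h1 h2] h3] r rp rr'.
have Q := @quot_le R n C 0 b (y k) C0 h3 0 r r' (lexx _) rp rr' r'1.
have n1 : `|quot (y k) 0 r - quot (y k) 0 r'| <= e / 3 by apply: le_trans Q _; rewrite subr0.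
have n2 : `|y k r' - y k 0 - r' *: u| <= r' * (2 * (e / 3)).
  have h4 : `|z r' - z 0 - (r' - 0) *: u| <= e / 3 * `|r' - 0|.
    by apply: Hd; rewrite subr0 gtr0_norm//; move: r'2 d0; glra.
  rewrite subr0 gtr0_norm// in h4.
  have -> : y k r' - y k 0 - r' *: u = (y k r' - z r') - (y k 0 - z 0) + (z r' - z 0 - r' *: u).
    by apply/rowP => p; rewrite !mxE; ring.
  apply: le_trans (ler_normD _ _) _; have := ler_normB (y k r' - z r') (y k 0 - z 0).
  have -> : r' * (2 * (e / 3)) = r' * (e / 3) / 2 + r' * (e / 3) / 2 + e / 3 * r' by field.
  by move: h1 h2 h4; glra.
have n3 : `|quot (y k) 0 r' - u| <= 2 * (e / 3).
  have -> : quot (y k) 0 r' - u = r'^-1 *: (y k r' - y k 0 - r' *: u).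
    by rewrite /quot subr0 [RHS]scalerBr scalerA mulVf ?scale1r// gt_eqF.
  by rewrite normrZ gtr0_norm ?invr_gt0// mulrC ler_pdivrMr// mulrC.
have -> : y k r - y k 0 - r *: u = r *: ((quot (y k) 0 r - quot (y k) 0 r') + (quot (y k) 0 r' - u)).
  by rewrite subrKA scalerBr /quot subr0 scalerA mulfV ?scale1r// gt_eqF.
rewrite normrZ gtr0_norm// mulrC ler_wpM2r ?(ltW rp)//.
by apply: le_trans (ler_normD _ _) _; move: n1 n3; glra.
Qed.

(** Only a piece of length proportional to [h k] at one end is altered: the moved end is joined
    directly to the point of the minimizer at parameter [K * h k]. All this happens in one chart at
    a vanishing scale, and the two ends can be treated separately. *)
Lemma first_variation_end (V : set_system nat) (c : R -> M) (s0 l w : R) (σ : nat -> R -> M) (s h d : nat -> R)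
    (gam : R -> M) (u : 'rV[R]_n) : let i := chart_at A (c s0) in
  UltraFilter V -> smooth_curve A setT c -> 0 < w ->
  (forall e, 0 < e -> V [set k | `|s k - s0| <= e]) ->
  (forall k, 0 < h k) -> (forall e, 0 < e -> V [set k | h k <= e]) ->
  V [set k | w <= d k] -> (forall k, minimizer g 1 0 (d k) (σ k)) -> (forall k, σ k 0 = c (s k)) ->
  (forall τ, 0 <= τ <= w -> forall e : R, 0 < e -> V [set k | (dist (gam τ) (σ k τ) <= e%:E)%E]) ->
  gam 0 = c s0 -> is_derive (0 : R) 1 (chart_map i \o gam) u -> {for (0 : R), continuous gam} ->
  forall ε, 0 < ε -> exists2 K : R, 0 < K & V [set k | K * h k <= w / 4 /\
    (dist (c (s k + h k * l)%R) (σ k (K * h k)%R) <=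
     (K * h k - h k * bilin (gmx g i (chart_map i (c s0))) u (l *: 'D_1 (chart_map i \o c) s0) + ε * h k)%:E)%E].
Proof.
move=> i UV sc w0 Hs h0 Hh Hd mσ σ0 Hγ γ0 dγ cγ ε ε0.
have is0 : chart_dom i (c s0) by exact: chart_at_dom.
pose x0 := chart_map i (c s0).
have xI0 : chart_img i x0 by exact: chart_img_in.
have [r [lo [L [K0 [k0 [[r0 lo0 L0 K00 k00] N1 D2 D3 _]]]]]] := local_metric g xI0.
have [rm [C [dm [rm0 C0 dm0 Hm]]]] := minimizer_chart g xI0 ler01.
pose G := gmx g i x0.
have mG : metric_mx G by exact: gmx_metric.
have x00 : `|x0 - x0| < r by rewrite subrr normr0.
have HL a : gnorm G a <= L * `|a| by have [_ /(_ a)[]] := N1 _ x00.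
pose xc := chart_map i \o c.
pose v := l *: 'D_1 xc s0.
pose Nv := gnorm G v; have Nv0 : 0 <= Nv by exact: gnorm_ge0.
(* Makes the quadratic error [Nv ^+ 2 / K / 2] from [gnorm_linear_bound] at most [ε / 8]. *)
pose K := 4 * Nv ^+ 2 / ε + 1.
have K1 : 0 < K by rewrite ltr_wpDl// divr_ge0 ?(ltW ε0)// mulr_ge0// sqr_ge0.
have KN : Nv ^+ 2 / K / 2 <= ε / 8.
  rewrite ler_pdivrMr// ler_pdivrMr// /K; have := sqr_ge0 Nv => Nv2.
  have -> : ε / 8 * 2 * (4 * Nv ^+ 2 / ε + 1) = Nv ^+ 2 + ε / 4 by field; rewrite gt_eqF.
  by move: ε0; glra.
pose Z := 3 / 2 * K + `|bilin G u v| + L * (Nv + 1) + ε.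
have LN : 0 <= L * (Nv + 1) by rewrite mulr_ge0 ?(ltW L0)// addr_ge0.
have Z0 : 0 <= Z by rewrite /Z; move: LN K1 ε0 (normr_ge0 (bilin G u v)); glra.
have Z1 : 0 < 3 / 2 * K + K + Z + 1 by move: K1 Z0; glra.
have Z2 : 0 < 8 * (L * (Nv + 1)) + 1 by move: LN; glra.
have [e1 [e10 e11 e12]] := @small2 R 1 (ε / (8 * (L * (Nv + 1)) + 1)) ltr01 ltac:(by rewrite divr_gt0).
have e1L : L * e1 * (Nv + 1) <= ε / 8.
  have : e1 * (8 * (L * (Nv + 1)) + 1) <= ε by rewrite -ler_pdivlMr.
  have -> : L * e1 * (Nv + 1) = e1 * (L * (Nv + 1)) by ring.
  by rewrite mulrDr; move: e10; glra.
have [κ [κ0 κ1 κ2 κ3 _]] := @small4 R 1 (ε / 8 / (3 / 2 * K + K + Z + 1)) (K0 * r / 2) 1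
  ltr01 ltac:(by rewrite !divr_gt0) ltac:(by rewrite divr_gt0// mulr_gt0) ltr01.
have κZ : κ * (3 / 2 * K + K + Z) <= ε / 8.
  have : κ * (3 / 2 * K + K + Z + 1) <= ε / 8 by rewrite -ler_pdivlMr.
  by rewrite [κ * (_ + 1)]mulrDr; move: κ0; glra.
pose ρ := κ / K0.
have ρ0 : 0 < ρ by rewrite divr_gt0.
have ρr : ρ < r.
  apply: (@le_lt_trans _ _ (r / 2)); last by move: r0; glra.
  by rewrite ler_pdivrMr//; move: κ3; rewrite [K0 * r]mulrC mulrAC.
have K0ρ : K0 * ρ = κ by rewrite /ρ mulrCA mulfV ?mulr1// gt_eqF.
have oS : open (setT `&` c @^-1` chart_dom i) by apply: smooth_curve_open sc; exact: openT.
have [hc hc0 Hc] := open_ball_sub oS (conj I is0 : (setT `&` c @^-1` chart_dom i) s0).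
have dxc t : `|t - s0| < hc -> is_derive t 1 xc ('D_1 xc t).
  by move=> /Hc[_ it]; exact: smooth_curve_derive sc I it.
have cxc : {for s0, continuous (fun t => 'D_1 xc t)}.
  exact: (Ck_continuous (@Ck_derive _ 0 _ _ _ _ (1 : R) (sc.2 i 1%N)) (conj I is0)).
have e1l : 0 < e1 / (`|l| + 1) by rewrite divr_gt0// ltr_wpDl.
have [η η0 Hη] := C1_uniform hc0 e1l dxc cxc.
have s00 : `|s0 - s0| < hc by rewrite subrr normr0.
have ρ20 : 0 < ρ / 2 by rewrite divr_gt0.
have [η2 η20 Hη2] := (continuous_normP _ _).1 (is_derive_continuous (dxc _ s00)) _ ρ20.
have [η3 η30 Hη3] := (continuous_normP _ _).1 (is_derive_continuous (dxc _ s00)) _ rm0.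
have [η' [η'0 η'1 η'2 η'3 η'4]] := small4 η0 hc0 η20 η30.
have [bγ bγ0 Hbγ] : exists2 b : R, 0 < b & forall t, 0 <= t <= b -> chart_dom i (gam t).
  have : \forall t \near (0 : R), chart_dom i (gam t) by apply: near_chart_dom => //; rewrite γ0.
  move=> /nbhs_ballP[b b0 Hb]; exists (b / 2); first by rewrite divr_gt0.
  move=> t /andP[t0 tb]; apply: Hb; rewrite /ball/= sub0r normrN ger0_norm//.
  by move: tb b0; rewrite /=; glra.
have [b [b0 b1 b2 b3 _]] := @small4 R bγ w (dm / 2) 1 bγ0 w0 ltac:(by rewrite divr_gt0) ltr01.
have close t e : 0 <= t <= b -> 0 < e -> V [set k | chart_dom i (σ k t) /\ `|chart_map i (σ k t) - chart_map i (gam t)| < e].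
  move=> /andP[t0 tb] e0.
  have ig : chart_dom i (gam t) by apply: Hbγ; rewrite t0 (le_trans tb).
  have [δ δ0 Hδ] := chart_near g ig e0.
  have tw : 0 <= t <= w by rewrite t0 (le_trans tb).
  by apply: filterS (Hγ t tw δ δ0) => k /=; exact: Hδ.
have η'h : 0 < η' / 2 by rewrite divr_gt0.
have near_s0 : V [set k | `|s k - s0| < η'].
  apply: filterS (Hs _ η'h) => k /= hk; apply: le_lt_trans hk _; by move: η'0; glra.
have start : V [set k | [/\ w <= d k, chart_dom i (c (s k)) & `|xc (s k) - x0| < rm]].
  apply: filterS (filterI Hd near_s0) => k [/= h1 h2]; split => //.
    by have [] := Hc (s k) (lt_le_trans h2 η'2).
  exact: Hη3 (lt_le_trans h2 η'4).
have inch : V [set k | (forall t, 0 <= t <= b -> chart_dom i (σ k t)) /\ almost_affine C 0 b (chart_map i \o σ k)].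
  apply: filterS start => k [h1 h2 h3].
  have bd : b <= d k by exact: le_trans b2 h1.
  have mb : minimizer g 1 0 b (σ k) by exact: minimizer_sub (mσ k) (lexx _) bd.
  have bdm : b - 0 < dm by rewrite subr0; move: b3 dm0; glra.
  have is' : chart_dom i (σ k 0) by rewrite σ0.
  have xs' : `|chart_map i (σ k 0) - x0| < rm by rewrite σ0.
  have [h4 h5] := Hm (σ k) 0 b 1 (ltW b0) bdm ler01 (lexx _) mb is' xs'.
  by split => // t /h4[].
have [||r1 r10 Hr1] := @quot_limit V (fun k => chart_map i \o σ k) (chart_map i \o gam) u C b e1 UV C0 b0 e10 _ _ dγ.
- by apply: filterS inch => k [].
- by move=> t tb e e0; apply: filterS (close t e tb e0) => k [].
have u1 : 0 < `|u| + 1 by rewrite ltr_wpDl.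
have [q [q0 q1 q2 q3 q4]] := @small4 R r1 b (w / 4) (ρ / 4 / (`|u| + 1)) r10 b0 ltac:(by rewrite divr_gt0) ltac:(by rewrite !divr_gt0).
have l1 : 0 < `|l| + 1 by rewrite ltr_wpDl.
have [p [p0 p1 p2 _ _]] := @small4 R (q / K) (η' / 2 / (`|l| + 1)) 1 1 ltac:(by rewrite divr_gt0) ltac:(by rewrite divr_gt0) ltr01 ltr01.
have ρ4 : 0 < ρ / 4 by rewrite divr_gt0.
have [η4 η40 Hη4] := (continuous_normP _ _).1 (is_derive_continuous (dxc _ s00)) _ ρ4.
have η42 : 0 < Num.min (η' / 4) (η4 / 2) by rewrite lt_min !divr_gt0.
exists K => //.
apply: filterS (filterI (filterI (Hh p p0) (Hs _ η42)) (filterI Hr1 (filterI inch Hd))).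
move=> k [[/= hp]]; rewrite le_min => /andP[sk1 sk2] [Hk [[dσ _] wd]].
have hk := h0 k.
set r' := K * h k.
have r'0 : 0 < r' by rewrite mulr_gt0.
have r'q : r' <= q by rewrite /r' mulrC -ler_pdivlMr//; exact: le_trans p1.
split; first exact: le_trans q3.
have hl : `|h k * l| <= η' / 2.
  have : h k * (`|l| + 1) <= η' / 2 by rewrite -ler_pdivlMr//; exact: le_trans p2.
  by rewrite normrM gtr0_norm// mulrDr mulr1; move: hk; glra.
have sη : `|s k - s0| < η' by move: sk1 η'0; glra.
have tη : `|s k + h k * l - s0| < η'.
  by rewrite addrAC; apply: le_lt_trans (ler_normD _ _) _; move: sk2 sη hl η'0 sk1; glra.
set t' := s k + h k * l in tη *.
have ts : t' - s k = h k * l by rewrite /t' addrAC subrr add0r.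
have n1 : `|xc t' - xc (s k) - h k *: v| <= e1 * h k.
  have := Hη _ _ (lt_le_trans sη η'1) (lt_le_trans tη η'1).
  rewrite ts /v scalerA => /le_trans; apply.
  rewrite normrM gtr0_norm// mulrAC ler_pdivrMr// -mulrA ler_wpM2l ?(ltW e10)//.
  by rewrite ler_wpM2l ?(ltW hk)// lerDl.
have y0 : chart_map i (σ k 0) = xc (s k) by rewrite σ0.
pose yr := chart_map i (σ k r').
have n2 : `|yr - xc (s k) - r' *: u| <= e1 * r' by have := Hk r' r'0 (le_trans r'q q1); rewrite /= y0.
have n3 : `|xc (s k) - x0| < ρ / 4 by apply: Hη4; move: sk2 η40; glra.
have n4 : `|xc t' - x0| < ρ / 2 by apply: Hη2; exact: lt_le_trans η'3.
have n5 : `|yr - x0| < ρ.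
  have -> : yr - x0 = (yr - xc (s k) - r' *: u) + r' *: u + (xc (s k) - x0).
    by apply/rowP => w'; rewrite !mxE; ring.
  apply: le_lt_trans (ler_normD _ _) _.
  have := ler_normD (yr - xc (s k) - r' *: u) (r' *: u); rewrite [`|r' *: u|]normrZ gtr0_norm//.
  have : q * (`|u| + 1) <= ρ / 4 by rewrite -ler_pdivlMr.
  have : r' * (`|u| + 1) <= q * (`|u| + 1) by rewrite ler_wpM2r ?(ltW u1).
  have : e1 * r' <= 1 * r' by rewrite ler_wpM2r ?(ltW r'0).
  by rewrite [r' * (_ + _)]mulrDr; move: n2 n3 ρ0; glra.
have r'b : 0 <= r' <= b by rewrite (ltW r'0) (le_trans r'q).
have n3' : `|xc (s k) - x0| < ρ by move: n3 ρ0; glra.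
have n4' : `|xc t' - x0| < ρ by move: n4 ρ0; glra.
have i1 : chart_dom i (c t') by have [] := Hc t' (lt_le_trans tη η'2).
have i2 : chart_dom i (c (s k)) by have [] := Hc (s k) (lt_le_trans sη η'2).
have i3 := dσ r' r'b.
have ND : gnorm G (yr - xc (s k)) <= (1 + κ) * r'.
  rewrite -K0ρ; apply: (D3 x0 _ _ ρ r' x00 ρ0 ρr n3' n5).
  rewrite /xc /yr /= !chart_mapK// -σ0 mσ.
  - by rewrite sub0r normrN gtr0_norm// mul1r.
  - by rewrite lexx (le_trans (ltW w0)).
  - by rewrite (ltW r'0) (le_trans r'q)// (le_trans q2)// (le_trans b2).
have NB := gnorm_linear_bound v mG hk r'0 (ltW κ0) κ1 (ltW e10) (ltW L0) HL ND n2.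
have ND2 : gnorm G (yr - xc t') <= gnorm G (yr - xc (s k) - h k *: v) + L * (e1 * h k).
  have -> : yr - xc t' = (yr - xc (s k) - h k *: v) + - (xc t' - xc (s k) - h k *: v).
    by apply/rowP => w'; rewrite !mxE; ring.
  apply: le_trans (gnormD _ _ mG) _; rewrite lerD2l gnormN; apply: le_trans (HL _) _.
  by rewrite ler_wpM2l ?(ltW L0).
have := D2 x0 _ _ ρ x00 ρ0 ρr n4' n5; rewrite /xc /yr /= !chart_mapK// => /le_trans; apply.
rewrite lee_fin -/x0 -/xc -/v -/G -/yr K0ρ.
have hr : h k / r' = K^-1 by rewrite /r' invfM mulrCA mulfV ?mulr1// gt_eqF.
rewrite hr -/Nv in NB.
have X1 : gnorm G (yr - xc t') <= h k * (K + 3 / 2 * κ * K - bilin G u v + ε / 4).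
  apply: le_trans ND2 _; apply: le_trans (lerD NB (lexx _)) _.
  have -> : r' + 3 / 2 * κ * r' - h k * bilin G u v + h k * (L * e1 * Nv) + h k * (K^-1 * Nv ^+ 2 / 2) + L * (e1 * h k)
    = h k * (K + 3 / 2 * κ * K - bilin G u v + (L * e1 * (Nv + 1) + Nv ^+ 2 / K / 2)) by rewrite /r'; ring.
  by rewrite ler_wpM2l ?(ltW hk)// lerD2l; move: e1L KN; glra.
have X2 : gnorm G (yr - xc t') <= h k * (K + Z).
  apply: le_trans X1 _; rewrite ler_wpM2l ?(ltW hk)// /Z.
  have : κ * K <= 1 * K by rewrite ler_wpM2r ?(ltW K1).
  have := ler_norm (- bilin G u v); rewrite normrN.
  have -> : 3 / 2 * κ * K = 3 / 2 * (κ * K) by rewrite mulrA.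
  by move: LN ε0; glra.
have X3 : κ * gnorm G (yr - xc t') <= κ * (h k * (K + Z)) by rewrite ler_wpM2l ?(ltW κ0).
rewrite mulrDl mul1r; apply: le_trans (lerD X1 X3) _.
have -> : h k * (K + 3 / 2 * κ * K - bilin G u v + ε / 4) + κ * (h k * (K + Z)) =
  h k * (K - bilin G u v + ε / 4 + κ * (3 / 2 * K + K + Z)) by ring.
have -> : r' - h k * bilin G u v + ε * h k = h k * (K - bilin G u v + ε) by rewrite /r'; ring.
by rewrite ler_wpM2l ?(ltW hk)//; move: κZ ε0; glra.
Qed.

End FirstVariation.

Lemma bilinNl {R : realType} {n : nat} (G : 'M[R]_n) u v : bilin G (- u) v = - bilin G u v.
Proof. by rewrite -scaleN1r bilinZl mulN1r. Qed.

(** * Decrease of the distance near a regular pair *)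

Section Decrease.
Context {R : realType} {n : nat} {M : topologicalType}.
Context {A : smooth_manifold R n M}.
Context (g : riemannian_metric A) (hg : complete_riemannian g).
Local Notation dist := (dist g).
Implicit Types (i : chart_index A) (γ : R -> M).

Lemma dist_perturb p q p' q' (d d' e e' : R) : dist p q = d%:E -> dist p' q' = d'%:E ->
  (dist p p' <= e%:E)%E -> (dist q q' <= e'%:E)%E -> `|d - d'| <= e + e'.
Proof.
move=> D D' H H'.
have h1 : (dist p' q' <= (e + (d + e'))%:E)%E.
  by apply: dist_tri (dist_sym_le H) _; apply: dist_tri H'; rewrite D.
have h2 : (dist p q <= (e + (d' + e'))%:E)%E.
  by apply: dist_tri H _; apply: dist_tri (dist_sym_le H'); rewrite D'.
by move: h1 h2; rewrite D D' !lee_fin ler_norml; alra.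
Qed.

(** [first_variation_end] is applied at both ends, the second time to the reversed minimizers; with
    the untouched middle part this bounds the distance of the moved pair by less than the
    counterexample permits. *)
Lemma decrease (c : R -> M) (s0 t0 w l1 l2 : R) : smooth_curve A setT c -> 0 < w -> dist (c s0) (c t0) = w%:E ->
  (forall a gam, minimising_geodesic g a gam -> gam 0 = c s0 -> gam a = c t0 ->
     inner g (c t0) (l2 *: velocity A c t0) (velocity A gam a)
     - inner g (c s0) (l1 *: velocity A c s0) (velocity A gam 0) < 0) ->
  exists2 δ : R, 0 < δ & forall s t h d, `|s - s0| < δ -> `|t - t0| < δ -> 0 < h -> h < δ ->
    dist (c s) (c t) = d%:E -> (dist (c (s + h * l1)%R) (c (t + h * l2)%R) <= (d - δ * h)%:E)%E.
Proof.
move=> sc w0 Dw reg; apply: contrapT => Nδ.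
have bad (k : nat) : exists p : R * R * R * R, let: (s, t, h, d) := p in
    [/\ `|s - s0| < k.+1%:R^-1, `|t - t0| < k.+1%:R^-1, 0 < h < k.+1%:R^-1, dist (c s) (c t) = d%:E &
      ~ (dist (c (s + h * l1)%R) (c (t + h * l2)%R) <= (d - k.+1%:R^-1 * h)%:E)%E].
  apply: contrapT => Np; apply: Nδ; exists k.+1%:R^-1; first by rewrite invr_gt0 ltr0Sn.
  move=> s t h d hs ht h0 h1 D; apply: contrapT => Nd; apply: Np; exists (s, t, h, d).
  by split => //; rewrite h0.
have [f Hf] := choice bad.
pose s k := (f k).1.1.1; pose t k := (f k).1.1.2; pose h k := (f k).1.2; pose d k := (f k).2.
have {}Hf k : [/\ `|s k - s0| < k.+1%:R^-1, `|t k - t0| < k.+1%:R^-1, 0 < h k < k.+1%:R^-1, dist (c (s k)) (c (t k)) = (d k)%:E &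
      ~ (dist (c (s k + h k * l1)%R) (c (t k + h k * l2)%R) <= (d k - k.+1%:R^-1 * h k)%:E)%E].
  by have := Hf k; rewrite /s /t /h /d; case: (f k) => [[[? ?] ?] ?].
have Hσ k : exists σ, [/\ minimizer g 1 0 (d k) σ, σ 0 = c (s k) & σ (d k) = c (t k)].
  by have [_ _ _ D _] := Hf k; exact: (minimizer_exists hg D).
have {Hσ}[σ Hσ] := choice Hσ.
have [V UV HV] := ultra_nat.
have small (e : R) : 0 < e -> V [set k | k.+1%:R^-1 <= e].
  by move=> e0; have [N HN] := inv_nat_small e0; apply: filterS (HV N) => k /= /HN.
have Vs e : 0 < e -> V [set k | `|s k - s0| <= e].
  by move=> /small; apply: filterS => k /= ke; have [h1 _ _ _ _] := Hf k; apply: le_trans (ltW h1) ke.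
have Vt e : 0 < e -> V [set k | `|t k - t0| <= e].
  by move=> /small; apply: filterS => k /= ke; have [_ h1 _ _ _] := Hf k; apply: le_trans (ltW h1) ke.
have Vh e : 0 < e -> V [set k | h k <= e].
  by move=> /small; apply: filterS => k /= ke; have [_ _ /andP[_ h1] _ _] := Hf k; apply: le_trans (ltW h1) ke.
have h0 k : 0 < h k by have [_ _ /andP[]] := Hf k.
have Vc (u : nat -> R) u0 : (forall e, 0 < e -> V [set k | `|u k - u0| <= e]) ->
    forall e, 0 < e -> V [set k | (dist (c u0) (c (u k)) <= e%:E)%E].
  move=> Hu e e0; have [d1 d10 H1] := @continuous_dist _ _ _ _ g _ c u0 (sc.1 u0 I) e e0.
  have d2 : 0 < d1 / 2 by rewrite divr_gt0.
  apply: filterS (Hu _ d2) => k /= hk; apply: H1; rewrite /ball/= distrC.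
  by apply: le_lt_trans hk _; move: d10; rewrite /=; glra.
have Vd e : 0 < e -> V [set k | `|d k - w| <= e].
  move=> e0; have e2 : 0 < e / 2 by rewrite divr_gt0.
  apply: filterS (filterI (Vc _ _ Vs _ e2) (Vc _ _ Vt _ e2)) => k [/= h1 h2].
  have [_ _ _ D _] := Hf k.
  have := dist_perturb Dw D h1 h2; rewrite distrC; alra.
have d0 k : 0 <= d k by have [_ _ _ D _] := Hf k; rewrite -lee_fin -D dist_ge0.
(* The lengths [d k] converge to [w] but may be smaller, so each curve waits at its end until time
   [w]. *)
pose σ' k τ := σ k (Num.min τ (d k)).
have mind k τ : 0 <= τ -> 0 <= Num.min τ (d k) <= d k.
  by move=> τ0; rewrite le_min τ0 d0/= ge_min lexx orbT.
have [γ Hγ] : exists γ : R -> M, forall τ, 0 <= τ <= w -> forall e : R, 0 < e ->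
    V [set k | (dist (γ τ) (σ' k τ) <= e%:E)%E].
  apply: (ultralimit hg (r := 1 + w) (p := c s0) UV) => τ /andP[τ0 τw].
  apply: filterS (Vc _ _ Vs 1 ltr01) => k /= hk; apply: dist_tri hk _.
  have [m e1 _] := Hσ k; rewrite -e1 m ?mind ?lexx ?d0// lee_fin mul1r sub0r normrN.
  by rewrite ger0_norm; [rewrite ge_min τw|case/andP: (mind k _ τ0)].
have [w1 w2] : 0 <= (0 : R) <= w /\ 0 <= w <= w by rewrite !lexx (ltW w0).
have γ0 : γ 0 = c s0.
  apply: (@dist_eq0 _ _ _ _ g); apply: (@ultralimit_dist _ _ _ _ g V _ _ (fun k => σ' k 0) (fun k => c (s k)) 0 UV (Hγ 0 w1)).
    exact: Vc Vs.
  move=> e e0; apply: filterS (HV 0%N) => k _ /=.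
  have [_ e1 _] := Hσ k; rewrite /σ' min_l// e1 dist_refl lee_fin; alra.
have γw : γ w = c t0.
  apply: (@dist_eq0 _ _ _ _ g); apply: (@ultralimit_dist _ _ _ _ g V _ _ (fun k => σ' k w) (fun k => c (t k)) 0 UV (Hγ w w2)).
    exact: Vc Vt.
  move=> e e0; apply: filterS (Vd e e0) => k /= hk.
  have [m _ e1] := Hσ k; rewrite /σ' -e1 m ?mind ?lexx ?d0 ?(ltW w0)// lee_fin mul1r add0r.
  by move: hk; rewrite minElt; case: ifP => _; rewrite ?subrr ?normr0 distrC// => ?; exact: ltW.
have mγ : minimizer g 1 0 w γ.
  apply: lip_minimizer => //; [exact: ltW| |by rewrite γ0 γw Dw subr0 mul1r].
  move=> a b ab bb; rewrite mul1r.
  apply: (@ultralimit_dist _ _ _ _ g V _ _ (fun k => σ' k a) (fun k => σ' k b) _ UV (Hγ a ab) (Hγ b bb)).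
  move=> e e0; apply: filterS (HV 0%N) => k _ /=; have [m _ _] := Hσ k.
  case/andP: ab bb => a0 _ /andP[b0 _]; rewrite m ?mind// lee_fin mul1r.
  have : `|Num.min a (d k) - Num.min b (d k)| <= `|a - b|.
    rewrite !minElt; case: ifP => h1; case: ifP => h2 => //; rewrite ?subrr ?normr0//.
      by move: h1 h2 => h1 /negbT; rewrite -leNgt => h2; rewrite !ler0_norm; alra.
    by move: h1 h2 => /negbT; rewrite -leNgt => h1 h2; rewrite !ger0_norm; alra.
  by move: e0; glra.
have [gam [mg Eγ]] := minimising_geodesic_exists hg w0 mγ.
have [[_ [e e0 [sg _]] _] _] := mg.
have g0 : gam 0 = c s0 by rewrite Eγ.
have gw : gam w = c t0 by rewrite Eγ.
have J0 x : 0 <= x <= w -> `]- e, w + e[%classic x.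
  by move=> xb; rewrite /= in_itv/=; move: xb e0; glra.
pose i := chart_at A (c s0); pose j := chart_at A (c t0).
have i0 : chart_dom i (gam 0) by rewrite g0; exact: chart_at_dom.
have j0 : chart_dom j (gam w) by rewrite gw; exact: chart_at_dom.
have di := smooth_curve_derive sg (J0 0 w1) i0.
have dj := smooth_curve_derive sg (J0 w w2) j0.
have cg x : 0 <= x <= w -> {for x, continuous gam} by move=> xb; exact: sg.1 (J0 x xb).
have w20 : 0 < w / 2 by rewrite divr_gt0.
have Vw : V [set k | w / 2 <= d k].
  by apply: filterS (Vd _ w20) => k /=; rewrite ler_norml; move: w0; glra.
set u1 := 'D_1 (chart_map i \o gam) 0 in di.
set u2 := 'D_1 (chart_map j \o gam) w in dj.
pose X1 := bilin (gmx g i (chart_map i (c s0))) u1 (l1 *: 'D_1 (chart_map i \o c) s0).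
(* The reversed geodesic leaves [c t0] with velocity [- u2]. *)
pose X2 := bilin (gmx g j (chart_map j (c t0))) (- u2) (l2 *: 'D_1 (chart_map j \o c) t0).
have X12 : 0 < X1 + X2.
  have := reg w gam mg g0 gw.
  have -> : inner g (c t0) (l2 *: velocity A c t0) (velocity A gam w) = - X2.
    rewrite /inner /velocity gw -/j !derive1E /X2 bilinNl opprK; apply: bilinC.
    by apply: gmx_sym; apply: chart_img_in; exact: chart_at_dom.
  have -> : inner g (c s0) (l1 *: velocity A c s0) (velocity A gam 0) = X1.
    rewrite /inner /velocity g0 -/i !derive1E /X1; apply: bilinC.
    by apply: gmx_sym; apply: chart_img_in; exact: chart_at_dom.
  by move=> ?; alra.
(* The gain is [4 * ε * h k]; the errors at the two ends take [ε * h k] each, and the remaining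
   [2 * ε] is at least [1 / (k + 1)] for most [k]. *)
pose ε := (X1 + X2) / 4; have ε0 : 0 < ε by rewrite divr_gt0.
have [K1 K10 H1] : exists2 K : R, 0 < K & V [set k | K * h k <= w / 2 / 4 /\
    (dist (c (s k + h k * l1)%R) (σ k (K * h k)%R) <= (K * h k - h k * X1 + ε * h k)%:E)%E].
  apply: (@first_variation_end _ _ _ _ g V c s0 l1 (w / 2) σ s h d gam u1) => //.
  - by move=> k; have [] := Hσ k.
  - by move=> k; have [] := Hσ k.
  - move=> τ /andP[τ0 τw] e' e'0; have τb : 0 <= τ <= w by rewrite τ0 (le_trans τw)//; move: w0; glra.
    apply: filterS (filterI (Hγ τ τb e' e'0) Vw) => k [/=]; rewrite Eγ// /σ' => h1 h2.
    by move: h1; rewrite min_l// (le_trans τw).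
  - exact: cg.
have [K2 K20 H2] : exists2 K : R, 0 < K & V [set k | K * h k <= w / 2 / 4 /\
    (dist (c (t k + h k * l2)%R) (σ k (d k - K * h k)%R) <= (K * h k - h k * X2 + ε * h k)%:E)%E].
  apply: (@first_variation_end _ _ _ _ g V c t0 l2 (w / 2) (fun k τ => σ k (d k - τ)) t h d (fun τ => gam (w - τ)) (- u2)) => //.
  - move=> k a b ab bb; have [m _ _] := Hσ k; rewrite m; [|by move: ab; alra|by move: bb; alra].
    by congr (_ * _)%:E; rewrite opprB addrC addrA subrK distrC.
  - by move=> k; rewrite subr0; have [] := Hσ k.
  - move=> τ /andP[τ0 τw] e' e'0.
    have τb : 0 <= w - τ <= w by move: τ0 τw w0; alra.
    have e'2 : 0 < e' / 2 by rewrite divr_gt0.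
    apply: filterS (filterI (filterI (Hγ _ τb _ e'2) Vw) (Vd _ e'2)) => k [[/= h1 h2] h3].
    have -> : e' = e' / 2 + e' / 2 by alra.
    rewrite Eγ//; apply: dist_tri h1 _; have [m _ _] := Hσ k.
    have dτ : 0 <= d k - τ <= d k by move: τw h2 τ0; rewrite /=; glra.
    rewrite /σ' m ?mind//; last by case/andP: τb.
    rewrite lee_fin mul1r; move: h3 τ0; rewrite !ler_norml minElt; case: ifP => [_|/negbT]; first by alra.
    by rewrite -leNgt; alra.
  - by rewrite subr0.
  - have := @is_derive_affine R _ (chart_map j \o gam) w 0 (-1) u2; rewrite mul0r addr0 scaleN1r => /(_ dj).
    by have -> : (fun s => (chart_map j \o gam) (w + s * -1)) = chart_map j \o (fun τ => gam (w - τ))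
      by apply/funext => z /=; rewrite mulrN1.
  - apply: (@continuous_comp _ _ _ (fun τ : R => w - τ) gam); last by rewrite subr0; exact: cg.
    by apply: continuousB; [exact: cst_continuous|exact: cvg_id].
have ε2 : 0 < 2 * ε by rewrite mulr_gt0.
have [k [[H1k H2k] [Vwk Vek]]] := ultra_ex2 UV (filterI H1 H2) (filterI Vw (small _ ε2)).
case: H1k => a1 b1; case: H2k => a2 b2.
have [_ _ _ Dk Bk] := Hf k; apply: Bk.
have hk := h0 k; have [m _ _] := Hσ k.
have K1h : 0 < K1 * h k by rewrite mulr_gt0.
have K2h : 0 < K2 * h k by rewrite mulr_gt0.
have mid : (dist (σ k (K1 * h k)%R) (σ k (d k - K2 * h k)%R) <= (d k - K2 * h k - K1 * h k)%:E)%E.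
  rewrite m; [|by move: a1 K1h Vwk w0; rewrite /=; glra|by move: a2 K2h Vwk w0; rewrite /=; glra].
  rewrite lee_fin mul1r distrC ger0_norm//.
  by move: a1 a2 Vwk w0; rewrite /=; glra.
have tot := dist_tri b1 (dist_tri mid (dist_sym_le b2)).
apply: le_trans tot _; rewrite lee_fin.
have : k.+1%:R^-1 * h k <= 2 * ε * h k by rewrite ler_wpM2r ?(ltW hk).
have -> : K1 * h k - h k * X1 + ε * h k + (d k - K2 * h k - K1 * h k + (K2 * h k - h k * X2 + ε * h k)) =
  d k - 4 * ε * h k + 2 * ε * h k by rewrite /ε; field.
by move: (_.+1%:R^-1 * _) => z; glra.
Qed.

End Decrease.

(** * Deformation near a level without critical points *)

Section CircleDistance.
Context {R : realType} {n : nat} {M : topologicalType}.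
Context {A : smooth_manifold R n M}.
Context (g : riemannian_metric A) (c : R -> M) (hc : embedded_circle A c).
Local Notation dist := (dist g).

Lemma circle_shift (s : R) (k : int) : c (s + k%:~R) = c s.
Proof. by have [_ inj _] := hc; apply/inj; exists k. Qed.

Lemma circle_inj s t : c s = c t -> exists k : int, s = t + k%:~R.
Proof. by have [_ inj _] := hc; move/inj. Qed.

Lemma circle_smooth : smooth_curve A setT c.
Proof. by have [] := hc. Qed.

Lemma speed_shift (t : R) (k : int) : speed g c (t + k%:~R) = speed g c t.
Proof.
have := @speed_affine _ _ _ _ g setT c k%:~R 1 t circle_smooth I.
have -> : (fun t => c (k%:~R + t * 1)) = c by apply/funext => s; rewrite mulr1 addrC circle_shift.
by rewrite normr1 mul1r mulr1 addrC => <-.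
Qed.

Lemma shift01 (s : R) : exists k : int, 0 <= s + k%:~R < 1.
Proof.
exists (- Num.floor s); rewrite mulrNz subr_ge0 ltrBlDr floor_le//.
by have := lt_succ_floor s; rewrite intrD addrC.
Qed.

Lemma circle_speed_bound : exists2 Λ : R, 0 < Λ & forall t, speed g c t <= Λ.
Proof.
have [|Λ Λ0 H] := @cont_bounded R (speed g c) 0 1 ler01.
  by move=> t _; exact: (@speed_continuous _ _ _ _ g setT c t openT circle_smooth I).
exists Λ => // t; have [k /andP[k0 k1]] := shift01 t.
rewrite -(speed_shift t k); apply: le_trans (ler_norm _) (H _ _).
by rewrite k0 ltW.
Qed.

Lemma dist_circle_lip (Λ : R) s t : (forall t, speed g c t <= Λ) -> (dist (c s) (c t) <= (Λ * `|t - s|)%:E)%E.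
Proof.
move=> HΛ; pose c' τ := c (s + τ * (t - s)).
have sc' : smooth_curve A setT c' by exact: (smooth_curve_affine s (t - s) circle_smooth).
have c01 : smooth_curve A `]0 - 1, 1 + 1[ c' by apply: smooth_curve_sub sc'.
have [Fp HF _] := curve_length_primitive g ler01 ltr01 c01.
have := @dist_subcurve _ _ _ _ g c' 1 Fp ltr01 c01 HF 0 1.
rewrite /c' mul0r addr0 mul1r subrKC !lexx ler01 => /(_ isT isT) /le_trans; apply.
rewrite lee_fin; have [x xb ->] := mvt_is_derive ler01 HF.
rewrite subr0 mulr1 ger0_norm; last exact: speed_ge0.
have := @speed_affine _ _ _ _ g setT c s (t - s) x circle_smooth I.
by rewrite /c' => ->; rewrite mulrC ler_wpM2r.
Qed.

Lemma int_gap (k : int) : -1 < (k%:~R : R) -> (k%:~R : R) < 0 -> False.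
Proof.
have -> : (-1 : R) = (-1)%:~R by rewrite mulrN1z.
rewrite ltr_int -[0 : R]/(0%:~R) ltr_int; lia.
Qed.

(** The distance on lifted pairs. Taking [fine] loses nothing, since [c] itself joins any two points
    of the circle with finite length. *)
Definition cdist s t : R := fine (dist (c s) (c t)).

Lemma cdistE s t : dist (c s) (c t) = (cdist s t)%:E.
Proof.
have [Λ _ HΛ] := circle_speed_bound.
by have [D [E _ _]] := dist_fin (dist_circle_lip s t HΛ); rewrite /cdist E.
Qed.

Lemma cdist_ge0 s t : 0 <= cdist s t.
Proof. by rewrite -lee_fin -cdistE dist_ge0. Qed.

Lemma cdist_shift s t (k m : int) : cdist (s + k%:~R) (t + m%:~R) = cdist s t.
Proof. by rewrite /cdist !circle_shift. Qed.

Lemma cdist_sym s t : cdist s t = cdist t s.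
Proof. by rewrite /cdist dist_sym. Qed.

Lemma cdist_eq0 s t : cdist s t <= 0 -> exists k : int, s = t + k%:~R.
Proof. by move=> h; apply: circle_inj; apply: (@dist_eq0 _ _ _ _ g); rewrite cdistE lee_fin. Qed.

Lemma cdist_perturb s t s' t' : `|cdist s t - cdist s' t'| <= cdist s s' + cdist t t'.
Proof. by apply: (dist_perturb (cdistE s t) (cdistE s' t')); rewrite cdistE. Qed.

Lemma cdist_lip : exists2 Λ : R, 0 < Λ & forall s t, cdist s t <= Λ * `|t - s|.
Proof.
have [Λ Λ0 HΛ] := circle_speed_bound; exists Λ => // s t.
by rewrite -lee_fin -cdistE dist_circle_lip.
Qed.

(** Injectivity of [c] modulo 1 made quantitative. The least distance from [c s] to the points
    [c (s + u)] with [u] in [[η, 1 - η]] is a Lipschitz function of [s], so it attains a positive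
    minimum: two minimisations in one variable. *)
Lemma cdist_separation (η : R) : 0 < η -> exists2 m : R, 0 < m & forall s t, cdist s t < m ->
  exists k : int, `|t - s - k%:~R| < η.
Proof.
move=> η0.
wlog η4 : η η0 / η <= 4^-1.
  move=> H; have [q [q0 q1 q2]] := @small2 R η 4^-1 η0 ltac:(by rewrite invr_gt0).
  have [m m0 Hm] := H q q0 q2; exists m => // s t /Hm[k hk]; exists k; exact: lt_le_trans q1.
have [Λ Λ0 HΛ] := cdist_lip.
have ηη : η <= 1 - η by alra.
have lipF s t s' t' : `|cdist s t - cdist s' t'| <= Λ * `|s - s'| + Λ * `|t - t'|.
  apply: le_trans (cdist_perturb s t s' t') _; apply: lerD.
    by rewrite distrC.
  by rewrite distrC.
have mex s : exists u, η <= u <= 1 - η /\ forall v, η <= v <= 1 - η -> cdist s (s + u) <= cdist s (s + v).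
  have [|u ub Hu] := @EVT_min R (fun v => cdist s (s + v)) η (1 - η) ηη.
    apply: (lip_within (ltW Λ0)) => v w _ _; apply: le_trans (lipF _ _ _ _) _.
    by rewrite subrr normr0 mulr0 add0r opprD addrACA subrr add0r.
  exists u; split; first by move: ub; rewrite in_itv.
  by move=> v vb; apply: Hu; rewrite in_itv.
have [U HU] := choice mex.
have [|s0 s0b Hs0] := @EVT_min R (fun s => cdist s (s + U s)) 0 1 ler01.
  have L2 : 0 <= 2 * Λ by rewrite mulr_ge0// ltW.
  apply: (lip_within L2) => s t _ _.
  have h x y : cdist x (x + U x) - cdist y (y + U y) <= 2 * Λ * `|x - y|.
    have h1 := (HU x).2 (U y) (HU y).1.
    have := lipF x (x + U y) y (y + U y).
    have -> : x + U y - (y + U y) = x - y by rewrite opprD addrACA subrr addr0.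
    by rewrite ler_norml; move: h1; alra.
  have := h s t; have := h t s; rewrite [`|t - s|]distrC ler_norml; alra.
have [ub _] := HU s0.
exists (cdist s0 (s0 + U s0)).
  rewrite ltNge; apply/negP => /cdist_eq0[k].
  by move=> E; apply: (@int_gap k); move: ub E η0 ηη; alra.
move=> s t st.
have [k /andP[k0 k1]] := shift01 s.
have [m /andP[m0 m1]] := shift01 (t - s).
set u := t - s + m%:~R in m0 m1.
have E : cdist s t = cdist (s + k%:~R) (s + k%:~R + u).
  by rewrite -(cdist_shift s t k (k + m)) /u intrD; congr cdist; alra.
have [uη|ηu] := ltP u η.
  by exists (- m); rewrite mulrNz opprK -/u ger0_norm.
have [u1|u1] := ltP (1 - η) u.
  exists (1 - m); rewrite intrB opprB addrA -/u ltr_norml; move: m1 u1 η0; alra.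
have h1 := (HU (s + k%:~R)).2 u; rewrite ηu u1 in h1.
have h2 := Hs0 (s + k%:~R); rewrite in_itv/= k0 (ltW k1) in h2.
by have := h1 isT; have := h2 isT; move: st; rewrite E; alra.
Qed.

End CircleDistance.

(** * Equivariant moves of lifted pairs *)

Section Pushes.
Context {R : realType} {n : nat} {M : topologicalType}.
Context {A : smooth_manifold R n M}.
Context (g : riemannian_metric A) (c : R -> M) (hc : embedded_circle A c).
Local Notation F := (cdist g c).
Implicit Types (T : R * R -> R * R) (x y : R * R).

(* [T] lifts to [R * R] a self-map of the pairs of points of the circle. By the
   last clause it sends lifted closed arcs [`[s, t]], of length at most one, to
   such arcs. *)
Definition is_push (w : R) T :=
  [/\ forall x (e : R), 0 < e -> exists2 d : R, 0 < d & forall y, `|y.1 - x.1| < d -> `|y.2 - x.2| < d ->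
        `|(T y).1 - (T x).1| < e /\ `|(T y).2 - (T x).2| < e,
      forall s t (k m : int), T (s + k%:~R, t + m%:~R) = ((T (s, t)).1 + k%:~R, (T (s, t)).2 + m%:~R),
      forall x, F (T x).1 (T x).2 <= F x.1 x.2,
      forall x, F x.1 x.2 < w / 2 -> T x = x &
      forall s t, s <= t <= s + 1 -> (T (s, t)).1 <= (T (s, t)).2 <= (T (s, t)).1 + 1].

Definition displacement_le T (e : R) := forall x, `|(T x).1 - x.1| <= e /\ `|(T x).2 - x.2| <= e.

Lemma push_id w : is_push w id.
Proof. by split => // x e e0; exists e. Qed.

Lemma push_comp w T T' : is_push w T -> is_push w T' -> is_push w (T' \o T).
Proof.
move=> [c1 e1 d1 i1 o1] [c2 e2 d2 i2 o2]; split.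
- move=> x e e0; have [η η0 Hη] := c2 (T x) e e0; have [d d0 Hd] := c1 x η η0.
  by exists d => // y y1 y2; have [h1 h2] := Hd y y1 y2; exact: Hη.
- by move=> s t k m /=; rewrite e1 e2; case: (T (s, t)).
- by move=> x; apply: le_trans (d2 _) (d1 x).
- by move=> x h /=; rewrite i1// i2.
- by move=> s t /o1 /=; case: (T (s, t)) => a b /=; exact: o2.
Qed.

Lemma displacement_comp T T' e e' : displacement_le T e -> displacement_le T' e' -> displacement_le (T' \o T) (e + e').
Proof.
move=> h h' x; have [a1 a2] := h x; have [b1 b2] := h' (T x); split => /=.
  by rewrite -(subrKA (T x).1) [e + _]addrC; apply: le_trans (ler_normD _ _) _; exact: lerD.
by rewrite -(subrKA (T x).2) [e + _]addrC; apply: le_trans (ler_normD _ _) _; exact: lerD.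
Qed.

Definition clamp (u : R) := Num.max 0 (Num.min 1 u).

Lemma clampP u : [\/ u <= 0 /\ clamp u = 0, 0 <= u <= 1 /\ clamp u = u | 1 <= u /\ clamp u = 1].
Proof.
rewrite /clamp; have [u0|] := boolP (u <= 0).
  by constructor 1; rewrite min_r ?max_l//; apply: le_trans u0 _.
rewrite -ltNge => u0; have [u1|] := boolP (u <= 1).
  by constructor 2; rewrite min_r// max_r ?u1 (ltW u0).
by rewrite -ltNge => u1; constructor 3; rewrite min_l ?max_r ?(ltW u1).
Qed.

Lemma clamp_lip u v : `|clamp u - clamp v| <= `|u - v|.
Proof.
have := ler_norm (u - v); have := ler_norm (v - u); rewrite [`|v - u|]distrC ler_norml.
by case: (clampP u) => -[? ->]; case: (clampP v) => -[? ->]; alra.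
Qed.

Lemma clamp01 u : 0 <= clamp u <= 1.
Proof. by case: (clampP u) => -[? ->]; alra. Qed.

(** The move along [(l1, l2)] is cut off by [χ], a function of the distances to [c s0] and [c t0]
    and therefore periodic in both variables. Its support contains only pairs at distance more than
    [w / 2]. *)
Lemma elementary_push (w s0 t0 l1 l2 δ : R) : 0 < w -> F s0 t0 = w -> 0 < δ ->
  (forall s t h, `|s - s0| < δ -> `|t - t0| < δ -> 0 < h -> h < δ ->
     F (s + h * l1) (t + h * l2) <= F s t - δ * h) ->
  exists2 ρ : R, 0 < ρ & forall e : R, 0 < e -> exists T γ, [/\ is_push w T, displacement_le T e, 0 < γ &
    forall x, `|x.1 - s0| < ρ -> `|x.2 - t0| < ρ -> F (T x).1 (T x).2 <= F x.1 x.2 - γ].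
Proof.
move=> w0 Fw δ0 dec.
have [Λ Λ0 HΛ] := cdist_lip g hc.
have [m m0 Hm] := cdist_separation g hc δ0.
have [κ [κ0 κ1 κ2]] := @small2 R (m / 2) (w / 8) ltac:(by rewrite divr_gt0) ltac:(by rewrite divr_gt0).
pose N x := F s0 x.1 + F t0 x.2.
pose χ x := clamp (2 - N x / κ).
have N0 x : 0 <= N x by rewrite addr_ge0// cdist_ge0.
have χ01 x : 0 <= χ x <= 1 by exact: clamp01.
have χpos x : 0 < χ x -> N x < 2 * κ.
  move=> h; rewrite ltNge; apply/negP => h2; move: h.
  have : 2 - N x / κ <= 0 by rewrite subr_le0 ler_pdivlMr.
  by rewrite /χ; case: (clampP (2 - N x / κ)) => -[? ->]; alra.
have χ1 x : N x <= κ -> χ x = 1.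
  move=> h; have : 1 <= 2 - N x / κ by have : N x / κ <= 1; [rewrite ler_pdivrMr ?mul1r|alra].
  by rewrite /χ; case: (clampP (2 - N x / κ)) => -[? ->]; alra.
have Nlip x y : `|N x - N y| <= Λ * `|x.1 - y.1| + Λ * `|x.2 - y.2|.
  have -> : N x - N y = (F s0 x.1 - F s0 y.1) + (F t0 x.2 - F t0 y.2) by rewrite /N; ring.
  apply: le_trans (ler_normD _ _) _.
  have := cdist_perturb g hc s0 x.1 s0 y.1; have := cdist_perturb g hc t0 x.2 t0 y.2.
  have := HΛ s0 s0; have := HΛ t0 t0; rewrite !subrr normr0 mulr0.
  have := HΛ x.1 y.1; have := HΛ x.2 y.2; rewrite [`|y.1 - _|]distrC [`|y.2 - _|]distrC; alra.
have Nshift s t (k p : int) : N (s + k%:~R, t + p%:~R) = N (s, t).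
  by rewrite /N /= -[F s0 (s + _)](cdist_shift g hc _ _ 0 0) -{1}[s0]addr0 -{1}[t0]addr0 /cdist !(circle_shift hc) !addr0.
have Flow x : 0 < χ x -> w / 2 < F x.1 x.2.
  move=> /χpos h; have := cdist_perturb g hc s0 t0 x.1 x.2; rewrite Fw -/(N x) ler_norml.
  by move: h κ2 w0; alra.
exists (κ / 2 / Λ); first by rewrite !divr_gt0.
move=> e e0; pose l := `|l1| + `|l2| + 1.
have l0 : 0 < l by rewrite ltr_wpDl// addr_ge0.
(* The bounds on [h] serve, in this order, the validity of [dec], the displacement [e], and the
   order clause: a total displacement of at most [w / 2 / Λ] cannot exhaust an arc whose ends are
   more than [w / 2] apart. *)
have [h [h0 h1 h2 h3 _]] := @small4 R (δ / 2) (e / l) (w / 2 / Λ / l) 1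
  ltac:(by rewrite divr_gt0) ltac:(by rewrite divr_gt0) ltac:(by rewrite !divr_gt0) ltr01.
have hχ x : 0 <= h * χ x <= h.
  have [a b] := andP (χ01 x).
  by rewrite mulr_ge0 ?(ltW h0)//= -[leRHS]mulr1 ler_wpM2l// ltW.
pose T x := (x.1 + h * χ x * l1, x.2 + h * χ x * l2).
have Tgain x : 0 < χ x -> F (T x).1 (T x).2 <= F x.1 x.2 - δ * (h * χ x).
  move=> xp; have := χpos x xp; rewrite /N => hN.
  (* A pair in the support of [χ] is close to [(s0, t0)] only modulo integers. *)
  have [k hk] : exists k : int, `|x.1 - s0 - k%:~R| < δ.
    by apply: Hm; have := cdist_ge0 g hc t0 x.2; move: hN κ1; alra.
  have [p hp] : exists k : int, `|x.2 - t0 - k%:~R| < δ.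
    by apply: Hm; have := cdist_ge0 g hc s0 x.1; move: hN κ1; alra.
  have hχ0 : 0 < h * χ x by rewrite mulr_gt0.
  have := dec (x.1 + (- k)%:~R) (x.2 + (- p)%:~R) (h * χ x).
  rewrite !mulrNz [x.1 - _ - s0]addrAC [x.2 - _ - t0]addrAC => /(_ hk hp hχ0)/(_ _)/wrap[|].
    by have /andP[_ ?] := hχ x; move: h1 δ0; alra.
  rewrite -!mulrNz (cdist_shift g hc) => H.
  apply: le_trans H; rewrite -(cdist_shift g hc _ _ (-k) (-p)) /T /=.
  by rewrite !mulrNz addrAC [x.2 + _ - _]addrAC.
have dT x : h * χ x * (`|l1| + `|l2|) <= h * l.
  have /andP[a b] := hχ x; apply: ler_pM => //.
  by rewrite /l lerDl.
have hle : h * l <= e by rewrite -ler_pdivlMr.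
have hlw : h * l <= w / 2 / Λ by rewrite -ler_pdivlMr.
have hl1 x : `|h * χ x * l1| + `|h * χ x * l2| <= h * l.
  have /andP[a _] := hχ x.
  by rewrite ![`|h * χ x * _|]normrM (ger0_norm a) -mulrDr; exact: dT.
exists T, (δ * h); split.
- split.
  + move=> x e' e'0.
    pose D := 1 + h * l * (2 * Λ / κ).
    have D0 : 0 < D by rewrite /D ltr_pwDl// !mulr_ge0 ?invr_ge0 ?(ltW h0) ?(ltW l0) ?(ltW Λ0) ?(ltW κ0).
    exists (e' / D); first by rewrite divr_gt0.
    move=> y y1 y2.
    have [z [z1 z2 zD]] : exists z, [/\ `|y.1 - x.1| <= z, `|y.2 - x.2| <= z & z < e' / D].
      exists (Num.max `|y.1 - x.1| `|y.2 - x.2|); split; rewrite ?le_max ?lexx ?orbT//.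
      by rewrite gt_max y1 y2.
    have z0 : 0 <= z by apply: le_trans z1.
    have χd : `|χ y - χ x| <= 2 * Λ / κ * z.
      apply: le_trans (clamp_lip _ _) _.
      have -> : 2 - N y / κ - (2 - N x / κ) = - (N y - N x) / κ by ring.
      rewrite normrM normrN normfV (gtr0_norm κ0) ler_pdivrMr//; apply: le_trans (Nlip y x) _.
      have -> : 2 * Λ / κ * z * κ = Λ * z + Λ * z by field; rewrite gt_eqF.
      by apply: lerD; rewrite ler_wpM2l// ltW.
    have zD' : z * D < e' by rewrite -ltr_pdivlMr.
    have bnd (li a b : R) : `|a - b| <= z -> `|li| <= l -> `|a + h * χ y * li - (b + h * χ x * li)| < e'.
      move=> ab il; have -> : a + h * χ y * li - (b + h * χ x * li) = (a - b) + h * (li * (χ y - χ x)) by ring.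
      apply: le_lt_trans (ler_normD _ _) (le_lt_trans _ zD'); rewrite /D [z * (_ + _)]mulrDr [z * 1]mulr1; apply: lerD => //.
      rewrite !normrM (gtr0_norm h0).
      have -> : z * (h * l * (2 * Λ / κ)) = h * (l * (2 * Λ / κ * z)) by ring.
      by rewrite ler_wpM2l ?(ltW h0)// ler_pM.
    split; apply: bnd => //; rewrite /l; have := normr_ge0 l1; have := normr_ge0 l2; alra.
  + by move=> s t k p; rewrite /T /= /χ Nshift; congr (_, _); rewrite addrAC.
  + move=> x; have /andP[] := χ01 x; rewrite le_eqVlt => /predU1P[E|xp] _.
      by rewrite /T -E mulr0 !mul0r !addr0.
    by apply: le_trans (Tgain x xp) _; rewrite gerBl mulr_ge0 ?(ltW δ0)//; have /andP[] := hχ x.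
  + move=> x xw; have /andP[] := χ01 x; rewrite le_eqVlt => /predU1P[E|xp] _.
      by rewrite /T -E mulr0 !mul0r !addr0; case: (x).
    by have := Flow x xp; rewrite ltNge (ltW xw).
  + move=> s t /andP[st ts]; have /andP[] := χ01 (s, t); rewrite le_eqVlt => /predU1P[E|xp] _.
      by rewrite /T -E mulr0 !mul0r !addr0/= st.
    have := Flow _ xp => /= fl.
    have f1 := HΛ s t.
    have f2 : F s t <= Λ * `|t - (s + 1)|.
      by rewrite -[F s t](cdist_shift g hc s t 1 0) mulr0z addr0 mulr1z.
    rewrite ger0_norm ?subr_ge0// in f1; rewrite distrC ger0_norm ?subr_ge0// in f2.
    have g1 : w / 2 / Λ < t - s by rewrite ltr_pdivrMr// [_ * Λ]mulrC; exact: lt_le_trans f1.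
    have g2 : w / 2 / Λ < s + 1 - t by rewrite ltr_pdivrMr// [_ * Λ]mulrC; exact: lt_le_trans f2.
    have := hl1 (s, t); have := ler_norm (h * χ (s, t) * l1); have := ler_norm (h * χ (s, t) * l2).
    have := ler_norm (- (h * χ (s, t) * l1)); have := ler_norm (- (h * χ (s, t) * l2)); rewrite !normrN /T /=.
    by move: g1 g2 hlw; alra.
- move=> x; rewrite /T /=; split; rewrite addrAC subrr add0r; apply: le_trans hle; apply: le_trans (hl1 x); rewrite ?lerDl ?lerDr//.
- exact: mulr_gt0.
- move=> x x1 x2.
  have Nx : N x <= κ.
    have := HΛ s0 x.1; have := HΛ t0 x.2.
    have : Λ * `|x.1 - s0| <= κ / 2 by rewrite mulrC -ler_pdivlMr// ltW.
    have : Λ * `|x.2 - t0| <= κ / 2 by rewrite mulrC -ler_pdivlMr// ltW.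
    by rewrite /N; alra.
  by have := Tgain x; rewrite χ1// mulr1 => /(_ ltr01).
Qed.

End Pushes.

(** * Composition of moves by compactness *)

Section Deformation.
Context {R : realType} {n : nat} {M : topologicalType}.
Context {A : smooth_manifold R n M}.
Context (g : riemannian_metric A) (hg : complete_riemannian g).
Context (c : R -> M) (hc : embedded_circle A c).
Local Notation F := (cdist g c).
Implicit Types (T : R * R -> R * R) (x y : R * R) (S : set (R * R)).

(** The radius [ρ] comes before the displacement [e]: a preceding move can be made so small that
    points do not leave the neighbourhood on which the next one acts. The gain [G] may depend on
    [e]. *)
Definition pushable (w : R) S := exists2 ρ : R, 0 < ρ & forall e : R, 0 < e ->
  exists T G, [/\ is_push g c w T, displacement_le T e, 0 < G &
    forall x y, S x -> `|y.1 - x.1| < ρ -> `|y.2 - x.2| < ρ -> F y.1 y.2 <= w + G ->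
      F (T y).1 (T y).2 <= w - G].

Lemma pushable_sub w S S' : S' `<=` S -> pushable w S -> pushable w S'.
Proof.
move=> sub [ρ ρ0 H]; exists ρ => // e e0; have [T [G [h1 h2 h3 h4]]] := H e e0.
by exists T, G; split => // x y /sub; exact: h4.
Qed.

Lemma pushableU w S S' : pushable w S -> pushable w S' -> pushable w (S `|` S').
Proof.
move=> [ρ ρ0 H] [ρ' ρ'0 H'].
have ρ2 : 0 < ρ' / 2 by rewrite divr_gt0.
have [q [q0 q1 q2]] := small2 ρ0 ρ2.
exists q => // e e0; have e2 : 0 < e / 2 by rewrite divr_gt0.
have [d [d0 d1 d2]] := small2 e2 ρ2.
have [T [G [h1 h2 h3 h4]]] := H d d0; have [T' [G' [h1' h2' h3' h4']]] := H' _ e2.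
have [G2 [G20 g1 g2]] := small2 h3 h3'.
exists (T' \o T), G2; split => //; first exact: push_comp.
  move=> x; have [a1 a2] := displacement_comp h2 h2' x.
  by split; [apply: le_trans a1 _|apply: le_trans a2 _]; move: d1; glra.
move=> x y [Sx|Sx] y1 y2 Fy /=.
  have [_ _ d' _ _] := h1'; apply: le_trans (d' _) _; apply: le_trans (h4 x y Sx _ _ _) _.
  - exact: lt_le_trans q1.
  - exact: lt_le_trans q1.
  - by apply: le_trans Fy _; rewrite lerD2l.
  - by rewrite lerD2l lerN2.
have [a1 a2] := h2 y; have [_ _ dd _ _] := h1.
apply: le_trans (h4' x (T y) Sx _ _ _) _.
- rewrite -(subrKA y.1); apply: le_lt_trans (ler_normD _ _) _; move: a1 d2 y1 q2; glra.
- rewrite -(subrKA y.2); apply: le_lt_trans (ler_normD _ _) _; move: a2 d2 y2 q2; glra.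
- by apply: le_trans (dd y) _; apply: le_trans Fy _; rewrite lerD2l.
- by rewrite lerD2l lerN2.
Qed.

Lemma pushable_point (w : R) x : 0 < w -> (F x.1 x.2 = w -> regular_pair g c (c x.1) (c x.2)) ->
  exists2 r : R, 0 < r & pushable w (ball x r).
Proof.
move=> w0 reg.
have [E|nE] := eqVneq (F x.1 x.2) w.
  have [v1 [v2 [[s1 [l1 [e1 ->]]] [t1 [l2 [e2 ->]]] H]]] := reg E.
  have D : dist g (c s1) (c t1) = w%:E by rewrite e1 e2 cdistE// E.
  have [|δ δ0 Hδ] := @decrease _ _ _ _ g hg c s1 t1 w l1 l2 (circle_smooth hc) w0 D.
    by move=> a gam mg g0 ga; rewrite e1 e2; apply: H => //; rewrite -?e1 -?e2.
  have [k Ek] := circle_inj hc e1; have [m Em] := circle_inj hc e2.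
  have [s t h hs ht h0 h1|ρ ρ0 Hρ] := @elementary_push _ _ _ _ g c hc w x.1 x.2 l1 l2 δ w0 E δ0.
    have e3 (a b : R) (p : int) : a + p%:~R - (b + p%:~R) = a - b by rewrite opprD addrACA subrr addr0.
    have := Hδ (s + k%:~R) (t + m%:~R) h (F s t); rewrite Ek Em !e3 => /(_ hs ht h0 h1).
    rewrite !(circle_shift hc) (cdistE g hc) => /(_ erefl).
    by rewrite addrAC (circle_shift hc) addrAC (circle_shift hc) cdistE// lee_fin.
  exists (ρ / 2); first by rewrite divr_gt0.
  exists (ρ / 2); first by rewrite divr_gt0.
  move=> e e0; have [T [γ [h1 h2 γ0 h3]]] := Hρ e e0.
  exists T, (γ / 2); split => //; first by rewrite divr_gt0.
  move=> z y [z1 z2] y1 y2 Fy.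
  have a1 : `|y.1 - x.1| < ρ.
    rewrite -(subrKA z.1); apply: le_lt_trans (ler_normD _ _) _.
    by move: z1; rewrite /ball/= distrC; move: y1; rewrite /=; glra.
  have a2 : `|y.2 - x.2| < ρ.
    rewrite -(subrKA z.2); apply: le_lt_trans (ler_normD _ _) _.
    by move: z2; rewrite /ball/= distrC; move: y2; rewrite /=; glra.
  by have := h3 y a1 a2; move: Fy; glra.
have [Λ Λ0 HΛ] := cdist_lip g hc.
(* Off the level [w] the identity will do: nearby pairs lie either below [w - θ / 4] or above
   [w + θ / 4], where nothing is claimed. *)
pose θ := `|F x.1 x.2 - w|; have θ0 : 0 < θ by rewrite normr_gt0 subr_eq0.
pose r := θ / 8 / Λ; have r0 : 0 < r by rewrite !divr_gt0.
exists r => //; exists r => // e e0; exists id, (θ / 4); split.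
- exact: push_id.
- by move=> y; rewrite /= !subrr normr0 ltW.
- by rewrite divr_gt0.
- move=> z y [z1 z2] y1 y2 /= Fy.
  have bnd (a b d : R) : `|a - b| < r -> `|b - d| < r -> F d a <= θ / 4.
    move=> ab bd; apply: le_trans (HΛ _ _) _.
    have -> : θ / 4 = Λ * (r + r) by rewrite /r; field; rewrite gt_eqF.
    rewrite ler_wpM2l ?(ltW Λ0)// -(subrKA b); apply: le_trans (ler_normD _ _) _.
    by rewrite lerD// ltW.
  have b1 : F x.1 y.1 <= θ / 4 by apply: bnd y1 _; rewrite distrC.
  have b2 : F x.2 y.2 <= θ / 4 by apply: bnd y2 _; rewrite distrC.
  have := cdist_perturb g hc x.1 x.2 y.1 y.2.
  have := ler_norm (F x.1 x.2 - w); have := ler_norm (w - F x.1 x.2); rewrite [`|w - _|]distrC -/θ.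
  have : θ = F x.1 x.2 - w \/ θ = w - F x.1 x.2.
    by rewrite /θ; have [h|h] := leP w (F x.1 x.2); [left; rewrite ger0_norm ?subr_ge0|right; rewrite ltr0_norm ?subr_lt0// opprB].
  by rewrite ler_norml => -[] E' _ _ /andP[h3 h4]; move: b1 b2 Fy θ0 E' h3 h4; glra.
Qed.

(** [real_induction] acts twice as compactness, along the second variable for thin strips and then
    along the first; equivariance carries the result from the unit square to all lifted pairs. *)
Theorem deformation (w : R) : 0 < w ->
  (forall s t, F s t = w -> regular_pair g c (c s) (c t)) ->
  exists T G, [/\ is_push g c w T, 0 < G & forall x, F x.1 x.2 <= w + G -> F (T x).1 (T x).2 <= w - G].
Proof.
move=> w0 reg.
have pt x : exists r : R, 0 < r /\ pushable w (ball x r).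
  by have [r r0 H] := @pushable_point w x w0 (reg x.1 x.2); exists r.
have [r Hr] := choice pt.
pose box (a b a' b' : R) : set (R * R) := [set x | a <= x.1 <= b /\ a' <= x.2 <= b'].
have strip s : exists2 d : R, 0 < d & pushable w (box (s - d) (s + d) 0 1).
  apply: (@real_induction R 0 1 (fun t u => exists2 d : R, 0 < d & pushable w (box (s - d) (s + d) t u)) ler01).
    move=> t u v [d d0 P1] [d' d'0 P2]; have [q [q0 q1 q2]] := small2 d0 d'0.
    exists q => //; apply: pushable_sub (pushableU P1 P2) => x [/andP[x1 x2] /andP[x3 x4]].
    have [xu|ux] := leP x.2 u; [left|right]; split; rewrite ?x3 ?x4 ?xu ?(ltW ux)//.
      by move: x1 x2 q1; glra.
    by move: x1 x2 q2; glra.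
  move=> t _; have [r0 H] := Hr (s, t); set ρ := r (s, t) in r0 H.
  exists ρ => // a b _ at_ tb _ h1 h2.
  split; (exists (ρ / 2); first by rewrite divr_gt0); apply: pushable_sub H => x [x1 x2];
    split; rewrite /ball/= ltr_norml; move: x1 x2 h1 h2 at_ tb r0; glra.
have PD : pushable w (box 0 1 0 1).
  apply: (@real_induction R 0 1 (fun a b => pushable w (box a b 0 1)) ler01).
    move=> a b d P1 P2; apply: pushable_sub (pushableU P1 P2) => x [/andP[x1 x2] x3].
    by have [xu|ux] := leP x.1 b; [left|right]; split; rewrite ?x1 ?x2 ?xu ?(ltW ux).
  move=> s _; have [d d0 H] := strip s; exists d => // a b _ sa sb _ h1 h2.
  by split; apply: pushable_sub H => x [x1 x2]; split => //; move: x1 h1 h2 sa sb d0; glra.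
have [ρ ρ0 H] := PD; have [T [G [h1 _ h3 h4]]] := H 1 ltr01.
exists T, G; split => // x Fx.
have [k /andP[k0 k1]] := shift01 x.1; have [m /andP[m0 m1]] := shift01 x.2.
have := h4 (x.1 + k%:~R, x.2 + m%:~R) (x.1 + k%:~R, x.2 + m%:~R).
rewrite /= !subrr normr0 cdist_shift// => /(_ _ ρ0 ρ0 Fx)/wrap[|].
  by split; rewrite /= ?k0 ?m0 ltW.
have [_ h _ _ _] := h1; rewrite h /= cdist_shift//.
by case: (x).
Qed.

End Deformation.

(** * Sweepouts and the width *)

Section ArcDistance.
Context {R : realType} {n : nat} {M : topologicalType}.
Context {A : smooth_manifold R n M}.
Context (g : riemannian_metric A) (c : R -> M) (hc : embedded_circle A c).
Local Notation arc_dist := (arc_dist g c).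
Local Notation mu := (@lebesgue_measure R).

Lemma speed_measurable (D : set R) : measurable D -> measurable_fun D (fun t => (speed g c t)%:E).
Proof.
move=> mD; apply/measurable_EFinP; apply: (@measurable_funS _ _ _ _ setT) => //.
apply: continuous_measurable_fun => t.
exact: (@speed_continuous _ _ _ _ g setT c t openT (circle_smooth hc) I).
Qed.

Lemma circle_continuous : continuous c.
Proof. by move=> t; have [sc _] := circle_smooth hc; exact: sc. Qed.

Lemma arc_preimage_measurable (a b : R) : measurable (c @^-1` (c @` `[a, b])).
Proof.
apply: closed_measurable; apply: (continuous_closedP c).1; first exact: circle_continuous.
apply: compact_closed; first exact: manifold_hausdorff A.
apply: continuous_compact; last exact: segment_compact.
by apply: continuous_subspaceT; exact: circle_continuous.
Qed.

Lemma arc_diff_measurable (a b a' b' : R) :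
  measurable (`[0%R, 1%R[ `&` c @^-1` ((c @` `[a, b]) `+` (c @` `[a', b']))).
Proof.
apply: measurableI => //; rewrite /setY preimage_setU.
have -> (X Y : set M) : c @^-1` (X `\` Y) = c @^-1` X `\` c @^-1` Y by [].
by apply: measurableU; apply: measurableD; exact: arc_preimage_measurable.
Qed.

Fixpoint nbhd_union (s : seq R) (ε : R) : set R :=
  if s is x :: s' then `[x - ε, x + ε] `|` nbhd_union s' ε else set0.

Lemma nbhd_unionP s ε y x : x \in s -> `|y - x| <= ε -> nbhd_union s ε y.
Proof.
elim: s => //= z s IH; rewrite inE => /predU1P[->|xs] h; last by right; exact: IH.
by left; rewrite /= in_itv/=; move: h; rewrite ler_norml; alra.
Qed.

Lemma nbhd_union_measurable s ε : measurable (nbhd_union s ε).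
Proof. by elim: s => [|x s IH] /=; [exact: measurable0|apply: measurableU]. Qed.

Lemma nbhd_union_measure s ε : 0 <= ε -> (mu (nbhd_union s ε) <= ((size s)%:R * (2 * ε))%:E)%E.
Proof.
move=> ε0; elim: s => [|x s IH] /=; first by rewrite measure0 mul0r.
apply: le_trans (measureU2 _ _ _) _ => //; first exact: nbhd_union_measurable.
rewrite -natr1 mulrDl mul1r EFinD addeC; apply: leeD => //.
change (lebesgue_measure [set` `[(x - ε)%R, (x + ε)%R]] <= (2 * ε)%:E)%E.
rewrite lebesgue_measure_itv/=; case: ifP => _; last by rewrite lee_fin mulr_ge0.
by rewrite -EFinB lee_fin; alra.
Qed.

Lemma integral_speed_le (S : set R) s ε Λ : 0 <= ε -> 0 <= Λ -> (forall t, speed g c t <= Λ) -> measurable S ->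
  S `<=` nbhd_union s ε ->
  (\int[mu]_(t in S) (speed g c t)%:E <= (Λ * ((size s)%:R * (2 * ε)))%:E)%E.
Proof.
move=> ε0 Λ0 HΛ mS SU; have mU := nbhd_union_measurable s ε.
apply: (@le_trans _ _ (\int[mu]_(t in nbhd_union s ε) (speed g c t)%:E)%E).
  apply: ge0_subset_integral => //; first exact: speed_measurable.
  by move=> t _; rewrite lee_fin speed_ge0.
apply: (@le_trans _ _ (\int[mu]_(t in nbhd_union s ε) Λ%:E)%E).
  apply: ge0_le_integral => //.
  - by move=> t _; rewrite lee_fin speed_ge0.
  - exact: speed_measurable.
  - by move=> t _; rewrite lee_fin.
rewrite integral_cst// EFinM lee_wpmul2l ?lee_fin//.
exact: nbhd_union_measure.
Qed.

Lemma int_small (j : int) : -2 < (j%:~R : R) -> (j%:~R : R) < 2 -> [\/ j = -1, j = 0 | j = 1].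
Proof.
rewrite -[2 : R]/(2%:~R) -[- 2%:~R]mulrNz !ltr_int => h1 h2.
have : (j == -1) || (j == 0) || (j == 1) by lia.
by case/orP => [/orP[]|] /eqP ->; [constructor 1|constructor 2|constructor 3].
Qed.

(** Modulo 1, the arcs differ only within [ε] of an end of the first one. Each end is reduced to
    [[0, 1[] and taken with its translates by -1 and 1: six intervals of length [2 * ε], whence the
    constant 12. *)
Lemma arc_dist_upper : exists2 B : R, 0 < B & forall α α' β β' ε : R, 0 <= ε -> ε <= 1 ->
  `|α - β| <= ε -> `|α' - β'| <= ε ->
  (arc_dist (c @` `[α, α']) (c @` `[β, β']) <= (B * ε)%:E)%E.
Proof.
have [Λ Λ0 HΛ] := circle_speed_bound g hc.
exists (Λ * 12); first by rewrite mulr_gt0.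
move=> α α' β β' ε ε0 ε1 h h'.
have [m /andP[m0 m1]] := shift01 α; have [m' /andP[m'0 m'1]] := shift01 α'.
pose a := α + m%:~R; pose a' := α' + m'%:~R.
pose s := [:: a - 1; a; a + 1; a' - 1; a'; a' + 1].
have -> : Λ * 12 * ε = Λ * ((size s)%:R * (2 * ε)) by rewrite /=; ring.
apply: integral_speed_le => //; [exact: ltW|exact: arc_diff_measurable|].
have near x y k : 0 <= x < 1 -> x = y + k%:~R ->
    `|y - α| <= ε \/ `|y - α'| <= ε -> nbhd_union s ε x.
  move=> /andP[x0 x1] E [hy|hy].
    have Ej : x - a - (k - m)%:~R = y - α by rewrite E /a intrB; alra.
    have [||j|j|j] := @int_small (k - m).
    - by move: hy; rewrite -Ej ler_norml /a; move: m0 m1; rewrite -/a; alra.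
    - by move: hy; rewrite -Ej ler_norml /a; move: m0 m1; rewrite -/a; alra.
    - by apply: (nbhd_unionP (x := a - 1)); rewrite ?inE ?eqxx ?orbT// (_ : x - (a - 1) = y - α)// -Ej j mulrN1z; ring.
    - by apply: (nbhd_unionP (x := a)); rewrite ?inE ?eqxx ?orbT// (_ : x - (a) = y - α)// -Ej j mulr0z; ring.
    - by apply: (nbhd_unionP (x := a + 1)); rewrite ?inE ?eqxx ?orbT// (_ : x - (a + 1) = y - α)// -Ej j mulr1z; ring.
  have Ej : x - a' - (k - m')%:~R = y - α' by rewrite E /a' intrB; alra.
  have [||j|j|j] := @int_small (k - m').
  - by move: hy; rewrite -Ej ler_norml /a'; move: m'0 m'1; rewrite -/a'; alra.
  - by move: hy; rewrite -Ej ler_norml /a'; move: m'0 m'1; rewrite -/a'; alra.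
  - by apply: (nbhd_unionP (x := a' - 1)); rewrite ?inE ?eqxx ?orbT// (_ : x - (a' - 1) = y - α')// -Ej j mulrN1z; ring.
  - by apply: (nbhd_unionP (x := a')); rewrite ?inE ?eqxx ?orbT// (_ : x - (a') = y - α')// -Ej j mulr0z; ring.
  - by apply: (nbhd_unionP (x := a' + 1)); rewrite ?inE ?eqxx ?orbT// (_ : x - (a' + 1) = y - α')// -Ej j mulr1z; ring.
move=> x [/=]; rewrite in_itv/= => x01 [] [[y]]; rewrite /= in_itv/= => yb e ny.
  have [k Ek] := circle_inj hc (esym e); apply: (near x y k) => //.
  have : ~ (β <= y <= β') by move=> yb'; apply: ny; exists y => //=; rewrite in_itv.
  move: yb h h'; rewrite !ler_norml => /andP[y1 y2] /andP[h1 h2] /andP[h3 h4] ny'.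
  have [yβ|βy] := leP β y; last by left; alra.
  by right; have [yβ'|βy'] := leP y β'; [exfalso; apply: ny'; rewrite yβ|alra].
have [k Ek] := circle_inj hc (esym e); apply: (near x y k) => //.
have : ~ (α <= y <= α') by move=> yb'; apply: ny; exists y => //=; rewrite in_itv.
move: yb h h'; rewrite !ler_norml => /andP[y1 y2] /andP[h1 h2] /andP[h3 h4] ny'.
have [yβ|βy] := leP α y; last by left; alra.
by right; have [yβ'|βy'] := leP y α'; [exfalso; apply: ny'; rewrite yβ|alra].
Qed.

Lemma speed_pos t : 0 < speed g c t.
Proof.
have [_ _ v0] := hc; rewrite /speed sqrtr_gt0 /inner.
by apply: gmx_pos => //; apply: chart_img_in; exact: chart_at_dom.
Qed.

Lemma speed_lower : exists2 λ : R, 0 < λ & forall t, λ <= speed g c t.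
Proof.
have [|s sb Hs] := @EVT_min R (speed g c) 0 1 ler01.
  apply: within_continuous_of => t _.
  exact: (@speed_continuous _ _ _ _ g setT c t openT (circle_smooth hc) I).
exists (speed g c s); first exact: speed_pos.
move=> t; have [k /andP[k0 k1]] := shift01 t.
by rewrite -(speed_shift g hc t k); apply: Hs; rewrite in_itv/= k0 ltW.
Qed.

(** The speed is integrated over a piece of the second half of the window, translated into [[0, 1[].
    So [m] depends on the window from [a] to [b] but not on the arcs. *)
Lemma arc_dist_lower (a b : R) : a < b -> exists2 m : R, 0 < m & forall α α' β β' : R,
  (forall y, a < y < b -> (c @` `[α, α'] `+` c @` `[β, β']) (c y)) ->
  (m%:E <= arc_dist (c @` `[α, α']) (c @` `[β, β']))%E.
Proof.
move=> ab; have [λ λ0 Hλ] := speed_lower.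
have [k /andP[k0 k1]] := shift01 ((a + b) / 2).
set z := _ + k%:~R in k0 k1.
have [ζ [ζ0 ζ1 ζ2]] := @small2 R (1 - z) ((b - a) / 2) ltac:(by rewrite subr_gt0) ltac:(by rewrite divr_gt0// subr_gt0).
pose J := `[z + ζ / 4, z + ζ / 2].
exists (λ * (ζ / 4)); first by rewrite mulr_gt0// divr_gt0.
move=> α α' β β' H.
have sub : [set` J] `<=` `[0%R, 1%R[ `&` c @^-1` ((c @` `[α, α']) `+` (c @` `[β, β'])).
  move=> x; rewrite /J /= in_itv/= => /andP[x1 x2]; split.
    by rewrite /= in_itv/=; move: k0 ζ0 ζ1 x1 x2; alra.
  rewrite /preimage/= -(circle_shift hc x (- k)); apply: H; rewrite mulrNz.
  by move: x1 x2 ζ0 ζ2; rewrite /z; alra.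
apply: (@le_trans _ _ (\int[mu]_(t in [set` J]) (speed g c t)%:E)%E); last first.
  apply: ge0_subset_integral => //; [exact: arc_diff_measurable| |].
    by apply: speed_measurable; exact: arc_diff_measurable.
  by move=> t _; rewrite lee_fin speed_ge0.
apply: (@le_trans _ _ (\int[mu]_(t in [set` J]) λ%:E)%E).
  rewrite integral_cst//.
  change ((λ * (ζ / 4))%:E <= λ%:E * lebesgue_measure [set` `[(z + ζ / 4)%R, (z + ζ / 2)%R]])%E.
  rewrite lebesgue_measure_itv/= lte_fin.
  have -> : z + ζ / 4 < z + ζ / 2 by rewrite ltrD2l; move: ζ0; alra.
  by rewrite -EFinB -EFinM lee_fin ler_wpM2l ?(ltW λ0)//; alra.
apply: ge0_le_integral => //.
- by move=> t _; rewrite lee_fin ltW.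
- exact: speed_measurable.
- by move=> t _; rewrite lee_fin.
Qed.

End ArcDistance.

Lemma cvg0_within {R : realType} (f : R -> \bar R) (t : R) : (forall s, 0 <= f s)%E ->
  (f s @[s --> within [set` `[0%R, 1%R]] (nbhs t)] --> 0%E) <->
  forall e : R, 0 < e -> exists2 d : R, 0 < d & forall s, 0 <= s <= 1 -> `|s - t| < d -> (f s <= e%:E)%E.
Proof.
move=> f0; split=> H.
  move=> e e0; have U : nbhs (0%E : \bar R) [set y : \bar R | (y < e%:E)%E].
    by apply: open_nbhs_nbhs; split; [exact: open_ereal_lt_ereal|rewrite /= lte_fin].
  have [d d0 Hd] := H _ U; exists d => // s sb st; apply/ltW/(Hd s).
    by rewrite /ball/= distrC.
  by rewrite /= in_itv.
move=> U /= [e e0 He].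
have e2 : 0 < e / 2 by rewrite divr_gt0.
have [d d0 Hd] := H _ e2; exists d => // s st /=; rewrite in_itv/= => sb.
have := f0 s; have := Hd s sb; rewrite distrC => /(_ st).
case: (f s) => //= r; rewrite !lee_fin => h1 h2; apply: He.
by rewrite /ball/= sub0r normrN ger0_norm//; move: h1 e0; rewrite /=; alra.
Qed.

(** * Images of sweepouts under moves *)

Section SweepoutPush.
Context {R : realType} {n : nat} {M : topologicalType}.
Context {A : smooth_manifold R n M}.
Context (g : riemannian_metric A) (c : R -> M) (hc : embedded_circle A c).
Local Notation dist := (dist g).
Local Notation arc_dist := (arc_dist g c).
Local Notation F := (cdist g c).

Lemma dist_nbhs p (e : R) : 0 < e -> nbhs p [set m | (dist p m <= e%:E)%E].
Proof.
move=> e0; pose i := chart_at A p; have ip : chart_dom i p by exact: chart_at_dom.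
have [d d0 Hd] := dist_near g ip e0.
have N1 : nbhs p (chart_dom i) by apply: open_nbhs_nbhs; split => //; exact: chart_dom_open.
have cφ := chart_map_continuous ip.
have N2 : nbhs p [set m | `|chart_map i m - chart_map i p| < d].
  apply: (cφ [set x | `|x - chart_map i p| < d]); apply/nbhs_ballP; exists d => // x.
  by rewrite -ball_normE /= distrC.
apply: filterS (filterI N1 N2) => m [im mp] /=.
by have [_] := Hd _ mp; rewrite chart_mapK.
Qed.

Definition uniform_at (p : R -> M) := forall t, 0 <= t <= 1 -> forall e : R, 0 < e ->
  exists2 d : R, 0 < d & forall s, 0 <= s <= 1 -> `|s - t| < d -> (dist (p t) (p s) <= e%:E)%E.

Lemma within_uniform_at (p : R -> M) : {within [set` `[(0 : R), 1]], continuous p} -> uniform_at p.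
Proof.
move=> /subspace_continuousP H t tb e e0.
have [|d d0 Hd] := H t _ _ (dist_nbhs (p t) e0); first by rewrite /= in_itv.
by exists d => // s sb st; apply: Hd; rewrite /= ?in_itv// /ball/= distrC.
Qed.

Lemma clamp_id u : 0 <= u <= 1 -> clamp u = u :> R.
Proof. by case: (clampP u) => -[? ->]; alra. Qed.

Lemma uniform_at_within p : uniform_at p -> {within [set` `[(0 : R), 1]], continuous (fun t => p (clamp t))}.
Proof.
move=> H; apply: continuous_subspaceT => t; apply: (@dist_continuous _ _ _ _ g) => e e0.
have [d d0 Hd] := H _ (clamp01 t) e e0; exists d => // s st; apply: Hd; first exact: clamp01.
by apply: le_lt_trans (clamp_lip _ _) _; rewrite distrC.
Qed.

(** [bounds_arc] lets the arc start at either endpoint; when it starts at the second one, the pair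
    is exchanged so that the lifts are ordered along the arc. *)
Definition swap_push (T : R * R -> R * R) x := ((T (x.2, x.1)).2, (T (x.2, x.1)).1).

Lemma swap_pushP w T : is_push g c w T -> is_push g c w (swap_push T).
Proof.
move=> [h1 h2 h3 h4 h5]; split.
- move=> x e e0; have [d d0 Hd] := h1 (x.2, x.1) e e0; exists d => // y y1 y2.
  by have [] := Hd (y.2, y.1) y2 y1.
- by move=> s t k m; rewrite /swap_push /= h2.
- by move=> x; rewrite /swap_push /= cdist_sym; apply: le_trans (h3 _) _; rewrite /= cdist_sym.
- by move=> x xw; rewrite /swap_push h4/= ?[F x.2 _]cdist_sym//; case: (x).
- move=> s t /andP[st ts]; rewrite /swap_push /=.
  (* The order clause is applied to the complementary arc, from [t] to [s + 1]. *)
  have := h5 t (s + 1); rewrite ts lerD2r st => /(_ isT).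
  by have := h2 t s 0 1; rewrite !mulr0z !addr0 mulr1z => -> /=; alra.
Qed.

Lemma local_lift (η : R) : 0 < η -> exists2 m : R, 0 < m & forall s p, range c p -> (dist (c s) p <= m%:E)%E ->
  exists u, `|u - s| < η /\ c u = p.
Proof.
move=> η0; have [m m0 Hm] := cdist_separation g hc η0.
exists (m / 2); first by rewrite divr_gt0.
move=> s p [a _ <-]; rewrite (cdistE g hc) lee_fin => h.
have [|k hk] := Hm s a; first by move: h m0; alra.
exists (a + (- k)%:~R); rewrite (circle_shift hc); split => //.
by rewrite mulrNz addrAC.
Qed.

Lemma push_shift w T x y : is_push g c w T -> c x.1 = c y.1 -> c x.2 = c y.2 ->
  c (T x).1 = c (T y).1 /\ c (T x).2 = c (T y).2.
Proof.
move=> [_ h _ _ _]; case: x => a b; case: y => a' b' /= /(circle_inj hc)[k ->] /(circle_inj hc)[m ->].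
by rewrite h /= !(circle_shift hc).
Qed.

Lemma arc_shift (a b : R) (k : int) : c @` `[a + k%:~R, b + k%:~R] = c @` `[a, b].
Proof.
apply/seteqP; split => x [y]; rewrite /= in_itv/= => yb <-.
  exists (y + (- k)%:~R); rewrite ?(circle_shift hc)//= in_itv/= mulrNz.
  by move: yb; alra.
by exists (y + k%:~R); rewrite ?(circle_shift hc)//= in_itv/= !lerD2r.
Qed.

Lemma shift_unique (k m : int) (d : R) : 0 < d -> d < 1 -> 0 <= d + (m - k)%:~R -> d + (m - k)%:~R <= 1 -> m = k.
Proof.
move=> d0 d1 h1 h2; apply/eqP; rewrite -subr_eq0; apply/eqP.
have [||j|//|j] := @int_small R (m - k); [alra|alra| |]; exfalso; move: h1 h2; rewrite j ?mulrN1z ?mulr1z; alra.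
Qed.

(** Serves to exclude a flip of orientation: a nearby pair of ends bounds two arcs, and the one from
    [v] to [u + 1] differs from the given arc on the whole window between [a] and [b]. *)
Lemma arc_complement (σ σ' u v a b y : R) : σ < a -> b < σ' -> u < a -> b < v -> a < y < b ->
  v < u + 1 -> (c @` `[v, u + 1] `+` c @` `[σ, σ']) (c y).
Proof.
move=> h1 h2 h3 h4 /andP[h5 h6] h7; right; split.
  by exists y => //=; rewrite in_itv/=; alra.
move=> [z]; rewrite /= in_itv/= => /andP[z1 z2] /(circle_inj hc)[k Ek].
have k0 : 0 < (k%:~R : R) by move: Ek z1; alra.
have k1 : 1 <= (k%:~R : R) by move: k0; rewrite ltr0z ler1z gtz0_ge1.
by move: Ek z2; alra.
Qed.

Lemma arc_dist_ge0 C D : (0 <= arc_dist C D)%E.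
Proof. by apply: integral_ge0 => t _; rewrite lee_fin speed_ge0. Qed.

Lemma cdist_self s t : c s = c t -> F s t = 0.
Proof.
move=> e; have [Λ Λ0 HΛ] := cdist_lip g hc.
have := HΛ s s; rewrite subrr normr0 mulr0 /cdist e => h.
by apply/eqP; rewrite eq_le h/= cdist_ge0.
Qed.

(** By equivariance the pushed endpoints do not depend on the lift. The pushed arcs are continuous
    for two reasons: where the distance is less than [w / 2], nothing moves at nearby times;
    elsewhere the arc has a lift varying continuously, its orientation being locally constant by
    [arc_complement]. *)
Theorem push_sweepout (w : R) T p q : 0 < w -> is_push g c w T -> sweepout g c p q ->
  exists p' q', sweepout g c p' q' /\ forall t, 0 <= t <= 1 ->
    exists x, [/\ c x.1 = p t, c x.2 = q t, p' t = c (T x).1 & q' t = c (T x).2].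
Proof.
move=> w0 PT [[pq0 pq1] rg [cp cq] [C [Hb Hc C0 C1]]].
have up := within_uniform_at cp; have uq := within_uniform_at cq.
have [Λ Λ0 HΛ] := cdist_lip g hc.
have w2 : 0 < w / 2 by rewrite divr_gt0.
have lifts t : exists x : R * R, 0 <= t <= 1 -> c x.1 = p t /\ c x.2 = q t.
  have [tb|ntb] := boolP (0 <= t <= 1); last by exists (0, 0).
  by have [[a _ ea] [b _ eb]] := rg t tb; exists (a, b).
have [L HL] := choice lifts.
pose p1 t := c (T (L t)).1; pose q1 t := c (T (L t)).2.
have key t x : 0 <= t <= 1 -> c x.1 = p t -> c x.2 = q t -> p1 t = c (T x).1 /\ q1 t = c (T x).2.
  move=> tb e1 e2; have [l1 l2] := HL t tb.
  by apply: (push_shift PT); rewrite ?l1 ?l2.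
have same t : 0 <= t <= 1 -> F (L t).1 (L t).2 < w / 2 -> forall x, c x.1 = p t -> c x.2 = q t -> T x = x.
  move=> tb h x e1 e2; have [_ _ _ i _] := PT; apply: i.
  by move: h; have [l1 l2] := HL t tb; rewrite /cdist l1 l2 e1 e2.
have near t (η : R) : 0 <= t <= 1 -> 0 < η -> exists2 d : R, 0 < d & forall s, 0 <= s <= 1 -> `|s - t| < d ->
    forall x : R * R, c x.1 = p t -> c x.2 = q t -> exists u v, [/\ `|u - x.1| < η, `|v - x.2| < η, c u = p s & c v = q s].
  move=> tb η0; have [m m0 Hm] := local_lift η0.
  have [d1 d10 H1] := up t tb m m0; have [d2 d20 H2] := uq t tb m m0.
  have [d [d0 d1' d2']] := small2 d10 d20; exists d => // s sb st x e1 e2.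
  have [r1 r2] := rg s sb.
  have [|u [u1 u2]] := Hm x.1 (p s) r1; first by rewrite e1; apply: H1 => //; exact: lt_le_trans d1'.
  have [|v [v1 v2]] := Hm x.2 (q s) r2; first by rewrite e2; apply: H2 => //; exact: lt_le_trans d2'.
  by exists u, v.
have cont1 t e : 0 <= t <= 1 -> 0 < e -> exists2 d : R, 0 < d & forall s, 0 <= s <= 1 -> `|s - t| < d ->
    (dist (p1 t) (p1 s) <= e%:E)%E /\ (dist (q1 t) (q1 s) <= e%:E)%E.
  move=> tb e0; have eΛ : 0 < e / Λ by rewrite divr_gt0.
  have [cT _ _ _ _] := PT; have [η η0 Hη] := cT (L t) _ eΛ.
  have [d d0 Hd] := near t η tb η0; exists d => // s sb st.
  have [l1 l2] := HL t tb.
  have [u [v [hu hv eu ev]]] := Hd s sb st (L t) l1 l2.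
  have [k1 k2] := key s (u, v) sb eu ev; have [h1 h2] := Hη (u, v) hu hv.
  rewrite k1 k2 /p1 /q1 !(cdistE g hc) !lee_fin.
  by split; apply: le_trans (HΛ _ _) _; rewrite mulrC -ler_pdivlMr// ltW.
(* Sweepouts are constrained on the unit interval only; clamping makes the endpoints continuous on
   the whole line. *)
pose p' t := p1 (clamp t); pose q' t := q1 (clamp t).
have Ep t : 0 <= t <= 1 -> p' t = p1 t by move=> tb; rewrite /p' clamp_id.
have Eq t : 0 <= t <= 1 -> q' t = q1 t by move=> tb; rewrite /q' clamp_id.
have orient t : exists z : (R * R) * bool, 0 <= t <= 1 -> [/\ z.1.1 <= z.1.2 <= z.1.1 + 1, C t = c @` `[z.1.1, z.1.2],
    c z.1.1 = (if z.2 then p t else q t) & c z.1.2 = (if z.2 then q t else p t)].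
  have [tb|ntb] := boolP (0 <= t <= 1); last by exists ((0, 0), true).
  have [s [s' [h1 h2 [[h3 h4]|[h3 h4]]]]] := Hb t tb; first by exists ((s, s'), true).
  by exists ((s, s'), false).
have [S HS] := choice orient.
pose To (o : bool) := if o then T else swap_push T.
have PTo o : is_push g c w (To o) by case: o => //; exact: swap_pushP.
pose C' t : set M := c @` `[(To (S t).2 (S t).1).1, (To (S t).2 (S t).1).2].
have C'C t : 0 <= t <= 1 -> F (L t).1 (L t).2 < w / 2 -> C' t = C t.
  move=> tb h; have [h1 h2 h3 h4] := HS t tb; rewrite /C' h2.
  suff -> : To (S t).2 (S t).1 = (S t).1 by [].
  move: h3 h4; case: (S t).2 => h3 h4 /=; first exact: (same t tb h).
  rewrite /swap_push (same t tb h ((S t).1.2, (S t).1.1) h4 h3) /=.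
  by case: (S t).1.
have p0b : 0 <= (0 : R) <= 1 by rewrite lexx ler01.
have p1b : 0 <= (1 : R) <= 1 by rewrite lexx ler01.
have end_ t : 0 <= t <= 1 -> p t = q t -> [/\ p' t = p t, q' t = q t & C' t = C t].
  move=> tb e; have [l1 l2] := HL t tb.
  have F0 : F (L t).1 (L t).2 < w / 2 by rewrite cdist_self// l1 l2.
  split; last exact: C'C.
    by rewrite Ep// /p1 (same t tb F0 (L t)).
  by rewrite Eq// /q1 (same t tb F0 (L t)).
have [e1 e2 e3] := end_ 0 p0b pq0; have [e4 e5 e6] := end_ 1 p1b pq1.
exists p', q'; split; last first.
  move=> t tb; exists (L t); have [l1 l2] := HL t tb.
  by rewrite Ep// Eq.
split; [by rewrite e1 e2 e4 e5|by move=> t _; split; eexists| |].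
  split.
    by apply: uniform_at_within => t tb e e0; have [d d0 Hd] := cont1 t e tb e0; exists d => // s sb /(Hd s sb)[].
  by apply: uniform_at_within => t tb e e0; have [d d0 Hd] := cont1 t e tb e0; exists d => // s sb /(Hd s sb)[].
exists C'; split; [|..|by rewrite e6].
- move=> t tb; have [h1 h2 h3 h4] := HS t tb.
  exists (To (S t).2 (S t).1).1, (To (S t).2 (S t).1).2; split => //.
    by have [_ _ _ _ o] := PTo (S t).2; have := o _ _ h1; case: (S t).1.
  rewrite Ep// Eq//; move: h3 h4; case: (S t).2 => h3 h4 /=.
    by left; have [-> ->] := key t (S t).1 tb h3 h4.
  by right; have [-> ->] := key t ((S t).1.2, (S t).1.1) tb h4 h3.
- move=> t tb; apply/cvg0_within => [s|e e0]; first exact: arc_dist_ge0.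
  have hC := (cvg0_within t (fun s => arc_dist_ge0 (C s) (C t))).1 (Hc t tb).
  have [l1 l2] := HL t tb.
  have [small|large] := ltP (F (L t).1 (L t).2) (w / 2).
    have gap : 0 < (w / 2 - F (L t).1 (L t).2) / 4 by rewrite divr_gt0// subr_gt0.
    have [d1 d10 H1] := up t tb _ gap; have [d2 d20 H2] := uq t tb _ gap.
    have [d3 d30 H3] := hC e e0.
    have [d [d0 da db dc _]] := small4 d10 d20 d30 ltr01.
    exists d => // s sb st; rewrite !C'C//; first by apply: H3 => //; exact: lt_le_trans dc.
    have [m1 m2] := HL s sb.
    have := H1 s sb (lt_le_trans st da); have := H2 s sb (lt_le_trans st db).
    rewrite -l1 -l2 -m1 -m2 !(cdistE g hc) !lee_fin => h1 h2.
    have := cdist_perturb g hc (L s).1 (L s).2 (L t).1 (L t).2.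
    by rewrite ler_norml [F (L s).1 (L t).1]cdist_sym [F (L s).2 (L t).2]cdist_sym; move: gap h1 h2; glra.
  have [h1 h2 h3 h4] := HS t tb.
  move: h1 h2 h3 h4; rewrite /C'; set o := (S t).2; set σ := (S t).1.1; set σ' := (S t).1.2 => h1 h2 h3 h4.
  have ES : (S t).1 = (σ, σ') by rewrite /σ /σ'; case: (S t).1.
  have Fσ : w / 2 <= F σ σ'.
    by move: h3 h4; case: o => h3 h4; [|rewrite cdist_sym]; rewrite /cdist h3 h4 -l1 -l2.
  have σσ' : σ < σ'.
    rewrite lt_def; case/andP: h1 => -> _; rewrite andbT; apply/eqP => E.
    by move: Fσ w2; rewrite E cdist_self//; glra.
  have σ'σ : σ' < σ + 1.
    rewrite lt_def; case/andP: h1 => _ ->; rewrite andbT; apply/eqP => E.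
    move: Fσ w2; rewrite cdist_self; first by glra.
    by rewrite -E -[1]/(1%:~R) (circle_shift hc).
  (* The middle third of the arc is the window for [arc_complement]; [η] is at most a third of the
     length, so that nearby ends stay off the window. *)
  pose a := σ + (σ' - σ) / 3; pose b := σ + 2 * (σ' - σ) / 3.
  have ab : a < b by rewrite /a /b; move: σσ'; glra.
  have [m1 m10 Hm1] := arc_dist_lower g hc ab.
  have [B B0 HB] := arc_dist_upper g hc.
  have [ε [ε0 εe ε1]] := @small2 R (e / B) 1 ltac:(by rewrite divr_gt0) ltr01.
  have [cT _ _ _ _] := PTo o; have [d1 d10 Hd1] := cT (σ, σ') ε ε0.
  have [η [η0 ηa ηb ηc _]] := @small4 R d1 ((σ' - σ) / 3) ((σ + 1 - σ') / 2) 1 d10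
    ltac:(by rewrite divr_gt0// subr_gt0) ltac:(by rewrite divr_gt0// subr_gt0) ltr01.
  have [d2 d20 Hd2] := near t η tb η0.
  have m12 : 0 < m1 / 2 by rewrite divr_gt0.
  have [d3 d30 Hd3] := hC _ m12.
  have [d [d0 da db]] := small2 d20 d30.
  exists d => // s sb st.
  have [u [v [hu hv eu ev]]] : exists u v, [/\ `|u - σ| < η, `|v - σ'| < η,
      c u = (if o then p s else q s) & c v = (if o then q s else p s)].
    move: h3 h4; case: (o) => h3 h4.
      exact: (Hd2 s sb (lt_le_trans st da) (σ, σ') h3 h4).
    have [u [v [x1 x2 x3 x4]]] := Hd2 s sb (lt_le_trans st da) (σ', σ) h4 h3.
    by exists v, u.
  have AD := Hd3 s sb (lt_le_trans st db).
  have [g1 g2 g3 g4] := HS s sb.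
  have [uv vu] : u < v /\ v < u + 1.
    by split; move: hu hv ηb ηc σσ' σ'σ; rewrite !ltr_norml; glra.
  (* With equal orientations, the chosen lift at [s] is an integer translate of [(u, v)], which is
     close to the lift at [t]. With opposite ones, the arc at [s] would be close to the complement,
     against the continuity of [C]. *)
  have [oo|oo] := eqVneq (S s).2 o.
    rewrite oo in g3 g4 *.
    have [k Ek] := circle_inj hc (etrans g3 (esym eu)); have [k' Ek'] := circle_inj hc (etrans g4 (esym ev)).
    have Ekk : k' = k.
      apply: (@shift_unique k k' (v - u)); rewrite ?intrB; move: g1 uv vu; rewrite Ek Ek'; glra.
    have -> : (S s).1 = (u + k%:~R, v + k%:~R) by rewrite -Ek -Ekk -Ek'; case: (S s).1.
    have [_ sh _ _ _] := PTo o; rewrite sh /= arc_shift ES.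
    have [x1 x2] := Hd1 (u, v) (lt_le_trans hu ηa) (lt_le_trans hv ηa).
    apply: le_trans (HB _ _ _ _ ε (ltW ε0) ε1 (ltW x1) (ltW x2)) _.
    by rewrite lee_fin mulrC -ler_pdivlMr.
  have {}oo : (S s).2 = ~~ o by move: oo; case: (S s).2; case: (o).
  have e7 : c (S s).1.1 = c v by rewrite g3 oo ev; case: (o).
  have e8 : c (S s).1.2 = c u by rewrite g4 oo eu; case: (o).
  have [k Ek] := circle_inj hc e7; have [k' Ek'] := circle_inj hc e8.
  have Ekk : k' - 1 = k.
    apply: (@shift_unique k (k' - 1) (1 - (v - u))); rewrite ?intrB; move: g1 uv vu; rewrite Ek Ek'; glra.
  have ECs : C s = c @` `[v, u + 1].
    rewrite g2 -(arc_shift v (u + 1) k) Ek Ek' -Ekk intrB.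
    by have -> : u + 1 + (k'%:~R - 1) = u + k'%:~R by glra.
  move: AD; rewrite h2 ECs => AD.
  have H1 : (m1%:E <= arc_dist (c @` `[v, (u + 1)%R]) (c @` `[σ, σ']))%E.
    apply: Hm1 => y yab; apply: (@arc_complement _ _ u v a b) => //.
    - by rewrite /a; move: σσ'; glra.
    - by rewrite /b; move: σσ'; glra.
    - by move: hu; rewrite ltr_norml /a; move: ηb σσ'; glra.
    - by move: hv; rewrite ltr_norml /b; move: ηb σσ'; glra.
  by exfalso; move: (le_trans H1 AD) m10; rewrite lee_fin; glra.
- by rewrite e3 C0 e1.
Qed.

End SweepoutPush.

(** * Positivity and finiteness of the width *)

Section Width.
Context {R : realType} {n : nat} {M : topologicalType}.
Context {A : smooth_manifold R n M}.
Context (g : riemannian_metric A) (c : R -> M) (hc : embedded_circle A c).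
Local Notation dist := (dist g).
Local Notation arc_dist := (arc_dist g c).
Local Notation F := (cdist g c).

(** The thresholds here and in [long_arc] match [cdist_separation] at [4^-1]: an arc whose ends are
    close is short or long. *)
Definition short_arc (C : set M) := exists s s' : R, [/\ s <= s', s' < s + 4^-1 & C = c @` `[s, s']].

Definition long_arc (C : set M) := exists s s' : R, [/\ s + 3 / 4 < s', s' <= s + 1 & C = c @` `[s, s']].

(** The two windows are a quarter of the circle apart on one side and half of it on the other, too
    far for a short arc to meet both. *)
Lemma short_arc_misses (s s' x : R) : s' < s + 4^-1 ->
  (forall y, x < y < x + 8^-1 -> ~ (c @` `[s, s']) (c y)) \/
  (forall y, x + 3 / 8 < y < x + 2^-1 -> ~ (c @` `[s, s']) (c y)).
Proof.
move=> ss; apply: contrapT => /not_orP[/existsNP[y /not_implyP[yb /contrapT[z zb ez]]]].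
move=> /existsNP[y' /not_implyP[yb' /contrapT[z' zb' ez']]].
have [k Ek] := circle_inj hc ez; have [k' Ek'] := circle_inj hc ez'.
move: zb zb'; rewrite /= !in_itv/= Ek Ek' => zb zb'.
by apply: (@int_gap R (k' - k)); rewrite intrB; move: zb zb' yb yb'; alra.
Qed.

Lemma long_arc_contains (τ τ' y : R) : τ' <= τ + 1 -> ~ (c @` `[τ', τ + 1]) (c y) -> (c @` `[τ, τ']) (c y).
Proof.
move=> ττ ny; have [k /andP[k0 k1]] := shift01 (y - τ).
exists (y + k%:~R); rewrite ?(circle_shift hc)//= in_itv/=; apply/andP; split; first by move: k0; alra.
rewrite leNgt; apply/negP => h; apply: ny; exists (y + k%:~R); rewrite ?(circle_shift hc)//= in_itv/=.
by move: h k1; alra.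
Qed.

(** The long arc contains both windows of [short_arc_misses], and a short arc misses one of them; so
    the arcs differ on a whole window. *)
Lemma long_far (τ τ' : R) : τ + 3 / 4 < τ' -> τ' <= τ + 1 -> exists2 m : R, 0 < m &
  forall s s', s <= s' -> s' < s + 4^-1 -> (m%:E <= arc_dist (c @` `[s, s']) (c @` `[τ, τ']))%E.
Proof.
move=> h1 h2.
have ab1 : τ < τ + 8^-1 by alra.
have ab2 : τ + 3 / 8 < τ + 2^-1 by alra.
have [m1 m10 H1] := arc_dist_lower g hc ab1; have [m2 m20 H2] := arc_dist_lower g hc ab2.
have [m [m0 ma mb]] := small2 m10 m20; exists m => // s s' _ ss.
have [miss|miss] := @short_arc_misses s s' τ ss.
  apply: (@le_trans _ _ m1%:E); first by rewrite lee_fin.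
  apply: H1 => y yb; right; split; last exact: miss.
  by exists y => //=; rewrite in_itv/=; move: yb h1; alra.
apply: (@le_trans _ _ m2%:E); first by rewrite lee_fin.
apply: H2 => y yb; right; split; last exact: miss.
by exists y => //=; rewrite in_itv/=; move: yb h1; alra.
Qed.

(** [short_arc_misses] is applied to the complement of the long arc, which is short, with both
    windows placed outside the given arc. *)
Lemma short_far (s s' : R) : s <= s' -> s' < s + 4^-1 -> exists2 m : R, 0 < m &
  forall τ τ', τ + 3 / 4 < τ' -> τ' <= τ + 1 -> (m%:E <= arc_dist (c @` `[τ, τ']) (c @` `[s, s']))%E.
Proof.
move=> h1 h2; pose x := s' + 8^-1.
have ab1 : x < x + 8^-1 by alra.
have ab2 : x + 3 / 8 < x + 2^-1 by alra.
have [m1 m10 H1] := arc_dist_lower g hc ab1; have [m2 m20 H2] := arc_dist_lower g hc ab2.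
have out y : x < y < x + 2^-1 -> ~ (c @` `[s, s']) (c y).
  move=> yb [z]; rewrite /= in_itv/= => zb /(circle_inj hc)[k Ek].
  by apply: (@int_gap R k); move: zb yb; rewrite Ek /x; alra.
have [m [m0 ma mb]] := small2 m10 m20; exists m => // τ τ' t1 t2.
have t3 : τ + 1 < τ' + 4^-1 by alra.
have [miss|miss] := @short_arc_misses τ' (τ + 1) x t3.
  apply: (@le_trans _ _ m1%:E); first by rewrite lee_fin.
  apply: H1 => y yb; left; split; first by apply: long_arc_contains => //; exact: miss.
  by apply: out; move: yb; alra.
apply: (@le_trans _ _ m2%:E); first by rewrite lee_fin.
apply: H2 => y yb; left; split; first by apply: long_arc_contains => //; exact: miss.
by apply: out; move: yb; alra.
Qed.

Lemma short_not_full : ~ short_arc (range c).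
Proof.
move=> [s [s' [h1 h2 E]]].
have : range c (c (s' + 2^-1)) by exists (s' + 2^-1).
rewrite E => -[z]; rewrite /= in_itv/= => zb /(circle_inj hc)[k Ek].
by apply: (@int_gap R k); move: zb; rewrite Ek; alra.
Qed.

(** If all pairs of ends were closer than [m], every arc would be short or long. The kind cannot
    change along the sweepout, yet it starts with a point and ends with the full circle, which is
    not short. *)
Lemma sweepout_lower : exists2 m : R, 0 < m & forall p q, sweepout g c p q ->
  exists2 t, 0 <= t <= 1 & (m%:E <= dist (p t) (q t))%E.
Proof.
have q4 : (0 : R) < 4^-1 by rewrite invr_gt0.
have [m m0 Hm] := cdist_separation g hc q4.
exists m => // p q [_ rg _ [C [Hb Hc C0 C1]]].
apply: contrapT => /forall2NP far.
have lt t : 0 <= t <= 1 -> (dist (p t) (q t) < m%:E)%E.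
  by move=> tb; case: (far t) => // /negP; rewrite -ltNge.
have type t : 0 <= t <= 1 -> short_arc (C t) \/ long_arc (C t).
  move=> tb; have [s [s' [/andP[s1 s2] -> E]]] := Hb t tb.
  have h : F s s' < m.
    have := lt t tb; rewrite -lte_fin -(cdistE g hc).
    by case: E => -[-> ->] //; rewrite dist_sym.
  have [k hk] := Hm s s' h.
  have [||j|j|j] := @int_small R k; [move: hk; rewrite ltr_norml; alra|move: hk; rewrite ltr_norml; alra|..].
  - by exfalso; move: hk; rewrite j mulrN1z ltr_norml; alra.
  - by left; exists s, s'; split => //; move: hk; rewrite j mulr0z ltr_norml; alra.
  - by right; exists s, s'; split => //; move: hk; rewrite j mulr1z ltr_norml; alra.
have C0s : short_arc (C 0).
  have [|[a _ ea] _] := rg 0; first by rewrite lexx ler01.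
  exists a, a; split; [exact: lexx|by rewrite ltrDl|].
  rewrite C0 -ea; apply/seteqP; split => [_ ->|x [y]]; first by exists a => //=; rewrite in_itv/= lexx.
  by rewrite /= in_itv/= => yb <-; congr c; alra.
have C1s : ~ short_arc (C 1) by rewrite C1; exact: short_not_full.
apply: C1s; move: C0s.
(* The relation propagated is an implication, so the local step can also be made at times with a
   long arc. *)
apply: (@real_induction R 0 1 (fun s t => short_arc (C s) -> short_arc (C t)) ler01).
  by move=> s t u h1 h2 /h1.
move=> t tb.
have hC := (cvg0_within t (fun s => @arc_dist_ge0 _ _ _ _ g c (C s) (C t))).1 (Hc t tb).
have [S|L] := type t tb.
  have [s [s' [s1 s2 E]]] := S; have [k k0 Hk] := short_far s1 s2.
  have k2 : 0 < k / 2 by rewrite divr_gt0.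
  have [d d0 Hd] := hC _ k2; exists d => // a b a0 at_ tb' b1 h1 h2; split=> [//|_].
  have bb : 0 <= b <= 1 by case/andP: tb => t0 _; rewrite b1 (le_trans t0).
  have [//|[τ [τ' [τ1 τ2 E']]]] := type b bb.
  have := Hd b bb; rewrite ger0_norm ?subr_ge0// => /(_ h2).
  by rewrite E E' => /(le_trans (Hk _ _ τ1 τ2)); rewrite lee_fin; alra.
have [τ [τ' [τ1 τ2 E]]] := L; have [k k0 Hk] := long_far τ1 τ2.
have k2 : 0 < k / 2 by rewrite divr_gt0.
have nS : ~ short_arc (C t).
  move=> [s [s' [s1 s2 E']]]; have [k' k'0 Hk'] := short_far s1 s2.
  have k'2 : 0 < k' / 2 by rewrite divr_gt0.
  have [d d0 Hd] := hC _ k'2; have := Hd t tb; rewrite subrr normr0 => /(_ d0).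
  by rewrite {1}E E' => /(le_trans (Hk' _ _ τ1 τ2)); rewrite lee_fin; alra.
have [d d0 Hd] := hC _ k2; exists d => // a b a0 at_ tb' b1 h1 h2; split=> [|/nS//].
move=> [s [s' [s1 s2 E']]]; exfalso.
have ab : 0 <= a <= 1 by case/andP: tb => _ t1; rewrite a0 (le_trans at_).
have := Hd a ab; rewrite distrC ger0_norm ?subr_ge0// => /(_ h1).
by rewrite E E' => /(le_trans (Hk _ _ s1 s2)); rewrite lee_fin; alra.
Qed.

Lemma width_gt0 : (0 < width g c)%E.
Proof.
have [m m0 H] := sweepout_lower; apply: (@lt_le_trans _ _ m%:E); first by rewrite lte_fin.
apply: le_ereal_inf_tmp => _ [p [q [S ->]]]; have [t tb mt] := H p q S.
by apply: le_trans mt (ereal_sup_ubound _); exists t => //=; rewrite in_itv.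
Qed.

(** One end rests at [c 0] while the other runs once around; this shows that the width is finite. *)
Lemma sweepout_exists : sweepout g c (fun _ => c 0) c.
Proof.
have c1 : c 1 = c 0 by rewrite -[c 0](circle_shift hc 0 1) add0r.
split.
- by rewrite c1.
- by move=> t _; split; eexists.
- by split; apply: continuous_subspaceT; [move=> t; exact: cst_continuous|exact: circle_continuous hc].
exists (fun t => c @` `[0, t]); split.
- move=> t /andP[t0 t1]; exists 0, t; split; [by rewrite t0 add0r| |by left].
  by [].
- move=> t tb; apply/cvg0_within => [s|e e0]; first exact: arc_dist_ge0.
  have [B B0 HB] := arc_dist_upper g hc.
  have [d [d0 d1 d2]] := @small2 R (e / B) 1 ltac:(by rewrite divr_gt0) ltr01.
  exists d => // s sb /ltW st.
  apply: le_trans (HB 0 s 0 t d (ltW d0) d2 _ st) _; first by rewrite subrr normr0 ltW.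
  by rewrite lee_fin mulrC -ler_pdivlMr.
- apply/seteqP; split => [x [y]|_ ->]; last by exists 0 => //=; rewrite in_itv/= lexx.
  by rewrite /= in_itv/= => yb <- /=; congr c; alra.
- apply/seteqP; split => x [y]; first by move=> _ <-; exists y.
  move=> _ <-; have [k /andP[k0 k1]] := shift01 y; exists (y + k%:~R); last exact: (circle_shift hc).
  by rewrite /= in_itv/= k0 ltW.
Qed.

Lemma width_fin : exists w : R, width g c = w%:E.
Proof.
have [Λ Λ0 HΛ] := cdist_lip g hc.
have h : (width g c <= Λ%:E)%E.
  apply: (@le_trans _ _ (ereal_sup [set dist (c 0) (c t) | t in [set` `[(0 : R), 1]]])).
    by apply: ereal_inf_lbound; exists (fun _ => c 0), c; split => //; exact: sweepout_exists.
  apply: ge_ereal_sup => _ [t tb <-]; move: tb; rewrite /= in_itv/= => /andP[t0 t1].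
  rewrite (cdistE g hc) lee_fin; apply: le_trans (HΛ _ _) _.
  by rewrite subr0 ger0_norm// -[leRHS]mulr1 ler_wpM2l// ltW.
have := width_gt0; case: (width g c) h => [w| |]//; by exists w.
Qed.

End Width.

Theorem theoremA (R : realType) (n : nat) (M : topologicalType)
    (A : smooth_manifold R n M) (g : riemannian_metric A) (c : R -> M)
    (hg : complete_riemannian g) (hc : embedded_circle A c) :
  (0 < width g c)%E /\
  exists p q : M, [/\ range c p, range c q, critical_pair g c p q &
                      dist g p q = width g c].
Proof.
have w0 := width_gt0 g hc; split => //.
have [w Ew] := width_fin g hc; rewrite Ew lte_fin in w0 *.
apply: contrapT => nex.
have reg s t : cdist g c s t = w -> regular_pair g c (c s) (c t).
  move=> Fst; apply: contrapT => nr; apply: nex; exists (c s), (c t).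
  by split; [exists s|exists t|exact: nr|rewrite cdistE// Fst].
have [T [G [PT G0 HT]]] := deformation hg hc w0 reg.
have : (width g c < (w + G)%:E)%E by rewrite Ew lte_fin ltrDl.
move=> /ereal_inf_lt[_ [p [q [S ->]]] Sw].
have [p' [q' [S' H]]] := push_sweepout hc w0 PT S.
have : (width g c <= (w - G)%:E)%E.
  apply: (@le_trans _ _ (ereal_sup [set dist g (p' t) (q' t) | t in [set` `[(0 : R), 1]]])).
    by apply: ereal_inf_lbound; exists p', q'.
  apply: ge_ereal_sup => _ [t tb <-]; rewrite /= in_itv/= in tb.
  have [x [e1 e2 -> ->]] := H t tb; rewrite cdistE// lee_fin; apply: HT.
  rewrite -lee_fin -(cdistE g hc) e1 e2; apply: le_trans (ltW Sw).
  by apply: ereal_sup_ubound; exists t => //=; rewrite in_itv.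
by rewrite Ew lee_fin => h; move: h G0; lra.
Qed.
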